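(* Let $F$ be a number field and $p$ a prime. For any two Galois representations $V_1,V_2\in\mathcal{C}_F$, the representations $V_1\oplus V_2$ and $V_1\otimes V_2$ also belong to $\mathcal{C}_F$.
   Context: $G_F=\mathrm{Gal}(\overline{F}/F)$. $\mathcal{C}_F$ is the class of (isomorphism classes of) finite-dimensional $\mathbb{Q}_p$-representations of $G_F$ that can be realized as subquotients of $\mathbb{Q}_p[\pi_1^{\mathrm{pro-alg}}(\mathbb{P}^1_{\overline{F}}\setminus\{0,1,\infty\},0_v)]^{G_F-\mathrm{fin}}$ for every choice of tangential base point $0_v$ supported at $0$ (i.e. every non-zero $v\in T_0\mathbb{P}^1_F$). Tangential base points: let $v\in T_0\mathbb{P}^1_F$ be non-zero and let $t$ be a uniformizer of $\mathcal{O}_{\mathbb{P}^1_F,0}$ with $dt(v)=1$. This gives $\iota:\mathrm{Spec}\,F((t))\to\mathbb{P}^1_F\setminus\{0,1,\infty\}$. Restriction along $\mathrm{Spec}\,F((t))\to\mathrm{Spec}\,F[t,t^{-1}]=\mathbb{G}_{m,F}$ is an equivalence between finite étale covers of $\mathbb{G}_{m,F}$ and of $\mathrm{Spec}\,F((t))$. The tangential base point $0_v$ is the functor from finite étale covers of $\mathbb{P}^1_F\setminus\{0,1,\infty\}$ to finite étale covers of $\mathrm{Spec}\,F$ obtained by pulling back along $\iota$, applying the inverse of this equivalence, and taking the fiber at $t=1$ (independent of $t$ up to isomorphism). It yields a geometric fiber functor, hence the profinite group $\pi_1^{\mathrm{\acute{e}t}}(\mathbb{P}^1_{\overline{F}}\setminus\{0,1,\infty\},0_v)$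 with a continuous action of $G_F$. For a topological group $\Gamma$, $\mathbb{Q}_p[\Gamma^{\mathrm{pro-alg}}]$ (regular functions on the pro-algebraic completion over $\mathbb{Q}_p$) is the space of continuous functions $\Gamma\to\mathbb{Q}_p$ that factor as $\Gamma\xrightarrow{\rho}GL_n(\mathbb{Q}_p)\xrightarrow{f}\mathbb{Q}_p$ with $\rho$ a continuous representation and $f$ a regular function on $GL_{n,\mathbb{Q}_p}$. For $\Gamma=\pi_1^{\mathrm{\acute{e}t}}(\mathbb{P}^1_{\overline{F}}\setminus\{0,1,\infty\},0_v)$ it is denoted $\mathbb{Q}_p[\pi_1^{\mathrm{pro-alg}}(\mathbb{P}^1_{\overline{F}}\setminus\{0,1,\infty\},0_v)]$; $G_F$ acts by $(\sigma f)(\gamma)=f(\sigma^{-1}(\gamma))$, and $G_F-\mathrm{fin}$ denotes the subspace of functions whose $G_F$-orbit spans a finite-dimensional space. *)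

(* Defs.v *)
From HB Require Import structures.
From mathcomp Require Import all_boot all_order all_algebra all_field.
From mathcomp Require Import boolp.
From mathcomp.real_closed Require mxtens.
From mathcomp Require mpoly.
From Stdlib Require List.

Set Implicit Arguments.
Unset Strict Implicit.
Unset Printing Implicit Defensive.

Import GRing.Theory Num.Theory.
Local Open Scope ring_scope.

Section ClassicalInverse.
Variable R : comNzRingType.

Definition cunit : {pred R} := fun x => `[< exists y, y * x = 1 >].

Definition cinv (x : R) : R :=
  if pselect (exists y, y * x = 1) is left e then projT1 (cid e) else x.

Lemma cmulVr : {in cunit, left_inverse 1 cinv *%R}.
Proof.
move=> x /asboolP ex; rewrite /cinv.
by case: pselect => [e|/(_ ex)//]; case: (cid e).
Qed.

Lemma cunitPl (x y : R) : y * x = 1 -> x \in cunit.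
Proof. by move=> yx; apply/asboolP; exists y. Qed.

Lemma cinv_out : {in [predC cunit], cinv =1 id}.
Proof.
move=> x /negP xU; rewrite /cinv; case: pselect => // e.
by case: xU; apply/asboolP.
Qed.
End ClassicalInverse.

Record pseries (K : Type) := PSeries { coefps : nat -> K }.

Lemma psP (K : Type) (a b : pseries K) : coefps a =1 coefps b -> a = b.
Proof. by case: a b => [a] [b] /= /funext ->. Qed.

HB.instance Definition _ (K : Type) := gen_eqMixin (pseries K).
HB.instance Definition _ (K : Type) := gen_choiceMixin (pseries K).

Section PowerSeries.
Variable K : fieldType.
Implicit Types a b c : pseries K.

Definition ps_add a b := PSeries (fun n => coefps a n + coefps b n).
Definition ps_opp a := PSeries (fun n => - coefps a n).
Definition ps_zero := PSeries (fun _ => 0 : K).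
Definition psC (x : K) := PSeries (fun n => if n == 0%N then x else 0).
Definition psX := PSeries (fun n => (n == 1%N)%:R : K).
Definition ps_mul a b :=
  PSeries (fun n => \sum_(i < n.+1) coefps a i * coefps b (n - i)).

Let trunc n a := \poly_(i < n.+1) coefps a i.

Lemma ps_mul_trunc n a b i : (i <= n)%N ->
  coefps (ps_mul a b) i = (trunc n a * trunc n b)`_i.
Proof.
move=> le_in; rewrite coefM /=; apply: eq_bigr => j _.
have le_ji : (j <= i)%N by rewrite -ltnS ltn_ord.
by rewrite !coef_poly !ltnS (leq_trans le_ji) // (leq_trans (leq_subr _ _)).
Qed.

Lemma ps_addA : associative ps_add.
Proof. by move=> a b c; apply: psP => n /=; rewrite addrA. Qed.
Lemma ps_addC : commutative ps_add.
Proof. by move=> a b; apply: psP => n /=; rewrite addrC. Qed.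
Lemma ps_add0 : left_id ps_zero ps_add.
Proof. by move=> a; apply: psP => n /=; rewrite add0r. Qed.
Lemma ps_addN : left_inverse ps_zero ps_opp ps_add.
Proof. by move=> a; apply: psP => n /=; rewrite addNr. Qed.

HB.instance Definition _ :=
  GRing.isZmodule.Build (pseries K) ps_addA ps_addC ps_add0 ps_addN.

Lemma ps_mulC : commutative ps_mul.
Proof.
by move=> a b; apply: psP => n; rewrite !(@ps_mul_trunc n) // mulrC.
Qed.

Lemma ps_mulA : associative ps_mul.
Proof.
move=> a b c; apply: psP => n.
transitivity ((trunc n a * (trunc n b * trunc n c))`_n).
  rewrite coefM; apply: eq_bigr => j _.
  rewrite coef_poly ltn_ord (@ps_mul_trunc n) ?leq_subr //.
rewrite mulrA coefM; apply: eq_bigr => j _.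
by rewrite coef_poly ltnS leq_subr (@ps_mul_trunc n) // -ltnS.
Qed.

Lemma ps_mul1 : left_id (psC 1) ps_mul.
Proof.
move=> a; apply: psP => n /=; rewrite big_ord_recl /= subn0 mul1r.
by rewrite big1 ?addr0 // => i _; rewrite mul0r.
Qed.

Lemma ps_mulDl : left_distributive ps_mul +%R.
Proof.
move=> a b c; apply: psP => n /=; rewrite -big_split /=.
by apply: eq_bigr => i _; rewrite mulrDl.
Qed.

Lemma ps_one_neq0 : psC 1 != 0.
Proof.
by apply/eqP => /(congr1 (fun a => coefps a 0)) /eqP; rewrite /= oner_eq0.
Qed.

HB.instance Definition _ := GRing.Zmodule_isComNzRing.Build (pseries K)
  ps_mulA ps_mulC ps_mul1 ps_mulDl ps_one_neq0.
HB.instance Definition _ := GRing.ComNzRing_hasMulInverse.Build (pseries K)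
  (@cmulVr (pseries K)) (@cunitPl (pseries K)) (@cinv_out (pseries K)).

Lemma coefpsM a b n :
  coefps (a * b) n = \sum_(i < n.+1) coefps a i * coefps b (n - i).
Proof. by []. Qed.

Lemma ps_neq0P a : a != 0 ->
  exists n, coefps a n != 0 /\ forall i, (i < n)%N -> coefps a i = 0.
Proof.
move=> a0; have [n an] : exists n, coefps a n != 0.
  apply: contrapT => h; case/eqP: a0; apply: psP => n /=.
  by apply: contrapT => /eqP an; apply: h; exists n.
have ex : exists n, coefps a n != 0 by exists n.
exists (ex_minn ex); case: ex_minnP => m am min; split => // i ltim.
by apply: contraTeq ltim => /min; rewrite -leqNgt.
Qed.

Lemma ps_mulf_eq0 : GRing.integral_domain_axiom (pseries K).
Proof.
move=> a b ab0; apply: contrapT => /negP; rewrite negb_or => /andP[a0 b0].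
have [n [an an']] := ps_neq0P a0; have [m [bm bm']] := ps_neq0P b0.
have /eqP := congr1 (fun c => coefps c (n + m)) ab0; rewrite coefpsM /=.
have nlt : (n < (n + m).+1)%N by rewrite ltnS leq_addr.
rewrite (bigD1 (Ordinal nlt)) //= addKn big1 ?addr0.
  by rewrite mulf_eq0 (negPf an) (negPf bm).
move=> i; rewrite -val_eqE /= neq_ltn => /orP[/an' ->|lt_ni].
  by rewrite mul0r.
rewrite (bm' (n + m - i)%N) ?mulr0 //.
have le_i : (i <= n + m)%N by rewrite -ltnS.
by rewrite -(ltn_add2r i) subnK // [X in (_ < X)%N]addnC ltn_add2r.
Qed.

HB.instance Definition _ :=
  GRing.ComUnitRing_isIntegral.Build (pseries K) ps_mulf_eq0.

Lemma psC_is_zmod_morphism : zmod_morphism psC.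
Proof. by move=> x y; apply: psP => -[|n] //=; rewrite subr0. Qed.
Lemma psC_is_monoid_morphism : monoid_morphism psC.
Proof.
split=> // x y; apply: psP => n; rewrite coefpsM big_ord_recl /= subn0.
rewrite big1 ?addr0 => [|i _]; last by rewrite mul0r.
by case: n => //= n; rewrite mulr0.
Qed.
HB.instance Definition _ :=
  GRing.isZmodMorphism.Build K (pseries K) psC psC_is_zmod_morphism.
HB.instance Definition _ :=
  GRing.isMonoidMorphism.Build K (pseries K) psC psC_is_monoid_morphism.

Lemma coefpsD a b n : coefps (a + b) n = coefps a n + coefps b n.
Proof. by []. Qed.
Lemma coefps0_mul a b : coefps (a * b) 0 = coefps a 0 * coefps b 0.
Proof. by rewrite coefpsM big_ord_recl big_ord0 addr0. Qed.

End PowerSeries.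

Definition ps_map (K L : fieldType) (s : K -> L) (a : pseries K) : pseries L :=
  PSeries (s \o coefps a).

Section PowerSeriesMap.
Variables (K L : fieldType) (s : {rmorphism K -> L}).
Lemma ps_map_is_zmod_morphism : zmod_morphism (ps_map s).
Proof. by move=> a b; apply: psP => n /=; rewrite rmorphB. Qed.
Lemma ps_map_is_monoid_morphism : monoid_morphism (ps_map s).
Proof.
split=> [|a b]; apply: psP => n.
  by rewrite /=; case: eqP; rewrite ?rmorph1 ?rmorph0.
rewrite coefpsM /= rmorph_sum; apply: eq_bigr => i _; exact: rmorphM.
Qed.
HB.instance Definition _ := GRing.isZmodMorphism.Build (pseries K) (pseries L)
  (ps_map s) ps_map_is_zmod_morphism.
HB.instance Definition _ := GRing.isMonoidMorphism.Build (pseries K) (pseries L)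
  (ps_map s) ps_map_is_monoid_morphism.
Lemma ps_map_inj : injective (ps_map s).
Proof.
move=> a b /(congr1 (@coefps _)) /= ab; apply: psP => n.
by apply: (fmorph_inj s); have := congr1 (fun f => f n) ab.
Qed.
End PowerSeriesMap.

Local Notation "x %:F" := (@FracField.tofrac _ x).

Section FractionLift.
Variables (R : idomainType) (L : fieldType) (f : {rmorphism R -> L}).

Lemma frac_numden (x : {fraction R}) :
  x = (\n_(repr x))%:F / (\d_(repr x))%:F.
Proof.
rewrite -[x in LHS]reprK; move: (repr x) => r.
have r0 := denom_ratioP r; have o0 := oner_neq0 R.
have d0 : (\d_r)%:F != 0 :> {fraction R} by rewrite tofrac_eq0.
apply: (canRL (mulfK d0)); unlock FracField.tofrac.
rewrite -[LHS]FracField.pi_mul; apply/eqP; rewrite FracField.equivf_def.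
by rewrite /FracField.mulf !numden_Ratio ?mulr1 // mulrC.
Qed.

Definition frac_lift of injective f := fun x : {fraction R} =>
  f \n_(repr x) / f \d_(repr x).

Hypothesis f_inj : injective f.

Let fN0 (d : R) : d != 0 -> f d != 0.
Proof. by apply: contraNneq => fd; apply/eqP/f_inj; rewrite fd rmorph0. Qed.

Lemma frac_liftE (n d : R) : d != 0 ->
  frac_lift f_inj (n%:F / d%:F) = f n / f d.
Proof.
move=> d0; rewrite /frac_lift; set x := n%:F / d%:F.
have := frac_numden x; set n' := \n_ _; have := denom_ratioP (repr x).
set d' := \d_ _ => d'0 /eqP; rewrite /x eqr_div ?tofrac_eq0 //.
rewrite -!tofracM tofrac_eq => /eqP/(congr1 f); rewrite !rmorphM => e.
by apply/eqP; rewrite eqr_div ?fN0 // -e.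
Qed.

Lemma frac_lift_tofrac (n : R) : frac_lift f_inj n%:F = f n.
Proof.
by rewrite -[n%:F]divr1 -tofrac1 frac_liftE ?oner_neq0 // rmorph1 divr1.
Qed.

Lemma frac_lift_is_zmod_morphism : zmod_morphism (frac_lift f_inj).
Proof.
move=> x y; rewrite (frac_numden x) (frac_numden y).
set a := \n_ _; set b := \d_ _; set c := \n_ _; set d := \d_ _.
have b0 : b != 0 := denom_ratioP _; have d0 : d != 0 := denom_ratioP _.
rewrite -mulNr addf_div ?tofrac_eq0 // -tofracN -!tofracM -tofracD.
rewrite !frac_liftE ?mulf_neq0 // rmorphD !rmorphM rmorphN.
by rewrite -[- (_ / _)]mulNr addf_div ?fN0.
Qed.

Lemma frac_lift_is_monoid_morphism : monoid_morphism (frac_lift f_inj).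
Proof.
split=> [|x y]; first by rewrite -tofrac1 frac_lift_tofrac rmorph1.
rewrite (frac_numden x) (frac_numden y).
set a := \n_ _; set b := \d_ _; set c := \n_ _; set d := \d_ _.
have b0 : b != 0 := denom_ratioP _; have d0 : d != 0 := denom_ratioP _.
by rewrite mulf_div -!tofracM !frac_liftE ?mulf_neq0 // !rmorphM -mulf_div.
Qed.

HB.instance Definition _ := GRing.isZmodMorphism.Build {fraction R} L
  (frac_lift f_inj) frac_lift_is_zmod_morphism.
HB.instance Definition _ := GRing.isMonoidMorphism.Build {fraction R} L
  (frac_lift f_inj) frac_lift_is_monoid_morphism.

Lemma frac_morph_ext (g h : {rmorphism {fraction R} -> L}) :
  (forall r : R, g r%:F = h r%:F) -> g =1 h.
Proof. by move=> gh x; rewrite (frac_numden x) !fmorph_div !gh. Qed.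

End FractionLift.


Section FractionMap.
Variables (R S : idomainType) (f : {rmorphism R -> S}).
Hypothesis f_inj : injective f.

Lemma tofrac_comp_inj : injective f -> injective (@FracField.tofrac S \o f).
Proof. by move=> fi x y /eqP; rewrite /= tofrac_eq => /eqP/fi. Qed.

Definition frac_map (fi : injective f) : {fraction R} -> {fraction S} :=
  frac_lift (tofrac_comp_inj fi).

HB.instance Definition _ := GRing.RMorphism.copy (frac_map f_inj)
  (frac_lift (tofrac_comp_inj f_inj)).

Lemma frac_map_tofrac (x : R) :
  frac_map f_inj (FracField.tofrac x) = FracField.tofrac (f x).
Proof. exact: frac_lift_tofrac. Qed.
End FractionMap.

Section Localization.
Variables (K : fieldType) (f : {poly K}).

(* locring f is the localization K[X][1/f], as a subring of K(X). *)
Definition loc_pred : {pred {fraction {poly K}}} :=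
  fun x => `[< exists n p, x * f%:F ^+ n = p%:F >].

Lemma loc_pred_subring : subring_closed loc_pred.
Proof.
split=> [|x y|x y].
- by apply/asboolP; exists 0%N, 1; rewrite expr0 mulr1 tofrac1.
- move=> /asboolP[n [p ep]] /asboolP[m [q eq]]; apply/asboolP.
  exists (n + m)%N, (p * f ^+ m - q * f ^+ n).
  rewrite tofracB !tofracM !tofracXn -ep -eq exprD mulrBl; congr (_ - _).
    by rewrite mulrA.
  by rewrite -mulrA (mulrC (f%:F ^+ n)).
- move=> /asboolP[n [p ep]] /asboolP[m [q eq]]; apply/asboolP.
  by exists (n + m)%N, (p * q); rewrite exprD mulrACA ep eq tofracM.
Qed.

HB.instance Definition _ :=
  GRing.isSubringClosed.Build {fraction {poly K}} loc_pred loc_pred_subring.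

Record locring :=
  LocRing { loc_val : {fraction {poly K}}; _ : loc_val \in loc_pred }.
HB.instance Definition _ := [isSub for loc_val].
HB.instance Definition _ := [Choice of locring by <:].
HB.instance Definition _ := [SubChoice_isSubComNzRing of locring by <:].

Lemma loc_poly_subproof (p : {poly K}) : p%:F \in loc_pred.
Proof. by apply/asboolP; exists 0%N, p; rewrite expr0 mulr1. Qed.
Definition loc_poly p : locring := LocRing (loc_poly_subproof p).

End Localization.

Section Expansion.
Variable K : fieldType.
Implicit Types (z : pseries K) (p : {poly K}).

Definition ps_subst z : {poly K} -> pseries K :=
  horner_eval z \o map_poly (@psC K).
HB.instance Definition _ z := GRing.RMorphism.on (ps_subst z).

Lemma ps_substC z (a : K) : ps_subst z a%:P = psC a.
Proof. by rewrite /ps_subst /= map_polyC /horner_eval hornerC. Qed.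

Lemma ps_substX z : ps_subst z 'X = z.
Proof. by rewrite /ps_subst /= map_polyX /horner_eval hornerX. Qed.

Definition ps_nonunit z := coefps z 0 = 0 /\ z <> 0.

Lemma ps_subst0 z p : coefps z 0 = 0 -> coefps (ps_subst z p) 0 = p.[0].
Proof.
move=> z0; elim/poly_ind: p => [|p c IH]; first by rewrite rmorph0 horner0.
rewrite rmorphD rmorphM coefpsD coefps0_mul.
rewrite [X in _ * coefps X 0]ps_substX [X in _ + coefps X 0]ps_substC.
by rewrite z0 mulr0 !hornerE.
Qed.

Lemma ps_subst_inj z : ps_nonunit z -> injective (ps_subst z).
Proof.
move=> [z0 /eqP zN0]; apply: raddf_inj => p; apply: contra_eq => pN0.
have [m [q]] := multiplicity_XsubC p 0; rewrite pN0 /= => q0 ->.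
rewrite rmorphM rmorphXn polyC0 subr0 /= ps_substX mulf_neq0 ?expf_neq0 //.
apply: contraNneq q0 => e; rewrite rootE -(ps_subst0 q z0) e.
by [].
Qed.

Lemma psX_nonunit : ps_nonunit (psX K).
Proof.
split=> // /(congr1 (fun a => coefps a 1)) /= /eqP.
by rewrite oner_eq0.
Qed.

(* K((t)) *)
Definition laurent := {fraction (pseries K)}.

(* The K-algebra map from K[X][1/f] to K((t)) that sends X to z. *)
Definition expand z (zP : ps_nonunit z) (f : {poly K}) :
  locring f -> laurent := frac_map (ps_subst_inj zP) \o val.
HB.instance Definition _ z zP f := GRing.RMorphism.on (@expand z zP f).

End Expansion.

Section CoefficientMaps.
Variables (K : fieldType) (s : {rmorphism K -> K}).

Definition laurent_map : laurent K -> laurent K :=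
  frac_map (@ps_map_inj _ _ s).
HB.instance Definition _ := GRing.RMorphism.on laurent_map.

Definition ratfun_map : {fraction {poly K}} -> {fraction {poly K}} :=
  frac_map (@map_poly_inj _ _ s).
HB.instance Definition _ := GRing.RMorphism.on ratfun_map.

Variable f : {poly K}.
Hypothesis sf : map_poly s f = f.

Lemma loc_map_subproof (x : locring f) : ratfun_map (val x) \in loc_pred f.
Proof.
case: x => x /= /asboolP[n [p e]]; apply/asboolP; exists n, (map_poly s p).
have := congr1 ratfun_map e; rewrite rmorphM rmorphXn /=.
by rewrite /ratfun_map !frac_map_tofrac /= sf.
Qed.

Definition loc_map (x : locring f) := LocRing (loc_map_subproof x).

Lemma loc_map_is_zmod_morphism : zmod_morphism loc_map.
Proof. by move=> x y; apply: val_inj; rewrite /= rmorphB. Qed.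
Lemma loc_map_is_monoid_morphism : monoid_morphism loc_map.
Proof.
by split=> [|x y]; apply: val_inj; rewrite /= ?rmorph1 // rmorphM.
Qed.
HB.instance Definition _ := GRing.isZmodMorphism.Build (locring f) (locring f)
  loc_map loc_map_is_zmod_morphism.
HB.instance Definition _ := GRing.isMonoidMorphism.Build (locring f) (locring f)
  loc_map loc_map_is_monoid_morphism.

Lemma loc_map_poly p : loc_map (loc_poly f p) = loc_poly f (map_poly s p).
Proof. by apply: val_inj; rewrite /= /ratfun_map frac_map_tofrac. Qed.

Lemma ps_map_subst z p : ps_map s z = z ->
  ps_subst z (map_poly s p) = ps_map s (ps_subst z p).
Proof.
move=> sz; elim/poly_ind: p => [|p c IH]; first by rewrite !rmorph0.
rewrite !(rmorphD, rmorphM) /= map_polyX map_polyC /= !ps_substC !ps_substX.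
rewrite IH sz; congr (_ + _); apply: psP => -[|n] //=; exact/esym/rmorph0.
Qed.

Lemma expand_map z (zP : ps_nonunit z) (x : locring f) : ps_map s z = z ->
  expand zP (loc_map x) = laurent_map (expand zP x).
Proof.
move=> sz; rewrite /expand /=; move: (val x) => {}x.
apply: (@frac_morph_ext _ _ (frac_map (ps_subst_inj zP) \o ratfun_map)
          (laurent_map \o frac_map (ps_subst_inj zP))) => p /=.
by rewrite /laurent_map /ratfun_map !frac_map_tofrac /= ps_map_subst.
Qed.
End CoefficientMaps.

Section CoefficientMapsK.
Variables (K : fieldType) (s t : {rmorphism K -> K}).
Hypothesis stK : cancel s t.

Lemma laurent_mapK : cancel (laurent_map s) (laurent_map t).
Proof.
move=> x; apply: (@frac_morph_ext _ _ (laurent_map t \o laurent_map s) idfun).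
move=> a; rewrite /= /laurent_map !frac_map_tofrac; congr _%:F.
by apply: psP => n /=; rewrite stK.
Qed.

Lemma loc_mapK f (sf : map_poly s f = f) (tf : map_poly t f = f) :
  cancel (loc_map sf) (loc_map tf).
Proof.
move=> x; apply: val_inj => /=; move: (val x) => {}x.
apply: (@frac_morph_ext _ _ (ratfun_map t \o ratfun_map s) idfun).
move=> p; rewrite /= /ratfun_map !frac_map_tofrac; congr _%:F.
by apply/polyP => n; rewrite !coef_map /= stK.
Qed.
End CoefficientMapsK.

Record topGroup := TopGroup {
  tg_sort :> Type;
  tg_one : tg_sort;
  tg_mul : tg_sort -> tg_sort -> tg_sort;
  tg_inv : tg_sort -> tg_sort;
  tg_open : (tg_sort -> Prop) -> Prop;
  tg_mulA : associative tg_mul;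
  tg_mul1g : left_id tg_one tg_mul;
  tg_mulVg : left_inverse tg_one tg_inv tg_mul;
  tg_openT : tg_open (fun _ => True);
  tg_openI : forall U V, tg_open U -> tg_open V ->
    tg_open (fun g => U g /\ V g);
  tg_open_bigU : forall (P : (tg_sort -> Prop) -> Prop),
    (forall U, P U -> tg_open U) -> tg_open (fun g => exists2 U, P U & U g);
  tg_mul_cont : forall U g h, tg_open U -> U (tg_mul g h) ->
    exists V W, [/\ tg_open V, tg_open W, V g, W h &
                 forall g' h', V g' -> W h' -> U (tg_mul g' h')];
  tg_inv_cont : forall U, tg_open U -> tg_open (fun g => U (tg_inv g))
}.

(* A group acting faithfully on a family of sets, with the topology of
   pointwise convergence for the discrete topology on these sets. *)
Section PointwiseTopology.
Variables (G : Type) (one : G) (mul : G -> G -> G) (inv : G -> G).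
Variables (I : Type) (X : I -> Type) (act : G -> forall i, X i -> X i).
Hypothesis act_inj : forall g h, (forall i x, act g (i := i) x = act h x) ->
  g = h.
Hypothesis act1 : forall i (x : X i), act one x = x.
Hypothesis actM : forall g h i (x : X i), act (mul g h) x = act g (act h x).
Hypothesis actV : forall g i (x : X i), act (inv g) (act g x) = x.

Definition agree_on (s : seq {i : I & X i}) (g h : G) :=
  forall i (x : X i), List.In (existT _ i x) s -> act h x = act g x.

Definition pointwise_open (U : G -> Prop) :=
  forall g, U g -> exists s, forall h, agree_on s g h -> U h.

Let actKV g i (x : X i) : act g (act (inv g) x) = x.
Proof. by rewrite -[LHS](actV (inv g)) [act (inv g) (act g _)]actV actV. Qed.

Lemma pw_mulA : associative mul.
Proof. by move=> g h k; apply: act_inj => i x; rewrite !actM. Qed.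
Lemma pw_mul1g : left_id one mul.
Proof. by move=> g; apply: act_inj => i x; rewrite actM act1. Qed.
Lemma pw_mulVg : left_inverse one inv mul.
Proof. by move=> g; apply: act_inj => i x; rewrite actM act1 actV. Qed.

Lemma pw_openT : pointwise_open (fun _ => True).
Proof. by move=> g _; exists [::]. Qed.

Lemma pw_openI U V : pointwise_open U -> pointwise_open V ->
  pointwise_open (fun g => U g /\ V g).
Proof.
move=> oU oV g [/oU[s sU] /oV[t tV]]; exists (s ++ t) => h hst.
by split; [apply: sU|apply: tV] => i x xs; apply: hst;
  apply: List.in_or_app; [left|right].
Qed.

Lemma pw_open_bigU (P : (G -> Prop) -> Prop) :
  (forall U, P U -> pointwise_open U) ->
  pointwise_open (fun g => exists2 U, P U & U g).
Proof.
move=> oP g [U PU Ug]; have [s sU] := oP _ PU _ Ug.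
by exists s => h /sU Uh; exists U.
Qed.

Lemma agree_on_open s g : pointwise_open (agree_on s g).
Proof. by move=> h gh; exists s => k hk i x xs; rewrite hk // gh. Qed.

Let img g (s : seq {i : I & X i}) :=
  List.map (fun y => existT X (projT1 y) (act g (projT2 y))) s.

Let in_img g s i (x : X i) :
  List.In (existT _ i x) s -> List.In (existT _ i (act g x)) (img g s).
Proof.
by move=> /(List.in_map (fun y => existT X (projT1 y) (act g (projT2 y)))).
Qed.

Lemma pw_mul_cont U g h : pointwise_open U -> U (mul g h) ->
  exists V W, [/\ pointwise_open V, pointwise_open W, V g, W h &
               forall g' h', V g' -> W h' -> U (mul g' h')].
Proof.
move=> oU /oU[s sU]; exists (agree_on (img h s) g), (agree_on s h).
split=> //; do ?exact: agree_on_open.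
move=> g' h' gg' hh'; apply: sU => i x xs.
by rewrite !actM hh' // gg' //; exact: in_img.
Qed.

Lemma pw_inv_cont U : pointwise_open U -> pointwise_open (fun g => U (inv g)).
Proof.
move=> oU g /oU[s sU]; exists (img (inv g) s) => h gh; apply: sU => i x xs.
have := gh _ _ (in_img (inv g) xs); rewrite actKV => e.
by rewrite -{1}e actV.
Qed.

Definition pointwise_topGroup := TopGroup pw_mulA pw_mul1g pw_mulVg
  pw_openT pw_openI pw_open_bigU pw_mul_cont pw_inv_cont.

End PointwiseTopology.

Section AbsoluteGaloisGroup.
Variables (F K : fieldType) (iota : {rmorphism F -> K}).

(* The automorphisms of K that fix F, for K an extension of F; the topology of
   galois_group below is the Krull topology. *)
Record gal := Gal {
  gal_fun :> K -> K;
  gal_funV : K -> K;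
  gal_zmod : zmod_morphism gal_fun;
  gal_monoid : monoid_morphism gal_fun;
  gal_funK : cancel gal_fun gal_funV;
  gal_funVK : cancel gal_funV gal_fun;
  gal_fix : forall a, gal_fun (iota a) = iota a
}.

HB.instance Definition _ (s : gal) :=
  GRing.isZmodMorphism.Build K K (gal_fun s) (gal_zmod s).
HB.instance Definition _ (s : gal) :=
  GRing.isMonoidMorphism.Build K K (gal_fun s) (gal_monoid s).

Lemma galP (s t : gal) : gal_fun s =1 gal_fun t -> s = t.
Proof.
case: s t => [s s' sz sm sK sK' sf] [t t' tz tm tK tK' tf] /= /funext est.
subst t; have es't' : s' = t'.
  by apply: funext => x; rewrite -[x in LHS]tK' sK.
by subst t'; congr Gal; exact: Prop_irrelevance.
Qed.

Lemma gal1_zmod : zmod_morphism (@id K). Proof. by []. Qed.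
Lemma gal1_monoid : monoid_morphism (@id K). Proof. by []. Qed.
Definition gal1 := @Gal id id gal1_zmod gal1_monoid
  (fun _ => erefl) (fun _ => erefl) (fun _ => erefl).

Lemma galM_zmod (s t : gal) : zmod_morphism (s \o t).
Proof. exact: raddfB. Qed.
Lemma galM_monoid (s t : gal) : monoid_morphism (s \o t).
Proof. by split; [exact: rmorph1|exact: rmorphM]. Qed.
Lemma galM_fix (s t : gal) a : s (t (iota a)) = iota a.
Proof. by rewrite !gal_fix. Qed.
Definition galM (s t : gal) := Gal (galM_zmod s t) (galM_monoid s t)
  (can_comp (gal_funK s) (gal_funK t)) (can_comp (gal_funVK t) (gal_funVK s))
  (galM_fix s t).

Lemma galV_zmod (s : gal) : zmod_morphism (gal_funV s).
Proof. exact: (can2_zmod_morphism (gal_funK s) (gal_funVK s)). Qed.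
Lemma galV_monoid (s : gal) : monoid_morphism (gal_funV s).
Proof. exact: (can2_monoid_morphism (gal_funK s) (gal_funVK s)). Qed.
Lemma galV_fix (s : gal) a : gal_funV s (iota a) = iota a.
Proof. by rewrite -{1}(gal_fix s) gal_funK. Qed.
Definition galV (s : gal) := Gal (galV_zmod s) (galV_monoid s)
  (gal_funVK s) (gal_funK s) (galV_fix s).

Definition galois_group : topGroup :=
  @pointwise_topGroup gal gal1 galM galV unit (fun _ => K)
    (fun s _ => gal_fun s) (fun s t e => galP (e tt)) (fun _ _ => erefl)
    (fun _ _ _ _ => erefl) (fun s _ => gal_funK s).

End AbsoluteGaloisGroup.

Definition is_pushout (R S T U : comPzRingType) (f : {rmorphism R -> S})
    (g : {rmorphism R -> T}) (u : {rmorphism S -> U})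
    (v : {rmorphism T -> U}) :=
  u \o f =1 v \o g /\
  forall (X : comPzRingType) (x : {rmorphism S -> X}) (y : {rmorphism T -> X}),
    x \o f =1 y \o g ->
    exists h : {rmorphism U -> X}, [/\ h \o u =1 x, h \o v =1 y &
      forall h' : {rmorphism U -> X}, h' \o u =1 x -> h' \o v =1 y -> h' =1 h].

Definition module_finitely_presented (R S : comPzRingType)
    (f : {rmorphism R -> S}) :=
  exists (n m : nat) (e : 'I_n -> S) (r : 'I_m -> 'I_n -> R),
    (forall s, exists c : 'I_n -> R, s = \sum_i f (c i) * e i) /\
    (forall c : 'I_n -> R, \sum_i f (c i) * e i = 0 <->
      exists b : 'I_m -> R, forall i, c i = \sum_j b j * r j i).

(* The lifting property along T -> U surjective with kernel of square zero. *)
Definition formally_etale (R S : comPzRingType) (f : {rmorphism R -> S}) :=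
  forall (T U : comPzRingType) (q : {rmorphism T -> U}),
    (forall u, exists t, q t = u) ->
    (forall x y, q x = 0 -> q y = 0 -> x * y = 0) ->
  forall (g : {rmorphism R -> T}) (u : {rmorphism S -> U}), q \o g =1 u \o f ->
    exists h : {rmorphism S -> T}, [/\ h \o f =1 g, q \o h =1 u &
      forall h' : {rmorphism S -> T}, h' \o f =1 g -> q \o h' =1 u -> h' =1 h].

(* For a module-finite algebra, being finitely presented as a module and as
   an algebra are equivalent. *)
Definition finite_etale (R S : comPzRingType) (f : {rmorphism R -> S}) :=
  module_finitely_presented f /\ formally_etale f.

Section Twist.
Variables (R : comPzRingType) (s t : {rmorphism R -> R}).
Hypotheses (stK : cancel s t) (tsK : cancel t s).

Lemma finite_etale_twist (S : comPzRingType) (f : {rmorphism R -> S}) :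
  finite_etale f -> finite_etale (f \o s).
Proof.
move=> [[n [m [e [r [gen rel]]]]] et]; split.
  exists n, m, e, (fun j i => t (r j i)); split=> [x|c].
    have [c ->] := gen x; exists (t \o c).
    by apply: eq_bigr => i _ /=; rewrite tsK.
  split=> [/rel[b eb]|[b eb]].
    exists (t \o b) => i; rewrite -[c i]stK eb rmorph_sum.
    by apply: eq_bigr => j _; rewrite rmorphM.
  apply/rel; exists (s \o b) => i; rewrite eb rmorph_sum.
  by apply: eq_bigr => j _; rewrite rmorphM /= tsK.
move=> T U q qs qn g u qg; have [x|h [h1 h2 h3]] := et T U q qs qn (g \o t) u.
  by have := qg (t x); rewrite /= tsK.
exists h; split=> // [x|h' h1' h2'] /=.
  by rewrite -[LHS]/((h \o f) (s x)) h1 /= stK.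
by apply: h3 => // x; have := h1' (t x); rewrite /= tsK.
Qed.

End Twist.

Lemma pushout_twist (R S T U : comPzRingType) (f : {rmorphism R -> S})
    (g : {rmorphism R -> T}) (u : {rmorphism S -> U}) (v : {rmorphism T -> U})
    (sR tR : {rmorphism R -> R}) (sT tT : {rmorphism T -> T}) :
  cancel tR sR -> cancel sT tT -> cancel tT sT ->
  g \o sR =1 sT \o g ->
  is_pushout f g u v -> is_pushout (f \o sR) g u (v \o sT).
Proof.
move=> tsR stT tsT gs [uv univ]; split=> [a|X x y xy] /=.
  by rewrite -[LHS]/((u \o f) (sR a)) uv /= -[g _]/((g \o sR) a) gs.
have [a|h [h1 h2 h3]] := univ X x (y \o tT).
  have /= := xy (tR a); rewrite tsR => ->.
  suff -> : g (tR a) = tT (g a) by [].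
  by apply: (can_inj stT); rewrite tsT -[LHS]/((sT \o g) _) -gs /= tsR.
exists h; split=> // [b|h' h1' h2'] /=.
  by rewrite -[LHS]/((h \o v) _) h2 /= stT.
by apply: h3 => // b; have /= := h2' (tT b); rewrite tsT.
Qed.

Section TangentialBasePoint.
Variable F : fieldType.

(* v : F stands for the tangent vector v * d/dz at 0, where z is the coordinate
   on P^1, and t = tb_num / tb_den is a local parameter at 0 with dt(v) = 1.
   tb_z is the expansion of z as a power series in t (tb_zE says that t,
   computed from it, is the variable): it exists and is unique. The resulting map
   Spec F((t)) -> P^1 \ {0, 1, oo} sends z to tb_z. *)
Record tangential_base_point (v : F) := TangentialBasePoint {
  tb_num : {poly F};
  tb_den : {poly F};
  tb_den0 : tb_den.[0] != 0;
  tb_num0 : tb_num.[0] = 0;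
  tb_dt : v * (tb_num^`().[0] / tb_den.[0]) = 1;
  tb_z : pseries F;
  tb_z0 : coefps tb_z 0 = 0;
  tb_zE : ps_subst tb_z tb_num = psX F * ps_subst tb_z tb_den
}.

Lemma tb_nonunit v (b : tangential_base_point v) (K : fieldType)
  (iota : {rmorphism F -> K}) : ps_nonunit (ps_map iota (tb_z b)).
Proof.
case: b => num den den0 num0 _ z z0 zE /=; split.
  by rewrite /= z0 rmorph0.
rewrite -(rmorph0 (ps_map iota)) => /ps_map_inj z_eq0.
have := congr1 (fun a => coefps a 1) zE.
rewrite coefpsM 2!big_ord_recl big_ord0 /= mul0r mul1r add0r addr0 subnn.
rewrite ps_subst0 // => e; case/eqP: den0; rewrite -e {}z_eq0.
elim/poly_ind: {zE e} num num0 => [|p c _]; first by rewrite rmorph0.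
rewrite !hornerE /= => ->; rewrite addr0 rmorphM [X in _ * X]ps_substX mulr0.
by [].
Qed.

End TangentialBasePoint.

(* P^1 \ {0, 1, oo} and Gm are affine, and are given by their coordinate rings
   K[z, 1/z, 1/(1-z)] and K[t, 1/t]; their finite etale covers are the spectra
   of the finite etale algebras over these rings. *)
Definition P1_minus_01oo (K : fieldType) := locring ('X * (1 - 'X) : {poly K}).
Definition Gm (K : fieldType) := locring ('X : {poly K}).

Section FundamentalGroup.
Variables (K : fieldType) (z : pseries K) (zP : ps_nonunit z).

(* A cover Spec tc_B of P^1 \ {0, 1, oo}, with a cover Spec tc_C of Gm and an
   identification, as tc_D, of their pullbacks to Spec K((t)). As restriction
   from Gm to Spec K((t)) is an equivalence, (tc_C, tc_CD) is determined by tc_B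
   up to a unique isomorphism, and forgetting it is an equivalence from the
   category of these data to that of the finite etale covers of
   P^1 \ {0, 1, oo}. The value of the tangential fiber functor on Spec tc_B is
   the fiber of Spec tc_C at t = 1; its K-points are given by tfiber. *)
Record tcover := TCover {
  tc_B : comPzRingType;
  tc_C : comPzRingType;
  tc_D : comPzRingType;
  tc_b : {rmorphism P1_minus_01oo K -> tc_B};
  tc_c : {rmorphism Gm K -> tc_C};
  tc_d : {rmorphism laurent K -> tc_D};
  tc_BD : {rmorphism tc_B -> tc_D};
  tc_CD : {rmorphism tc_C -> tc_D};
  tc_etB : finite_etale tc_b;
  tc_etC : finite_etale tc_c;
  tc_poB : is_pushout tc_b (expand zP (f := _)) tc_BD tc_d;
  tc_poC : is_pushout tc_c (expand (psX_nonunit K) (f := _)) tc_CD tc_d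
}.

Record tc_hom (O O' : tcover) := TCHom {
  th_B : {rmorphism tc_B O -> tc_B O'};
  th_C : {rmorphism tc_C O -> tc_C O'};
  th_D : {rmorphism tc_D O -> tc_D O'};
  th_b : th_B \o tc_b O =1 tc_b O';
  th_c : th_C \o tc_c O =1 tc_c O';
  th_d : th_D \o tc_d O =1 tc_d O';
  th_BD : th_D \o tc_BD O =1 tc_BD O' \o th_B;
  th_CD : th_D \o tc_CD O =1 tc_CD O' \o th_C
}.

Record tfiber (O : tcover) := TFiber {
  tf_fun :> tc_C O -> K;
  tf_zmod : zmod_morphism tf_fun;
  tf_monoid : monoid_morphism tf_fun;
  tf_const : forall a : K, tf_fun (tc_c O (loc_poly _ a%:P)) = a;
  tf_t1 : tf_fun (tc_c O (loc_poly _ 'X)) = 1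
}.

HB.instance Definition _ O (x : tfiber O) :=
  GRing.isZmodMorphism.Build (tc_C O) K (tf_fun x) (tf_zmod x).
HB.instance Definition _ O (x : tfiber O) :=
  GRing.isMonoidMorphism.Build (tc_C O) K (tf_fun x) (tf_monoid x).

Lemma tfiberP O (x y : tfiber O) : tf_fun x =1 tf_fun y -> x = y.
Proof.
case: x y => [x x1 x2 x3 x4] [y y1 y2 y3 y4] /= /funext xy; subst y.
by congr TFiber; exact: Prop_irrelevance.
Qed.

Section Pull.
Variables (O O' : tcover) (m : tc_hom O O') (x : tfiber O').
Lemma pull_zmod : zmod_morphism (x \o th_C m).
Proof. exact: raddfB. Qed.
Lemma pull_monoid : monoid_morphism (x \o th_C m).
Proof. by split; [exact: rmorph1|exact: rmorphM]. Qed.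
Lemma pull_const a : x (th_C m (tc_c O (loc_poly _ a%:P))) = a.
Proof. by rewrite -[th_C m _]/((th_C m \o tc_c O) _) th_c tf_const. Qed.
Lemma pull_t1 : x (th_C m (tc_c O (loc_poly _ 'X))) = 1.
Proof. by rewrite -[th_C m _]/((th_C m \o tc_c O) _) th_c tf_t1. Qed.
Definition tf_pull : tfiber O :=
  TFiber pull_zmod pull_monoid pull_const pull_t1.
End Pull.

(* The automorphisms of the fiber functor. *)
Record pi1 := Pi1 {
  pi_fun :> forall O, tfiber O -> tfiber O;
  pi_funV : forall O, tfiber O -> tfiber O;
  pi_funK : forall O, cancel (@pi_fun O) (@pi_funV O);
  pi_funVK : forall O, cancel (@pi_funV O) (@pi_fun O);
  pi_nat : forall O O' (m : tc_hom O O') (x : tfiber O'),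
    pi_fun (tf_pull m x) = tf_pull m (pi_fun x)
}.

Lemma pi1P (g h : pi1) : (forall O (x : tfiber O), g O x = h O x) -> g = h.
Proof.
case: g h => [g g' gK gK' gn] [h h' hK hK' hn] /= gh.
have e : g = h by apply: functional_extensionality_dep => O; exact/funext/gh.
subst h; have e' : g' = h'.
  apply: functional_extensionality_dep => O; apply: funext => x.
  by rewrite -{1}(hK' O x) gK.
by subst h'; congr Pi1; exact: Prop_irrelevance.
Qed.

Definition pi1_one := @Pi1 (fun _ => id) (fun _ => id) (fun _ _ => erefl)
  (fun _ _ => erefl) (fun _ _ _ _ => erefl).

Lemma pi1_mul_nat (g h : pi1) O O' (m : tc_hom O O') (x : tfiber O') :
  g _ (h _ (tf_pull m x)) = tf_pull m (g _ (h _ x)).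
Proof. by rewrite !pi_nat. Qed.
Definition pi1_mul (g h : pi1) := Pi1
  (fun O => can_comp (@pi_funK g O) (@pi_funK h O))
  (fun O => can_comp (@pi_funVK h O) (@pi_funVK g O)) (pi1_mul_nat g h).

Lemma pi1_inv_nat (g : pi1) O O' (m : tc_hom O O') (x : tfiber O') :
  pi_funV g (tf_pull m x) = tf_pull m (pi_funV g x).
Proof. by rewrite -{1}(pi_funVK g x) -pi_nat pi_funK. Qed.
Definition pi1_inv (g : pi1) :=
  Pi1 (@pi_funVK g) (@pi_funK g) (pi1_inv_nat g).

Definition pi1_group : topGroup :=
  @pointwise_topGroup pi1 pi1_one pi1_mul pi1_inv tcover tfiber pi_fun pi1P
    (fun _ _ => erefl) (fun _ _ _ _ => erefl) (fun g => @pi_funK g).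

End FundamentalGroup.

Section GaloisAction.
Variables (F K : fieldType) (iota : {rmorphism F -> K}) (zF : pseries F).
Let z := ps_map iota zF.
Variable (zP : ps_nonunit z).
Implicit Types (s : gal iota) (O : tcover zP).

Lemma gal_poly_P1 s : map_poly s ('X * (1 - 'X)) = 'X * (1 - 'X).
Proof. by rewrite rmorphM rmorphB rmorph1 /= map_polyX. Qed.
Lemma gal_poly_Gm s : map_poly s 'X = 'X.
Proof. by rewrite /= map_polyX. Qed.

Definition gal_P1 s : P1_minus_01oo K -> P1_minus_01oo K :=
  loc_map (gal_poly_P1 s).
HB.instance Definition _ s := GRing.RMorphism.on (gal_P1 s).
Definition gal_Gm s : Gm K -> Gm K := loc_map (gal_poly_Gm s).
HB.instance Definition _ s := GRing.RMorphism.on (gal_Gm s).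

Lemma gal_z s : ps_map s z = z.
Proof. by apply: psP => n /=; rewrite gal_fix. Qed.
Lemma gal_psX s : ps_map s (psX K) = psX K.
Proof. by apply: psP => n /=; rewrite rmorph_nat. Qed.

Lemma twist_poB s O : is_pushout (tc_b O \o gal_P1 s) (expand zP (f := _))
  (tc_BD O) (tc_d O \o laurent_map s).
Proof.
apply: (pushout_twist (tR := gal_P1 (galV s)) (tT := laurent_map (galV s))).
- exact/loc_mapK/gal_funVK.
- exact/laurent_mapK/gal_funK.
- exact/laurent_mapK/gal_funVK.
- by move=> a; exact: (expand_map _ _ _ (gal_z s)).
- exact: tc_poB.
Qed.

Lemma twist_poC s O : is_pushout (tc_c O \o gal_Gm s)
  (expand (psX_nonunit K) (f := _)) (tc_CD O) (tc_d O \o laurent_map s).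
Proof.
apply: (pushout_twist (tR := gal_Gm (galV s)) (tT := laurent_map (galV s))).
- exact/loc_mapK/gal_funVK.
- exact/laurent_mapK/gal_funK.
- exact/laurent_mapK/gal_funVK.
- by move=> a; exact: (expand_map _ _ _ (gal_psX s)).
- exact: tc_poC.
Qed.

Lemma twist_etB s O : finite_etale (tc_b O \o gal_P1 s).
Proof.
apply: (finite_etale_twist (t := gal_P1 (galV s))); last exact: tc_etB.
  exact/loc_mapK/gal_funK.
exact/loc_mapK/gal_funVK.
Qed.
Lemma twist_etC s O : finite_etale (tc_c O \o gal_Gm s).
Proof.
apply: (finite_etale_twist (t := gal_Gm (galV s))); last exact: tc_etC.
  exact/loc_mapK/gal_funK.
exact/loc_mapK/gal_funVK.
Qed.

(* The base change of a cover along s^-1 : K -> K, obtained by composing its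
   structure maps with the action of s on the coefficients. *)
Definition twist s O : tcover zP :=
  TCover (twist_etB s O) (twist_etC s O) (twist_poB s O) (twist_poC s O).

Definition twist_hom s O O' (m : tc_hom O O') :
  tc_hom (twist s O) (twist s O') :=
  @TCHom _ _ _ (twist s O) (twist s O') (th_B m) (th_C m) (th_D m)
    (fun a => th_b m (gal_P1 s a)) (fun a => th_c m (gal_Gm s a))
    (fun a => th_d m (laurent_map s a)) (th_BD m) (th_CD m).

Section Fibers.
Variables (s : gal iota) (O : tcover zP).

Lemma tf_up_zmod (x : tfiber (twist s O)) : zmod_morphism (s \o x).
Proof. exact: raddfB. Qed.
Lemma tf_up_monoid (x : tfiber (twist s O)) : monoid_morphism (s \o x).
Proof. by split; [exact: rmorph1|exact: rmorphM]. Qed.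
Lemma tf_up_const (x : tfiber (twist s O)) a :
  s (x (tc_c O (loc_poly _ a%:P))) = a.
Proof.
have := tf_const x (galV s a); rewrite /= /gal_Gm loc_map_poly map_polyC /=.
by rewrite gal_funVK => ->; rewrite gal_funVK.
Qed.
Lemma tf_up_t1 (x : tfiber (twist s O)) : s (x (tc_c O (loc_poly _ 'X))) = 1.
Proof.
have := tf_t1 x; rewrite /= /gal_Gm loc_map_poly map_polyX => ->.
exact: rmorph1.
Qed.
Definition tf_up x : tfiber O :=
  TFiber (O := O) (tf_up_zmod x) (tf_up_monoid x) (tf_up_const x) (tf_up_t1 x).

Lemma tf_down_zmod (x : tfiber O) : zmod_morphism (galV s \o x).
Proof. exact: raddfB. Qed.
Lemma tf_down_monoid (x : tfiber O) : monoid_morphism (galV s \o x).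
Proof. by split; [exact: rmorph1|exact: rmorphM]. Qed.
Lemma tf_down_const (x : tfiber O) a :
  galV s (x (tc_c (twist s O) (loc_poly _ a%:P))) = a.
Proof.
by rewrite /= /gal_Gm loc_map_poly map_polyC /= tf_const gal_funK.
Qed.
Lemma tf_down_t1 (x : tfiber O) :
  galV s (x (tc_c (twist s O) (loc_poly _ 'X))) = 1.
Proof.
rewrite /= /gal_Gm loc_map_poly map_polyX tf_t1; exact: (rmorph1 (galV s)).
Qed.
Definition tf_down x : tfiber (twist s O) :=
  TFiber (O := twist s O) (tf_down_zmod x) (tf_down_monoid x)
    (tf_down_const x) (tf_down_t1 x).

Lemma tf_upK : cancel tf_up tf_down.
Proof. by move=> x; apply: tfiberP => c /=; rewrite gal_funK. Qed.
Lemma tf_downK : cancel tf_down tf_up.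
Proof. by move=> x; apply: tfiberP => c /=; rewrite gal_funVK. Qed.
End Fibers.

(* The automorphism s g s^-1 of the fiber functor. *)
Section Action.
Variables (s : gal iota) (g : pi1 zP).

Let act_fun O (x : tfiber O) := tf_up (g (twist s O) (tf_down s x)).
Let act_funV O (x : tfiber O) := tf_up (pi_funV g (tf_down s x)).

Lemma gal_act_K O : cancel (@act_fun O) (@act_funV O).
Proof. by move=> x; rewrite /act_funV tf_upK pi_funK tf_downK. Qed.
Lemma gal_act_VK O : cancel (@act_funV O) (@act_fun O).
Proof. by move=> x; rewrite /act_fun tf_upK pi_funVK tf_downK. Qed.
Lemma gal_act_nat O O' (m : tc_hom O O') (x : tfiber O') :
  act_fun (tf_pull m x) = tf_pull m (act_fun x).
Proof.
rewrite /act_fun.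
have -> : tf_down s (tf_pull m x) = tf_pull (twist_hom s m) (tf_down s x).
  exact: tfiberP.
by rewrite pi_nat; apply: tfiberP.
Qed.

Definition gal_act : pi1 zP := Pi1 gal_act_K gal_act_VK gal_act_nat.
End Action.

End GaloisAction.

Section PadicIntegers.
Variables (p : nat) (p_pr : prime p).

(* Z_p as the inverse limit of the Z/p^n: the n-th term is the representative
   in [0, p^n[ of the class modulo p^n. *)
Record padic_int (pr : prime p) := PadicInt {
  pz_seq : nat -> int;
  pz_seqP : forall n, pz_seq n = (pz_seq n.+1 %% (p ^ n)%N%:Z)%Z
}.
Local Notation Zp := (padic_int p_pr).
HB.instance Definition _ := gen_eqMixin Zp.
HB.instance Definition _ := gen_choiceMixin Zp.
Implicit Types a b c : Zp.

Lemma padic_intP a b : pz_seq a =1 pz_seq b -> a = b.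
Proof.
case: a b => [a aP] [b bP] /= /funext ab; subst b.
by congr PadicInt; exact: Prop_irrelevance.
Qed.

Lemma pz_seq_mod a n : (pz_seq a n %% (p ^ n)%N%:Z)%Z = pz_seq a n.
Proof. by rewrite pz_seqP modz_mod. Qed.

Lemma dvdz_pexp m n : (m <= n)%N -> ((p ^ m)%N%:Z %| (p ^ n)%N%:Z)%Z.
Proof. by move=> mn; rewrite !dvdzE !absz_nat dvdn_exp2l. Qed.

Lemma modz_pexp m n (x : int) : (m <= n)%N ->
  ((x %% (p ^ n)%N%:Z)%Z = x %[mod (p ^ m)%N%:Z])%Z.
Proof.
move=> /dvdz_pexp/dvdzP[q e]; apply/eqP; rewrite eqz_mod_dvd.
rewrite {2}(divz_eq x (p ^ n)%N%:Z) opprD addrCA subrr addr0 -mulNr.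
by rewrite e mulrA dvdz_mull.
Qed.

Definition pz_mk_proof (f : nat -> int)
  (fP : forall n, (f n.+1 = f n %[mod (p ^ n)%N%:Z])%Z) n :
  (f n %% (p ^ n)%N%:Z)%Z =
  ((f n.+1 %% (p ^ n.+1)%N%:Z)%Z %% (p ^ n)%N%:Z)%Z.
Proof. by rewrite modz_pexp // fP. Qed.

Definition pz_mk f fP : Zp := @PadicInt p_pr _ (@pz_mk_proof f fP).

Lemma pz_seq_step a n : (pz_seq a n.+1 = pz_seq a n %[mod (p ^ n)%N%:Z])%Z.
Proof. by rewrite [in RHS]pz_seqP modz_mod. Qed.

Lemma pz_add_proof a b n :
  (pz_seq a n.+1 + pz_seq b n.+1 = pz_seq a n + pz_seq b n
    %[mod (p ^ n)%N%:Z])%Z.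
Proof. by rewrite -modzDm !pz_seq_step modzDm. Qed.
Lemma pz_mul_proof a b n :
  (pz_seq a n.+1 * pz_seq b n.+1 = pz_seq a n * pz_seq b n
    %[mod (p ^ n)%N%:Z])%Z.
Proof. by rewrite -modzMm !pz_seq_step modzMm. Qed.
Lemma pz_opp_proof a n :
  (- pz_seq a n.+1 = - pz_seq a n %[mod (p ^ n)%N%:Z])%Z.
Proof. by rewrite -modzNm pz_seq_step modzNm. Qed.

Definition pz_add a b := pz_mk (pz_add_proof a b).
Definition pz_mul a b := pz_mk (pz_mul_proof a b).
Definition pz_opp a := pz_mk (pz_opp_proof a).
Definition pz_int (x : int) := @pz_mk (fun _ => x) (fun _ => erefl).

Lemma pz_addA : associative pz_add.
Proof.
by move=> a b c; apply: padic_intP => n /=; rewrite modzDmr modzDml addrA.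
Qed.
Lemma pz_addC : commutative pz_add.
Proof. by move=> a b; apply: padic_intP => n /=; rewrite addrC. Qed.
Lemma pz_add0 : left_id (pz_int 0) pz_add.
Proof.
by move=> a; apply: padic_intP => n /=; rewrite mod0z add0r pz_seq_mod.
Qed.
Lemma pz_addN : left_inverse (pz_int 0) pz_opp pz_add.
Proof. by move=> a; apply: padic_intP => n /=; rewrite modzDml addNr. Qed.
HB.instance Definition _ :=
  GRing.isZmodule.Build Zp pz_addA pz_addC pz_add0 pz_addN.

Lemma pz_mulA : associative pz_mul.
Proof.
by move=> a b c; apply: padic_intP => n /=; rewrite modzMmr modzMml mulrA.
Qed.
Lemma pz_mulC : commutative pz_mul.
Proof. by move=> a b; apply: padic_intP => n /=; rewrite mulrC. Qed.
Lemma pz_mul1 : left_id (pz_int 1) pz_mul.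
Proof.
by move=> a; apply: padic_intP => n /=; rewrite modzMml mul1r pz_seq_mod.
Qed.
Lemma pz_mulDl : left_distributive pz_mul +%R.
Proof.
move=> a b c; apply: padic_intP => n /=.
by rewrite modzMml mulrDl modzDm.
Qed.
Lemma pz_one_neq0 : pz_int 1 != 0.
Proof.
apply/eqP => /(congr1 (fun a => pz_seq a 1)) /=.
by rewrite mod0z expn1 modz_small //= ltz_nat prime_gt1.
Qed.
HB.instance Definition _ := GRing.Zmodule_isComNzRing.Build Zp
  pz_mulA pz_mulC pz_mul1 pz_mulDl pz_one_neq0.
HB.instance Definition _ := GRing.ComNzRing_hasMulInverse.Build Zp
  (@cmulVr Zp) (@cunitPl Zp) (@cinv_out Zp).

Lemma pz_seq_le a m n : (m <= n)%N ->
  (pz_seq a n = pz_seq a m %[mod (p ^ m)%N%:Z])%Z.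
Proof.
elim: n => [|n IH]; first by case: m.
rewrite leq_eqVlt => /orP[/eqP -> //|]; rewrite ltnS => mn.
by rewrite -(IH mn) [pz_seq a n]pz_seqP modz_pexp.
Qed.

Lemma pz_neq0P a : a != 0 -> exists n, forall m, (n <= m)%N ->
  ~~ ((p ^ n)%N%:Z %| pz_seq a m)%Z.
Proof.
move=> a0; have [n an] : exists n, pz_seq a n != 0.
  apply: contrapT => h; case/eqP: a0; apply: padic_intP => n /=.
  by rewrite mod0z; apply: contrapT => /eqP an; apply: h; exists n.
exists n => m nm; apply: contraNN an => /dvdz_mod0P e.
by rewrite -pz_seq_mod -(pz_seq_le a nm) e.
Qed.

Lemma pz_mulf_eq0 : GRing.integral_domain_axiom Zp.
Proof.
move=> a b ab0; apply: contrapT => /negP; rewrite negb_or => /andP[].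
move=> /pz_neq0P[n an] /pz_neq0P[m bm].
have := congr1 (fun c => pz_seq c (n + m)) ab0; rewrite /= mod0z.
have := an _ (leq_addr m n); have := bm _ (leq_addl n m).
move: (pz_seq a _) (pz_seq b _) => x y yd xd /dvdz_mod0P.
move: xd yd; rewrite !dvdzE !absz_nat abszM.
have [-> |x0] := posnP `|x|%N; first by rewrite dvdn0.
have [-> |y0] := posnP `|y|%N; first by rewrite dvdn0.
rewrite !pfactor_dvdn ?muln_gt0 ?x0 // lognM // -!ltnNge => ltx lty.
by rewrite leqNgt -addnS leq_add // ltnW.
Qed.

HB.instance Definition _ := GRing.ComUnitRing_isIntegral.Build Zp pz_mulf_eq0.

Definition padic := {fraction Zp}.

(* x - y belongs to p^k Z_p *)
Definition padic_close (k : nat) (x y : padic) :=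
  exists a : Zp, x - y = p%:R ^+ k * a%:F.

Definition padic_continuous (G : topGroup) (f : G -> padic) :=
  forall g k, exists U, [/\ tg_open U, U g &
    forall h, U h -> padic_close k (f h) (f g)].

End PadicIntegers.

Section Representations.
Variables (p : nat) (p_pr : prime p).
Local Notation Qp := (padic p_pr).

Definition continuous_rep (G : topGroup) (n : nat) (rho : G -> 'M[Qp]_n) :=
  [/\ rho (tg_one G) = 1%:M,
      forall g h, rho (tg_mul g h) = rho g *m rho h &
      forall i j, padic_continuous (fun g => rho g i j)].

(* A regular function on GL_n is a polynomial in the entries divided by a power
   of the determinant. *)
Definition proalg_function (G : topGroup) (f : G -> Qp) :=
  padic_continuous f /\
  exists (n : nat) (rho : G -> 'M[Qp]_n) (P : mpoly.mpoly (n * n) Qp) (k : nat),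
    continuous_rep rho /\
    forall g, f g = mpoly.meval (fun i => mxvec (rho g) 0 i) P
                    / \det (rho g) ^+ k.

Definition rep_dsum (G : Type) (n1 n2 : nat)
  (rho1 : G -> 'M[Qp]_n1) (rho2 : G -> 'M[Qp]_n2) : G -> 'M[Qp]_(n1 + n2) :=
  fun g => block_mx (rho1 g) 0 0 (rho2 g).

Definition rep_tens (G : Type) (n1 n2 : nat)
  (rho1 : G -> 'M[Qp]_n1) (rho2 : G -> 'M[Qp]_n2) : G -> 'M[Qp]_(n1 * n2) :=
  fun g => mxtens.tensmx (rho1 g) (rho2 g).

Definition lin_subspace (X : Type) (W : (X -> Qp) -> Prop) :=
  W (fun _ => 0) /\
  forall (a : Qp) f g, W f -> W g -> W (fun x => a * f x + g x).

Section Subquotients.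
Variables (G : topGroup) (X : Type) (act : G -> (X -> Qp) -> (X -> Qp)).
Implicit Types (f : X -> Qp) (W : (X -> Qp) -> Prop).

Definition act_stable W := forall g f, W f -> W (act g f).

Definition orbit_finite f := exists (m : nat) (e : 'I_m -> X -> Qp),
  forall g, exists c : 'I_m -> Qp, forall x, act g f x = \sum_i c i * e i x.

(* q is a linear equivariant surjection W1 -> Qp^n with kernel W2, that is,
   it induces an isomorphism W1 / W2 ~ Qp^n. *)
Definition is_subquotient W n (rho : G -> 'M[Qp]_n) :=
  exists W1 W2 (q : (X -> Qp) -> 'cV[Qp]_n),
  [/\ [/\ lin_subspace W1, act_stable W1 & forall f, W1 f -> W f],
      [/\ lin_subspace W2, act_stable W2 & forall f, W2 f -> W1 f],
      forall (a : Qp) f g, W1 f -> W1 g ->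
        q (fun x => a * f x + g x) = a *: q f + q g,
      forall g f, W1 f -> q (act g f) = rho g *m q f &
      (forall v, exists2 f, W1 f & q f = v) /\
      (forall f, W1 f -> (q f = 0 <-> W2 f))].
End Subquotients.

End Representations.

Section TheClassC.
Variables (F : fieldType) (K : fieldType) (iota : {rmorphism F -> K}).
Variables (p : nat) (p_pr : prime p).
Local Notation Qp := (padic p_pr).
Local Notation GF := (galois_group iota).

Definition tangential_pi1 v (b : tangential_base_point v) :=
  pi1_group (tb_nonunit b iota).

Definition gal_act_fun v (b : tangential_base_point v) (s : GF)
    (f : tangential_pi1 b -> Qp) : tangential_pi1 b -> Qp :=
  fun g => f (gal_act (tg_inv s) g).

Definition in_classC n (V : GF -> 'M[Qp]_n) :=
  continuous_rep V /\
  forall v, v != 0 -> forall b : tangential_base_point v,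
    is_subquotient (@gal_act_fun v b)
      (fun f => proalg_function f /\ orbit_finite (@gal_act_fun v b) f) V.
End TheClassC.

(* Main.v *)
(* The covers of the line minus {0, 1} are read off from their Puiseux expansions
   at the tangential base point b, so that pi_1 is the Galois group over K(z) of
   the field M of algebraic functions of z that are unramified away from 0, 1 and
   infinity; that such a field is realized by covers, with their fibers on G_m, is
   a trace-form argument, and simple connectedness of the line follows from
   Liouville's theorem applied to the Euler operator t d/dt.

   Let z = 27/4 w (1 - w)^2. The map from the w-line to the z-line is ramified only
   over 0, 1 and infinity, and w = 0 is a simple zero of z. Both 3 w and
   w / (4 - 3 w) take the values 0, 1 and infinity only over these points, so the
   fields M_1 and M_2 that belong to these coordinates lie in M. The branch points
   that they have in common reduce to w = 0, hence their intersection is K(w), and the open subgroup H of pi_1 that fixes w maps onto the product of the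
   groups of two other base points b_1 and b_2, compatibly with G_F.

   Extending by zero from H, a product f_1 (x) f_2 of functions on the two groups
   becomes a function on pi_1; it is again a matrix coefficient with a finite orbit.
   With V_i realized over b_i this makes V_1 (x) V_2 a subquotient of the functions
   on pi_1. For V_1 + V_2, both are realized over b_1 and separated by the two values
   of the indicator function of the subgroup H attached to b_2, which is invariant
   under G_F. *)

Require Import Defs.
From HB Require Import structures.
From mathcomp Require Import all_boot all_order all_algebra all_field.
From mathcomp Require Import boolp classical_sets functions.
From mathcomp Require Import ring lra zify.
From mathcomp Require mpoly.
From mathcomp.real_closed Require mxtens.
From Stdlib Require List.

Set Implicit Arguments.
Unset Strict Implicit.
Unset Printing Implicit Defensive.

Import Order.TTheory GRing.Theory Num.Theory.
Local Open Scope ring_scope.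

(** * Puiseux series *)

(** Products of functions in one common argument can satisfy relations that the tensors do not. Two
    independent arguments are needed, hence a map onto a product of two groups. The tangent vectors
    of b_1 and b_2 are dictated by that of b, which is why membership for every tangent vector is
    used. The cubic w (1 - w)^2 has the critical points 1 and 1/3, and the factor 27/4 makes the
    critical values 0 and 1. Above 0 lie 0 and 1, above 1 lie 1/3 and 4/3, above infinity only
    infinity. Of these five points, 3 w uses 0, 1/3 and infinity, and w / (4 - 3 w) uses 0, 1 and
    4/3. Both must use 0: the base points sit there, and there w is a power series over F, so that
    G_F fixes w. Surjectivity onto the product is then Goursat's lemma. The obstacle is that pi_1
    consists of automorphisms of a fiber functor on triples of algebras. To pass between these and
    Galois automorphisms there must be enough triples, so each finite set of unramified functions
    needs explicit finite etale algebras over the line and over G_m with the same pullback to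
    K((t)). *)

Section Exponents.
(* The exponent of the [i]-th term of [t^(-N/(n+1))] times a power series in
   [t^(1/(n+1))]. *)
Definition pexp (n N i : nat) : rat := (i%:R - N%:R) / n.+1%:R.

Lemma pexp_inj n N : injective (pexp n N).
Proof.
move=> i j; rewrite /pexp => /mulIf; rewrite invr_eq0 pnatr_eq0 => /(_ isT).
by move/addIr/eqP; rewrite eqr_nat => /eqP.
Qed.

Lemma pexpD n N M i j : pexp n N i + pexp n M j = pexp n (N + M) (i + j).
Proof. by rewrite /pexp -mulrDl !natrD opprD addrACA. Qed.

Lemma pexpB n N M i k : (i <= k)%N ->
  pexp n (N + M) k - pexp n N i = pexp n M (k - i).
Proof.
by move=> ik; apply/eqP; rewrite subr_eq addrC pexpD subnKC.
Qed.

Lemma pexp_shift n N M i : pexp n N i = pexp n (N + M) (i + M).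
Proof. by rewrite /pexp; congr (_ / _); rewrite !natrD; ring. Qed.

Lemma pexp_scale n m N i :
  pexp n N i = pexp (n.+1 * m.+1).-1 (N * m.+1) (i * m.+1).
Proof.
rewrite /pexp prednK ?muln_gt0 // !natrM -mulrBl -mulf_div.
by rewrite divff ?mulr1 // pnatr_eq0.
Qed.
End Exponents.

Section Puiseux.
Variable K : fieldType.

Definition plev n N (a : rat -> K) :=
  forall q, a q != 0 -> exists i, q = pexp n N i.

Lemma plev_shift n N M a : plev n N a -> plev n (N + M) a.
Proof. by move=> la q /la[i ->]; exists (i + M)%N; exact: pexp_shift. Qed.

Lemma plev_scale n m N a :
  plev n N a -> plev (n.+1 * m.+1).-1 (N * m.+1) a.
Proof. by move=> la q /la[i ->]; exists (i * m.+1)%N; exact: pexp_scale. Qed.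

Lemma plev_common n N m M a b : plev n N a -> plev m M b ->
  exists k L, plev k L a /\ plev k L b.
Proof.
move=> la lb; exists (n.+1 * m.+1).-1, (N * m.+1 + M * n.+1)%N; split.
  exact/plev_shift/plev_scale.
by rewrite mulnC addnC; apply/plev_shift/plev_scale.
Qed.

(** Coefficient functions on [rat]: equality is then pointwise, and no ramification index has to be
    fixed in advance. [pc_lev] bounds the denominators of the exponents, and the exponents from
    below. *)
Record puiseux := Puiseux {
  pc : rat -> K;
  pc_lev : exists n N, plev n N pc
}.
HB.instance Definition _ := gen_eqMixin puiseux.
HB.instance Definition _ := gen_choiceMixin puiseux.
Implicit Types a b c : puiseux.

Lemma puiseuxP a b : pc a =1 pc b -> a = b.
Proof.
case: a b => [a la] [b lb] /= /funext ab; subst b.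
by congr Puiseux; exact: Prop_irrelevance.
Qed.

Lemma pc_common2 a b : exists n N, plev n N (pc a) /\ plev n N (pc b).
Proof.
have [n [N la]] := pc_lev a; have [m [M lb]] := pc_lev b.
exact: plev_common la lb.
Qed.

Lemma pc_common3 a b c :
  exists n N, [/\ plev n N (pc a), plev n N (pc b) & plev n N (pc c)].
Proof.
have [n [N [la lb]]] := pc_common2 a b; have [m [M lc]] := pc_lev c.
exists (n.+1 * m.+1).-1, (N * m.+1 + M * n.+1)%N; split.
- exact/plev_shift/plev_scale.
- exact/plev_shift/plev_scale.
- by rewrite mulnC addnC; apply/plev_shift/plev_scale.
Qed.

Lemma padd_lev a b : exists n N, plev n N (fun q => pc a q + pc b q).
Proof.
have [n [N [la lb]]] := pc_common2 a b; exists n, N => q.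
have [a0|/la//] := eqVneq (pc a q) 0; rewrite a0 add0r; exact: lb.
Qed.
Lemma popp_lev a : exists n N, plev n N (fun q => - pc a q).
Proof.
by have [n [N la]] := pc_lev a; exists n, N => q; rewrite oppr_eq0 => /la.
Qed.
Lemma pmono_lev (q0 : rat) (x : K) :
  exists n N, plev n N (fun q => if q == q0 then x else 0).
Proof.
pose m := `|denq q0|%N.-1; pose N := `|numq q0|%N.
exists m, N => q; case: (q =P q0) => [-> _|_]; last by rewrite eqxx.
have d0 : (0 < `|denq q0|)%N by rewrite absz_gt0 denq_neq0.
exists (absz (numq q0 + N%:Z)%R); rewrite /pexp prednK // -{1}(divq_num_den q0).
have n0 : 0 <= numq q0 + N%:Z by rewrite /N; lia.
congr (_ / _); last first.
  by rewrite -[RHS]/((_ %:Z)%:~R) gez0_abs // denq_ge0.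
rewrite -[X in X - _]/((_ %:Z)%:~R) gez0_abs // -[X in _ - X]/(N%:Z%:~R).
by rewrite -rmorphB /= addrK.
Qed.

Definition padd a b := Puiseux (padd_lev a b).
Definition popp a := Puiseux (popp_lev a).
Definition pmono q0 x := Puiseux (pmono_lev q0 x).

Lemma padd_A : associative padd.
Proof. by move=> a b c; apply: puiseuxP => q /=; rewrite addrA. Qed.
Lemma padd_C : commutative padd.
Proof. by move=> a b; apply: puiseuxP => q /=; rewrite addrC. Qed.
Lemma padd_0 : left_id (pmono 0 0) padd.
Proof. by move=> a; apply: puiseuxP => q /=; rewrite if_same add0r. Qed.
Lemma padd_N : left_inverse (pmono 0 0) popp padd.
Proof. by move=> a; apply: puiseuxP => q /=; rewrite if_same addNr. Qed.
HB.instance Definition _ :=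
  GRing.isZmodule.Build puiseux padd_A padd_C padd_0 padd_N.

Lemma pcD a b q : pc (a + b) q = pc a q + pc b q. Proof. by []. Qed.
Lemma pcN a q : pc (- a) q = - pc a q. Proof. by []. Qed.
Lemma pcB a b q : pc (a - b) q = pc a q - pc b q. Proof. by []. Qed.
Lemma pc0 q : pc 0 q = 0. Proof. by rewrite /= if_same. Qed.
Lemma pc_sum I (r : seq I) P (F : I -> puiseux) q :
  pc (\sum_(i <- r | P i) F i) q = \sum_(i <- r | P i) pc (F i) q.
Proof. by apply: (big_rec2 (fun a x => pc a q = x)); [exact: pc0|move=> i y x _ <-]. Qed.

Definition conv_supp a b q (l : seq rat) :=
  uniq l /\ forall r, pc a r * pc b (q - r) != 0 -> r \in l.

Lemma conv_supp_iota a b n N M k : plev n N (pc a) -> plev n M (pc b) ->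
  conv_supp a b (pexp n (N + M) k) [seq pexp n N i | i <- iota 0 k.+1].
Proof.
move=> la lb; split=> [|r].
  by rewrite map_inj_uniq ?iota_uniq //; exact: pexp_inj.
rewrite mulf_eq0 negb_or => /andP[/la[i ->] /lb[j e]].
have {}e : pexp n (N + M) k = pexp n (N + M) (i + j).
  by rewrite -pexpD -e addrC subrK.
by rewrite mem_map ?mem_iota //; [rewrite (pexp_inj e); lia|exact: pexp_inj].
Qed.

Lemma conv_supp_off a b n N M q : plev n N (pc a) -> plev n M (pc b) ->
  (forall i, q <> pexp n (N + M) i) -> conv_supp a b q [::].
Proof.
move=> la lb qN; split=> // r.
rewrite mulf_eq0 negb_or => /andP[/la[i ei] /lb[j ej]].
by case: (qN (i + j)%N); rewrite -pexpD -ei -ej addrC subrK.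
Qed.

Lemma conv_supp_ex a b q : exists l, conv_supp a b q l.
Proof.
have [n [N [la lb]]] := pc_common2 a b.
have [[i ->]|h] := pselect (exists i, q = pexp n (N + N) i).
  by exists [seq pexp n N j | j <- iota 0 i.+1]; exact: conv_supp_iota.
by exists [::]; apply: (conv_supp_off la lb) => i e; apply: h; exists i.
Qed.

(** Each coefficient of a product is a finite sum. The list of exponents is a choice; by [sum_supp]
    any other duplicate-free list that contains the support gives the same value. *)
Definition pconv a b q :=
  \sum_(r <- projT1 (cid (conv_supp_ex a b q))) pc a r * pc b (q - r).

Lemma sum_supp (F : rat -> K) l1 l2 : uniq l1 -> uniq l2 ->
  (forall r, F r != 0 -> r \in l1) -> (forall r, F r != 0 -> r \in l2) ->
  \sum_(r <- l1) F r = \sum_(r <- l2) F r.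
Proof.
move=> u1 u2 s1 s2.
rewrite (bigID (fun r => F r == 0)) /= big1 ?add0r => [|r /eqP//].
rewrite [RHS](bigID (fun r => F r == 0)) /= [X in X + _]big1 ?add0r => [|r /eqP//].
rewrite -big_filter -[RHS]big_filter; apply: perm_big.
apply: uniq_perm; rewrite ?filter_uniq // => r; rewrite !mem_filter.
by case: eqP => //= /eqP F0; rewrite s1 // s2.
Qed.

Lemma pconvE a b q l : conv_supp a b q l ->
  pconv a b q = \sum_(r <- l) pc a r * pc b (q - r).
Proof.
by move=> [ul sl]; rewrite /pconv; case: (cid _) => l' [ul' sl'] /=; exact: sum_supp.
Qed.

Lemma pconv_levE n N M a b : plev n N (pc a) -> plev n M (pc b) ->
  plev n (N + M) (pconv a b).
Proof.
move=> la lb q; apply: contra_neqP => h; rewrite (@pconvE _ _ _ [::]) ?big_nil //.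
by apply: conv_supp_off la lb _ => i e; apply: h; exists i.
Qed.

Lemma pconv_lev a b : exists n N, plev n N (pconv a b).
Proof.
by have [n [N [la lb]]] := pc_common2 a b; exists n, (N + N)%N; exact: pconv_levE.
Qed.

Definition pmul a b := Puiseux (pconv_lev a b).

Definition psq n N a := PSeries (fun i => pc a (pexp n N i)).

Lemma psq_inj n N a b : plev n N (pc a) -> plev n N (pc b) ->
  psq n N a = psq n N b -> a = b.
Proof.
move=> la lb e; apply: puiseuxP => q.
have [[i ->]|h] := pselect (exists i, q = pexp n N i).
  by have := congr1 (fun f => coefps f i) e.
have -> : pc a q = 0 by apply: contrapT => /eqP/la.
by apply/esym; apply: contrapT => /eqP/lb.
Qed.

(** At a common level, a shift of the exponents turns the convolution into that of power series in a
    root of t. Commutativity, associativity and distributivity are inherited in this way. *)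
Lemma psqM n N M a b : plev n N (pc a) -> plev n M (pc b) ->
  psq n (N + M) (pmul a b) = psq n N a * psq n M b.
Proof.
move=> la lb; apply: psP => k; rewrite coefpsM /=.
rewrite (pconvE (conv_supp_iota k la lb)) big_map -(big_mkord predT
  (fun i => pc a (pexp n N i) * pc b (pexp n M (k - i)))).
rewrite /index_iota subn0 big_seq [RHS]big_seq; apply: eq_bigr => i.
by rewrite mem_iota add0n => ik; rewrite pexpB // -ltnS.
Qed.

Lemma pmul_C : commutative pmul.
Proof.
move=> a b; have [n [N [la lb]]] := pc_common2 a b.
by apply: (@psq_inj n (N + N)); rewrite ?psqM 1?mulrC //; apply: pconv_levE.
Qed.

Lemma pmul_A : associative pmul.
Proof.
move=> a b c; have [n [N [la lb lc]]] := pc_common3 a b c.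
have lbc := pconv_levE lb lc; have lab := pconv_levE la lb.
apply: (@psq_inj n (N + (N + N))); first exact: (pconv_levE la).
  by rewrite addnA; exact: pconv_levE.
by rewrite [LHS]psqM // psqM // [in RHS]addnA psqM // psqM // mulrA.
Qed.

Lemma pmul_mono q x a r : pc (pmul (pmono q x) a) r = x * pc a (r - q).
Proof.
rewrite /= (@pconvE _ _ _ [:: q]) ?big_seq1 /= ?eqxx //; split=> // s /=.
by rewrite inE; case: (s =P q) => // _; rewrite mul0r eqxx.
Qed.

Lemma pmul_1 : left_id (pmono 0 1) pmul.
Proof. by move=> a; apply: puiseuxP => q; rewrite pmul_mono mul1r subr0. Qed.

Lemma pmul_Dl : left_distributive pmul padd.
Proof.
move=> a b c; have [n [N [la lb lc]]] := pc_common3 a b c.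
have lab : plev n N (pc (padd a b)).
  move=> q; have [a0|/la//] := eqVneq (pc a q) 0; rewrite /= a0 add0r; exact: lb.
apply: (@psq_inj n (N + N)); first exact: pconv_levE.
  move=> q; have [a0|/(pconv_levE la lc)//] := eqVneq (pconv a c q) 0.
  rewrite /= a0 add0r; exact: pconv_levE.
rewrite psqM // [RHS](_ : _ = psq n (N + N) (pmul a c) + psq n (N + N) (pmul b c)) //.
by rewrite !psqM // -mulrDl.
Qed.

Lemma pone_neq0 : pmono 0 1 != 0.
Proof.
apply/eqP => /(congr1 (fun a => pc a 0)); rewrite pc0 /=.
by move/eqP; rewrite oner_eq0.
Qed.

HB.instance Definition _ := GRing.Zmodule_isComNzRing.Build puiseux
  pmul_A pmul_C pmul_1 pmul_Dl pone_neq0.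
HB.instance Definition _ := GRing.ComNzRing_hasMulInverse.Build puiseux
  (@cmulVr puiseux) (@cunitPl puiseux) (@cinv_out puiseux).

Lemma pcM a b q l : conv_supp a b q l ->
  pc (a * b) q = \sum_(r <- l) pc a r * pc b (q - r).
Proof. exact: pconvE. Qed.

Lemma pc1 q : pc 1 q = (q == 0)%:R. Proof. by rewrite /=; case: eqP. Qed.

Lemma pcZ q x a r : pc (pmono q x * a) r = x * pc a (r - q).
Proof. exact: pmul_mono. Qed.

Lemma pmonoM q x r y : pmono q x * pmono r y = pmono (q + r) (x * y).
Proof.
apply: puiseuxP => s; rewrite pcZ /= subr_eq addrC.
by case: eqP; rewrite ?mulr0.
Qed.

End Puiseux.

(* [pser n f] is [f(t^(1/(n+1)))]. *)
Section PuiseuxField.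
Variable K : fieldType.
Implicit Types (a b : puiseux K) (f g : pseries K).

Lemma ps_inv_ex f : coefps f 0 != 0 -> exists g, f * g = 1.
Proof.
move=> f0.
(* The next coefficient of the inverse in terms of the previous ones, listed in [l]; [it n] is the
   list of the first n. *)
pose step (l : seq K) : K := ((size l == 0%N)%:R -
  \sum_(i < size l) coefps f (size l - i) * l`_i) / coefps f 0.
pose fix it n := if n is m.+1 then rcons (it m) (step (it m)) else [::] : seq K.
have sz n : size (it n) = n by elim: n => //= n; rewrite size_rcons => ->.
have itn m n : (m < n)%N -> (it n)`_m = step (it m).
  elim: n => // n IH; rewrite ltnS leq_eqVlt nth_rcons sz => /orP[/eqP ->|mn].
    by rewrite ltnn eqxx.
  by rewrite mn IH.
pose g := PSeries (fun n => step (it n)).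
exists g; apply: psP => n; rewrite mulrC coefpsM big_ord_recr /= subnn.
rewrite /step sz divfK // addrC; set S := \sum_(_ < _) _; set S' := \sum_(_ < _) _.
suff -> : S' = S by rewrite subrK; case: n @S @S'.
by apply: eq_bigr => i _; rewrite itn // -/(step _) mulrC.
Qed.

Definition pser_fun n f (q : rat) : K :=
  if pselect (exists i, q = pexp n 0 i) is left e
  then coefps f (projT1 (cid e)) else 0.

Lemma pser_funE n f i : pser_fun n f (pexp n 0 i) = coefps f i.
Proof.
rewrite /pser_fun; case: pselect => [e|[]]; last by exists i.
by case: (cid e) => j /= /pexp_inj ->.
Qed.

Lemma pser_lev0 n f : plev n 0 (pser_fun n f).
Proof. by move=> q; rewrite /pser_fun; case: pselect => // _; rewrite eqxx. Qed.

Lemma pser_lev n f : exists m N, plev m N (pser_fun n f).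
Proof. by exists n, 0%N; exact: pser_lev0. Qed.

Definition pser n f := Puiseux (pser_lev n f).

Lemma plev_pser n f : plev n 0 (pc (pser n f)).
Proof. exact: pser_lev0. Qed.

Lemma psq_pser n f : psq n 0 (pser n f) = f.
Proof. by apply: psP => i /=; rewrite pser_funE. Qed.

Lemma pser_psq n a : plev n 0 (pc a) -> pser n (psq n 0 a) = a.
Proof.
move=> la; apply: (psq_inj (@plev_pser _ _) la); exact: psq_pser.
Qed.

Lemma pser_is_zmod n : zmod_morphism (pser n).
Proof.
move=> f g; apply: (@psq_inj _ n 0); first exact: plev_pser.
  move=> q; rewrite pcB; have [f0|/plev_pser//] := eqVneq (pc (pser n f) q) 0.
  by rewrite f0 sub0r oppr_eq0; exact: (@plev_pser _ _).
by rewrite psq_pser; apply: psP => i; rewrite /= !pser_funE.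
Qed.

Lemma pser_is_monoid n : monoid_morphism (pser n).
Proof.
have l1 : plev n 0 (pc (1 : puiseux K)).
  move=> q; rewrite pc1; case: (q =P 0) => [-> _|_]; last by rewrite eqxx.
  by exists 0%N; rewrite /pexp subrr mul0r.
split=> [|f g].
  apply: (psq_inj (@plev_pser _ _) l1); rewrite psq_pser; apply: psP => i.
  rewrite [RHS]/= /pexp subr0 mulf_eq0 invr_eq0 !pnatr_eq0 orbF.
  by case: i.
have lf := @plev_pser n f; have lg := @plev_pser n g.
apply: (@psq_inj _ n 0); [exact: plev_pser|exact: (pconv_levE lf lg)|].
by rewrite psq_pser (psqM lf lg) !psq_pser.
Qed.

HB.instance Definition _ n := GRing.isZmodMorphism.Build (pseries K) (puiseux K)
  (pser n) (pser_is_zmod n).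
HB.instance Definition _ n := GRing.isMonoidMorphism.Build (pseries K)
  (puiseux K) (pser n) (pser_is_monoid n).

Lemma pser_inj n : injective (pser n).
Proof. by move=> f g /(congr1 (psq n 0)); rewrite !psq_pser. Qed.

Lemma pmono_exp q (x : K) n : pmono q x ^+ n = pmono (q *+ n) (x ^+ n).
Proof.
by elim: n => [|n IH]; rewrite ?mulr0n ?expr0 // !exprS IH pmonoM mulrS.
Qed.

Lemma puiseux_decomp a : a != 0 -> exists n q f,
  coefps f 0 != 0 /\ a = pmono q 1 * pser n f.
Proof.
move=> a0; have [n [N la]] := pc_lev a.
have /ps_neq0P[m [fm fl]] : psq n N a != 0.
  apply: contra_neq a0 => e; apply: (@psq_inj _ n N _ _ la).
    by move=> q; rewrite pc0 eqxx.
  by rewrite e; apply: psP => i /=; rewrite if_same.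
exists n, (pexp n N m), (PSeries (fun i => coefps (psq n N a) (i + m))).
split=> //; apply: puiseuxP => q; rewrite pcZ mul1r.
have [[i ->]|h] := pselect (exists i, q = pexp n N i); last first.
  have -> : pc a q = 0 by apply: contrapT => /eqP/la.
  apply/esym; apply: contrapT => /eqP/plev_pser[i e]; apply: h.
  exists (i + m)%N; move/eqP: e; rewrite subr_eq => /eqP ->.
  by rewrite pexpD add0n.
have [mi|im] := leqP m i.
  have -> : pexp n N i - pexp n N m = pexp n 0 (i - m).
    by apply/eqP; rewrite subr_eq pexpD subnK // add0n.
  by rewrite [RHS]pser_funE /= subnK.
rewrite -[LHS]/(coefps (psq n N a) i) fl //.
apply/esym; apply: contrapT => /eqP/plev_pser[j e].
have : pexp n N i = pexp n N (j + m).
  by move/eqP: e; rewrite subr_eq pexpD add0n => /eqP.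
by move/pexp_inj => e'; move: im; rewrite e' ltnNge leq_addl.
Qed.

Lemma puiseux_fieldP (a : puiseux K) : a != 0 -> a \is a GRing.unit.
Proof.
move=> /puiseux_decomp[n [q [f [f0 ->]]]]; have [g fg] := ps_inv_ex f0.
apply/asboolP; exists (pmono (- q) 1 * pser n g).
rewrite mulrACA pmonoM addNr mulr1 -rmorphM [g * f]mulrC fg rmorph1.
by rewrite mulr1.
Qed.

HB.instance Definition _ :=
  GRing.ComUnitRing_isField.Build (puiseux K) puiseux_fieldP.

End PuiseuxField.

Section PuiseuxOrder.
Variable K : fieldType.
Implicit Types (a b : puiseux K) (f g : pseries K) (x y q r : rat).

(* [pge x a] says that the order of [a] is at least [x], and [pc a 0] is the
   residue of an integral series [a]. *)
Definition pge x a := forall q, q < x -> pc a q = 0.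
Definition pint a := pge 0 a.

Lemma pge_le x y a : x <= y -> pge y a -> pge x a.
Proof. by move=> xy ya q qx; apply: ya; exact: lt_le_trans xy. Qed.

Lemma pge0 x : pge x 0.
Proof. by move=> q _; exact: pc0. Qed.

Lemma pgeB x a b : pge x a -> pge x b -> pge x (a - b).
Proof. by move=> xa xb q qx; rewrite pcB xa // xb // subr0. Qed.

Lemma pgeN x a : pge x a -> pge x (- a).
Proof. by rewrite -sub0r; apply: pgeB; exact: pge0. Qed.

Lemma pgeD x a b : pge x a -> pge x b -> pge x (a + b).
Proof. by move=> xa xb; rewrite -[b]opprK; apply: pgeB => //; exact: pgeN. Qed.

Lemma pge_sum x (I : Type) (s : seq I) (P : pred I) (F : I -> puiseux K) :
  (forall i, P i -> pge x (F i)) -> pge x (\sum_(i <- s | P i) F i).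
Proof.
move=> h; apply: (big_ind (pge x)) => //; [exact: pge0|exact: pgeD].
Qed.

Lemma conv_supp_lead x y a b :
  pge x a -> pge y b -> conv_supp a b (x + y) [:: x].
Proof.
move=> xa yb; split=> // r; rewrite mulf_eq0 negb_or inE => /andP[ar br].
have : x <= r by rewrite leNgt; apply: contraNN ar => /xa/eqP.
rewrite le_eqVlt eq_sym => /orP[//|xr]; case/eqP: br; apply: yb.
by rewrite ltrBlDr addrC ltrD2l.
Qed.

Lemma pc_lead x y a b :
  pge x a -> pge y b -> pc (a * b) (x + y) = pc a x * pc b y.
Proof.
by move=> xa yb; rewrite (pcM (conv_supp_lead xa yb)) big_seq1 [x + y]addrC addrK.
Qed.

Lemma pgeM x y a b : pge x a -> pge y b -> pge (x + y) (a * b).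
Proof.
move=> xa yb q qxy; rewrite (@pcM _ _ _ _ [::]) ?big_nil //; split=> // r.
have [rx|xr] := ltP r x; first by rewrite xa // mul0r eqxx.
rewrite yb ?mulr0 ?eqxx // ltrBlDr (lt_le_trans qxy) // [x + y]addrC.
by rewrite lerD2l.
Qed.

Lemma ord_ex a : a != 0 -> exists2 q, pc a q != 0 & pge q a.
Proof.
move=> /puiseux_decomp[n [q [f [f0 ->]]]].
have e0 : (0 : rat) = pexp n 0 0 by rewrite /pexp subrr mul0r.
exists q; first by rewrite pcZ mul1r subrr [in pc _ _]e0 /= pser_funE.
move=> r rq; rewrite pcZ mul1r; apply: contrapT => /eqP/plev_pser[i].
rewrite /pexp subr0 => e; move: rq; rewrite -subr_lt0 e ltNge.
by rewrite divr_ge0 ?ler0n.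
Qed.

Lemma pge_inv q a : pge q a -> pc a q != 0 ->
  pge (- q) a^-1 /\ pc a^-1 (- q) = (pc a q)^-1.
Proof.
move=> qa aq; have a0 : a != 0 by apply: contraNneq aq => ->; rewrite pc0.
have [r ar ra] : exists2 q, pc a^-1 q != 0 & pge q a^-1.
  by apply: ord_ex; rewrite invr_eq0.
have := pc_lead qa ra; rewrite divff // pc1.
have [qr|_ /esym/eqP] := eqVneq; last by rewrite mulf_eq0 (negPf aq) (negPf ar).
have -> : - q = r by apply/eqP; rewrite eq_sym -addr_eq0 addrC; exact/eqP.
by move=> e; split=> //; apply/(mulfI aq); rewrite -e divff.
Qed.

Lemma pint1 : pint 1.
Proof. by move=> q q0; rewrite pc1 lt_eqF. Qed.
Lemma pintM a b : pint a -> pint b -> pint (a * b).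
Proof. by rewrite /pint -{3}[0]addr0; exact: pgeM. Qed.
Lemma pintD a b : pint a -> pint b -> pint (a + b).
Proof. exact: pgeD. Qed.
Lemma pintB a b : pint a -> pint b -> pint (a - b).
Proof. exact: pgeB. Qed.
Lemma pintX a n : pint a -> pint (a ^+ n).
Proof.
by move=> ai; elim: n => [|n IH]; [exact: pint1|rewrite exprS; exact: pintM].
Qed.
Lemma res_mul a b : pint a -> pint b -> pc (a * b) 0 = pc a 0 * pc b 0.
Proof. by move=> ai bi; rewrite -{1}[0]addr0 (pc_lead ai bi). Qed.
Lemma res1 : pc (1 : puiseux K) 0 = 1.
Proof. by rewrite pc1 eqxx. Qed.
Lemma resX a n : pint a -> pc (a ^+ n) 0 = pc a 0 ^+ n.
Proof.
move=> ai; elim: n => [|n IH]; first by rewrite !expr0 res1.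
by rewrite !exprS res_mul ?IH //; exact: pintX.
Qed.

Lemma pint_unit a : pint a -> pc a 0 != 0 -> pint a^-1.
Proof. by move=> ai a0; have [] := pge_inv ai a0; rewrite oppr0. Qed.
Lemma res_inv a : pint a -> pc a 0 != 0 -> pc a^-1 0 = (pc a 0)^-1.
Proof. by move=> ai a0; have [] := pge_inv ai a0; rewrite oppr0. Qed.

Lemma pint_or_inv a : ~ pint a -> pint a^-1 /\ pc a^-1 0 = 0.
Proof.
move=> ai; have a0 : a != 0 by apply/eqP => e; apply: ai; rewrite e; exact: pge0.
have [q aq qa] := ord_ex a0; have [iq _] := pge_inv qa aq.
have q0 : q < 0.
  by rewrite ltNge; apply/negP => q0; apply: ai; exact: pge_le qa.
by split; [apply: pge_le iq|apply: iq]; rewrite ?oppr_ge0 ?ltW // oppr_gt0.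
Qed.

(** The valuation ring is integrally closed: if [a] had a pole, dividing its equation by a power of
    [a] would express [a] as a polynomial in a^-1 with integral coefficients, while a^-1 is
    integral. *)
Lemma pint_root (p : {poly puiseux K}) a :
  p \is monic -> (forall i, pint p`_i) -> root p a -> pint a.
Proof.
move=> pm pi /rootP pa; apply: contrapT => ai.
have a0 : a != 0 by apply/eqP => e; apply: ai; rewrite e; exact: pge0.
have [bi _] := pint_or_inv ai.
case: (posnP (size p).-1) => [s0|].
  have p1 : p = 1.
    apply/polyP => i; rewrite coef1; case: i => [|i].
      by have /monicP := pm; rewrite lead_coefE s0.
    by rewrite nth_default //; move: s0; case: (size p) => [|[]].
  by move/eqP: pa; rewrite p1 hornerC oner_eq0.
move=> n0; have [k sk] : exists k, size p = k.+2.
  by exists (size p).-2; move: n0; case: (size p) => [|[]].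
move: pa (monicP pm); rewrite lead_coefE horner_coef sk /= => /eqP pa pk; apply: ai.
move: pa; rewrite big_ord_recr /= pk mul1r addrC addr_eq0 exprSr.
move=> /eqP/(canRL (mulKf _)) -> //; last by rewrite expf_neq0.
rewrite mulrN mulr_sumr; apply/pgeN/pge_sum => i _; rewrite mulrCA.
apply: pintM; first exact: pi.
rewrite -[X in (a ^+ X)^-1](@subnK i k); last by rewrite -ltnS ltn_ord.
rewrite exprD invfM -mulrA mulVf ?expf_neq0 // mulr1 -exprVn; exact: pintX.
Qed.

Lemma pgeX_nat x a n : pge x a -> pge (x *+ n) (a ^+ n).
Proof.
move=> xa; elim: n => [|n IH]; first by rewrite mulr0n expr0; exact: pint1.
by rewrite mulrS exprS; exact: pgeM.
Qed.

End PuiseuxOrder.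

Section PuiseuxLevel.
Variable K : fieldType.
Implicit Types (a b : puiseux K) (f g : pseries K).

(* The field of Laurent series in [t^(1/(n+1))]. *)
Definition lau n : laurent K -> puiseux K := frac_lift (@pser_inj K n).
HB.instance Definition _ n := GRing.RMorphism.on (lau n).
Arguments lau : simpl never.

(** Level 0 is K((t)) itself; an expansion of level 0 is how being unramified at a place is
    expressed throughout. *)
Definition lvl n a := exists x, a = lau n x.

Lemma lau_ps n f : lau n (FracField.tofrac f) = pser n f.
Proof. exact: frac_lift_tofrac. Qed.

Lemma lvl_ps n f : lvl n (pser n f).
Proof. by exists (FracField.tofrac f); rewrite lau_ps. Qed.
Lemma lvl0 n : lvl n 0. Proof. by exists 0; rewrite rmorph0. Qed.
Lemma lvlB n a b : lvl n a -> lvl n b -> lvl n (a - b).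
Proof. by move=> [x ->] [y ->]; exists (x - y); rewrite rmorphB. Qed.
Lemma lvlD n a b : lvl n a -> lvl n b -> lvl n (a + b).
Proof. by move=> [x ->] [y ->]; exists (x + y); rewrite rmorphD. Qed.
Lemma lvlM n a b : lvl n a -> lvl n b -> lvl n (a * b).
Proof. by move=> [x ->] [y ->]; exists (x * y); rewrite rmorphM. Qed.
Lemma lvlV n a : lvl n a -> lvl n a^-1.
Proof. by move=> [x ->]; exists x^-1; rewrite fmorphV. Qed.
Lemma lvlX n a k : lvl n a -> lvl n (a ^+ k).
Proof. by move=> [x ->]; exists (x ^+ k); rewrite rmorphXn. Qed.
Lemma lvl_sum n (I : Type) (s : seq I) (P : pred I) (F : I -> puiseux K) :
  (forall i, P i -> lvl n (F i)) -> lvl n (\sum_(i <- s | P i) F i).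
Proof. by move=> h; apply: (big_ind (lvl n)) => //; [exact: lvl0|exact: lvlD]. Qed.

Lemma pmono_pser n (x : K) m :
  pmono (m%:R / n.+1%:R) x = pser n (psC x * psX K ^+ m).
Proof.
have pX : pser n (psX K) = pmono (n.+1%:R)^-1 1.
  apply: (@psq_inj _ n 0); first exact: plev_pser.
    move=> q; rewrite /=; case: (q =P _) => [-> _|_]; last by rewrite eqxx.
    by exists 1%N; rewrite /pexp subr0 mul1r.
  rewrite psq_pser; apply: psP => i /=; rewrite /pexp subr0.
  have n0 : n.+1%:R != 0 :> rat by rewrite pnatr_eq0.
  by rewrite -(inj_eq (mulIf n0)) /= divfK // mulVf // pnatr_eq1; case: eqP.
have pC : pser n (psC x) = pmono 0 x.
  apply: (@psq_inj _ n 0); first exact: plev_pser.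
    move=> q; rewrite /=; case: (q =P _) => [-> _|_]; last by rewrite eqxx.
    by exists 0%N; rewrite /pexp subr0 mul0r.
  rewrite psq_pser; apply: psP => i /=; rewrite /pexp subr0 mulf_eq0.
  by rewrite invr_eq0 !pnatr_eq0 orbF.
rewrite rmorphM rmorphXn /= pX pC pmono_exp pmonoM add0r expr1n mulr1.
by rewrite mulr_natl.
Qed.

Lemma pser_Xn n m : pser n (psX K ^+ m) = pmono (m%:R / n.+1%:R) 1.
Proof. by rewrite pmono_pser rmorph1 mul1r. Qed.

(** A nonzero power series is a power of t times a unit, so denominators can be taken to be powers
    of t. *)
Lemma laurentP (x : laurent K) : exists m f,
  x * FracField.tofrac (psX K ^+ m) = FracField.tofrac f.
Proof.
have d0 := denom_ratioP (repr x); rewrite (frac_numden x).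
set p := \n_ _; set d := \d_ _ in d0 *.
have [m [dm dl]] := ps_neq0P d0.
have eX k i : coefps (psX K ^+ k) i = (i == k)%:R.
  elim: k i => [|k IH] i; first by rewrite expr0 /=; case: i.
  rewrite exprS coefpsM; case: i => [|i].
    by rewrite big_ord_recl big_ord0 mul0r addr0.
  rewrite big_ord_recl big_ord_recl big1 => [|j _] /=; last by rewrite mul0r.
  by rewrite mul0r mul1r add0r addr0 subn1 /= IH.
have de : d = psX K ^+ m * PSeries (fun i => coefps d (i + m)).
  apply: psP => i; rewrite coefpsM; have [im|mi] := ltnP i m.
    rewrite dl // big1 // => j _; rewrite eX ltn_eqF ?mul0r //.
    by apply: leq_ltn_trans im; rewrite -ltnS.
  rewrite (bigD1 (Ordinal (mi : (m < i.+1)%N))) //= big1 => [|j].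
    by rewrite addr0 eX eqxx mul1r subnK.
  by rewrite -val_eqE /= eX => /negPf ->; rewrite mul0r.
have [g dg] : exists g, PSeries (fun i => coefps d (i + m)) * g = 1.
  exact: ps_inv_ex.
exists m, (p * g); have d0F : FracField.tofrac d != 0 by rewrite tofrac_eq0.
apply: (mulIf d0F); rewrite mulrAC divfK // -!tofracM; congr FracField.tofrac.
move: de dg; move: (PSeries _) => d' -> dg.
by rewrite -[LHS]mulr1 -dg; ring.
Qed.

Lemma lvl_plev n a : lvl n a -> exists N, plev n N (pc a).
Proof.
move=> [x ->]; have [m [f ef]] := laurentP x.
have e : lau n x * pmono (m%:R / n.+1%:R) 1 = pser n f.
  by rewrite -lau_ps -ef rmorphM -pser_Xn -lau_ps.
exists m => q; have := congr1 (fun a => pc a (q + m%:R / n.+1%:R)) e.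
rewrite mulrC pcZ mul1r addrK => -> /plev_pser[i ei]; exists i.
by move/eqP: ei; rewrite eq_sym -subr_eq eq_sym => /eqP ->; rewrite /pexp subr0 mulrBl.
Qed.

Lemma plev_lvl n N a : plev n N (pc a) -> lvl n a.
Proof.
move=> la; pose m := pmono (N%:R / n.+1%:R) (1 : K).
have m1 : m * pmono (- (N%:R / n.+1%:R)) 1 = 1.
  by rewrite pmonoM subrr mulr1.
have lm : lvl n m by rewrite /m pmono_pser; exact: lvl_ps.
have -> : a = m^-1 * (m * a).
  by rewrite mulKf //; apply: contra_eq_neq m1 => ->; rewrite mul0r eq_sym oner_eq0.
apply: lvlM; first exact: lvlV.
suff /pser_psq <- : plev n 0 (pc (m * a)) by exact: lvl_ps.
move=> q; rewrite pcZ mul1r => /la[i ei]; exists i.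
by move/eqP: ei; rewrite subr_eq => /eqP ->; rewrite /pexp mulrBl subrK subr0.
Qed.

Lemma lvl_ex a : exists n, lvl n a.
Proof. by have [n [N /plev_lvl]] := pc_lev a; exists n. Qed.

Lemma lvl_scale n m a : lvl n a -> lvl (n.+1 * m.+1).-1 a.
Proof. by move=> /lvl_plev[N /(plev_scale m)]; exact: plev_lvl. Qed.

Lemma lvl_common (s : seq (puiseux K)) : exists n, forall a, a \in s -> lvl n a.
Proof.
elim: s => [|b s [n IH]]; first by exists 0%N.
have [m bm] := lvl_ex b; exists (n.+1 * m.+1).-1 => a.
rewrite inE => /orP[/eqP ->|/IH]; last exact: lvl_scale.
by rewrite mulnC; exact: lvl_scale.
Qed.

Lemma lvl_int_ps n a : lvl n a -> pint a -> exists f, a = pser n f.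
Proof.
move=> /lvl_plev[N la] ai; exists (psq n 0 a); rewrite pser_psq // => q aq.
have [i ei] := la _ aq.
have : 0 <= q by rewrite leNgt; apply: contraNN aq => /ai/eqP.
rewrite ei pmulr_lge0 ?invr_gt0 ?ltr0n // subr_ge0 ler_nat => Ni.
by exists (i - N)%N; rewrite /pexp subr0 natrB.
Qed.

Lemma lvl0_supp a q : lvl 0 a -> pc a q != 0 -> exists z : int, q = z%:~R.
Proof.
move=> /lvl_plev[N la] /la[i ->]; exists (i%:Z - N%:Z).
by rewrite /pexp divr1 rmorphB.
Qed.

Lemma pint_lvl0_pge1 a : lvl 0 a -> pint a -> pc a 0 = 0 -> pge 1 a.
Proof.
move=> la ai a0 q q1; apply: contrapT => /eqP aq.
have [z ez] := lvl0_supp la aq; case/eqP: aq.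
have [q0|] := ltP q 0; first exact: ai.
move: q1; rewrite ez ltrz1 ler0z => z1 z0.
by have -> : z = 0 by lia.
Qed.

Definition pcst (x : K) : puiseux K := pser 0 (psC x).
HB.instance Definition _ := GRing.RMorphism.copy pcst (pser 0 \o @psC K).
Lemma pser_C n (x : K) : pser n (psC x) = pmono 0 x.
Proof. by have := pmono_pser n x 0; rewrite mul0r expr0 mulr1. Qed.
Lemma pcstE x : pcst x = pmono 0 x.
Proof. exact: pser_C. Qed.
Lemma lvl_cst n x : lvl n (pcst x).
Proof. by rewrite pcstE -(pser_C n); exact: lvl_ps. Qed.
Lemma pint_cst x : pint (pcst x).
Proof. by rewrite pcstE => q q0 /=; rewrite lt_eqF. Qed.
Lemma pc_cst x q : pc (pcst x) q = if q == 0 then x else 0.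
Proof. by rewrite pcstE. Qed.
Lemma res_cst x : pc (pcst x) 0 = x.
Proof. by rewrite pc_cst eqxx. Qed.
Lemma pc_cstM x a q : pc (pcst x * a) q = x * pc a q.
Proof. by rewrite pcstE pcZ subr0. Qed.

Definition pX : puiseux K := pser 0 (psX K).
Lemma pXE : pX = pmono 1 1.
Proof.
by rewrite /pX -[psX K]expr1 pser_Xn divr1.
Qed.
Lemma lvl_X : lvl 0 pX. Proof. exact: lvl_ps. Qed.
Lemma pint_X : pint pX.
Proof. by rewrite pXE => q q0 /=; case: eqP q0 => // ->. Qed.
Lemma pge_X : pge 1 pX.
Proof. by rewrite pXE => q q0 /=; rewrite lt_eqF. Qed.
Lemma pc_X1 : pc pX 1 = 1. Proof. by rewrite pXE. Qed.
Lemma res_X : pc pX 0 = 0. Proof. by rewrite pXE. Qed.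
Lemma pX_neq0 : pX != 0.
Proof. by apply/eqP => e; have := pc_X1; rewrite e pc0 => /esym/eqP; rewrite oner_eq0. Qed.

End PuiseuxLevel.

Section PuiseuxMaps.
Variable K : fieldType.
Implicit Types (a b : puiseux K).

(* The substitution [t := t^(n+1)]. *)
Section Scale.
Variable n : nat.
Local Notation n1 := (n.+1%:R : rat).
Let n1_neq0 : n1 != 0. Proof. by rewrite pnatr_eq0. Qed.

Lemma pscale_levE m N a : plev m N (pc a) ->
  plev m (N * n.+1) (fun q => pc a (q / n1)).
Proof.
move=> la q /la[i ei]; exists (i * n.+1)%N; rewrite -[q](divfK n1_neq0) ei.
by rewrite /pexp mulrAC !natrM -mulrBl.
Qed.
Lemma pscale_lev a : exists m N, plev m N (fun q => pc a (q / n1)).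
Proof. by have [m [N /pscale_levE]] := pc_lev a; exists m, (N * n.+1)%N. Qed.

Definition pscale a := Puiseux (pscale_lev a).

Lemma pscale_is_zmod : zmod_morphism pscale.
Proof. by move=> a b; exact: puiseuxP. Qed.
Lemma pscale_is_monoid : monoid_morphism pscale.
Proof.
split=> [|a b]; apply: puiseuxP => q.
  by rewrite [LHS]/= pc1 mulf_eq0 invr_eq0 (negPf n1_neq0) orbF; case: eqP.
have [l [ul cl]] := conv_supp_ex a b (q / n1).
rewrite [LHS](pcM (conj ul cl)) (@pcM _ _ _ _ [seq r * n1 | r <- l]).
  by rewrite big_map; apply: eq_bigr => r _; rewrite /= mulrBl mulfK.
split=> [|r /=]; first by rewrite map_inj_uniq //; exact: mulIf.
rewrite mulrBl => /cl rl; apply/mapP; exists (r / n1) => //.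
by rewrite divfK.
Qed.
HB.instance Definition _ := GRing.isZmodMorphism.Build (puiseux K) (puiseux K)
  pscale pscale_is_zmod.
HB.instance Definition _ := GRing.isMonoidMorphism.Build (puiseux K)
  (puiseux K) pscale pscale_is_monoid.

Lemma pscale_mono q x : pscale (pmono q x) = pmono (q * n1) x.
Proof.
apply: puiseuxP => r /=; congr (if _ then _ else _).
by apply/eqP/eqP => [<-|->]; rewrite ?divfK ?mulfK.
Qed.

Lemma pscale_lvl a : lvl n a -> lvl 0 (pscale a).
Proof.
move=> /lvl_plev[N la]; apply: (@plev_lvl _ 0 N) => q /la[i ei].
by exists i; rewrite -[q](divfK n1_neq0) ei /pexp divfK // divr1.
Qed.

Lemma pscale_ex b : exists a, pscale a = b.
Proof.
have [m [N lb]] := pc_lev b.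
suff h : exists m N, plev m N (fun q => pc b (q * n1)).
  by exists (Puiseux h); apply: puiseuxP => q /=; rewrite divfK.
exists (m.+1 * n.+1).-1, N => q /lb[i ei]; exists i.
by rewrite -[q](mulfK n1_neq0) ei /pexp -mulrA -invfM -natrM prednK ?muln_gt0.
Qed.
End Scale.

Section CoefMap.
Variable s : {rmorphism K -> K}.
Lemma pmap_lev a : exists m N, plev m N (s \o pc a).
Proof.
have [m [N la]] := pc_lev a; exists m, N => q /= saq; apply: la.
by apply: contraNneq saq => ->; rewrite rmorph0.
Qed.
Definition pmap a := Puiseux (pmap_lev a).
Lemma pmap_is_zmod : zmod_morphism pmap.
Proof. by move=> a b; apply: puiseuxP => q; rewrite /= rmorphB. Qed.
Lemma pmap_is_monoid : monoid_morphism pmap.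
Proof.
split=> [|a b]; apply: puiseuxP => q.
  by rewrite /=; case: eqP => _; rewrite ?rmorph1 ?rmorph0.
have [l [ul cl]] := conv_supp_ex a b q.
rewrite [LHS]/= -[pconv a b q]/(pc (a * b) q) (pcM (conj ul cl)).
rewrite rmorph_sum (@pcM _ _ _ _ l).
  by apply: eq_bigr => r _; rewrite rmorphM.
by split=> // r; rewrite /= -rmorphM fmorph_eq0; exact: cl.
Qed.
HB.instance Definition _ := GRing.isZmodMorphism.Build (puiseux K) (puiseux K)
  pmap pmap_is_zmod.
HB.instance Definition _ := GRing.isMonoidMorphism.Build (puiseux K)
  (puiseux K) pmap pmap_is_monoid.

Lemma pmap_mono q x : pmap (pmono q x) = pmono q (s x).
Proof. by apply: puiseuxP => r /=; case: eqP; rewrite ?rmorph0. Qed.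
Lemma pmap_pser n f : pmap (pser n f) = pser n (ps_map s f).
Proof.
apply: (@psq_inj _ n 0); last by rewrite psq_pser; apply: psP => i /=; rewrite pser_funE.
  by move=> q; rewrite -[pc _ q]/(s (pc (pser n f) q)) fmorph_eq0 => /plev_pser.
exact: plev_pser.
Qed.
End CoefMap.

(* Laurent polynomials in the roots of [t], and their value at [t^q = 1]. *)
Definition pfin a := exists l : seq rat, forall q, pc a q != 0 -> q \in l.

Lemma pfin_uniq a : pfin a -> exists2 l, uniq l & forall q, pc a q != 0 -> q \in l.
Proof.
by move=> [l h]; exists (undup l); [exact: undup_uniq|move=> q /h; rewrite mem_undup].
Qed.

Lemma pfin_mono q x : pfin (pmono q x).
Proof. by exists [:: q] => r /=; case: (r =P q) => [->|]; rewrite ?inE ?eqxx. Qed.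
Lemma pfinB a b : pfin a -> pfin b -> pfin (a - b).
Proof.
move=> [l al] [m bm]; exists (l ++ m) => q; rewrite pcB mem_cat.
have [-> |/al ->//] := eqVneq (pc a q) 0.
by rewrite sub0r oppr_eq0 => /bm ->; rewrite orbT.
Qed.
Lemma pfin0 : pfin 0. Proof. exact: pfin_mono. Qed.
Lemma pfinN a : pfin a -> pfin (- a).
Proof. by move=> fa; rewrite -sub0r; apply: pfinB => //; exact: pfin0. Qed.
Lemma pfinD a b : pfin a -> pfin b -> pfin (a + b).
Proof. by move=> fa fb; rewrite -[b]opprK; apply: pfinB => //; exact: pfinN. Qed.
Lemma pfin_sum (I : Type) (s : seq I) (P : pred I) (F : I -> puiseux K) :
  (forall i, P i -> pfin (F i)) -> pfin (\sum_(i <- s | P i) F i).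
Proof. by move=> h; apply: (big_ind pfin) => //; [exact: pfin0|exact: pfinD]. Qed.

Lemma pfinE a l : uniq l -> (forall q, pc a q != 0 -> q \in l) ->
  a = \sum_(q <- l) pmono q (pc a q).
Proof.
move=> ul al; apply: puiseuxP => q; rewrite pc_sum.
rewrite (@sum_supp _ (fun r => pc (pmono r (pc a r)) q) l [:: q]) //.
- by rewrite big_seq1 /= eqxx.
- by move=> r /=; case: (q =P r) => [<- /al//|]; rewrite eqxx.
- by move=> r /=; rewrite inE; case: (q =P r) => [->|_]; rewrite ?eqxx.
Qed.

Lemma pfinM a b : pfin a -> pfin b -> pfin (a * b).
Proof.
move=> /pfin_uniq[l ul al] /pfin_uniq[m um bm].
rewrite (pfinE ul al) (pfinE um bm) mulr_suml; apply: pfin_sum => q _.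
by rewrite mulr_sumr; apply: pfin_sum => r _; rewrite pmonoM; exact: pfin_mono.
Qed.

Lemma pfin1 : pfin 1. Proof. exact: pfin_mono. Qed.
Lemma pfinX a n : pfin a -> pfin (a ^+ n).
Proof.
by move=> fa; elim: n => [|n IH]; rewrite ?expr0 ?exprS; [exact: pfin1|exact: pfinM].
Qed.

(** All the roots t^(1/n) are set to 1 at once: this compatible choice of roots is what the fiber at
    t = 1 amounts to. Series with infinite support get the value 0. *)
Definition ev1 a : K :=
  if pselect (pfin a) is left e then \sum_(q <- undup (projT1 (cid e))) pc a q
  else 0.

Lemma ev1E a l : uniq l -> (forall q, pc a q != 0 -> q \in l) ->
  ev1 a = \sum_(q <- l) pc a q.
Proof.
move=> ul al; rewrite /ev1; case: pselect => [e|[]]; last by exists l.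
case: (cid e) => m /= am; apply: sum_supp => // [|q /am].
  exact: undup_uniq.
by rewrite mem_undup.
Qed.

Lemma ev1_mono q x : ev1 (pmono q x) = x.
Proof.
rewrite (@ev1E _ [:: q]) ?big_seq1 /= ?eqxx // => r.
by rewrite inE; case: (r =P q) => _ //; rewrite eqxx.
Qed.

Lemma ev1D a b : pfin a -> pfin b -> ev1 (a + b) = ev1 a + ev1 b.
Proof.
move=> [l al] [m bm]; pose k := undup (l ++ m).
have ak q : pc a q != 0 -> q \in k by move=> /al ql; rewrite mem_undup mem_cat ql.
have bk q : pc b q != 0 -> q \in k.
  by move=> /bm ql; rewrite mem_undup mem_cat ql orbT.
have uk : uniq k by exact: undup_uniq.
rewrite (ev1E uk ak) (ev1E uk bk) -big_split; apply: ev1E => // q.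
by rewrite pcD; have [->|/ak//] := eqVneq (pc a q) 0; rewrite add0r; exact: bk.
Qed.

Lemma ev1_sum (I : Type) (s : seq I) (F : I -> puiseux K) :
  (forall i, pfin (F i)) -> ev1 (\sum_(i <- s) F i) = \sum_(i <- s) ev1 (F i).
Proof.
move=> h; elim: s => [|i s IH]; first by rewrite !big_nil ev1_mono.
rewrite !big_cons ev1D ?IH //; exact: pfin_sum.
Qed.

Lemma ev1M a b : pfin a -> pfin b -> ev1 (a * b) = ev1 a * ev1 b.
Proof.
move=> /pfin_uniq[l ul al] /pfin_uniq[m um bm].
rewrite (ev1E ul al) (ev1E um bm) {1}(pfinE ul al) {1}(pfinE um bm).
rewrite mulr_suml ev1_sum => [|q]; last first.
  by rewrite mulr_sumr; apply: pfin_sum => r _; rewrite pmonoM; exact: pfin_mono.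
rewrite mulr_suml; apply: eq_bigr => q _.
rewrite mulr_sumr ev1_sum => [|r]; last by rewrite pmonoM; exact: pfin_mono.
by rewrite mulr_sumr; apply: eq_bigr => r _; rewrite pmonoM ev1_mono.
Qed.
Lemma ev1N a : pfin a -> ev1 (- a) = - ev1 a.
Proof.
move=> fa; have -> : - a = pmono 0 (-1) * a.
  by apply: puiseuxP => q; rewrite pcZ mulN1r subr0.
by rewrite ev1M ?ev1_mono ?mulN1r //; exact: pfin_mono.
Qed.
End PuiseuxMaps.

(** * The Euler operator on Puiseux series in characteristic zero *)

Section Euler.
Variable K : fieldType.
Hypothesis charK : [pchar K] =i pred0.
Implicit Types (a b : puiseux K).

Lemma natrK_neq0 n : (n.+1%:R : K) != 0.
Proof.
by have /pcharf0P -> : [pchar K] =i pred0 by [].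
Qed.

Lemma intrK_neq0 (z : int) : z != 0 -> (z%:~R : K) != 0.
Proof.
case: z => [[|n]|n] // _; first exact: natrK_neq0.
by rewrite NegzE rmorphN /= oppr_eq0; exact: natrK_neq0.
Qed.

(** The image of a rational exponent in [K]; it respects sums because denominators are invertible in
    characteristic zero. *)
Definition qK (q : rat) : K := (numq q)%:~R / (denq q)%:~R.

Lemma qKE (z d : int) : d != 0 -> qK (z%:~R / d%:~R) = z%:~R / d%:~R.
Proof.
move=> d0; set q := _ / _; rewrite /qK; apply/eqP.
rewrite eqr_div ?intrK_neq0 ?denq_neq0 // -!rmorphM /=; apply/eqP; congr _%:~R.
apply: (@intr_inj rat); rewrite !rmorphM /=.
have : q = (numq q)%:~R / (denq q)%:~R by rewrite divq_num_den.
move/eqP; rewrite /q eqr_div ?intr_eq0 ?denq_neq0 // => /eqP ->.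
by rewrite mulrC.
Qed.

Lemma qKB q r : qK (q - r) = qK q - qK r.
Proof.
rewrite -(divq_num_den q) -(divq_num_den r) -mulNr addf_div ?intr_eq0 ?denq_neq0 //.
rewrite -rmorphN -!rmorphM -rmorphD /= !qKE ?mulf_neq0 ?denq_neq0 //.
rewrite rmorphD !rmorphM rmorphN /= -addf_div ?intrK_neq0 ?denq_neq0 //.
by rewrite mulNr.
Qed.
Lemma qK_nat n : qK n%:R = n%:R.
Proof.
have := @qKE n%:Z 1; rewrite divr1 => -> //; by rewrite divr1.
Qed.
Lemma qKD q r : qK (q + r) = qK q + qK r.
Proof.
by rewrite -[r in LHS]opprK qKB -[- r]sub0r qKB (qK_nat 0) sub0r opprK.
Qed.

(* The Euler operator [t d/dt]. *)
Lemma ptheta_lev a : exists m N, plev m N (fun q => qK q * pc a q).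
Proof.
have [m [N la]] := pc_lev a; exists m, N => q.
by rewrite mulf_eq0 negb_or => /andP[_ /la].
Qed.
Definition ptheta a := Puiseux (ptheta_lev a).

Lemma pc_theta a q : pc (ptheta a) q = qK q * pc a q. Proof. by []. Qed.

Lemma ptheta_is_zmod : zmod_morphism ptheta.
Proof. by move=> a b; apply: puiseuxP => q; rewrite /= mulrBr. Qed.
HB.instance Definition _ := GRing.isZmodMorphism.Build (puiseux K) (puiseux K)
  ptheta ptheta_is_zmod.

Lemma pthetaM a b : ptheta (a * b) = ptheta a * b + a * ptheta b.
Proof.
apply: puiseuxP => q; have [l [ul cl]] := conv_supp_ex a b q.
rewrite [LHS]/= -[pconv a b q]/(pc (a * b) q) (pcM (conj ul cl)) pcD.
rewrite !(@pcM _ _ _ _ l).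
- rewrite -big_split mulr_sumr; apply: eq_bigr => r _ /=.
  by rewrite -[q in qK q](subrK r) qKD; ring.
- split=> // r /=; rewrite mulrCA mulf_eq0 negb_or => /andP[_]; exact: cl.
- split=> // r /=; rewrite -mulrA mulf_eq0 negb_or => /andP[_]; exact: cl.
Qed.

Lemma ptheta_cst x : ptheta (pcst x) = 0.
Proof.
apply: puiseuxP => q; rewrite pc_theta pc_cst pc0.
by case: eqP => [->|]; rewrite ?mulr0 // (qK_nat 0) mul0r.
Qed.
Lemma ptheta_X : ptheta (pX K) = pX K.
Proof.
apply: puiseuxP => q; rewrite pc_theta pXE /=.
by case: eqP => [->|]; rewrite ?mulr0 // (qK_nat 1) mul1r.
Qed.
Lemma pge_theta x a : pge x a -> pge x (ptheta a).
Proof. by move=> xa q qx; rewrite /= xa // mulr0. Qed.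
Lemma lvl_theta n a : lvl n a -> lvl n (ptheta a).
Proof.
move=> /lvl_plev[N la]; apply: (@plev_lvl _ n N) => q.
by rewrite /= mulf_eq0 negb_or => /andP[_ /la].
Qed.
Lemma res_theta a : pc (ptheta a) 0 = 0.
Proof. by rewrite /= (qK_nat 0) mul0r. Qed.
End Euler.
Lemma pc_mono (K : fieldType) q (x : K) r :
  pc (pmono q x) r = if r == q then x else 0.
Proof. by []. Qed.

Lemma pc_pser (K : fieldType) n (f : pseries K) i :
  pc (pser n f) (pexp n 0 i) = coefps f i.
Proof. exact: pser_funE. Qed.

Arguments pc : simpl never.

(** * The algebraic closure of the field of Laurent series *)

Section Hensel.
Variable K : fieldType.
Implicit Types (p g h : {poly pseries K}).

Definition ps_res (f : pseries K) : K := coefps f 0.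
Lemma ps_res_zmod : zmod_morphism ps_res. Proof. by []. Qed.
Lemma ps_res_monoid : monoid_morphism ps_res.
Proof. by split=> // f g; exact: coefps0_mul. Qed.
HB.instance Definition _ := GRing.isZmodMorphism.Build (pseries K) K
  ps_res ps_res_zmod.
HB.instance Definition _ := GRing.isMonoidMorphism.Build (pseries K) K
  ps_res ps_res_monoid.

Lemma coefps_sum I (s : seq I) (F : I -> pseries K) k :
  coefps (\sum_(i <- s) F i) k = \sum_(i <- s) coefps (F i) k.
Proof.
by apply: (big_rec2 (fun a x => coefps a k = x)) => [|i y x _ <-//]; case: k.
Qed.

(** Reducing one Bezout coefficient modulo [a] brings both below the degrees of the factors. This
    solves the linear equation that Hensel lifting meets at each order. *)
Lemma bezout_small (a b c : {poly K}) : a \is monic -> b \is monic ->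
  coprimep a b -> (size c < size (a * b)%R)%N ->
  exists u v, [/\ c = a * v + b * u, (size u < size a)%N & (size v < size b)%N].
Proof.
move=> am bm /Bezout_eq1_coprimepP[[x y] /= e] sc.
have a0 : a != 0 := monic_neq0 am; have b0 : b != 0 := monic_neq0 bm.
pose u := (y * c) %% a; have su : (size u < size a)%N by rewrite ltn_modp.
have [v ev] : exists v, c - b * u = a * v.
  exists (x * c + b * ((y * c) %/ a)).
  have := divp_eq (y * c) a; rewrite -/u; move: (_ %/ _) => q eu.
  rewrite mulrDr mulrCA [a * (b * q)]mulrCA -[a * q]mulrC -(addrK u (q * a)) -eu.
  by rewrite -{1}[c]mul1r -e; ring.
exists u, v; split=> //; first by rewrite -ev subrK.
have [->|v0] := eqVneq v 0; first by rewrite size_poly0 size_poly_gt0.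
have : (size (a * v)%R < size (a * b)%R)%N.
  rewrite -ev (leq_ltn_trans (size_polyD _ _)) // size_polyN gtn_max sc /=.
  have [->|u0] := eqVneq u 0.
    by rewrite mulr0 size_poly0 size_poly_gt0 mulf_neq0.
  rewrite mulrC !size_mul //.
  by move: (size_poly_gt0 a) (size_poly_gt0 b) su; rewrite a0 b0; move: (size u) (size a) (size b); lia.
rewrite !size_mul //; move: (size_poly_gt0 a); rewrite a0; move: (size v) (size a) (size b); lia.
Qed.

(** The factors are found coefficient by coefficient in t: at order n the new pair enters linearly,
    as a v + b u, and the other terms are known. The bounds on the sizes keep the first factor monic
    of the size of [a]. *)
Lemma hensel p (a b : {poly K}) : p \is monic -> a \is monic -> b \is monic ->
  coprimep a b -> map_poly ps_res p = a * b ->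
  exists g h, [/\ g \is monic, size g = size a, p = g * h & map_poly ps_res g = a].
Proof.
move=> pm am bm ab rp.
have sp : size p = size (a * b)%R.
  by rewrite -rp size_map_poly_id0 // (monicP pm) rmorph1 oner_neq0.
pose pk k := \poly_(i < size p) coefps p`_i k.
have pkE k i : (pk k)`_i = coefps p`_i k.
  rewrite coef_poly; case: ltnP => // /(nth_default 0) ->.
  by case: k.
have pk0 : pk 0%N = a * b.
  by rewrite -rp; apply/polyP => i; rewrite pkE.
have spk k : (0 < k)%N -> (size (pk k) < size (a * b)%R)%N.
  move=> k0; rewrite -sp -[size p]prednK ?size_poly_gt0 ?monic_neq0 // ltnS.
  apply/leq_sizeP => j; rewrite leq_eqVlt => /orP[/eqP <-|].
    rewrite pkE -lead_coefE (monicP pm); by case: k k0.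
  rewrite prednK ?size_poly_gt0 ?monic_neq0 // pkE => /(nth_default 0) ->.
  by case: (k).
(* Made total with the pair 0, so that the recursion can be defined before the sizes of its
   right-hand sides are known. *)
have nxt (c : {poly K}) : exists uv : {poly K} * {poly K}, (size c < size (a * b)%R)%N ->
    [/\ c = a * uv.2 + b * uv.1, (size uv.1 < size a)%N & (size uv.2 < size b)%N].
  have [sc|sc] := boolP (size c < size (a * b)%R)%N; last by exists 0.
  by have [u [v h]] := bezout_small am bm ab sc; exists (u, v).
(* What the known coefficients leave to be matched at order [size l]. *)
pose rhs (l : seq ({poly K} * {poly K})) := pk (size l) -
  \sum_(1 <= i < size l) (nth 0 l i).1 * (nth 0 l (size l - i)).2.
pose step l := if l is [::] then (a, b) else projT1 (cid (nxt (rhs l))).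
pose fix it n := if n is m.+1 then rcons (it m) (step (it m)) else [::].
have sz n : size (it n) = n by elim: n => //= n; rewrite size_rcons => ->.
pose s n := step (it n).
have itn m n : (m < n)%N -> nth 0 (it n) m = s m.
  elim: n => // n IH; rewrite ltnS leq_eqVlt nth_rcons sz => /orP[/eqP ->|mn].
    by rewrite ltnn eqxx.
  by rewrite mn IH.
have s0 : s 0%N = (a, b) by [].
have rhsE n : rhs (it n) = pk n - \sum_(1 <= i < n) (s i).1 * (s (n - i)%N).2.
  rewrite /rhs sz; congr (_ - _); rewrite big_nat [RHS]big_nat.
  by apply: eq_bigr => i /andP[i0 i1]; rewrite !itn // ltn_subrL i0 (leq_trans _ i1).
have sS n : (0 < n)%N -> [/\ pk n = \sum_(i < n.+1) (s i).1 * (s (n - i)%N).2,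
    (size (s n).1 < size a)%N & (size (s n).2 < size b)%N].
  elim/ltn_ind: n => n IH n0.
  have : (size (rhs (it n)) < size (a * b)%R)%N.
    rewrite rhsE (leq_ltn_trans (size_polyD _ _)) // size_polyN gtn_max spk //=.
    apply: leq_ltn_trans (size_sum _ _ _) _.
    rewrite big_nat; apply: (big_ind (fun m => m < size (a * b)%R)%N).
    - by rewrite size_poly_gt0 mulf_neq0 ?monic_neq0.
    - by move=> x y hx hy; rewrite gtn_max hx.
    move=> i /andP[i0 iN]; have [_ h1 _] := IH i iN i0.
    have lt : (n - i < n)%N by rewrite ltn_subrL i0 n0.
    have gt : (0 < n - i)%N by rewrite subn_gt0.
    have [_ _ h2] := IH _ lt gt.
    rewrite (leq_ltn_trans (size_polyMleq _ _)) // size_mul ?monic_neq0 //.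
    by move: h1 h2; move: (size (s i).1) (size (s _).2) (size a) (size b); lia.
  have : s n = projT1 (cid (nxt (rhs (it n)))).
    by rewrite /s /step; have := sz n; case: (it n) => //= e; rewrite -e in n0.
  case: (cid _) => -[u v] /= h sn /h[e su sv]; rewrite sn; split=> //.
  move/eqP: e; rewrite rhsE subr_eq => /eqP ->.
  rewrite -(big_mkord predT (fun i => (s i).1 * (s (n - i)%N).2)).
  rewrite big_nat_recr //= subnn [in RHS]big_ltn // subn0 s0 sn /=; ring.
pose G := \poly_(i < size a) PSeries (fun k => (s k).1`_i).
pose H := \poly_(i < size b) PSeries (fun k => (s k).2`_i).
have GE k i : coefps G`_i k = (s k).1`_i.
  rewrite coef_poly; case: ltnP => // ia; rewrite nth_default; first by case: k.
  apply: leq_trans ia; case: k => [|k]; first by rewrite s0.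
  by have [//|_ /ltnW] := sS k.+1.
have HE k i : coefps H`_i k = (s k).2`_i.
  rewrite coef_poly; case: ltnP => // ia; rewrite nth_default; first by case: k.
  apply: leq_trans ia; case: k => [|k]; first by rewrite s0.
  by have [//|_ _ /ltnW] := sS k.+1.
have sa : (0 < size a)%N by rewrite size_poly_gt0 monic_neq0.
have lG : G`_(size a).-1 = 1.
  apply: psP => k; rewrite GE; case: k => [|k].
    by rewrite s0 /= -lead_coefE (monicP am).
  rewrite nth_default //; have [//|_ h _] := sS k.+1.
  by rewrite -ltnS prednK.
have sG : size G = size a.
  apply/eqP; rewrite eqn_leq size_poly /= -[size a]prednK // ltnNge.
  by apply/negP => /leq_sizeP/(_ _ (leqnn _)); rewrite lG => /eqP; rewrite oner_eq0.
exists G, H; split=> //; first by rewrite monicE lead_coefE sG lG.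
  2: by apply/polyP => i; rewrite coef_map [LHS]GE s0.
apply/polyP => i; apply: psP => k; rewrite coefM coefps_sum.
transitivity ((\sum_(j < k.+1) (s j).1 * (s (k - j)%N).2)`_i).
  case: k => [|k]; last by have [//|<-] := sS k.+1; rewrite pkE.
  by rewrite big_ord_recl big_ord0 addr0 s0 /= -pk0 pkE.
rewrite coef_sum; under eq_bigr do rewrite coefM.
rewrite [RHS]exchange_big; apply: eq_bigr => j _.
by apply: eq_bigr => l _; rewrite GE HE.
Qed.
End Hensel.

Section PuiseuxClosed.
Variable K : closedFieldType.
Hypothesis charK : [pchar K] =i pred0.

Section TaylorShift.
Variables (R : comNzRingType) (c : R).

Lemma size_XDexp d : size (('X + c%:P) ^+ d) = d.+1.
Proof. by rewrite -[c]opprK polyCN size_exp_XsubC. Qed.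

Lemma lead_XDexp d : (('X + c%:P) ^+ d)`_d = 1.
Proof.
have /monicP : ('X + c%:P) ^+ d \is monic.
  by rewrite monic_exp // monicXaddC.
by rewrite lead_coefE (size_XDexp d).
Qed.

Lemma coef_XDexp d : (('X + c%:P) ^+ d.+1)`_d = c *+ d.+1.
Proof.
elim: d => [|d IH]; first by rewrite expr1 coefD coefX coefC add0r.
by rewrite exprS mulrDl coefD coefXM /= IH coefCM lead_XDexp mulr1 -mulrSr.
Qed.

(** The Tschirnhaus substitution: when d + 1 is invertible, c = - p_d / (d + 1) removes the second
    coefficient. *)
Lemma monic_comp_XD (p : {poly R}) d : p \is monic -> size p = d.+2 ->
  let q := p \Po ('X + c%:P) in
  [/\ q \is monic, size q = d.+2 & q`_d = p`_d + c *+ d.+1].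
Proof.
move=> pm sp q.
have qE : q = \sum_(i < d) p`_i *: ('X + c%:P) ^+ i +
    p`_d *: ('X + c%:P) ^+ d + ('X + c%:P) ^+ d.+1.
  rewrite /q comp_polyE sp 2!big_ord_recr /=.
  by have := monicP pm; rewrite lead_coefE sp /= => ->; rewrite scale1r.
have low i : (d <= i)%N -> (\sum_(i < d) p`_i *: ('X + c%:P) ^+ i)`_i = 0.
  move=> di; rewrite coef_sum big1 // => j _.
  rewrite coefZ [X in _ * X]nth_default ?mulr0 //.
  by rewrite size_XDexp (leq_trans _ di).
have q1 : q`_d.+1 = 1.
  rewrite qE !coefD low // coefZ [X in _ + _ * X]nth_default ?size_XDexp // mulr0 !add0r.
  exact: lead_XDexp.
have sq : size q = d.+2.
  apply/eqP; rewrite eqn_leq; apply/andP; split; last first.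
    rewrite ltnNge; apply/negP => /leq_sizeP/(_ _ (leqnn _)); rewrite q1.
    by move/eqP; rewrite oner_eq0.
  apply/leq_sizeP => j dj; have dj' : (d <= j)%N by rewrite ltnW // ltnW.
  rewrite qE !coefD low // coefZ [X in _ + _ * X]nth_default; last first.
    by rewrite size_XDexp ltnW.
  by rewrite mulr0 add0r add0r nth_default // size_XDexp.
split=> //; first by rewrite monicE lead_coefE sq q1.
by rewrite qE !coefD low // coefZ coef_XDexp add0r lead_XDexp mulr1.
Qed.
End TaylorShift.

Local Notation P := (puiseux K).

Definition pord (a : P) : rat :=
  if pselect (exists q, pc a q != 0 /\ pge q a) is left e then projT1 (cid e) else 0.
Lemma pordP a : a != 0 -> pc a (pord a) != 0 /\ pge (pord a) a.
Proof.
move=> a0; rewrite /pord; case: pselect => [e|[]]; first by case: (cid e).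
by have [q] := ord_ex a0; exists q.
Qed.

(** Newton's polygon: a substitution x = t^q0 y makes all coefficients integral and one below the
    top a unit. As the second coefficient is zero, the reduction is not a power of one linear
    factor, so Hensel's lemma splits off a factor of smaller degree, to which the induction
    hypothesis applies. *)
Lemma puiseux_root_reduced (p : {poly P}) d : p \is monic -> size p = d.+2 ->
  p`_d = 0 ->
  (forall q : {poly P}, q \is monic -> (1 < size q < d.+2)%N -> exists x, root q x) ->
  exists x, root p x.
Proof.
move=> pm sp pd IH.
have pd1 : p`_d.+1 = 1 by have := monicP pm; rewrite lead_coefE sp.
have [/existsP[i0 pi0]|none] := boolP [exists i : 'I_d.+1, p`_i != 0]; last first.
  exists 0; have -> : p = 'X^(d.+1).
    apply/polyP => i; rewrite coefXn; have [->//|ne] := eqVneq i d.+1.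
    have [id|di] := ltnP i d.+1; last by rewrite nth_default // sp ltn_neqAle eq_sym ne.
    by apply/eqP; apply: contraNT none => pi; apply/existsP; exists (Ordinal id).
  by rewrite rootE hornerXn expr0n.
(* The slopes towards the leading term; the smallest is the smallest order of a root. *)
pose sl (i : 'I_d.+1) := pord p`_i / (d.+1 - i)%:R.
have [m pm0 mmin] := @arg_minP _ _ _ i0 (fun i => p`_i != 0) sl pi0.
set q0 := sl m in mmin.
pose u (i : nat) : P := pmono ((i%:R - d.+1%:R) * q0) 1.
pose b i := u i * p`_i.
have bE i q : pc (b i) q = pc p`_i (q - (i%:R - d.+1%:R) * q0).
  by rewrite pcZ mul1r.
have b_int i : pint (b i).
  move=> q q_lt; rewrite bE; have [->|pi] := eqVneq p`_i 0; first exact: pc0.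
  have [id|] := ltnP i d.+1; last first.
    rewrite leq_eqVlt => /orP[/eqP <-|di].
      by rewrite subrr mul0r subr0 pd1 pint1.
    by move: pi; rewrite nth_default ?eqxx // sp.
  have [_ -> //] := pordP pi.
  have := mmin (Ordinal id) pi; rewrite /sl /= ler_pdivlMr ?ltr0n ?subn_gt0 //.
  by rewrite natrB 1?ltnW //; nra.
have b_m : pc (b m) 0 != 0.
  rewrite bE /q0; have -> : 0 - (m%:R - d.+1%:R) * sl m = pord p`_m.
    have nz : d.+1%:R - m%:R != 0 :> rat by rewrite subr_eq0 eqr_nat gtn_eqF.
    by rewrite /sl natrB ?(ltnW (ltn_ord m)) //; field; rewrite -mulrS.
  by have [] := pordP pm0.
have [n lb] := lvl_common [seq b i | i <- iota 0 d.+2].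
have fE i : exists f, (i < d.+2)%N -> b i = pser n f.
  have [id|] := boolP (i < d.+2)%N; last by exists 0.
  have [|f] := lvl_int_ps (lb (b i) _) (b_int i); last by exists f.
  by apply/mapP; exists i; rewrite // mem_iota.
pose Q := \poly_(i < d.+2) projT1 (cid (fE i)).
have QE i : pser n Q`_i = b i.
  rewrite coef_poly; case: (cid (fE i)) => f /=.
  case: ltnP => [_ /(_ isT) ->//|di _].
  by rewrite rmorph0 /b nth_default ?sp // mulr0.
have Q1 : Q`_d.+1 = 1.
  by apply: (@pser_inj _ n); rewrite QE /b pd1 /u subrr mul0r mulr1 rmorph1.
have sQ : size Q = d.+2.
  apply/eqP; rewrite eqn_leq size_poly ltnNge; apply/negP.
  by move=> /leq_sizeP/(_ _ (leqnn _)); rewrite Q1 => /eqP; rewrite oner_eq0.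
have Qm : Q \is monic by rewrite monicE lead_coefE sQ Q1.
suff [y ry] : exists y, root (map_poly (pser n) Q) y.
  exists (pmono q0 1 * y); move/rootP: ry => ry; apply/rootP.
  transitivity (pmono (d.+1%:R * q0) 1 * (map_poly (pser n) Q).[y]); last first.
    by rewrite ry mulr0.
  rewrite !horner_coef sp size_map_poly_id0; last first.
    by rewrite (monicP Qm) rmorph1 oner_neq0.
  rewrite sQ mulr_sumr; apply: eq_bigr => i _; rewrite coef_map /= QE /b.
  rewrite exprMn pmono_exp expr1n mulrA mulrA /u mulrA pmonoM mulr1 -mulrDl.
  by rewrite addrC subrK mulr_natl [pmono _ _ * p`_i]mulrC.
pose r := map_poly (@ps_res K) Q.
have rE i : r`_i = pc (b i) 0.
  rewrite -QE coef_map; have -> : (0 : rat) = pexp n 0 0.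
    by rewrite /pexp subrr mul0r.
  by rewrite pc_pser.
have rm : r \is monic by exact: monic_map.
have sr : size r = d.+2.
  by rewrite size_map_poly_id0 // (monicP Qm) rmorph1 oner_neq0.
have rd : r`_d = 0 by rewrite rE /b pd mulr0 pc0.
have [c rc] : exists c, root r c by apply/closed_rootP; rewrite sr.
have [k [g gc er]] := multiplicity_XsubC r c; rewrite monic_neq0 //= in gc.
have gm : g \is monic by move: rm; rewrite er monicMr ?monic_exp ?monicXsubC.
have sg : (size g + k = d.+2)%N.
  move: sr; rewrite er size_mul ?monic_neq0 ?monic_exp ?monicXsubC //.
  by rewrite size_exp_XsubC addnS.
have k0 : (0 < k)%N.
  rewrite lt0n; apply/eqP => ek; move: rc; rewrite er ek expr0 mulr1 => rc.
  by move: gc; rewrite rc.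
(* If r = (X - c)^(d+1), its second coefficient - (d + 1) c vanishes, so c = 0; this contradicts the
   nonzero coefficient of index [m]. *)
have [g1|g1] := leqP (size g) 1.
  have eg : g = 1.
    have g0 : g`_0 = 1.
      have := monicP gm; rewrite lead_coefE; have := size_poly_gt0 g.
      by rewrite monic_neq0 //; move: g1; case: (size g) => [|[]].
    by rewrite [g]size1_polyC // g0.
  have c0 : c = 0.
    move: rd; rewrite er eg mul1r.
    have -> : k = d.+1 by move: sg; rewrite eg size_poly1; lia.
    have -> : 'X - c%:P = 'X + (- c)%:P by rewrite polyCN.
    rewrite coef_XDexp => /eqP; rewrite mulNrn oppr_eq0 -mulr_natr mulf_eq0.
    by rewrite (negPf (natrK_neq0 charK d)) orbF => /eqP.
  by case/eqP: b_m; rewrite -rE er eg c0 mul1r subr0 coefXn ltn_eqF // (leq_trans (ltn_ord m)) //;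
    move: sg; rewrite eg size_poly1; lia.
have cop : coprimep (('X - c%:P) ^+ k) g.
  by apply: coprimep_expl; rewrite coprimep_sym coprimep_XsubC.
have am : ('X - c%:P) ^+ k \is monic by rewrite monic_exp // monicXsubC.
have er' : map_poly (@ps_res K) Q = ('X - c%:P) ^+ k * g by rewrite -/r er mulrC.
have [G [H [Gm sG eQ]]] := hensel Qm am gm cop er'.
rewrite size_exp_XsubC in sG.
have [||y ry] := IH (map_poly (pser n) G); first exact: monic_map.
  rewrite size_map_poly_id0 ?(monicP Gm) ?rmorph1 ?oner_neq0 // sG.
  by rewrite ltnS k0 /=; move: g1 sg; lia.
by exists y; rewrite eQ rmorphM rootM ry.
Qed.

Lemma puiseux_root (p : {poly P}) d : p \is monic -> size p = d.+2 ->
  exists x, root p x.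
Proof.
elim/ltn_ind: d p => d IH p pm sp.
pose c : P := - p`_d / d.+1%:R.
have [qm sq qd] := monic_comp_XD c pm sp; set q := _ \Po _ in qm sq qd.
have d0 : d.+1%:R != 0 :> P.
  by rewrite -(rmorph_nat (@pcst K)) fmorph_eq0 natrK_neq0.
have [||x rx] := puiseux_root_reduced qm sq.
- by rewrite qd -mulr_natr divfK // subrr.
- move=> r rm /andP[r1 r2]; apply: (IH (size r).-2 _ r) => //; last lia.
  by move: r1 r2; case: (size r) => [|[]] //=; lia.
exists (x + c); move: rx; rewrite /root horner_comp hornerD hornerX hornerC.
by [].
Qed.

Lemma puiseux_closed : GRing.closed_field_axiom P.
Proof.
move=> n F n0; pose p := 'X^n - \poly_(i < n) F i.
have sp : size p = n.+1.
  by rewrite size_polyDl ?size_polyXn // size_polyN ltnS size_poly.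
have pm : p \is monic.
  rewrite monicE lead_coefE sp coefB coefXn eqxx nth_default ?subr0 //.
  exact: size_poly.
have [|x] := @puiseux_root p n.-1 pm; first by rewrite prednK.
rewrite rootE hornerD hornerN hornerXn horner_poly subr_eq0 => /eqP.
by exists x.
Qed.
End PuiseuxClosed.

Local Open Scope classical_set_scope.

(* A partial embedding of [E] in [Q] is given by its graph, a subring of
   [E * Q]. *)
(** * Extension of embeddings *)

Section Extension.
Variables (E Q : fieldType).
Hypothesis clQ : GRing.closed_field_axiom Q.
Implicit Types (G : set (E * Q)) (P m : {poly E * Q}).

Lemma closed_root (p : {poly Q}) : (1 < size p)%N -> exists x, root p x.
Proof.
move=> sp; pose n := (size p).-1; pose c := lead_coef p.
have c0 : c != 0 by rewrite lead_coef_eq0 -size_poly_gt0 ltnW.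
have n0 : (0 < n)%N by rewrite /n; case: (size p) sp => [|[]].
have [x ex] := clQ (fun i => - p`_i / c) n0.
exists x; rewrite rootE horner_coef -[size p]prednK; last by rewrite ltnW.
rewrite -/n big_ord_recr /= -lead_coefE -/c ex mulr_sumr -big_split big1 //= => i _.
by rewrite mulrA mulrCA mulfV // mulr1 mulNr subrr.
Qed.

Lemma closed_normal (p : {poly Q}) : p \is monic ->
  exists r, p = \prod_(a <- r) ('X - a%:P).
Proof.
have [n] := ubnP (size p); elim: n p => // n IH p sp pm.
have [p1|p1] := leqP (size p) 1.
  have p0 : p`_0 = 1.
    have := monicP pm; rewrite lead_coefE; have := size_poly_gt0 p.
    by rewrite monic_neq0 //; move: p1; case: (size p) => [|[]].
  by exists [::]; rewrite big_nil [p]size1_polyC // p0.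
have [x /factor_theorem[q eq]] := closed_root p1.
have qm : q \is monic by move: pm; rewrite eq monicMr ?monicXsubC.
have [|r er] := IH q _ qm.
  by move: sp; rewrite eq size_Mmonic ?monicXsubC ?monic_neq0 // size_XsubC addn2.
by exists (x :: r); rewrite big_cons -er eq mulrC.
Qed.

Definition graph G := [/\ G 1, forall x y, G x -> G y -> G (x - y),
  forall x y, G x -> G y -> G (x * y),
  forall x, G x -> x.1 != 0 -> G (x.1^-1, x.2^-1) &
  forall q, G (0, q) -> q = 0].

Definition gpoly G P := forall i, G P`_i.

Definition galg G u := exists P, [/\ gpoly G P, P != 0 & root (map_poly fst P) u].

(* [m] lifts the minimal polynomial of [u]; the second projection of [m] is its
   image in [Q]. *)
Definition minp G u m := [/\ gpoly G m, m \is monic, root (map_poly fst m) u &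
  forall P, gpoly G P -> root (map_poly fst P) u -> P != 0 ->
    (size m <= size P)%N].

Section OneGraph.
Variable G : set (E * Q).
Hypothesis gG : graph G.

Let G1 : G 1. Proof. by case: gG. Qed.
Let GB x y : G x -> G y -> G (x - y). Proof. by case: gG => _ h _ _ _; exact: h. Qed.
Let GM x y : G x -> G y -> G (x * y). Proof. by case: gG => _ _ h _ _; exact: h. Qed.
Let GV x : G x -> x.1 != 0 -> G (x.1^-1, x.2^-1).
Proof. by case: gG => _ _ _ h _; exact: h. Qed.
Let G0q q : G (0, q) -> q = 0. Proof. by case: gG => _ _ _ _ h; exact: h. Qed.
Lemma graph0 : G 0. Proof. by rewrite -(subrr 1); exact: GB. Qed.
Let GN x : G x -> G (- x).
Proof. by rewrite -sub0r; apply/GB/graph0. Qed.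
Lemma graphD x y : G x -> G y -> G (x + y).
Proof. by move=> Gx Gy; rewrite -[y]opprK; apply/GB/GN. Qed.
Let G0 := graph0.
Let GD := graphD.
Let Gsum (I : Type) (s : seq I) (F : I -> E * Q) :
  (forall i, G (F i)) -> G (\sum_(i <- s) F i).
Proof. by move=> h; apply: (big_ind G). Qed.

Lemma graph_inj x : G x -> x.1 = 0 -> x = 0.
Proof. by case: x => a b /= Gab a0; subst a; rewrite (G0q Gab). Qed.

Lemma gpolyB P P' : gpoly G P -> gpoly G P' -> gpoly G (P - P').
Proof. by move=> h h' i; rewrite coefB; exact: GB. Qed.
Lemma gpolyD P P' : gpoly G P -> gpoly G P' -> gpoly G (P + P').
Proof. by move=> h h' i; rewrite coefD; exact: GD. Qed.
Lemma gpolyM P P' : gpoly G P -> gpoly G P' -> gpoly G (P * P').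
Proof. by move=> h h' i; rewrite coefM; apply: Gsum => j; exact: GM. Qed.
Lemma gpolyC c : G c -> gpoly G c%:P.
Proof. by move=> Gc i; rewrite coefC; case: ifP. Qed.
Lemma gpolyX : gpoly G 'X.
Proof. by move=> i; rewrite coefX; case: eqP. Qed.
Lemma gpolyXn n : gpoly G 'X^n.
Proof. by move=> i; rewrite coefXn; case: eqP. Qed.

Lemma gpoly_divp P m : gpoly G P -> gpoly G m -> m \is monic ->
  exists A R, [/\ gpoly G A, gpoly G R, P = A * m + R & (size R < size m)%N].
Proof.
have [n] := ubnP (size P); elim: n P => // n IH P sP hP hm mm.
have [Pm|mP] := ltnP (size P) (size m).
  exists 0, P; split=> //; first by move=> i; rewrite coef0.
  by rewrite mul0r add0r.
pose T := (lead_coef P)%:P * 'X^(size P - size m).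
have hT : gpoly G T by apply: gpolyM; [apply: gpolyC; exact: hP|exact: gpolyXn].
have m0 : (0 < size m)%N by rewrite size_poly_gt0 monic_neq0.
have P0 : (0 < size P)%N := leq_trans m0 mP.
have [|A [R [hA hR e sR]]] := IH (P - T * m) _ (gpolyB hP (gpolyM hT hm)) hm mm.
  apply: leq_trans (_ : size P <= n)%N; last by rewrite -ltnS.
  rewrite -[X in (_ < X)%N]prednK // ltnS; apply/leq_sizeP => j.
  rewrite leq_eqVlt => /orP[/eqP <-|].
    rewrite coefB /T -mulrA coefCM coefXnM.
    have -> : ((size P).-1 < size P - size m)%N = false by lia.
    have -> : ((size P).-1 - (size P - size m) = (size m).-1)%N by lia.
    by rewrite -(lead_coefE m) (monicP mm) mulr1 -lead_coefE subrr.
  rewrite prednK // => Pj; rewrite coefB nth_default // sub0r /T -mulrA coefCM coefXnM.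
  case: ltnP => [_|h]; first by rewrite mulr0 oppr0.
  by rewrite [m`_ _]nth_default ?mulr0 ?oppr0 //; move: Pj mP; clear; move: (size P) (size m); lia.
exists (A + T), R; split=> //; first exact: gpolyD.
by rewrite mulrDl addrAC -e subrK.
Qed.

Lemma minp_ex u : galg G u -> exists m, minp G u m.
Proof.
move=> [P [hP P0 rP]].
pose B n := `[< exists P, [/\ gpoly G P, P != 0, root (map_poly fst P) u & size P = n] >].
have exB : exists n, B n by exists (size P); apply/asboolP; exists P.
have := ex_minnP exB; move=> [n /asboolP[{P hP P0 rP}P [hP P0 rP sP]] min].
have l0 : (lead_coef P).1 != 0.
  by apply: contra_neq P0 => /(graph_inj (hP _))/eqP; rewrite lead_coef_eq0 => /eqP.
pose c : E * Q := ((lead_coef P).1^-1, (lead_coef P).2^-1).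
(* Otherwise the leading coefficient times its inverse would be (1, 0), and subtracting 1 would give
   (0, -1). *)
have l2 : (lead_coef P).2 != 0.
  apply/eqP => e; have Gl : G (lead_coef P) by exact: hP.
  have : G ((lead_coef P).1^-1 * (lead_coef P).1,
            (lead_coef P).2^-1 * (lead_coef P).2) := GM (GV Gl l0) Gl.
  rewrite e mulr0 mulVf // => /GB/(_ G1) h.
  have : (-1 : Q) = 0 by apply: G0q; move: h; rewrite -[_ - _]/(1 - 1, 0 - 1) subrr sub0r.
  by move/eqP; rewrite oppr_eq0 oner_eq0.
have cl : c * lead_coef P = 1.
  move: l0 l2; rewrite /c; case: (lead_coef P) => a b /= a0 b0.
  by rewrite -[_ * _]/(a^-1 * a, b^-1 * b) !mulVf.
have Gc : G c by apply: GV => //; exact: hP.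
have sc : size (c%:P * P) = size P.
  apply/eqP; rewrite eqn_leq; apply/andP; split.
    by apply/leq_sizeP => j Pj; rewrite coefCM nth_default ?mulr0.
  rewrite leqNgt; apply/negP; rewrite -ltnS -[in X in (_ < X)%N](@prednK (size P)); last first.
    by rewrite size_poly_gt0.
  rewrite ltnS => /leq_sizeP/(_ _ (leqnn _)); rewrite coefCM -lead_coefE cl.
  by move/eqP; rewrite oner_eq0.
exists (c%:P * P); split.
- by apply: gpolyM => //; exact: gpolyC.
- by rewrite monicE lead_coefE sc coefCM -lead_coefE cl.
- by rewrite rmorphM rootM rP orbT.
- by move=> R hR rR R0; rewrite sc sP; apply: min; apply/asboolP; exists R.
Qed.

Section Adjoin.
Variables (u : E) (m : {poly E * Q}).
Hypothesis mP : minp G u m.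

Lemma minp_dvd P : gpoly G P -> root (map_poly fst P) u ->
  exists2 A, gpoly G A & P = A * m.
Proof.
case: mP => hm mm rm min hP rP.
have [A [R [hA hR e sR]]] := gpoly_divp hP hm mm.
exists A => //; have [R0|R0] := eqVneq R 0; first by rewrite e R0 addr0.
have rR : root (map_poly fst R) u.
  have -> : R = P - A * m by rewrite e addrC addKr.
  rewrite rmorphB rmorphM /root hornerD hornerN hornerM.
  by rewrite (rootP rP) (rootP rm) mulr0 subrr.
by have := min _ hR rR R0; rewrite leqNgt sR.
Qed.

Variable v : Q.
Hypothesis rv : root (map_poly snd m) v.
Hypothesis algG : forall x, galg G x.

Definition adjoin (w : E * Q) := exists2 P, gpoly G P & w = P.[(u, v)].

Let h1 P w : (P.[w]).1 = (map_poly fst P).[w.1].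
Proof. by rewrite (horner_map (fst : {rmorphism (E * Q)%type -> E})). Qed.
Let h2 P w : (P.[w]).2 = (map_poly snd P).[w.2].
Proof. by rewrite (horner_map (snd : {rmorphism (E * Q)%type -> Q})). Qed.

Let adj0 q : adjoin (0, q) -> q = 0.
Proof.
move=> [P hP e]; have [|A _ eP] := minp_dvd hP.
  by apply/eqP; have := congr1 fst e; rewrite /= h1.
have := congr1 snd e; rewrite /= h2 /= => ->.
by rewrite eP rmorphM hornerM (rootP rv) mulr0.
Qed.

Let adjB x y : adjoin x -> adjoin y -> adjoin (x - y).
Proof.
move=> [P hP ->] [R hR ->]; exists (P - R); first exact: gpolyB.
by rewrite hornerD hornerN.
Qed.
Let adjM x y : adjoin x -> adjoin y -> adjoin (x * y).
Proof.
move=> [P hP ->] [R hR ->]; exists (P * R); first exact: gpolyM.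
by rewrite hornerM.
Qed.
Let adj1 : adjoin 1.
Proof. by exists 1; [exact: gpolyC|rewrite hornerC]. Qed.

Lemma sub_adjoin : G `<=` adjoin.
Proof. by move=> w Gw; exists w%:P; [exact: gpolyC|rewrite hornerC]. Qed.
Lemma adjoin_gen : adjoin (u, v).
Proof. by exists 'X; [exact: gpolyX|rewrite hornerX]. Qed.

(** The inverse of an element is read off from an annihilating polynomial of least degree: its
    constant term is nonzero, hence invertible in [G], and the inverse is a polynomial in the
    element. In the second component it is an inverse because the graph is single-valued. *)
Lemma graph_adjoin : graph adjoin.
Proof.
split=> // x ax x0; have [N0 [hN0 N00 rN0]] := algG x.1.
pose B n := `[< exists N, [/\ gpoly G N, N != 0, root (map_poly fst N) x.1 & size N = n] >].
have exB : exists n, B n by exists (size N0); apply/asboolP; exists N0.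
have := ex_minnP exB; move=> [n /asboolP[N [hN Nn0 rN sN]] min].
pose N' := Poly (behead N).
have eN : N = 'X * N' + (N`_0)%:P.
  apply/polyP => -[|i]; rewrite coefD coefXM coefC /= ?add0r //.
  by rewrite addr0 coef_Poly nth_behead.
have hN' : gpoly G N' by move=> i; rewrite coef_Poly nth_behead.
have c0 : (N`_0).1 != 0.
  apply/eqP => /(graph_inj (hN 0%N)) e; move: eN; rewrite e addr0 => {}eN.
  have sN' : (size N = (size N').+1)%N.
    rewrite eN mulrC size_mulX //; apply: contraNneq Nn0 => N'0.
    by rewrite eN N'0 mulr0.
  suff : (size N <= size N')%N by rewrite sN' ltnn.
  rewrite sN; apply: min; apply/asboolP; exists N'.
  split=> //; first by apply: contraNneq Nn0 => N'0; rewrite eN N'0 mulr0.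
  move: rN; rewrite eN rmorphM rootM /= map_polyX rootX.
  by rewrite (negPf x0).
have aN : adjoin N'.[x].
  rewrite horner_coef; apply: (big_ind adjoin) => [|y z ay az|i _].
  - by rewrite -(subrr 1); exact: adjB.
  - by rewrite -[z]opprK; apply: adjB => //; rewrite -sub0r; apply: adjB => //;
      rewrite -(subrr 1); exact: adjB.
  apply: adjM; first exact: sub_adjoin.
  by elim: (i : nat) => [|k IH]; rewrite ?expr0 ?exprS //; exact: adjM.
pose y : E * Q := - ((N`_0).1^-1, (N`_0).2^-1) * N'.[x].
have ay : adjoin y.
  apply: adjM => //; rewrite -sub0r; apply: adjB.
    by rewrite -(subrr 1); exact: adjB.
  by apply/sub_adjoin/GV.
have y1 : y.1 * x.1 = 1.
  have /rootP := rN; rewrite -(h1 N x) eN hornerD hornerM hornerX hornerC.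
  rewrite -[(_ + _).1]/(x.1 * (N'.[x]).1 + (N`_0).1) => /eqP.
  rewrite addr_eq0 => /eqP e.
  rewrite -[y.1]/(- (N`_0).1^-1 * (N'.[x]).1) -mulrA [_ * x.1]mulrC e.
  by rewrite mulrNN mulVf.
have y2 : y.2 * x.2 = 1.
  apply/eqP; rewrite -subr_eq0; apply/eqP/adj0.
  have := adjB (adjM ay ax) adj1.
  by rewrite -[_ - _]/(y.1 * x.1 - 1, y.2 * x.2 - 1) y1 subrr.
have -> : x.1^-1 = y.1 by rewrite -[LHS]mul1r -y1 mulfK.
have x2 : x.2 != 0 by apply: contra_eq_neq y2 => ->; rewrite mulr0 eq_sym oner_eq0.
have -> : x.2^-1 = y.2 by rewrite -[LHS]mul1r -y2 mulfK.
by rewrite -surjective_pairing.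
Qed.

End Adjoin.

End OneGraph.

Lemma graph_bigcup (C : set (set (E * Q))) X0 : C X0 ->
  (forall X, C X -> graph X) -> total_on C subset -> graph (\bigcup_(X in C) X).
Proof.
move=> C0 gC tC.
have two x y : (\bigcup_(X in C) X) x -> (\bigcup_(X in C) X) y ->
    exists X, [/\ C X, X x & X y].
  move=> [X CX Xx] [Y CY Yy]; have [XY|YX] := tC _ _ CX CY.
    by exists Y; split=> //; exact: XY.
  by exists X; split=> //; exact: YX.
split.
- by exists X0 => //; case: (gC _ C0).
- move=> x y bx by_; have [X [CX Xx Xy]] := two _ _ bx by_.
  by exists X => //; have [_ h _ _ _] := gC _ CX; exact: h.
- move=> x y bx by_; have [X [CX Xx Xy]] := two _ _ bx by_.
  by exists X => //; have [_ _ h _ _] := gC _ CX; exact: h.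
- move=> x [X CX Xx] x0.
  by exists X => //; have [_ _ _ h _] := gC _ CX; exact: h.
- by move=> q [X CX Xq]; have [_ _ _ _ h] := gC _ CX; exact: h.
Qed.

Lemma galg_sub G G' u : G `<=` G' -> galg G u -> galg G' u.
Proof. by move=> GG' [P [h P0 rP]]; exists P; split=> // i; exact/GG'. Qed.

(** A maximal graph exists by Zorn's lemma. It is defined everywhere, since a missing element could
    be adjoined together with a root in [Q] of its lifted minimal polynomial. *)
Theorem graph_extend G0 : graph G0 -> (forall u, galg G0 u) ->
  exists g : {rmorphism E -> Q}, forall x, G0 x -> g x.1 = x.2.
Proof.
(* The union with [G0] is built into the property, so that the empty chain satisfies it. *)
move=> g0 alg0; pose V X := graph (X `|` G0).
have [|A [VA max]] := @Zorn_bigcup _ V.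
  move=> F FV tF; rewrite /V.
  pose C Y := Y = G0 \/ exists2 X, F X & Y = X `|` G0.
  have -> : (\bigcup_(X in F) X) `|` G0 = \bigcup_(Y in C) Y.
    apply/seteqP; split=> x.
      move=> [[X FX Xx]|G0x]; last by exists G0; [left|].
      by exists (X `|` G0); [right; exists X|left].
    move=> [Y [->|[X FX ->]] Yx]; first by right.
    by case: Yx => [Xx|]; [left; exists X|right].
  apply: (@graph_bigcup _ G0); first by left.
    by move=> X [->//|[Y FY ->]]; exact: FV.
  move=> X Y [->|[X' FX ->]] [->|[Y' FY ->]].
  - by left.
  - by left => ? ?; right.
  - by right => ? ?; right.
  - by have [XY|YX] := tF _ _ FX FY; [left|right] => x [h|h];
      [left; exact: XY|right|left; exact: YX|right].
set G := A `|` G0 in VA.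
have algG u : galg G u by apply: galg_sub (alg0 u) => x; right.
have dom u : exists v, G (u, v).
  apply: contrapT => nu; have [m mP] := minp_ex VA (algG u).
  have [hm mm rm _] := mP.
  have sm : (1 < size (map_poly snd m))%N.
    have -> : size (map_poly snd m) = size m.
      by apply: size_map_poly_id0; rewrite (monicP mm) oner_neq0.
    have -> : size m = size (map_poly fst m).
      by rewrite size_map_poly_id0 // (monicP mm) oner_neq0.
    apply: root_size_gt1 rm; rewrite monic_neq0 // monicE lead_coef_map_id0 ?(monicP mm) //.
    by rewrite oner_neq0.
  have [v rv] := closed_root sm.
  have gA := graph_adjoin VA mP rv algG.
  have sA := sub_adjoin VA u v.
  apply: (max (adjoin G u v)).
    split; first by move=> x Ax; apply: sA; left.
    by move=> /(_ (u, v) (adjoin_gen VA u v)) Auv; apply: nu; exists v; left.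
  rewrite /V; suff -> : adjoin G u v `|` G0 = adjoin G u v by [].
  apply/seteqP; split=> x; last by left.
  by case=> // G0x; apply: sA; right.
have [G1 GB GM _ G0q] := VA.
have uniq x a b : G (x, a) -> G (x, b) -> a = b.
  move=> Ga Gb; apply/eqP; rewrite -subr_eq0; apply/eqP/G0q.
  by have := GB _ _ Ga Gb; rewrite -[_ - _]/(x - x, a - b) subrr.
pose g x := projT1 (cid (dom x)).
have gP x : G (x, g x) by rewrite /g; case: (cid _).
have gB : zmod_morphism g.
  by move=> x y; apply: (uniq (x - y)); [exact: gP|exact: (GB _ _ (gP x) (gP y))].
have gM : monoid_morphism g.
  split; first by apply: (uniq 1) => //; exact: gP.
  by move=> x y; apply: (uniq (x * y)); [exact: gP|exact: (GM _ _ (gP x) (gP y))].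
pose zM := GRing.isZmodMorphism.Build E Q g gB.
pose mM := GRing.isMonoidMorphism.Build E Q g gM.
pose gg : {rmorphism E -> Q} := HB.pack g zM mM.
exists gg => -[x a] Gx /=; apply: (uniq x); [exact: gP|by right].
Qed.

Theorem graph_extend1 G0 u m v : graph G0 -> (forall u, galg G0 u) ->
  minp G0 u m -> root (map_poly snd m) v ->
  exists2 g : {rmorphism E -> Q}, forall x, G0 x -> g x.1 = x.2 & g u = v.
Proof.
move=> g0 alg0 mP rv.
have [g gP] := graph_extend (graph_adjoin g0 mP rv alg0)
  (fun x => galg_sub (sub_adjoin g0 u v) (alg0 x)).
exists g => [x G0x|]; first exact/gP/sub_adjoin.
by have := gP _ (adjoin_gen g0 u v).
Qed.

End Extension.

(** * Embeddings of algebraic extensions and fixed fields *)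

Section GraphOfMorphisms.
Variables (k E Q : fieldType) (i : {rmorphism k -> E}) (f : {rmorphism k -> Q}).
Hypothesis clQ : GRing.closed_field_axiom Q.

Definition mgraph : set (E * Q) := [set w | exists a, w = (i a, f a)].

Lemma graph_mgraph : graph mgraph.
Proof.
split.
- by exists 1; rewrite !rmorph1.
- by move=> _ _ [a ->] [b ->]; exists (a - b); rewrite !rmorphB.
- by move=> _ _ [a ->] [b ->]; exists (a * b); rewrite !rmorphM.
- by move=> _ [a ->] _; exists a^-1; rewrite !fmorphV.
- by move=> q [a [/esym/eqP]]; rewrite fmorph_eq0 => /eqP -> ->; rewrite rmorph0.
Qed.

Definition kmin u (p : {poly k}) := [/\ p \is monic, root (map_poly i p) u &
  forall q, root (map_poly i q) u -> q != 0 -> (size p <= size q)%N].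

Lemma kmin_ex u : algebraicOver i u -> exists p, kmin u p.
Proof.
move=> [p0 p00 r0].
pose B n := `[< exists p, [/\ p != 0, root (map_poly i p) u & size p = n] >].
have exB : exists n, B n by exists (size p0); apply/asboolP; exists p0.
have := ex_minnP exB; move=> [n /asboolP[p [p_n0 rp sp]] min].
have l0 : lead_coef p != 0 by rewrite lead_coef_eq0.
exists ((lead_coef p)^-1 *: p); split.
- by rewrite monicE lead_coefZ mulVf.
- by rewrite map_polyZ rootZ // fmorphV invr_eq0 fmorph_eq0.
- move=> q rq q0; rewrite size_scale ?invr_eq0 // sp; apply: min.
  by apply/asboolP; exists q.
Qed.

Lemma kmin_size u p : kmin u p -> (1 < size p)%N.
Proof.
move=> [pm rp _]; rewrite -(size_map_poly i).
by apply: root_size_gt1 rp; rewrite map_poly_eq0 monic_neq0.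
Qed.

Lemma kmin_coef0 u p : kmin u p -> u != 0 -> p`_0 != 0.
Proof.
move=> [pm rp min] u0; apply/eqP => p0.
have /factor_theorem[q eq] : root p 0 by rewrite rootE horner_coef0 p0.
have q0 : q != 0.
  by have := monic_neq0 pm; rewrite {1}eq; apply: contra_neq => ->; rewrite mul0r.
have rq : root (map_poly i q) u.
  by move: rp; rewrite eq rmorphM rootM /= map_polyXsubC rmorph0 root_XsubC (negPf u0) orbF.
have := min _ rq q0; rewrite eq size_Mmonic ?monicXsubC // size_XsubC addn2 /=.
by rewrite ltnn.
Qed.

Let lift (p : {poly k}) := map_poly (fun a => (i a, f a)) p.
Let liftE (p : {poly k}) n : (lift p)`_n = (i p`_n, f p`_n).
Proof. by rewrite coef_map_id0 // !rmorph0. Qed.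
Let lift1 (p : {poly k}) : map_poly fst (lift p) = map_poly i p.
Proof. by apply/polyP => n; rewrite !coef_map /= liftE. Qed.
Let lift2 (p : {poly k}) : map_poly snd (lift p) = map_poly f p.
Proof. by apply/polyP => n; rewrite !coef_map /= liftE. Qed.
Let size_lift (p : {poly k}) : size (lift p) = size p.
Proof.
have [->|p0] := eqVneq p 0; first by rewrite /lift map_poly0 !size_poly0.
rewrite size_map_poly_id0 //; apply/eqP => -[/eqP]; rewrite fmorph_eq0.
by rewrite lead_coef_eq0 (negPf p0).
Qed.

Lemma galg_mgraph u : algebraicOver i u -> galg mgraph u.
Proof.
move=> [p p0 rp]; exists (lift p); split.
- by move=> n; rewrite liftE; exists p`_n.
- by rewrite -size_poly_eq0 size_lift size_poly_eq0.
- by rewrite lift1.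
Qed.

Lemma mgraph_extend : (forall u, algebraicOver i u) ->
  exists g : {rmorphism E -> Q}, g \o i =1 f.
Proof.
move=> alg; have [u|g gP] := graph_extend clQ graph_mgraph.
  exact/galg_mgraph/alg.
by exists g => a; apply: (gP (i a, f a)); exists a.
Qed.

(** The pair (u, v) is adjoined to the graph before extending, so every root of the minimal
    polynomial is a possible image of [u]. *)
Lemma mgraph_extend1 u p v : (forall u, algebraicOver i u) ->
  kmin u p -> root (map_poly f p) v ->
  exists2 g : {rmorphism E -> Q}, g \o i =1 f & g u = v.
Proof.
move=> alg [pm rp min] rv.
have [|||g gP gu] := @graph_extend1 _ _ clQ mgraph u (lift p) v graph_mgraph.
- by move=> w; exact/galg_mgraph/alg.
- split=> [n|||P hP rP P0].
  + by rewrite liftE; exists p`_n.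
  + by rewrite monicE lead_coefE size_lift liftE -lead_coefE (monicP pm) !rmorph1.
  + by rewrite lift1.
  rewrite size_lift.
  pose q := \poly_(n < size P) projT1 (cid (hP n)).
  have qE n : P`_n = (i q`_n, f q`_n).
    rewrite coef_poly; case: ltnP => [_|nP]; first by case: (cid _).
    by rewrite nth_default // !rmorph0.
  have eP : P = lift q by apply/polyP => n; rewrite qE liftE.
  rewrite eP size_lift; apply: min; first by move: rP; rewrite eP lift1.
  by move: P0; rewrite eP -size_poly_eq0 size_lift size_poly_eq0.
- by rewrite lift2.
by exists g => // a; apply: (gP (i a, f a)); exists a.
Qed.

End GraphOfMorphisms.

Section FixedField.
Variable E : fieldType.
Hypothesis clE : GRing.closed_field_axiom E.
Hypothesis charE : [pchar E] =i pred0.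

(** In characteristic zero [u] is a simple root of its minimal polynomial, whose degree is at least
    two because [u] lies outside the graph. So there is another root, to which [u] can be sent. *)
Lemma graph_moves (G : set (E * E)) u : graph G -> (forall x, G x -> x.1 = x.2) ->
  (forall x, galg G x) -> ~ G (u, u) ->
  exists2 g : {rmorphism E -> E}, forall x, G x -> g x.1 = x.1 & g u != u.
Proof.
move=> gG dG alg nGu; have [m mP] := minp_ex gG (alg u).
have [hm mm rm min] := mP; have [_ GB _ _ _] := gG.
pose p := map_poly fst m; have e12 : map_poly snd m = p.
  by apply/polyP => n; rewrite !coef_map /= dG.
have sp : size p = size m.
  by rewrite size_map_poly_id0 // (monicP mm) oner_neq0.
have pm : p \is monic.
  by rewrite monicE lead_coefE sp coef_map -lead_coefE (monicP mm).
have s2 : (2 < size m)%N.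
  rewrite ltnNge; apply/negP => sm.
  have s1 : (1 < size p)%N by apply: root_size_gt1 rm; exact: monic_neq0.
  have {}s2 : size m = 2%N by move: s1; rewrite sp; lia.
  have m1 : m`_1 = 1 by have := monicP mm; rewrite lead_coefE s2.
  apply: nGu; have -> : (u, u) = 0 - m`_0.
    have := rm; rewrite rootE horner_coef sp s2 2!big_ord_recl big_ord0 !coef_map.
    rewrite /= m1 expr0 mulr1 addr0 mul1r expr1 addr_eq0 => /eqP e.
    have := dG _ (hm 0%N); move: e; case: (m`_0) => a b /= -> <-.
    by rewrite -[LHS]/(u, u) sub0r -[RHS]/(- - u, - - u) opprK.
  apply: (GB _ _ _ (hm 0%N)); rewrite -(subrr 1); apply: GB; rewrite -m1; exact: hm.
have d_n0 : m^`() != 0.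
  apply/eqP => /(congr1 (fun p : {poly _} => (p`_(size m).-2).1)).
  rewrite coef_deriv coef0 [(size m).-2.+1]prednK; last by move: s2; case: (size m) => [|[|[]]].
  rewrite -lead_coefE (monicP mm).
  have -> : (size m).-1 = (size m).-2.+1 by move: s2; case: (size m) => [|[|[]]].
  move=> e; have /eqP := natrK_neq0 charE (size m).-2; apply.
  by rewrite -[RHS]e; elim: (_.+1) => // l IH; rewrite !mulrS IH.
have hd : gpoly G m^`().
  move=> n; rewrite coef_deriv; move: {1}n.+1 => j; elim: n.+1 => [|l IH].
    by rewrite mulr0n; exact: (graph0 gG).
  by rewrite mulrS; exact: (graphD gG (hm _) IH).
have du : ~~ root p^`() u.
  apply/negP => rd; have := min _ hd; rewrite -deriv_map => /(_ rd d_n0).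
  rewrite leqNgt lt_size_deriv //; exact: monic_neq0.
have [q eq] := factor_theorem _ _ rm.
have qu : ~~ root q u.
  apply: contra du => /rootP qu.
  by rewrite /p eq derivM derivXsubC mulr1 rootE hornerD hornerM qu hornerXsubC subrr mulr0 addr0.
have [v rv] : exists v, root q v.
  apply: (closed_root clE).
  have : size (map_poly fst m) = size p by [].
  have q0 : q != 0 by apply: contraNneq qu => ->; rewrite root0.
  by rewrite eq size_Mmonic ?monicXsubC // size_XsubC sp addn2 /= => sq; move: s2; rewrite -sq.
have [|g gP gu] := @graph_extend1 _ _ clE G u m v gG alg mP.
  by rewrite e12 /p eq rootM rv.
exists g; first by move=> x Gx; rewrite gP ?dG.
by rewrite gu; apply: contraNneq qu => <-.
Qed.

Lemma fixed_in (k : fieldType) (i : {rmorphism k -> E}) u :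
  (forall x, algebraicOver i x) ->
  (forall g : {rmorphism E -> E}, g \o i =1 i -> g u = u) -> exists a, u = i a.
Proof.
move=> alg fixu; apply: contrapT => nu.
have [|x|[a [e _]]|g gP gu] := @graph_moves (mgraph i i) u (graph_mgraph i i).
- by move=> _ [a ->].
- exact/galg_mgraph/alg.
- by apply: nu; exists a.
case/eqP: gu; apply: fixu => a.
by apply: (gP (i a, i a)); exists a.
Qed.

End FixedField.

(** * Places of algebraic functions *)

Section RationalFunctions.
Variables (K : closedFieldType) (E : fieldType) (kap : {rmorphism K -> E}).

Definition pev y : {poly K} -> E := horner_eval y \o map_poly kap.
HB.instance Definition _ y := GRing.RMorphism.on (pev y).

Lemma pevE y p : pev y p = (map_poly kap p).[y]. Proof. by []. Qed.
Lemma pevC y c : pev y c%:P = kap c.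
Proof. by rewrite pevE map_polyC hornerC. Qed.
Lemma pevX y : pev y 'X = y.
Proof. by rewrite pevE map_polyX hornerX. Qed.

Definition nonconst y := forall c, y <> kap c.

(** Over an algebraically closed field a polynomial in [y] is a product of factors y - c, so an
    element that is not a constant is transcendental. *)
Lemma pev_inj y : nonconst y -> injective (pev y).
Proof.
move=> ny; apply: raddf_inj => p py.
apply/eqP; apply: contraT => p0.
have [r er] := closed_field_poly_normal p.
have {}py : (map_poly kap p).[y] = 0 by exact: py.
move/eqP: py; rewrite {1}er map_polyZ hornerZ mulf_eq0 fmorph_eq0.
rewrite lead_coef_eq0 (negPf p0) /= rmorph_prod -[_.[y]]/(horner_eval y _) rmorph_prod.
rewrite prodf_seq_eq0 => /hasP[c _]; rewrite /= map_polyXsubC /horner_eval.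
by rewrite hornerXsubC subr_eq0 => /eqP/ny.
Qed.

Definition ratev y (ny : nonconst y) : {fraction {poly K}} -> E :=
  frac_lift (pev_inj ny).
HB.instance Definition _ y ny := GRing.RMorphism.on (@ratev y ny).

Lemma ratev_poly y (ny : nonconst y) p : ratev ny (FracField.tofrac p) = pev y p.
Proof. exact: frac_lift_tofrac. Qed.
End RationalFunctions.

Lemma ratev_comp (K : closedFieldType) (E Q : fieldType) (kE : {rmorphism K -> E})
  (kQ : {rmorphism K -> Q}) (g : {rmorphism E -> Q}) y Y
  (ny : nonconst kE y) (nY : nonconst kQ Y) :
  g \o kE =1 kQ -> g y = Y -> g \o ratev ny =1 ratev nY.
Proof.
move=> gk gy; apply: (@frac_morph_ext _ _ (g \o ratev ny) (ratev nY)) => p.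
rewrite /= !ratev_poly !pevE -(horner_map g) -map_poly_comp gy.
by congr (_.[_]); apply/polyP => n; rewrite !coef_map; exact: gk.
Qed.

Section ClearDenominators.
Variable R : idomainType.

Lemma clear_denominators (p : {poly {fraction R}}) : exists d (P : {poly R}),
  d != 0 /\ map_poly (@FracField.tofrac R) P = FracField.tofrac d *: p.
Proof.
elim/poly_ind: p => [|p c [d [P [d0 eP]]]].
  by exists 1, 0; split; rewrite ?oner_neq0 // map_poly0 scaler0.
exists (d * \d_(repr c)), ((\d_(repr c) *: P) * 'X + (d * \n_(repr c))%:P); split.
  by rewrite mulf_neq0 // denom_ratioP.
have e : FracField.tofrac (\d_(repr c)) * c = FracField.tofrac (\n_(repr c)).
  by rewrite {2}(frac_numden c) mulrC divfK // tofrac_eq0 denom_ratioP.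
rewrite rmorphD rmorphM /= map_polyX map_polyC map_polyZ eP /= scalerDr.
rewrite !tofracM -e scalerAl scalerA [X in X *: p]mulrC; congr (_ + _).
by rewrite -mul_polyC -rmorphM /= mulrA.
Qed.
End ClearDenominators.

Section PuiseuxEvaluation.
Variable K : closedFieldType.
Hypothesis charK : [pchar K] =i pred0.
Local Notation P := (puiseux K).
Local Notation pcst := (@pcst K).
Implicit Types (p : {poly K}).

Lemma pint_pev Y p : pint Y -> pint (pev pcst Y p) /\ pc (pev pcst Y p) 0 = p.[pc Y 0].
Proof.
move=> iY; elim/poly_ind: p => [|p c [IHi IHr]].
  by rewrite rmorph0 horner0 pc0; split=> //; exact: pge0.
rewrite rmorphD rmorphM /= pevX pevC; split.
  by apply: pintD; [exact: pintM|exact: pint_cst].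
by rewrite hornerMXaddC -IHr -res_mul // -{2}(res_cst c) -pcD.
Qed.

Lemma lvl_pev n Y p : lvl n Y -> lvl n (pev pcst Y p).
Proof.
move=> iY; elim/poly_ind: p => [|p c IH]; first by rewrite rmorph0; exact: lvl0.
rewrite rmorphD rmorphM /= pevX pevC; apply: lvlD; [exact: lvlM|exact: lvl_cst].
Qed.

Lemma lvl_ratev n Y (nY : nonconst pcst Y) x : lvl n Y -> lvl n (ratev nY x).
Proof.
move=> lY; rewrite (frac_numden x) fmorph_div /= !ratev_poly.
by apply: lvlM; [|apply: lvlV]; exact: lvl_pev.
Qed.

Lemma nonconst_int Y c : pint Y -> pc Y 0 = c -> Y != pcst c -> nonconst pcst Y.
Proof. by move=> iY rY nY d e; case/eqP: nY; rewrite e -rY e res_cst. Qed.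

Lemma ncX c : nonconst pcst (pcst c + pX K).
Proof.
move=> d /(congr1 (fun a => pc a 1)); rewrite pcD pc_X1 !pc_cst add0r.
by move/eqP; rewrite oner_eq0.
Qed.

Lemma ncXV : nonconst pcst (pX K)^-1.
Proof.
move=> d e; have := pc_X1 K; rewrite -[pX K]invrK e.
by rewrite -[(_ d)^-1](fmorphV pcst) pc_cst => /esym/eqP; rewrite oner_eq0.
Qed.

Lemma ncpX : nonconst pcst (pX K).
Proof. by have := @ncX 0; rewrite rmorph0 add0r. Qed.

Lemma pint_cX c : pint (pcst c + pX K).
Proof. by apply: pintD; [exact: pint_cst|exact: pint_X]. Qed.
Lemma res_cX c : pc (pcst c + pX K) 0 = c.
Proof. by rewrite pcD res_cst res_X addr0. Qed.
Lemma lvl_cX c : lvl 0 (pcst c + pX K).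
Proof. by apply: lvlD; [exact: lvl_cst|exact: lvl_X]. Qed.

(** In lowest terms, a root c of the denominator is a pole of the expansion at c. So each of them is
    a root of [f], and the denominator divides a power of [f]. *)
Lemma frac_pole (f : {poly K}) (x : {fraction {poly K}}) :
  (forall c, f.[c] != 0 -> pint (ratev (@ncX c) x)) -> x \in loc_pred f.
Proof.
move=> h; have d0 := denom_ratioP (repr x); have ex := frac_numden x.
set n := \n_ _ in ex; set d := \d_ _ in d0 ex.
have g0 : gcdp n d != 0 by rewrite gcdp_eq0 negb_and d0 orbT.
have := dvdp_gcdl n d; have := dvdp_gcdr n d; rewrite !dvdp_eq.
set d' := d %/ _; set n' := n %/ _ => /eqP ed /eqP en.
have d'0 : d' != 0 by apply: contraNneq d0 => d'0; rewrite ed d'0 mul0r.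
have cop : coprimep n' d'.
  by rewrite /n' /d' coprimep_div_gcd // d0 orbT.
have {}ex : x = FracField.tofrac n' / FracField.tofrac d'.
  rewrite ex ed {1}en !tofracM -mulf_div divff ?mulr1 // tofrac_eq0 //.
have [r er] := closed_field_poly_normal d'.
have rf c : c \in r -> f.[c] = 0.
  move=> cr; apply: contrapT => /eqP/h; set X := ratev _ x => iX.
  have rd : root d' c.
    by rewrite er rootZ ?lead_coef_eq0 // root_prod_XsubC.
  have nc : n'.[c] != 0.
    by apply: contraTneq rd => nc; apply: (coprimep_root cop); apply/rootP.
  have e : X * pev pcst (pcst c + pX K) d' = pev pcst (pcst c + pX K) n'.
    rewrite -!(ratev_poly (@ncX c)) -rmorphM; congr (ratev _ _).
    by rewrite ex divfK // tofrac_eq0.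
  have [id1 rd1] := pint_pev d' (pint_cX c).
  have [in1 rn1] := pint_pev n' (pint_cX c).
  case/eqP: nc; rewrite -(res_cX c) -rn1 -e res_mul // rd1 res_cX.
  by rewrite (rootP rd) mulr0.
have [q eq] : exists q, f ^+ size r = q * d'.
  suff /dvdpP[q eq] : d' %| f ^+ size r by exists q.
  rewrite er dvdpZl ?lead_coef_eq0 //.
  elim: (r) rf => [|c s IH] rf; first by rewrite big_nil dvd1p.
  rewrite big_cons exprS; apply: dvdp_mul.
    by rewrite dvdp_XsubCl rootE rf ?mem_head.
  by apply: IH => c' cs; apply: rf; rewrite inE cs orbT.
apply/asboolP; exists (size r), (n' * q); rewrite -tofracXn eq ex tofracM.
by rewrite [FracField.tofrac q * _]mulrC mulrA divfK ?tofrac_eq0 // tofracM.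
Qed.

Lemma frac_entire (x : {fraction {poly K}}) :
  (forall c, pint (ratev (@ncX c) x)) -> exists p, x = FracField.tofrac p.
Proof.
move=> h; have /asboolP[n [p e]] : x \in loc_pred (1 : {poly K}).
  by apply: frac_pole => c _; exact: h.
by exists p; rewrite -e tofrac1 expr1n mulr1.
Qed.

Definition bev (E : fieldType) (kap : {rmorphism K -> E}) y (R : {poly {poly K}}) a :=
  (map_poly (pev kap y) R).[a].

Lemma pthetaD (a b : P) : ptheta (a + b) = ptheta a + ptheta b.
Proof. exact: raddfD. Qed.
Lemma ptheta0 : ptheta (0 : P) = 0.
Proof. exact: raddf0. Qed.

Lemma theta_pev Y p : ptheta (pev pcst Y p) = ptheta Y * pev pcst Y p^`().
Proof.
elim/poly_ind: p => [|p c IH].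
  by rewrite deriv0 !rmorph0 ptheta0 mulr0.
rewrite derivD derivM derivC derivX addr0 mulr1 !rmorphD !rmorphM /=.
rewrite !pevX pevC pthetaD (pthetaM charK) (ptheta_cst charK) IH; ring.
Qed.

Lemma theta_bev Y (R : {poly {poly K}}) b : ptheta (bev pcst Y R b) =
  ptheta Y * bev pcst Y (map_poly (@deriv K) R) b + bev pcst Y R^`() b * ptheta b.
Proof.
rewrite /bev; elim/poly_ind: R => [|R c IH].
  by rewrite deriv0 !map_poly0 !horner0 ptheta0 mulr0 mul0r addr0.
have -> : map_poly (@deriv K) (R * 'X + c%:P) = map_poly (@deriv K) R * 'X + c^`()%:P.
  apply/polyP => i; rewrite coef_map_id0 ?derivC // !coefD !coefMX !coefC.
  case: i => [|i] /=; first by rewrite !add0r.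
  by rewrite !addr0 coef_map_id0 ?derivC.
rewrite derivD derivM derivC derivX addr0 mulr1 !rmorphD !rmorphM /=.
rewrite !map_polyX !map_polyC !hornerE pthetaD (pthetaM charK) IH theta_pev.
ring.
Qed.

End PuiseuxEvaluation.

Section Places.
Variable K : closedFieldType.
Hypothesis charK : [pchar K] =i pred0.
Local Notation P := (puiseux K).
Local Notation pcst := (@pcst K).
Variables (Om : fieldType) (kap : {rmorphism K -> Om}) (y : Om).
Hypothesis ny : nonconst kap y.
Hypothesis algy : forall u, algebraicOver (ratev ny) u.

(** A point of the curve with a branch and a local parameter, recorded as an embedding in Puiseux
    series: j y = c + t lies above y = c, and j y = 1/t above infinity. Ramification and poles of a
    function are read off from its image. *)
Definition place (j : {rmorphism Om -> P}) := forall c, j (kap c) = pcst c.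

Lemma place_nc j : place j -> nonconst pcst (j y).
Proof. by move=> pj c e; apply: (ny (c := c)); apply: (fmorph_inj j); rewrite pj. Qed.

Lemma place_of Y (nY : nonconst pcst Y) (j : {rmorphism Om -> P}) :
  j \o ratev ny =1 ratev nY -> place j /\ j y = Y.
Proof.
move=> e; split=> [c|].
  by have := e (FracField.tofrac c%:P); rewrite /= !ratev_poly !pevC.
by have := e (FracField.tofrac 'X); rewrite /= !ratev_poly !pevX.
Qed.

Lemma place_ex Y : nonconst pcst Y -> exists2 j, place j & j y = Y.
Proof.
move=> nY; have [j /place_of[pj jy]] :=
  mgraph_extend (ratev nY) (puiseux_closed charK) algy.
by exists j.
Qed.

Lemma place_ratev j Y (nY : nonconst pcst Y) : place j -> j y = Y ->
  j \o ratev ny =1 ratev nY.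
Proof. by move=> pj jy; exact: ratev_comp. Qed.

Lemma place_root u p Y (nY : nonconst pcst Y) v :
  kmin (ratev ny) u p -> root (map_poly (ratev nY) p) v ->
  exists j, [/\ place j, j y = Y & j u = v].
Proof.
move=> up rv; have [j /place_of[pj jy] ju] :=
  mgraph_extend1 (puiseux_closed charK) algy up rv.
by exists j.
Qed.

Lemma place_val u p Y (nY : nonconst pcst Y) j : place j -> j y = Y ->
  root (map_poly (ratev ny) p) u -> root (map_poly (ratev nY) p) (j u).
Proof.
move=> pj jy ru; rewrite -(eq_map_poly (place_ratev nY pj jy)) map_poly_comp.
exact: rmorph_root.
Qed.

(** All values are roots of one polynomial. This finiteness gives bounds that are uniform in the
    place. *)
Lemma place_values u Y (nY : nonconst pcst Y) :
  exists r : seq P, forall j, place j -> j y = Y -> j u \in r.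
Proof.
have [p [pm rp _]] := kmin_ex (algy u).
have [r er] := closed_normal (puiseux_closed charK) (monic_map (ratev nY) pm).
exists r => j pj jy; rewrite -root_prod_XsubC -er; exact: place_val.
Qed.

Lemma alg_bivariate u : exists R : {poly {poly K}},
  [/\ R != 0, bev kap y R u = 0 & bev kap y R^`() u != 0].
Proof.
have [p [pm rp min]] := kmin_ex (algy u).
have [d [R [d0 eR]]] := clear_denominators p.
have bevE S : bev kap y S u = (map_poly (ratev ny) (map_poly (@FracField.tofrac _) S)).[u].
  rewrite /bev -map_poly_comp; congr (_.[_]); apply: eq_map_poly => q.
  by rewrite /= ratev_poly.
have d0F : FracField.tofrac d != 0 by rewrite tofrac_eq0.
have p0 := monic_neq0 pm.
exists R; split.
- apply: contraNneq p0 => R0; move/eqP: eR; rewrite R0 map_poly0 eq_sym.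
  by rewrite scaler_eq0 (negPf d0F).
- by rewrite bevE eR map_polyZ hornerZ (rootP rp) mulr0.
have -> : bev kap y R^`() u = ratev ny (FracField.tofrac d) * (map_poly (ratev ny) p^`()).[u].
  by rewrite bevE -deriv_map eR derivZ map_polyZ hornerZ.
rewrite mulf_neq0 ?fmorph_eq0 //; apply/negP => /eqP/rootP rd.
have sp : (1 < size p)%N.
  have -> : size p = size (map_poly (ratev ny) p) by rewrite size_map_poly.
  by apply: root_size_gt1 rp; rewrite map_poly_eq0.
suff d'0 : p^`() != 0 by have := min _ rd d'0; rewrite leqNgt lt_size_deriv.
apply/eqP => /(congr1 (fun q : {poly _} => q`_(size p).-2)).
have sp' : (size p).-1 = (size p).-2.+1 by move: sp; case: (size p) => [|[]].
have charF : [pchar {fraction {poly K}}] =i pred0.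
  by move=> l; rewrite -(fmorph_pchar (ratev ny)) (fmorph_pchar kap); exact: charK.
rewrite coef_deriv coef0 -sp' -lead_coefE (monicP pm) sp' => /eqP.
by rewrite (negPf (natrK_neq0 charF _)).
Qed.

Local Notation bevO := (bev kap y).

Lemma place_bev j (R : {poly {poly K}}) a : place j ->
  j (bevO R a) = bev pcst (j y) R (j a).
Proof.
move=> pj; rewrite /bev -horner_map -map_poly_comp; congr (_.[_]).
apply: eq_map_poly => q; rewrite /= !pevE -horner_map -map_poly_comp; congr (_.[_]).
by apply: eq_map_poly => c; exact: pj.
Qed.

Lemma place_pev j p : place j -> j (pev kap y p) = pev pcst (j y) p.
Proof.
move=> pj; rewrite !pevE -horner_map -map_poly_comp; congr (_.[_]).
by apply: eq_map_poly => c; exact: pj.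
Qed.

(** Multiplication by the leading coefficient of an equation of [u] over K[y] makes it integral over
    K[y]. *)
Lemma clear_poles u : exists2 q : {poly K}, q != 0 &
  forall j, place j -> pint (j y) -> pint (j (pev kap y q * u)).
Proof.
have [R [R0 ru _]] := alg_bivariate u.
have l0 : lead_coef R != 0 by rewrite lead_coef_eq0.
exists (lead_coef R) => // j pj iy.
have s1 : (1 < size R)%N.
  rewrite ltnNge; apply/negP => /size1_polyC eR; move/eqP: ru.
  rewrite eR /bev map_polyC hornerC /= -(rmorph0 (pev kap y)) (inj_eq (pev_inj ny)).
  by move=> /eqP e0; case/eqP: R0; rewrite eR e0.
pose n := (size R).-1; have n0 : (0 < n)%N by rewrite /n; case: (size R) s1 => [|[]].
pose q := lead_coef R; pose a := j u; pose Q := pev pcst (j y) q.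
have -> : j (pev kap y q * u) = Q * a by rewrite rmorphM place_pev.
(* The equation of [a] multiplied by Q^(n-1), read as a monic equation for Q a. *)
pose S := 'X^n + \poly_(i < n) (pev pcst (j y) R`_i * Q ^+ (n.-1 - i)).
have sS : size S = n.+1.
  by rewrite size_polyDl size_polyXn // ltnS size_poly.
apply: (@pint_root _ S).
- by rewrite monicE lead_coefE sS coefD coefXn eqxx nth_default ?addr0 // size_poly.
- move=> i; rewrite coefD coefXn coef_poly; apply: pintD.
    by case: eqP => _; [exact: pint1|exact: pge0].
  case: ltnP => _; last exact: pge0.
  by apply: pintM; [|apply: pintX]; apply: (pint_pev _ _).1.
rewrite rootE hornerD hornerXn horner_poly.
have e : bev pcst (j y) R a = 0 by rewrite -place_bev // ru rmorph0.
move: e; rewrite /bev horner_coef size_map_poly_id0; last first.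
  by rewrite -(rmorph0 (pev pcst (j y))) (inj_eq (pev_inj (place_nc pj))).
have -> : size R = n.+1 by rewrite /n prednK // ltnW.
rewrite big_ord_recr /= [X in _ + X * _]coef_map -[R`_n]/q /= -/Q => e.
apply/eqP; transitivity (Q ^+ n.-1 * 0); last by rewrite mulr0.
rewrite -[in X in _ = X]e mulrDr addrC mulr_sumr; congr (_ + _); last first.
  by rewrite -{1}(prednK n0) exprMn exprSr -(prednK n0) -mulrA.
apply: eq_bigr => i _; rewrite coef_map /= exprMn.
have -> : Q ^+ n.-1 = Q ^+ (n.-1 - i) * Q ^+ i.
  by rewrite -exprD subnK // -ltnS prednK.
by ring.
Qed.

(** Implicit differentiation of the equation of [a]: the derivation y d/dy extends to the algebraic
    functions by one formula, valid at all places. *)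
Lemma euler_lift a : exists a', forall j, place j ->
  ptheta (j a) * j y = ptheta (j y) * j a'.
Proof.
have [R [_ ru du]] := alg_bivariate a.
exists (- y * bevO (map_poly (@deriv K) R) a / bevO R^`() a) => j pj.
have := congr1 (fun x => ptheta (j x)) ru; rewrite /= rmorph0 ptheta0 place_bev //.
rewrite (theta_bev charK) -!place_bev // => e.
have d0 : j (bevO R^`() a) != 0 by rewrite fmorph_eq0.
apply: (mulfI d0); rewrite !rmorphM fmorphV rmorphN.
have -> : j (bevO R^`() a) * (ptheta (j a) * j y) =
    (j (bevO R^`() a) * ptheta (j a)) * j y by rewrite mulrA.
move/eqP: e; rewrite addrC addr_eq0 => /eqP ->.
by field.
Qed.

(** Up to sign, the constant coefficient of the minimal polynomial is a product of values of [v] at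
    the places above a point. It is integral at all finite points, so a polynomial in [y], and it
    vanishes at infinity. Hence it is zero, and so is [v]. *)
Lemma liouville v : (forall c j, place j -> j y = pcst c + pX K -> pint (j v)) ->
  (forall j, place j -> j y = (pX K)^-1 -> pge 1 (j v)) -> v = 0.
Proof.
move=> hf hi; apply/eqP; apply: contraT => v0.
have [p vp] := kmin_ex (algy v); have [pm rp min] := vp.
have sp := kmin_size vp; have c0 := kmin_coef0 vp v0.
have val Y (nY : nonconst pcst Y) : exists2 r : seq P, r != [::] &
    ratev nY p`_0 = \prod_(a <- r) - a /\
    forall a, a \in r -> exists j, [/\ place j, j y = Y & j v = a].
  have [r er] := closed_normal (puiseux_closed charK) (monic_map (ratev nY) pm).
  exists r.
    apply: contraTneq sp => r0; have := congr1 (fun q : {poly P} => size q) er.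
    by rewrite r0 big_nil size_poly1 size_map_poly => ->.
  split; last first.
    by move=> a ar; apply: (place_root vp); rewrite er root_prod_XsubC.
  have := congr1 (fun q : {poly P} => q.[0]) er.
  rewrite horner_coef0 coef_map horner_prod /= => ->.
  by apply: eq_bigr => a _; rewrite hornerXsubC sub0r.
have [g eg] : exists g, p`_0 = FracField.tofrac g.
  apply: frac_entire => c; have [r _ [-> hr]] := val _ (@ncX K c).
  rewrite big_seq; apply: (big_ind (@pint K)); [exact: pint1|exact: pintM|].
  by move=> a /hr[j [pj jy <-]]; apply/pgeN/(hf c).
have g0 : g != 0 by move: c0; rewrite eg tofrac_eq0.
have : pge 1 (ratev (@ncXV K) p`_0).
  have [r r0 [-> hr]] := val _ (@ncXV K).
  have h a : a \in r -> pge 1 (- a) by move=> /hr[j [pj jy <-]]; apply/pgeN/hi.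
  case: r r0 h {hr} => // a r _ h; rewrite big_cons -[1]addr0.
  apply: pgeM; first by apply: h; rewrite mem_head.
  rewrite big_seq; apply: (big_ind (@pint K)); [exact: pint1|exact: pintM|].
  by move=> b br; apply: pge_le (h _ _); rewrite ?inE ?br ?orbT.
(* At y = 1/t the leading coefficient of [g] stands at the exponent - deg g, which is at most 0,
   where all coefficients vanish. *)
rewrite eg ratev_poly pevE => /(_ (- ((size g).-1)%:R)) h.
have := h _; rewrite horner_coef size_map_poly pc_sum.
have -> : (pX K)^-1 = pmono (-1) 1.
  have := pX_neq0 K; rewrite pXE => X0; apply: (mulfI X0).
  by rewrite mulfV // pmonoM subrr mulr1.
have sg : ((size g).-1 < size g)%N by rewrite ltn_predL size_poly_gt0.
rewrite (bigD1 (Ordinal sg)) //= big1 => [|i].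
  rewrite coef_map /= pmono_exp expr1n pc_cstM pc_mono mulNrn eqxx mulr1 addr0.
  rewrite -lead_coefE => /(_ _)/eqP; rewrite lead_coef_eq0 (negPf g0); apply.
  by rewrite (@lt_le_trans _ _ 1) // (@le_lt_trans _ _ 0) // oppr_le0 ler0n.
rewrite -val_eqE /= => ig; rewrite coef_map /= pmono_exp expr1n pc_cstM pc_mono.
by rewrite mulNrn eqr_opp eqr_nat eq_sym (negPf ig) mulr0.
Qed.

(** * Simple connectedness of the affine line *)

Section SimplyConnected.
Variable u : Om.
Hypothesis unr : forall c j, place j -> j y = pcst c + pX K -> lvl 0 (j u).

Let fincirc : forall a : Om, exists a' : Om, forall j, place j ->
  ptheta (j a) * j y = ptheta (j y) * j a' := euler_lift.

Let eul a := projT1 (cid (fincirc a)).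
Let eulP a j : place j -> ptheta (j a) * j y = ptheta (j y) * j (eul a).
Proof. by rewrite /eul; case: (cid _) => a' /= h; exact: h. Qed.

Let regular a := forall c j, place j -> j y = pcst c + pX K ->
  lvl 0 (j a) /\ pint (j a).

Let eul_regular a : regular a -> regular (eul a).
Proof.
move=> ra c j pj jy; have [la ia] := ra c j pj jy.
have := eulP a pj; rewrite jy pthetaD (ptheta_cst charK) add0r (ptheta_X charK).
move=> e; rewrite (canRL (mulKf (pX_neq0 K)) (esym e)); split.
  apply: lvlM; first by apply: lvlV; exact: lvl_X.
  by apply: lvlM; [exact: lvl_theta|exact: lvl_cX].
have t1 : pge 1 (ptheta (j a)).
  apply: pint_lvl0_pge1; [exact: lvl_theta|exact: pge_theta|exact: res_theta].
have X1 : pge (- 1) (pX K)^-1.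
  by have [] := pge_inv (@pge_X K) (_ : pc (pX K) 1 != 0); rewrite // pc_X1 oner_neq0.
rewrite mulrA; apply: pintM; last exact: pint_cX.
by rewrite /pint -(addNr 1); exact: pgeM.
Qed.

(** Multiply [u] by a polynomial in [y] to get [a] without finite poles. The iterates of y d/dy on
    [a] stay regular at finite places, with poles of order at most [m] at infinity. A nontrivial
    combination of sufficiently many of them vanishes to order m + 1 at all places above 0; divided
    by y^(m+1) it is zero by Liouville. So the expansion of [a] at 0 is killed by a polynomial L in
    t d/dt, its exponents are roots of L, and [a] is a polynomial. *)
Lemma simply_connected : exists r, u = ratev ny r.
Proof.
have [q q0 hq] := clear_poles u; pose a := pev kap y q * u.
have ra : regular a.
  move=> c j pj jy; split; last by apply: hq => //; rewrite jy; exact: pint_cX.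
  rewrite /a rmorphM; apply: lvlM; last exact: unr pj jy.
  by rewrite place_pev // jy; exact/lvl_pev/lvl_cX.
have [g ag] : exists g, a = pev kap y g; last first.
  exists (FracField.tofrac g / FracField.tofrac q).
  rewrite fmorph_div /= !ratev_poly -ag /a mulrAC divff ?mul1r //.
  by rewrite -(rmorph0 (pev kap y)) (inj_eq (pev_inj ny)).
pose A k := iter k eul a.
have rA k : regular (A k) by elim: k => //= k; exact: eul_regular.
have [m hm] : exists m : nat, forall j, place j -> j y = (pX K)^-1 ->
    pge (- m%:R) (j a).
  have [r hr] := place_values a (@ncXV K).
  suff [m h] : exists m : nat, forall b, b \in r -> pge (- m%:R) b.
    by exists m => j pj jy; apply: h; exact: hr.
  elim: r {hr} => [|b r [m IH]]; first by exists 0%N.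
  have [n [N lb]] := pc_lev b; exists (N + m)%N => b'.
  rewrite inE => /orP[/eqP ->|/IH]; last first.
    by apply: pge_le; rewrite lerN2 ler_nat leq_addl.
  move=> x xN; apply: contrapT => /eqP/lb[i ei]; move: xN; rewrite ei ltNge.
  apply/negP/negPn; rewrite /pexp ler_pdivlMr ?ltr0n // natrD.
  have := ler0n rat i; have := ler0n rat m; have := ler0n rat N.
  have : (1 : rat) <= n.+1%:R by rewrite ler1n.
  by nra.
have hmA k j : place j -> j y = (pX K)^-1 -> pge (- m%:R) (j (A k)).
  move=> pj jy; elim: k => [|k IH]; first exact: hm.
  have := eulP (A k) pj; rewrite jy => e.
  suff -> : j (A k.+1) = - ptheta (j (A k)) by apply/pgeN/pge_theta.
  have tX : ptheta (pX K)^-1 = - (pX K)^-1.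
    have := pthetaM charK (pX K) (pX K)^-1; rewrite divff ?pX_neq0 //.
    rewrite -(rmorph1 pcst) (ptheta_cst charK) (ptheta_X charK) divff ?pX_neq0 //.
    move=> /eqP; rewrite eq_sym addrC addr_eq0 => /eqP h.
    by apply: (mulfI (pX_neq0 K)); rewrite h mulrN divff ?pX_neq0.
  have Xi : (pX K)^-1 != 0 by rewrite invr_eq0 pX_neq0.
  by apply: (mulfI Xi); rewrite -[LHS]opprK -mulNr -tX -e mulrN mulrC.
have hA0 k j : place j -> j y = pX K -> j (A k) = iter k (@ptheta K) (j a).
  move=> pj jy; elim: k => //= k IH.
  have := eulP (A k) pj; rewrite jy (ptheta_X charK) mulrC => /(mulfI (pX_neq0 K)) <-.
  by rewrite IH.
have [r hr] := place_values a (@ncpX K).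
(* The number of linear conditions: the coefficients of t^0, ..., t^m in each of the finitely many
   expansions at 0. *)
pose N := (size r * m.+1)%N.
pose M := \matrix_(k < N.+1, i < N)
  pc (iter k (@ptheta K) r`_(i %/ m.+1)) (i %% m.+1)%:R.
have [L L0 LM] : exists2 L : 'rV[K]_N.+1, L != 0 & L *m M = 0.
  have : kermx M != 0.
    rewrite -mxrank_eq0 mxrank_ker subn_eq0 -ltnNge ltnS.
    exact: rank_leq_col.
  by move=> /rowV0Pn[L /sub_kermxP LM L0]; exists L.
pose v := \sum_(k < N.+1) kap (L 0 k) * A k.
have v0 : v = 0.
  pose v' := v / y ^+ m.+1.
  have y0 : y != 0 by apply/eqP => e; apply: (ny (c := 0)); rewrite e rmorph0.
  suff v'0 : v' = 0 by rewrite -[v](divfK (expf_neq0 m.+1 y0)) -/v' v'0 mul0r.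
  have jvE j : place j -> j v = \sum_(k < N.+1) pcst (L 0 k) * j (A k).
    by move=> pj; rewrite rmorph_sum; apply: eq_bigr => k _; rewrite rmorphM pj.
  have jv'E (j : {rmorphism Om -> P}) : j v' = j v / j y ^+ m.+1 by rewrite /v' rmorphM fmorphV rmorphXn.
  apply: liouville => [c j pj jy|j pj jy]; last first.
    rewrite jv'E jy exprVn invrK.
    have -> : (1 : rat) = - m%:R + m.+1%:R by rewrite -natr1 addrC addrK || (rewrite -natr1; lra).
    apply: pgeM; last by rewrite -[X in pge X]mulr1 mulr_natl; exact/pgeX_nat/pge_X.
    rewrite jvE //; apply: pge_sum => k _; rewrite -[- _]add0r.
    by apply: pgeM; [exact: pint_cst|exact: hmA].
  have iv : pint (j v).
    rewrite jvE //; apply: pge_sum => k _; apply: pintM; first exact: pint_cst.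
    by have [] := rA k c j pj jy.
  have [c0|c0] := eqVneq c 0; last first.
    rewrite jv'E jy; apply: pintM => //; apply: pint_unit; first exact/pintX/pint_cX.
    by rewrite resX ?res_cX ?expf_neq0 //; exact: pint_cX.
  have {}jy0 : j y = pX K by rewrite jy c0 rmorph0 add0r.
  have lv : lvl 0 (j v).
    rewrite jvE //; apply: lvl_sum => k _; apply: lvlM; first exact: lvl_cst.
    by have [] := rA k c j pj jy.
  have cv e : (e < m.+1)%N -> pc (j v) e%:R = 0.
    move=> em; rewrite jvE // pc_sum.
    have ir : (index (j a) r < size r)%N by rewrite index_mem; exact: hr.
    have iN : (index (j a) r * m.+1 + e < N)%N.
      apply: leq_trans (_ : (index (j a) r).+1 * m.+1 <= N)%N; last by rewrite leq_mul2r ir orbT.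
      by rewrite mulSn addnC ltn_add2r.
    have := congr1 (fun Z : 'rV_N => Z 0 (Ordinal iN)) LM; rewrite !mxE => h.
    rewrite -[RHS]h; apply: eq_bigr => k _; rewrite !mxE /= divnMDl // divn_small // addn0.
    by rewrite modnMDl modn_small // nth_index ?hr // pc_cstM hA0.
  have pv : pge m.+1%:R (j v).
    move=> x xm; apply: contrapT => /eqP vx; have [z ez] := lvl0_supp lv vx.
    case/eqP: vx; have [x0|x0] := ltP x 0; first exact: iv.
    case: z ez => z ez; last first.
      by move: x0; rewrite ez NegzE rmorphN /= oppr_ge0 lern0.
    by rewrite ez; apply: cv; move: xm; rewrite ez ltr_nat.
  rewrite jv'E jy0 /pint -(subrr m.+1%:R); apply: pgeM => //.
  have Xm : pge m.+1%:R (pX K ^+ m.+1) by exact/pgeX_nat/pge_X.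
  have [] // := pge_inv Xm (_ : pc (pX K ^+ m.+1) m.+1%:R != 0).
  by rewrite pXE pmono_exp expr1n pc_mono eqxx oner_neq0.
have [j pj jy] := place_ex (@ncpX K).
have jy' : j y = pcst 0 + pX K by rewrite rmorph0 add0r.
have [la ia] := ra 0 j pj jy'.
pose Lp := \poly_(k < N.+1) L 0 (inord k).
have Lp0 : Lp != 0.
  apply: contraNneq L0 => Lp0; apply/eqP/rowP => k; rewrite mxE.
  by have := congr1 (fun q : {poly K} => q`_k) Lp0; rewrite coef_poly ltn_ord inord_val coef0.
have iterE k b x : pc (iter k (@ptheta K) b) x = qK K x ^+ k * pc b x.
  by elim: k => [|k IH] /=; rewrite ?mul1r // pc_theta IH exprS mulrA.
(* The operator t d/dt multiplies the coefficient of t^i by i, so L(i) times this coefficient is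
   zero. *)
have Lpf (i : nat) : pc (j a) i%:R != 0 -> root Lp i%:R.
  have := congr1 j v0; rewrite /v rmorph_sum rmorph0 => /(congr1 (fun b => pc b i%:R)).
  rewrite pc_sum pc0 => e f0; apply/rootP; apply: (mulIf f0); rewrite mul0r -[RHS]e.
  rewrite horner_poly mulr_suml; apply: eq_bigr => k _.
  by rewrite rmorphM pj pc_cstM hA0 // iterE (qK_nat charK) inord_val mulrA.
have [B hB] : exists B : nat, forall i : nat, pc (j a) i%:R != 0 -> (i < B)%N.
  have [rs ers] := closed_field_poly_normal Lp.
  suff [B h] : exists B, forall i : nat, (i%:R : K) \in rs -> (i < B)%N.
    exists B => i /Lpf; rewrite ers rootZ ?lead_coef_eq0 // root_prod_XsubC.
    exact: h.
  elim: rs {ers} => [|x rs [B IH]]; first by exists 0%N.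
  have [[i0 ei0]|ni0] := pselect (exists i : nat, i%:R = x); last first.
    exists B => i; rewrite inE => /orP[/eqP ix|/IH//]; by case: ni0; exists i.
  exists (maxn B i0.+1) => i; rewrite inE leq_max => /orP[/eqP ix|/IH -> //].
  suff -> : i = i0 by rewrite ltnSn orbT.
  have inj k l : (k <= l)%N -> k%:R = l%:R :> K -> k = l.
    move=> kl /eqP; rewrite -(subnK kl) natrD -subr_eq subrr eq_sym.
    by case: (l - k)%N => // d; rewrite (negPf (natrK_neq0 charK d)).
  case: (leqP i i0) => [ii|/ltnW ii]; first by apply: inj; rewrite // ix.
  by apply/esym/inj; rewrite // ix.
exists (\poly_(i < B) pc (j a) i%:R); apply: (fmorph_inj j).
rewrite place_pev // jy pevE; apply: puiseuxP => x.
rewrite (horner_coef_wide _ (_ : _ <= B)%N); last first.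
  exact: leq_trans (size_poly _ _) (size_poly _ _).
have tE i : (map_poly pcst (\poly_(i < B) pc (j a) i%:R))`_i * pX K ^+ i =
    pmono i%:R (if (i < B)%N then pc (j a) i%:R else 0).
  by rewrite coef_map coef_poly /= pcstE pXE pmono_exp pmonoM add0r expr1n mulr1.
under eq_bigr do rewrite tE.
rewrite pc_sum.
have [[i [iB ->]]|nx] := pselect (exists i : nat, (i < B)%N /\ x = i%:R).
  rewrite (bigD1 (Ordinal iB)) //= big1 => [|l].
    by rewrite pc_mono eqxx iB addr0.
  by rewrite -val_eqE pc_mono eqr_nat eq_sym /= => /negPf ->.
rewrite big1 => [|i _]; last first.
  by rewrite pc_mono; case: eqP => // xi; case: nx; exists i.
apply: contrapT => /eqP ax; have [z ez] := lvl0_supp la ax.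
case: z ez => z ez; last first.
  by case/eqP: ax; apply: ia; rewrite ez NegzE rmorphN /= oppr_lt0 ltr0n.
by apply: nx; exists z; split=> //; apply: hB; rewrite -[_%:R]ez.
Qed.
End SimplyConnected.

End Places.

Definition mkrm (R S : pzRingType) (f : R -> S) (fz : zmod_morphism f)
    (fm : monoid_morphism f) : {rmorphism R -> S} :=
  HB.pack f (GRing.isZmodMorphism.Build R S f fz)
    (GRing.isMonoidMorphism.Build R S f fm).

(** Dual numbers: over a given [dre] part, a morphism into them is a derivation, and they are a
    square-zero extension to which formal etaleness applies. *)
Record dual (A : Type) := Dual { dre : A; deps : A }.

(** * Etale algebras and Puiseux series *)

Section DualNumbers.
Variable A : comPzRingType.
Implicit Types x y : dual A.

HB.instance Definition _ := gen_eqMixin (dual A).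
HB.instance Definition _ := gen_choiceMixin (dual A).

Lemma dualP x y : dre x = dre y -> deps x = deps y -> x = y.
Proof. by case: x y => [a b] [c d] /= -> ->. Qed.

Definition dual_add x y := Dual (dre x + dre y) (deps x + deps y).
Definition dual_opp x := Dual (- dre x) (- deps x).
Definition dual_mul x y := Dual (dre x * dre y) (dre x * deps y + deps x * dre y).
Definition dual0 := Dual (0 : A) 0.
Definition dual1 := Dual (1 : A) 0.

Lemma dual_addA : associative dual_add.
Proof. by move=> x y z; apply: dualP; rewrite /= addrA. Qed.
Lemma dual_addC : commutative dual_add.
Proof. by move=> x y; apply: dualP; rewrite /= addrC. Qed.
Lemma dual_add0 : left_id dual0 dual_add.
Proof. by move=> x; apply: dualP; rewrite /= add0r. Qed.
Lemma dual_addN : left_inverse dual0 dual_opp dual_add.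
Proof. by move=> x; apply: dualP; rewrite /= addNr. Qed.
HB.instance Definition _ :=
  GRing.isZmodule.Build (dual A) dual_addA dual_addC dual_add0 dual_addN.

Lemma dual_mulA : associative dual_mul.
Proof. by move=> x y z; apply: dualP; rewrite /= ?mulrA //; ring. Qed.
Lemma dual_mulC : commutative dual_mul.
Proof. by move=> x y; apply: dualP; rewrite /= ?(mulrC (dre x)) //; ring. Qed.
Lemma dual_mul1 : left_id dual1 dual_mul.
Proof. by move=> x; apply: dualP; rewrite /= ?mul1r ?mul0r ?addr0. Qed.
Lemma dual_mulDl : left_distributive dual_mul dual_add.
Proof. by move=> x y z; apply: dualP; rewrite /= ?mulrDl //; ring. Qed.
Lemma dual_mulr1 : right_id dual1 dual_mul.
Proof. by move=> x; rewrite dual_mulC dual_mul1. Qed.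
Lemma dual_mulDr : right_distributive dual_mul dual_add.
Proof. by move=> x y z; rewrite dual_mulC dual_mulDl !(dual_mulC x). Qed.
HB.instance Definition _ := GRing.Zmodule_isPzRing.Build (dual A)
  dual_mulA dual_mul1 dual_mulr1 dual_mulDl dual_mulDr.
HB.instance Definition _ := GRing.PzRing_hasCommutativeMul.Build (dual A) dual_mulC.

Lemma dre_zmod : zmod_morphism (@dre A). Proof. by []. Qed.
Lemma dre_monoid : monoid_morphism (@dre A). Proof. by []. Qed.
HB.instance Definition _ := GRing.isZmodMorphism.Build (dual A) A (@dre A) dre_zmod.
HB.instance Definition _ := GRing.isMonoidMorphism.Build (dual A) A (@dre A) dre_monoid.

Lemma dre_square0 (x y : dual A) : dre x = 0 -> dre y = 0 -> x * y = 0.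
Proof.
by case: x y => [a b] [c d] /= -> ->; apply: dualP; rewrite /= ?mul0r ?mulr0 ?addr0.
Qed.
End DualNumbers.

Section EtaleIntoPuiseux.
Variable K : closedFieldType.
Hypothesis charK : [pchar K] =i pred0.
Local Notation P := (puiseux K).
Local Notation pcst := (@pcst K).
Variables (S C : comPzRingType) (f : {rmorphism S -> C}).

Section ModuleFinite.
Hypothesis fpC : module_finitely_presented f.

Lemma finite_lvl (g : {rmorphism C -> P}) : (forall s, lvl 0 (g (f s))) ->
  exists n, forall b, lvl n (g b).
Proof.
move=> hS; have [N [_ [e [_ [gen _]]]]] := fpC.
have [n hn] := lvl_common [seq g (e i) | i <- enum 'I_N].
exists n => b; have [c ->] := gen b; rewrite rmorph_sum; apply: lvl_sum => i _.
rewrite rmorphM; apply: lvlM; last by apply: hn; apply/map_f; rewrite mem_enum.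
by have := lvl_scale n (hS (c i)); rewrite mul1n.
Qed.

(** Take a generator [e m] of least order. If [b] had a pole, b * e m would have smaller order than
    any combination of the generators with integral coefficients. *)
Lemma finite_pint (g : {rmorphism C -> P}) b :
  (forall s, pint (g (f s))) -> pint (g b).
Proof.
move=> hS; have [N [_ [e [_ [gen _]]]]] := fpC.
have [i0 ei0] : exists i, g (e i) != 0.
  apply: contrapT => h; have [c e1] := gen 1.
  have := rmorph1 g; rewrite e1 rmorph_sum big1 => [/esym/eqP|i _].
    by rewrite oner_eq0.
  have [ei|/eqP ei] := eqVneq (g (e i)) 0; first by rewrite rmorphM ei mulr0.
  by case: h; exists i; apply/eqP.
have [m em mmin] := @arg_minP _ _ _ i0 (fun i => g (e i) != 0)
  (fun i => pord (g (e i))) ei0.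
set o := pord _ in mmin.
have all_o i : pge o (g (e i)).
  have [->|ei] := eqVneq (g (e i)) 0; first exact: pge0.
  by have [_] := pordP ei; apply: pge_le; exact: mmin.
apply: contrapT => nb.
have b0 : g b != 0 by apply/eqP => b0; apply: nb; rewrite b0; exact: pge0.
have [qb bq] := pordP b0; set q := pord (g b) in qb bq.
have q0 : q < 0.
  by rewrite ltNge; apply/negP => q0; apply: nb; exact: pge_le bq.
have [c ec] := gen (b * e m).
have := congr1 g ec; rewrite rmorphM => h.
have : pge o (g b * g (e m)).
  rewrite h rmorph_sum; apply: pge_sum => i _.
  by rewrite rmorphM -[o]add0r; exact: (pgeM (hS _) (all_o i)).
move=> /(_ (q + o)); rewrite (pc_lead bq (all_o m)) gtrDr => /(_ q0)/eqP.
by rewrite mulf_eq0 (negPf qb) /=; have [/negPf ->] := pordP em.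
Qed.

(** The characteristic polynomial of multiplication by [b] on the generators. It depends on the
    matrix alone, so one polynomial serves all morphisms [g] at once; this uniformity later bounds
    the ramification of covers. *)
Lemma finite_root (k : fieldType) (a : {rmorphism S -> k}) b :
  exists2 p : {poly k}, p != 0 & forall (E : fieldType) (i : {rmorphism k -> E})
    (g : {rmorphism C -> E}), g \o f =1 i \o a -> root (map_poly i p) (g b).
Proof.
have [N [_ [e [_ [gen _]]]]] := fpC.
have [c hc] : exists c : 'I_N -> 'I_N -> S, forall l, b * e l = \sum_j f (c l j) * e j.
  exists (fun l => projT1 (cid (gen (b * e l)))) => l.
  by case: (cid _).
pose A := \matrix_(l, j) a (c j l).
exists (char_poly A) => [|E i g ha]; first exact/monic_neq0/char_poly_monic.
have {}ha s : g (f s) = i (a s) by exact: ha.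
rewrite map_char_poly -eigenvalue_root_char.
apply/eigenvalueP; exists (\row_l g (e l)).
  apply/rowP => l; rewrite !mxE -rmorphM hc rmorph_sum; apply: eq_bigr => j _.
  by rewrite !mxE rmorphM ha mulrC.
apply/eqP => v0; have [d e1] := gen 1.
have := rmorph1 g; rewrite e1 rmorph_sum big1 => [/esym/eqP|l _].
  by rewrite oner_eq0.
have := congr1 (fun v : 'rV_N => v 0 l) v0; rewrite !mxE rmorphM => ->.
by rewrite mulr0.
Qed.

End ModuleFinite.

Hypothesis etC : finite_etale f.

(* The lowest term of the difference of two lifts of a point is a derivation at
   this point. *)
Lemma etale_rigid (g g' : {rmorphism C -> P}) :
  g \o f =1 g' \o f -> (forall s, lvl 0 (g (f s))) -> (forall s, pint (g (f s))) ->
  (forall b, pc (g b) 0 = pc (g' b) 0) -> g =1 g'.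
Proof.
move=> gf lS iS gr; have [fpC eC] := etC.
have gf' s : g' (f s) = g (f s) by rewrite [LHS](esym (gf s)).
have ig b : pint (g b) by exact: finite_pint.
have ig' b : pint (g' b) by apply: finite_pint => // s; rewrite gf'.
have [n lg] := finite_lvl fpC lS.
have [n' lg'] : exists n', forall b, lvl n' (g' b).
  by apply: finite_lvl => // s; rewrite gf'.
pose m := (n.+1 * n'.+1).-1.
have lm b : lvl m (g b - g' b).
  apply: lvlB; first exact: lvl_scale.
  by rewrite /m mulnC; exact: lvl_scale.
have im b : pint (g b - g' b) by exact: pintB.
apply: contrapT => ne.
have [b0 nb0] : exists b, g b != g' b.
  by apply: contrapT => h; apply: ne => b; apply/eqP; apply: contrapT => /negP nb;
    apply: h; exists b.
pose B i := `[< exists b, pc (g b - g' b) (pexp m 0 i) != 0 >].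
have exB : exists i, B i.
  have [h eh] := lvl_int_ps (lm b0) (im b0).
  have : h != 0.
    apply: contra_neq nb0 => h0; apply/eqP; rewrite -subr_eq0 eh h0.
    by rewrite rmorph0.
  move=> /ps_neq0P[i [hi _]]; exists i; apply/asboolP; exists b0.
  by rewrite eh pc_pser.
(* The least exponent at which [g] and [g'] differ on some element. *)
have := ex_minnP exB; move=> [i /asboolP[b1 nb1] imin].
set q := pexp m 0 i in nb1.
have dq b : pge q (g b - g' b).
  have [h eh] := lvl_int_ps (lm b) (im b); rewrite eh => x xq.
  apply: contrapT => /eqP/[dup]/plev_pser[l el]; rewrite el -eh => nl.
  have : (i <= l)%N by apply: imin; apply/asboolP; exists b.
  move: xq; rewrite el /q /pexp !subr0 ltr_pM2r ?invr_gt0 ?ltr0n // ltr_nat.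
  by rewrite ltnNge => /negP.
pose d b := pc (g b - g' b) q.
have dB : zmod_morphism d by move=> a b; rewrite /d !rmorphB !pcB; ring.
have dM a b : d (a * b) = pc (g a) 0 * d b + d a * pc (g b) 0.
  rewrite /d.
  have -> : g (a * b) - g' (a * b) = g a * (g b - g' b) + (g a - g' a) * g' b.
    by rewrite !rmorphM; ring.
  rewrite pcD; congr (_ + _).
    by rewrite -{1}(add0r q) (pc_lead (ig a) (dq b)) gr.
  by rewrite -{1}(addr0 q) (pc_lead (dq a) (ig' b)) gr.
have x1 : pc (g 1) 0 = 1 by rewrite rmorph1 res1.
have d1 : d 1 = 0 by rewrite /d !rmorph1 subrr pc0.
have hz : zmod_morphism (fun b => Dual (pc (g b) 0) (d b)).
  by move=> a b; apply: dualP; rewrite /= ?dB // rmorphB pcB.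
have hm : monoid_morphism (fun b => Dual (pc (g b) 0) (d b)).
  split; first by rewrite x1 d1.
  by move=> a b; apply: dualP; rewrite /= ?dM // rmorphM res_mul.
have h0z : zmod_morphism (fun b => Dual (pc (g b) 0) 0).
  by move=> a b; apply: dualP; rewrite /= ?subr0 // rmorphB pcB.
have h0m : monoid_morphism (fun b => Dual (pc (g b) 0) 0).
  split; first by rewrite x1.
  by move=> a b; apply: dualP; rewrite /= ?mulr0 ?mul0r ?addr0 // rmorphM res_mul.
pose h := mkrm hz hm; pose h0 := mkrm h0z h0m.
have surj (u : K) : exists t, @dre K t = u by exists (Dual u 0).
(* [h] and [h0] lift the same residue map to the dual numbers and agree on [S]; uniqueness of the
   lift makes [d] vanish. *)
have comm : @dre K \o (h0 \o f) =1 (@dre K \o h0) \o f by [].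
have [k [_ _ uniq]] := eC _ _ _ surj (@dre_square0 K) _ _ comm.
have e1 : h =1 k.
  apply: uniq => //= s; apply: dualP => //=.
  by rewrite /d gf' subrr pc0.
have e2 : h0 =1 k by exact: uniq.
case/eqP: nb1; rewrite -/(d b1).
by have /(congr1 (@deps K)) := etrans (e1 b1) (esym (e2 b1)).
Qed.

End EtaleIntoPuiseux.

(** * Monodromy of Puiseux series over K((t)) *)

Section PuiseuxAutomorphisms.
Variable K : closedFieldType.
Hypothesis charK : [pchar K] =i pred0.
Local Notation P := (puiseux K).

Definition pfix (r : {rmorphism P -> P}) := r \o @lau K 0 =1 @lau K 0.

Lemma pfix_lvl r a : pfix r -> lvl 0 a -> r a = a.
Proof. by move=> fr [x ->]; exact: fr. Qed.

Lemma pser_split n (f : pseries K) : pser n f = \sum_(i < n.+1)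
  pser 0 (PSeries (fun k => coefps f (i + k * n.+1))) * pmono (n.+1%:R^-1) 1 ^+ i.
Proof.
apply: puiseuxP => q; rewrite pc_sum.
have tE (i : nat) x : pc (pser 0 (PSeries (fun k => coefps f (i + k * n.+1)))
    * pmono (n.+1%:R^-1) 1 ^+ i) x =
    pc (pser 0 (PSeries (fun k => coefps f (i + k * n.+1)))) (x - i%:R / n.+1%:R).
  by rewrite mulrC pmono_exp expr1n pcZ mul1r -[_ *+ i]mulr_natl.
have n0 : n.+1%:R != 0 :> rat by rewrite pnatr_eq0.
have [[l el]|nl] := pselect (exists l, q = pexp n 0 l); last first.
  rewrite big1 => [|i _]; first by apply: contrapT => /eqP/plev_pser.
  rewrite tE; apply: contrapT => /eqP/plev_pser[k ek]; apply: nl.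
  exists (i + k * n.+1)%N; move/eqP: ek; rewrite subr_eq => /eqP ->.
  by rewrite /pexp !subr0 divr1 natrD natrM mulrDl mulfK // addrC.
have lm : (l %% n.+1 < n.+1)%N by rewrite ltn_mod.
rewrite el pc_pser (bigD1 (Ordinal lm)) //= big1 => [|i].
  rewrite tE /= addr0.
  have -> : pexp n 0 l - (l %% n.+1)%:R / n.+1%:R = pexp 0 0 (l %/ n.+1).
    rewrite /pexp !subr0 divr1 {1}(divn_eq l n.+1) natrD natrM -mulrBl addrK.
    by rewrite mulfK.
  by rewrite pc_pser /= addnC -divn_eq.
rewrite -val_eqE /= => il; rewrite tE; apply: contrapT => /eqP/plev_pser[k ek].
move/eqP: ek; rewrite subr_eq /pexp !subr0 divr1 -[k%:R](mulfK n0) -mulrDl.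
rewrite (inj_eq (mulIf _)) ?invr_eq0 // -natrM -natrD eqr_nat => /eqP ek.
by case/eqP: il; rewrite ek modnMDl modn_small.
Qed.

Lemma puiseux_algebraic (a : P) : algebraicOver (@lau K 0) a.
Proof.
have root_alg n : algebraicOver (@lau K 0) (pmono (n.+1%:R^-1) 1).
  exists ('X^(n.+1) - (FracField.tofrac (psX K))%:P).
    by rewrite -size_poly_gt0 size_XnsubC.
  rewrite rmorphB /= map_polyXn map_polyC /= lau_ps rootE !hornerE.
  rewrite pmono_exp expr1n -/(pX K) pXE -[_ *+ n.+1]mulr_natl mulfV ?subrr //.
  by rewrite pnatr_eq0.
have lvl_alg b : lvl 0 b -> algebraicOver (@lau K 0) b.
  by move=> [x ->]; exact: algebraic_id.
have [n la] := lvl_ex a; have [N pl] := lvl_plev la.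
pose m := pmono (N%:R / n.+1%:R) (1 : K).
have m0 : m != 0 by apply/eqP => /(congr1 (fun b : P => pc b (N%:R / n.+1%:R)))/eqP;
  rewrite pc_mono eqxx pc0 oner_eq0.
have -> : a = m^-1 * (m * a) by rewrite mulKf.
have algX b k : algebraicOver (@lau K 0) b -> algebraicOver (@lau K 0) (b ^+ k).
  by move=> hb; elim: k => [|k IH]; rewrite ?expr0 ?exprS;
    [exact: algebraic1|exact: algebraic_mul].
have mE : m = pmono (n.+1%:R^-1) 1 ^+ N by rewrite pmono_exp expr1n -[_ *+ N]mulr_natl.
apply: algebraic_mul; first by apply: algebraic_inv; rewrite mE; exact: algX.
have /pser_psq <- : plev n 0 (pc (m * a)).
  move=> q; rewrite pcZ mul1r => /pl[i ei]; exists i.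
  by move/eqP: ei; rewrite subr_eq => /eqP ->; rewrite /pexp mulrBl subrK subr0.
rewrite pser_split; apply: (big_ind (algebraicOver (@lau K 0))).
- exact: algebraic0.
- by move=> x y; exact: algebraic_add.
- by move=> i _; apply: algebraic_mul; [apply/lvl_alg/lvl_ps|exact: algX].
Qed.

(** A morphism over K((t)) sends t^(1/(n+1)) to another root of t, which has positive order too. So
    integral series stay integral and keep their residues. *)
Lemma pfix_res r a : pfix r -> pint a -> pint (r a) /\ pc (r a) 0 = pc a 0.
Proof.
move=> fr ia; have [n la] := lvl_ex a; have [f ->] := lvl_int_ps la ia.
set s := pmono (n.+1%:R^-1) (1 : K).
have n0 : n.+1%:R != 0 :> rat by rewrite pnatr_eq0.
have sX : s ^+ n.+1 = pX K.
  by rewrite pmono_exp expr1n pXE -[_ *+ n.+1]mulr_natl mulfV.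
have rX : r s ^+ n.+1 = pX K by rewrite -rmorphXn sX; apply: pfix_lvl fr (lvl_X K).
have rs0 : r s != 0.
  by apply/eqP => e; have := pX_neq0 K; rewrite -rX e expr0n eqxx.
have [sq qs] := pordP rs0; set q := pord _ in sq qs.
have pow k : pc (r s ^+ k) (q *+ k) = pc (r s) q ^+ k.
  elim: k => [|k IH]; first by rewrite mulr0n !expr0 res1.
  by rewrite mulrS !exprS pc_lead ?IH //; exact: pgeX_nat.
have q0 : 0 < q.
  have := pow n.+1; rewrite rX pXE pc_mono; case: eqP => [|_ /esym/eqP].
    by rewrite -mulr_natl => e _; rewrite -(pmulr_rgt0 _ (_ : 0 < n.+1%:R)) ?ltr0n // e.
  by rewrite expf_eq0 (negPf sq).
have is_ : pint (r s) by apply: pge_le qs; exact: ltW.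
have rs_res : pc (r s) 0 = 0 by exact: qs.
have s_int : pint s.
  move=> x x0; rewrite pc_mono; case: eqP => // xe; move: x0.
  by rewrite xe invr_lt0 ltrn0.
have s_res : pc s 0 = 0.
  by rewrite pc_mono eq_sym invr_eq0 (negPf n0).
rewrite pser_split rmorph_sum !pc_sum; split.
  apply: pge_sum => i _; rewrite rmorphM rmorphXn; apply: pintM; last exact: pintX.
  rewrite (pfix_lvl fr (lvl_ps _ _)).
  move=> x x0; apply: contrapT => /eqP/plev_pser[k ek]; move: x0.
  by rewrite ek /pexp subr0 divr1 ltrn0.
apply: eq_bigr => i _; rewrite rmorphM rmorphXn (pfix_lvl fr (lvl_ps _ _)).
have ip (g : pseries K) : pint (pser 0 g).
  move=> x x0; apply: contrapT => /eqP/plev_pser[k ek]; move: x0.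
  by rewrite ek /pexp subr0 divr1 ltrn0.
by rewrite !res_mul ?resX ?rs_res ?s_res //; exact: pintX.
Qed.

Lemma charP : [pchar P] =i pred0.
Proof. by move=> l; rewrite (fmorph_pchar (@pcst K)); exact: charK. Qed.

Lemma pfix_fixed a : (forall r, pfix r -> r a = a) -> lvl 0 a.
Proof.
move=> h; have [||x ->] := @fixed_in P (puiseux_closed charK) charP _ (@lau K 0) a.
- exact: puiseux_algebraic.
- by move=> r; exact: h.
by exists x.
Qed.

(** Composition with a morphism over K((t)) does not change residues, so by rigidity it does not
    change the point; and what all these morphisms fix lies in K((t)). *)
Lemma etale_unramified (S C : comPzRingType) (f : {rmorphism S -> C})
  (g : {rmorphism C -> P}) b : finite_etale f ->
  (forall s, lvl 0 (g (f s))) -> (forall s, pint (g (f s))) -> lvl 0 (g b).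
Proof.
move=> et lS iS; apply: pfix_fixed => r fr; apply/esym.
have ig c : pint (g c) by apply: finite_pint et.1 _ _ _.
suff e : g =1 r \o g by exact: e.
apply: (@etale_rigid K S C f et g (r \o g)) => //= [s|c].
  by rewrite /= (pfix_lvl fr).
by have [_ ->] := pfix_res fr (ig c).
Qed.

End PuiseuxAutomorphisms.

(* A trace form for which [x] and [y] are dual bases, normalised by
   [\sum x k * y k = 1], makes [\sum x k (x) y k] a separability idempotent. *)
Section TraceForm.
Variables (R B : comPzRingType) (f : {rmorphism R -> B}).
Variables (tr : B -> R) (n : nat) (x y : 'I_n -> B).
Hypothesis trB : zmod_morphism tr.
Hypothesis trZ : forall r b, tr (f r * b) = r * tr b.
Hypothesis dual1 : forall b, b = \sum_k f (tr (y k * b)) * x k.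
Hypothesis dual2 : forall b, b = \sum_k f (tr (x k * b)) * y k.
Hypothesis unit_xy : \sum_k x k * y k = 1.

Let tr0 : tr 0 = 0. Proof. by rewrite -(subrr 0) trB subrr. Qed.
Let trD a b : tr (a + b) = tr a + tr b.
Proof.
have N c : tr (- c) = - tr c by rewrite -sub0r trB tr0 sub0r.
by rewrite -[b in LHS]opprK trB N opprK.
Qed.
Let tr_sum (I : Type) (s : seq I) (F : I -> B) :
  tr (\sum_(i <- s) F i) = \sum_(i <- s) tr (F i).
Proof. exact: (big_morph _ trD tr0). Qed.

Section Bilinear.
Variables (M : comPzRingType) (g : R -> M) (psi : B -> B -> M).
Hypothesis psiDl : forall a a' b, psi (a + a') b = psi a b + psi a' b.
Hypothesis psiDr : forall a b b', psi a (b + b') = psi a b + psi a b'.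
Hypothesis psiZl : forall r a b, psi (f r * a) b = g r * psi a b.
Hypothesis psiZr : forall r a b, psi a (f r * b) = g r * psi a b.

(** The identity b e = e b for e = sum x_k (x) y_k, evaluated under a bilinear [psi], so that no
    tensor product has to be formed. *)
Lemma separable_comm b : \sum_k psi (b * x k) (y k) = \sum_k psi (x k) (y k * b).
Proof.
have psi0l c : psi 0 c = 0.
  by apply: (addIr (psi 0 c)); rewrite -psiDl !add0r.
have psi0r c : psi c 0 = 0.
  by apply: (addIr (psi c 0)); rewrite -psiDr !add0r.
have suml I (s : seq I) (F : I -> B) c :
    psi (\sum_(i <- s) F i) c = \sum_(i <- s) psi (F i) c.
  exact: (big_morph (psi^~ c) (fun a a' => psiDl a a' c) (psi0l c)).
have sumr I (s : seq I) (F : I -> B) c :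
    psi c (\sum_(i <- s) F i) = \sum_(i <- s) psi c (F i).
  exact: (big_morph (psi c) (psiDr c) (psi0r c)).
transitivity (\sum_l \sum_k g (tr (x l * (y k * b))) * psi (x k) (y l)).
  apply: eq_bigr => l _; rewrite {1}(dual1 (b * x l)) suml.
  apply: eq_bigr => k _; rewrite psiZl; congr (g (tr _) * _).
  by ring.
rewrite exchange_big; apply: eq_bigr => k _ /=.
rewrite [in RHS](dual2 (y k * b)) sumr; apply: eq_bigr => l _.
by rewrite psiZr.
Qed.

End Bilinear.

(** The dual bases present [B] as a direct summand of a free module; 1 minus the projector generates
    the relations. *)
Lemma trace_finitely_presented : module_finitely_presented f.
Proof.
exists n, n, x, (fun j i => (i == j)%:R - tr (y i * x j)); split.
  by move=> b; exists (fun k => tr (y k * b)).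
have pr j : \sum_i f ((i == j)%:R - tr (y i * x j)) * x i = 0.
  transitivity (\sum_i (f (i == j)%:R * x i - f (tr (y i * x j)) * x i)).
    by apply: eq_bigr => i _; rewrite rmorphB mulrBl.
  rewrite sumrB -dual1 (bigD1 j) //= eqxx rmorph1 mul1r big1 ?addr0 ?subrr //.
  by move=> i /negPf ->; rewrite rmorph0 mul0r.
move=> c; split=> [c0|[b eb]].
  exists c => i; transitivity (\sum_j (c j * (i == j)%:R - tr (y i * (f (c j) * x j)))).
    rewrite sumrB -tr_sum -mulr_sumr c0 mulr0 tr0 subr0 (bigD1 i) //=.
    rewrite eqxx mulr1 big1 ?addr0 // => j ji; rewrite eq_sym (negPf ji) mulr0 //.
  by apply: eq_bigr => j _; rewrite mulrCA trZ mulrBr.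
transitivity (\sum_j f (b j) * \sum_i f ((i == j)%:R - tr (y i * x j)) * x i).
  under [RHS]eq_bigr do rewrite mulr_sumr.
  rewrite exchange_big; apply: eq_bigr => i _.
  by rewrite eb rmorph_sum mulr_suml; apply: eq_bigr => j _; rewrite rmorphM mulrA.
by rewrite big1 // => j _; rewrite pr mulr0.
Qed.

(** Existence: lift the module first, by [phi]. Its failure [om] to be multiplicative is a
    Hochschild 2-cocycle with values in the square-zero ideal; contraction with the separability
    idempotent makes it the coboundary of [eta], and phi - eta is multiplicative. Uniqueness: two
    lifts differ by a derivation, which vanishes by [separable_comm]. *)
Lemma trace_formally_etale : formally_etale f.
Proof.
move=> T U q qs qn g u qg.
have q_lift v : exists t, q t = u v by exact: qs.
pose t k := projT1 (cid (q_lift (x k))).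
have qt k : q (t k) = u (x k) by rewrite /t; case: (cid _).
pose phi b := \sum_k g (tr (y k * b)) * t k.
have phiD a b : phi (a + b) = phi a + phi b.
  rewrite /phi -big_split; apply: eq_bigr => k _ /=.
  by rewrite mulrDr trD rmorphD mulrDl.
have phiZ r b : phi (f r * b) = g r * phi b.
  rewrite /phi mulr_sumr; apply: eq_bigr => k _.
  by rewrite mulrCA trZ rmorphM mulrA.
have qphi b : q (phi b) = u b.
  rewrite rmorph_sum {2}(dual1 b) rmorph_sum; apply: eq_bigr => k _.
  by rewrite !rmorphM qt -[u (f _)]/((u \o f) _) -qg.
have qnl a b i : q a = q b -> q i = 0 -> a * i = b * i.
  move=> ab qi; apply/eqP; rewrite -subr_eq0 -mulrBl; apply/eqP/qn => //.
  by rewrite rmorphB ab subrr.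
pose om a b := phi a * phi b - phi (a * b).
have qom a b : q (om a b) = 0 by rewrite rmorphB !rmorphM !qphi rmorphM subrr.
have cocycle a b c :
    phi a * om b c - om (a * b) c + om a (b * c) - om a b * phi c = 0.
  by rewrite /om !mulrA; ring.
pose eta a := \sum_k phi (x k) * om (y k) a.
have qeta a : q (eta a) = 0.
  by rewrite rmorph_sum big1 // => k _; rewrite rmorphM qom mulr0.
(* Multiply the cocycle identity for (y k, a, b) by phi (x k) and sum over k. *)
have key a b : om a b = phi a * eta b - eta (a * b) + eta a * phi b.
  have h1 : \sum_k phi (x k) * (phi (y k) * om a b) = om a b.
    rewrite -[RHS]mul1r.
    transitivity ((\sum_k phi (x k) * phi (y k)) * om a b).
      by rewrite mulr_suml; apply: eq_bigr => k _; rewrite mulrA.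
    apply: qnl => //; rewrite rmorph1 -(rmorph1 u) -unit_xy !rmorph_sum.
    by apply: eq_bigr => k _; rewrite !rmorphM !qphi.
  have h2 : \sum_k phi (x k) * om (y k * a) b = phi a * eta b.
    rewrite -(@separable_comm T g (fun v w => phi v * om w b)).
    - rewrite mulr_sumr; apply: eq_bigr => k _; rewrite mulrA.
      by apply: qnl => //; rewrite rmorphM !qphi rmorphM.
    - by move=> *; rewrite phiD mulrDl.
    - by move=> *; rewrite /om mulrDl !phiD; ring.
    - by move=> *; rewrite phiZ mulrA.
    - by move=> *; rewrite /om -mulrA !phiZ; ring.
  have h3 : \sum_k phi (x k) * om (y k) (a * b) = eta (a * b) by [].
  have h4 : \sum_k phi (x k) * (om (y k) a * phi b) = eta a * phi b.
    by rewrite /eta mulr_suml; apply: eq_bigr => k _; rewrite mulrA.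
  have e : om a b - phi a * eta b + eta (a * b) - eta a * phi b = 0.
    rewrite -h1 -h2 -h3 -h4 -sumrB -big_split -sumrB big1 //= => k _.
    by rewrite -(mulr0 (phi (x k))) -(cocycle (y k) a b); ring.
  by rewrite -[LHS]subr0 -e; ring.
pose h a := phi a - eta a.
have qh a : q (h a) = u a by rewrite rmorphB qphi qeta subr0.
have hM a b : h (a * b) = h a * h b.
  have -> : h a * h b = phi a * phi b - phi a * eta b - eta a * phi b + eta a * eta b.
    by rewrite /h; ring.
  have -> : eta a * eta b = 0 by exact: qn.
  have := key a b; rewrite {1}/om => e; rewrite /h.
  by rewrite -[phi a * phi b](subrK (phi (a * b))) e; ring.
have etaD a b : eta (a + b) = eta a + eta b.
  rewrite /eta -big_split; apply: eq_bigr => k _ /=.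
  by rewrite /om (mulrDr (y k)) !phiD; ring.
have hB : zmod_morphism h.
  have hD a b : h (a + b) = h a + h b by rewrite /h phiD etaD; ring.
  by move=> a b; apply/eqP; rewrite eq_sym subr_eq -hD subrK.
have h1 : h 1 = 1.
  have e : h 1 * h 1 = h 1 by rewrite -hM mulr1.
  have z : (1 - h 1) * (1 - h 1) = 0 by apply: qn; rewrite rmorphB rmorph1 qh rmorph1 subrr.
  apply/eqP; rewrite eq_sym -subr_eq0 -z; apply/eqP.
  have -> : (1 - h 1) * (1 - h 1) = 1 - h 1 - h 1 + h 1 * h 1 by ring.
  by rewrite e; ring.
pose hr := mkrm hB (conj h1 hM : monoid_morphism h).
have uniq (k k' : {rmorphism B -> T}) : k \o f =1 k' \o f ->
    q \o k =1 u -> q \o k' =1 u -> k' =1 k.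
  move=> kf qk qk' b.
  have kf' r : k' (f r) = k (f r) by rewrite [RHS](kf r).
  have qd c : q (k' c - k c) = 0.
    by rewrite rmorphB -[q (k' c)]/((q \o k') c) -[q (k c)]/((q \o k) c) qk qk' subrr.
  pose D c := k' c - k c.
  have DM a c : D (a * c) = k a * D c + D a * k c.
    rewrite /D !rmorphM; apply/eqP; rewrite -subr_eq0 -(qn _ _ (qd a) (qd c)).
    by apply/eqP; ring.
  have e : \sum_l k (b * x l) * D (y l) = \sum_l k (x l) * D (y l * b).
    apply: (@separable_comm T (k \o f) (fun v w => k v * D w)).
    - by move=> *; rewrite rmorphD mulrDl.
    - by move=> *; rewrite /D !rmorphD; ring.
    - by move=> *; rewrite rmorphM mulrA.
    - by move=> *; rewrite /D !rmorphM kf' /=; ring.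
  apply/eqP; rewrite -subr_eq0 -/(D b); apply/eqP.
  have -> : D b = (\sum_l k (x l * y l)) * D b.
    by rewrite -rmorph_sum unit_xy rmorph1 mul1r.
  have : \sum_l k (x l) * D (y l * b) =
      (\sum_l k (x l * y l)) * D b + \sum_l k (b * x l) * D (y l).
    by rewrite mulr_suml -big_split; apply: eq_bigr => l _ /=; rewrite DM !rmorphM; ring.
  rewrite -e => h'; apply: (addIr (\sum_l k (b * x l) * D (y l))).
  by rewrite add0r -h'.
have hrf : hr \o f =1 g.
  move=> r /=; rewrite /h.
  have ph : phi (f r) = g r * phi 1 by rewrite -phiZ mulr1.
  have -> : eta (f r) = g r * eta 1.
    rewrite /eta mulr_sumr; apply: eq_bigr => k _.
    by rewrite /om -{2}[f r]mulr1 mulrCA !phiZ ph mulr1; ring.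
  by rewrite ph -mulrBr -/(h 1) h1 mulr1.
exists hr; split=> // h' h'f qh'; apply: uniq => // r.
by rewrite hrf h'f.
Qed.

Lemma trace_finite_etale : finite_etale f.
Proof. by split; [exact: trace_finitely_presented|exact: trace_formally_etale]. Qed.

(** A trace on [D] compatible with that of [B] gives every element of [D] coordinates in [T] with
    respect to the images of the x k. The map out of the pushout is defined by these coordinates. *)
Lemma trace_pushout (T D : comPzRingType) (g : {rmorphism R -> T})
    (u : {rmorphism B -> D}) (v : {rmorphism T -> D}) (trD' : D -> T) :
  u \o f =1 v \o g -> zmod_morphism trD' ->
  (forall t d, trD' (v t * d) = t * trD' d) ->
  (forall b, trD' (u b) = g (tr b)) ->
  (forall d, d = \sum_k u (x k) * v (trD' (u (y k) * d))) ->
  is_pushout f g u v.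
Proof.
move=> uv tB tZ tu dd; split=> // X a b ab.
have t0 : trD' 0 = 0 by rewrite -(subrr 0) tB subrr.
pose h d := \sum_k a (x k) * b (trD' (u (y k) * d)).
have hB : zmod_morphism h.
  move=> c d; rewrite /h -sumrB; apply: eq_bigr => k _.
  by rewrite mulrBr tB rmorphB mulrBr.
have hp c t : h (u c * v t) = a c * b t.
  rewrite /h {2}(dual1 c) rmorph_sum mulr_suml; apply: eq_bigr => k _.
  have -> : u (y k) * (u c * v t) = v t * u (y k * c) by rewrite rmorphM; ring.
  by rewrite tZ tu rmorphM -[b (g _)]/((b \o g) _) -ab rmorphM /=; ring.
have h0 : h 0 = 0 by rewrite -(subrr 0) hB subrr.
have hD c d : h (c + d) = h c + h d.
  have N e : h (- e) = - h e by rewrite -sub0r hB h0 sub0r.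
  by rewrite -[d in LHS]opprK hB N opprK.
have hsum (I : finType) (F : I -> D) : h (\sum_i F i) = \sum_i h (F i).
  exact: (big_morph _ hD h0).
have hu c : h (u c) = a c by rewrite -[u c]mulr1 -(rmorph1 v) hp rmorph1 mulr1.
have hv t : h (v t) = b t by rewrite -[v t]mul1r -(rmorph1 u) hp rmorph1 mul1r.
have hM c d : h (c * d) = h c * h d.
  rewrite {1}(dd c) {1}(dd d) mulr_suml hsum {2}(dd c) hsum mulr_suml.
  apply: eq_bigr => k _; rewrite mulr_sumr hsum {2}(dd d) hsum mulr_sumr.
  apply: eq_bigr => l _; rewrite mulrACA -!rmorphM !hp !rmorphM.
  by rewrite mulrACA.
pose hr := mkrm hB (conj (etrans (congr1 h (esym (rmorph1 u))) (etrans (hu 1) (rmorph1 a))) hM : monoid_morphism h).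
exists hr; split=> // h' h'u h'v d.
rewrite {1}(dd d) rmorph_sum /= /h; apply: eq_bigr => k _.
by rewrite rmorphM -(h'u (x k)) -(h'v (trD' _)).
Qed.

End TraceForm.

(** * Covers and their tangential fibers *)

Section AlgebraicElements.
Variables (k E : fieldType) (i : {rmorphism k -> E}).

Definition acl_pred : {pred E} := fun x => `[< algebraicOver i x >].

Lemma acl_mem x : algebraicOver i x -> x \in acl_pred.
Proof. by move=> ax; apply/asboolP. Qed.

Lemma acl_divring : divring_closed acl_pred.
Proof.
split=> [|x y /asboolP ax /asboolP ay|x y /asboolP ax /asboolP ay]; apply/asboolP.
- exact: algebraic1.
- exact: algebraic_sub.
- exact: algebraic_div.
Qed.

HB.instance Definition _ := GRing.isDivringClosed.Build E acl_pred acl_divring.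

(** The relative algebraic closure of [k] in [E]. Inside the Puiseux series, over the rational
    functions of a nonconstant series, it is a field of algebraic functions. *)
Record acl := Acl { acl_val; _ : acl_val \in acl_pred }.
HB.instance Definition _ := [isSub for acl_val].
HB.instance Definition _ := [Choice of acl by <:].
HB.instance Definition _ := [SubChoice_isSubIntegralDomain of acl by <:].
HB.instance Definition _ := [SubIntegralDomain_isSubField of acl by <:].

Lemma acl_ex x : algebraicOver i x -> exists a : acl, val a = x.
Proof. by move=> ax; exists (Acl (acl_mem ax)). Qed.

Lemma acl_lift (C : comPzRingType) (g : {rmorphism C -> E}) :
  (forall c, algebraicOver i (g c)) ->
  exists g' : {rmorphism C -> acl}, forall c, val (g' c) = g c.
Proof.
move=> ag; pose g' c := Acl (acl_mem (ag c)).
have gz : zmod_morphism g' by move=> a b; apply: val_inj; rewrite /= rmorphB.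
have gm : monoid_morphism g'.
  by split=> [|a b]; apply: val_inj; rewrite /= ?rmorph1 ?rmorphM.
by exists (mkrm gz gm).
Qed.

Lemma acl_closed : GRing.closed_field_axiom E -> GRing.closed_field_axiom acl.
Proof.
move=> clE n P n0; have [x ex] := clE n (fun i => val (P i)) n0.
have ax : algebraicOver i x.
  pose p := 'X^n - \poly_(j < n) val (P j).
  have pm : p \is monic.
    rewrite monicE lead_coefDl ?lead_coefXn // size_polyN size_polyXn ltnS.
    exact: size_poly.
  apply/integral_algebraic; apply: (@integral_root _ _ i p); rewrite ?monic_neq0 //.
    rewrite rootE !hornerE horner_poly ex subr_eq0; apply/eqP.
    by apply: eq_bigr.
  move=> c /(nthP 0)[l lp <-]; rewrite coefB coefXn coef_poly.
  apply: integral_sub; first by case: eqP => _; [exact: integral1|exact: integral0].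
  case: ifP => _; last exact: integral0.
  by apply/integral_algebraic; case: (P l) => ? /= /asboolP.
have [a ea] := acl_ex ax; exists a; apply: val_inj.
rewrite rmorphXn rmorph_sum /= ea ex; apply: eq_bigr => j _.
by rewrite -ea -[acl_val (a ^+ j)]/(val (a ^+ j)) rmorphXn.
Qed.

End AlgebraicElements.

Section AlgebraicFunctions.
Variables (K : closedFieldType) (E : fieldType) (kap : {rmorphism K -> E}).
Variables (y : E) (ny : nonconst kap y).
Local Notation A := (acl (ratev ny)).

Lemma acl_cst_subproof c : kap c \in acl_pred (ratev ny).
Proof.
apply/asboolP; rewrite -(pevC kap y) -(ratev_poly ny); exact: algebraic_id.
Qed.
Lemma acl_gen_subproof : y \in acl_pred (ratev ny).
Proof.
apply/asboolP; rewrite -[X in algebraicOver _ X](pevX kap y) -(ratev_poly ny).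
exact: algebraic_id.
Qed.

Definition acl_cst (c : K) : A := Acl (acl_cst_subproof c).
Definition acl_gen : A := Acl acl_gen_subproof.

Lemma acl_cst_is_zmod : zmod_morphism acl_cst.
Proof. by move=> a b; apply: val_inj; rewrite /= rmorphB. Qed.
Lemma acl_cst_is_monoid : monoid_morphism acl_cst.
Proof. by split=> [|a b]; apply: val_inj; rewrite /= ?rmorph1 ?rmorphM. Qed.
HB.instance Definition _ :=
  GRing.isZmodMorphism.Build K A acl_cst acl_cst_is_zmod.
HB.instance Definition _ :=
  GRing.isMonoidMorphism.Build K A acl_cst acl_cst_is_monoid.

Lemma acl_nonconst : nonconst acl_cst acl_gen.
Proof. by move=> c /(congr1 val) /= /ny. Qed.

Lemma acl_ratev : val \o ratev acl_nonconst =1 ratev ny.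
Proof. exact: (@ratev_comp K A E acl_cst kap val). Qed.

Lemma acl_pev p : val (pev acl_cst acl_gen p) = pev kap y p.
Proof.
rewrite -(ratev_poly acl_nonconst).
exact: etrans (acl_ratev _) (ratev_poly ny p).
Qed.

Lemma acl_algebraic (u : A) : algebraicOver (ratev acl_nonconst) u.
Proof.
have /asboolP[p p0 pu] := valP u; exists p => //.
rewrite -(fmorph_root (val : {rmorphism A -> E})) -map_poly_comp.
by rewrite (eq_map_poly acl_ratev).
Qed.

End AlgebraicFunctions.

Section Localizations.
Variables (K : closedFieldType) (f : {poly K}).

Lemma loc_ext (E : fieldType) (g g' : {rmorphism locring f -> E}) : f != 0 ->
  (forall c, g (loc_poly f c%:P) = g' (loc_poly f c%:P)) ->
  g (loc_poly f 'X) = g' (loc_poly f 'X) -> g =1 g'.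
Proof.
move=> f0 gc gX.
have lM p q : loc_poly f (p * q) = loc_poly f p * loc_poly f q.
  by apply: val_inj; rewrite /= tofracM.
have lD p q : loc_poly f (p + q) = loc_poly f p + loc_poly f q.
  by apply: val_inj; rewrite /= tofracD.
have gp p : g (loc_poly f p) = g' (loc_poly f p).
  elim/poly_ind: p => [|p c IH]; first by rewrite -[0]/(0%:P).
  by rewrite lD lM !(rmorphD, rmorphM) /= gc gX IH.
move=> a; have /asboolP[n [p e]] := valP a.
have ea : a * loc_poly f f ^+ n = loc_poly f p.
  by apply: val_inj; rewrite rmorphM rmorphXn.
have fV : loc_poly f 1 = 1 by apply: val_inj; rewrite /= tofrac1.
have g0 : g (loc_poly f f) != 0.
  have iP : (FracField.tofrac f)^-1 \in loc_pred f.
    by apply/asboolP; exists 1%N, 1; rewrite expr1 mulVf ?tofrac1 ?tofrac_eq0.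
  apply/eqP => g0; have := oner_neq0 E; rewrite -(rmorph1 g) -fV.
  have -> : loc_poly f 1 = loc_poly f f * LocRing iP.
    by apply: val_inj; rewrite /= tofrac1 mulfV ?tofrac_eq0.
  by rewrite rmorphM /= g0 mul0r eqxx.
apply: (mulIf (expf_neq0 n g0)); rewrite {2}gp -!rmorphXn -!rmorphM ea.
exact: gp.
Qed.

Lemma pint_loc (Y : puiseux K) (nY : nonconst (@pcst K) Y) x : x \in loc_pred f ->
  pint Y -> f.[pc Y 0] != 0 -> pint (ratev nY x).
Proof.
move=> /asboolP[n [p e]] iY fY; have [ip rp] := pint_pev f iY.
have e' : ratev nY x * pev (@pcst K) Y f ^+ n = pev (@pcst K) Y p.
  by rewrite -!(ratev_poly nY) -e rmorphM rmorphXn.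
have f0 : pev (@pcst K) Y f != 0 by apply: contraNneq fY => f0; rewrite -rp f0 pc0.
rewrite -[ratev nY x](mulfK (expf_neq0 n f0)) e' -exprVn; apply: pintM.
  by have [] := pint_pev p iY.
by apply: pintX; have := pint_unit ip; rewrite rp => /(_ fY).
Qed.

Lemma nc_nonunit z : ps_nonunit z -> nonconst (@pcst K) (pser 0 z).
Proof.
move=> [z0 zn]; have rz : pc (pser 0 z) 0 = 0.
  by have := @pc_pser K 0 z 0; rewrite /pexp subr0 mul0r z0.
apply: (@nonconst_int K _ 0) => //.
  move=> q q0; apply: contrapT => /eqP/plev_pser[i ei]; move: q0.
  by rewrite ei /pexp subr0 divr1 ltrn0.
rewrite rmorph0; apply/eqP => z1; apply: zn; apply: (@pser_inj K 0).
by rewrite z1 rmorph0.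
Qed.

Lemma expand_ratev z (zP : ps_nonunit z) (nz : nonconst (@pcst K) (pser 0 z))
  (x : locring f) : @lau K 0 (expand zP x) = ratev nz (val x).
Proof.
rewrite /expand /=; move: (val x) => {}x.
apply: (@frac_morph_ext _ _ (@lau K 0 \o frac_map (ps_subst_inj zP)) (ratev nz)) => p.
rewrite /= frac_map_tofrac ratev_poly lau_ps.
elim/poly_ind: p => [|p c IH]; first by rewrite !rmorph0.
by rewrite !(rmorphD, rmorphM) /= IH ps_substX ps_substC pevX pevC.
Qed.

End Localizations.

(** * Covers of the torus and their fibers at t = 1 *)

Section TorusCovers.
Variable K : closedFieldType.
Hypothesis charK : [pchar K] =i pred0.
Local Notation P := (puiseux K).
Local Notation pcst := (@pcst K).

Definition tval : {rmorphism Gm K -> {fraction {poly K}}} := val.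
(** Expansion at the origin. The points of torus covers with values in [P] are taken over this
    embedding. *)
Definition tstd : {rmorphism Gm K -> P} := ratev (@ncpX K) \o tval.

Lemma tstdE a : tstd a = @lau K 0 (expand (psX_nonunit K) a).
Proof. by rewrite (expand_ratev (psX_nonunit K) (@ncpX K)). Qed.

Lemma tstd_cst c : tstd (loc_poly _ c%:P) = pcst c.
Proof. by rewrite /tstd /= ratev_poly pevC. Qed.
Lemma tstd_X : tstd (loc_poly _ 'X) = pX K.
Proof. by rewrite /tstd /= ratev_poly pevX. Qed.

Definition tpow n : P := pmono (n.+1%:R^-1) 1.

Lemma tpowX n : tpow n ^+ n.+1 = pX K.
Proof. by rewrite pmono_exp expr1n pXE -[_ *+ n.+1]mulr_natl mulfV ?pnatr_eq0. Qed.

Lemma tpow_res n : pc (tpow n) 0 = 0.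
Proof. by rewrite pc_mono eq_sym invr_eq0 pnatr_eq0. Qed.

Lemma tpow_neq0 n : tpow n != 0.
Proof.
apply/eqP => e; have := tpowX n; rewrite e expr0n /= => /esym/eqP.
by rewrite (negPf (pX_neq0 K)).
Qed.

Lemma tpow_nc n : nonconst pcst (tpow n).
Proof.
apply: (@nonconst_int K _ 0); rewrite ?tpow_res //; last by rewrite rmorph0 tpow_neq0.
move=> q q0; rewrite pc_mono; case: eqP => // e; move: q0.
by rewrite e invr_lt0 ltrn0.
Qed.

Lemma ev1_tpow n u k p : u * tpow n ^+ k = pev pcst (tpow n) p ->
  pfin u /\ ev1 u = p.[1].
Proof.
have fs : pfin (tpow n) by exact: pfin_mono.
have pp q : pfin (pev pcst (tpow n) q) /\ ev1 (pev pcst (tpow n) q) = q.[1].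
  elim/poly_ind: q => [|q c [IH1 IH2]].
    by rewrite rmorph0 horner0; split; [exact: pfin0|exact: (ev1_mono 0)].
  have fc : pfin (pcst c) by rewrite pcstE; exact: pfin_mono.
  rewrite rmorphD rmorphM /= pevX pevC; split; first by apply: pfinD => //; exact: pfinM.
  rewrite ev1D ?ev1M ?IH2 //; last exact: pfinM.
  have ec : ev1 (pcst c) = c by rewrite pcstE ev1_mono.
  by rewrite ev1_mono [X in _ + X]ec !hornerE.
have sV : tpow n ^- k = pmono (n.+1%:R^-1 *- k) 1.
  rewrite /tpow; apply: (mulfI (expf_neq0 k (tpow_neq0 n))).
  by rewrite mulfV ?expf_neq0 ?tpow_neq0 // pmono_exp pmonoM subrr expr1n mul1r -pcstE rmorph1.
move=> e; rewrite -[u](mulfK (expf_neq0 k (tpow_neq0 n))) e sV.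
have [f1 f2] := pp p; split; first by apply: pfinM => //; exact: pfin_mono.
by rewrite ev1M ?ev1_mono ?f2 ?mulr1 //; exact: pfin_mono.
Qed.

Variables (C : comPzRingType) (f : {rmorphism Gm K -> C}).
Hypothesis etC : finite_etale f.

(* The extension of a point to a place where t^(1/(n+1)) takes another value. *)
Lemma torus_algebraic n (h : {rmorphism C -> P}) : h \o f =1 tstd ->
  forall c, algebraicOver (ratev (@tpow_nc n)) (h c).
Proof.
move=> hf c; have [p p0 hp] := finite_root etC.1 tval c.
have e : nonconst (@FracField.tofrac {poly K} \o @polyC K) (FracField.tofrac 'X^(n.+1)).
  move=> a /eqP; rewrite /= tofrac_eq => /eqP/(congr1 (fun q : {poly K} => size q)).
  by rewrite size_polyXn size_polyC; case: eqP.
exists (map_poly (ratev e) p); first by rewrite map_poly_eq0.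
rewrite -map_poly_comp; apply: hp => s /=; rewrite [LHS]hf /tstd /=.
apply/esym; apply: (@ratev_comp K {fraction {poly K}} P _ _ (ratev (@tpow_nc n)) _ _ e (@ncpX K)).
  by move=> a; rewrite /= ratev_poly pevC.
by rewrite [LHS](@ratev_poly K P pcst (tpow n) (@tpow_nc n)) rmorphXn [X in X ^+ _]pevX tpowX.
Qed.

Section Place.
Variables (n : nat) (h : {rmorphism C -> acl (ratev (@tpow_nc n))}).
Hypothesis hf : forall a, val (h (f a)) = tstd a.
Variable (j : {rmorphism acl (ratev (@tpow_nc n)) -> P}).
Hypothesis plj : place (acl_cst (@tpow_nc n)) j.

Lemma torus_place Y (nY : nonconst pcst Y) : j (acl_gen (@tpow_nc n)) ^+ n.+1 = Y ->
  forall a, j (h (f a)) = ratev nY (val a).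
Proof.
move=> jY; apply: (@loc_ext K 'X P (j \o (h \o f)) (ratev nY \o tval)).
- by rewrite polyX_eq0.
- move=> c; rewrite /= ratev_poly pevC; apply: etrans (plj c); congr (j _).
  by apply: val_inj; rewrite hf tstd_cst.
- rewrite /= ratev_poly pevX -jY -rmorphXn; congr (j _); apply: val_inj.
  by rewrite hf tstd_X rmorphXn -(tpowX n).
Qed.

Lemma torus_place_lvl : pint (j (acl_gen (@tpow_nc n))) ->
  lvl 0 (j (acl_gen (@tpow_nc n))) -> pc (j (acl_gen (@tpow_nc n))) 0 != 0 ->
  forall c, lvl 0 (j (h c)) /\ pint (j (h c)).
Proof.
set s := j _ => is_ ls rs.
have iY : pint (s ^+ n.+1) by exact: pintX.
have rY : pc (s ^+ n.+1) 0 != 0 by rewrite resX // expf_neq0.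
have nY : nonconst pcst (s ^+ n.+1).
  move=> c; rewrite /s -rmorphXn => e.
  have /fmorph_inj/(congr1 val) := etrans e (esym (plj c)).
  by rewrite rmorphXn => e'; exact: (ncpX (etrans (esym (tpowX n)) e')).
have hY := torus_place nY erefl.
have h1 a : lvl 0 ((j \o h) (f a)).
  by rewrite /= hY; apply/lvl_ratev/lvlX.
have h2 a : pint ((j \o h) (f a)).
  by rewrite /= hY; apply: (@pint_loc _ 'X); rewrite ?hornerX //; exact: valP.
move=> c; split; first exact: (@etale_unramified K charK _ _ f (j \o h)).
exact: (@finite_pint K _ _ f etC.1 (j \o h)).
Qed.

End Place.

(** Covers of the torus are Kummer covers. The index n + 1 is chosen so that all conjugates of the
    generators are series in s = t^(1/(n+1)); it does not depend on [h], since the conjugates are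
    roots of the polynomials [p i]. The functions are then unramified on the whole s-line, so
    rational in s by simple connectedness, and they are regular away from s = 0. *)
Theorem cover_laurent : exists n, forall h : {rmorphism C -> P}, h \o f =1 tstd ->
  forall c, exists k p, h c * tpow n ^+ k = pev pcst (tpow n) p.
Proof.
have [N [_ [e [_ [gen _]]]]] := etC.1.
have rt i := finite_root etC.1 tval (e i).
pose p i := projT1 (cid2 (rt i)).
have p0 i : p i != 0 by rewrite /p; case: cid2.
have pP i (E : fieldType) (u : {rmorphism {fraction {poly K}} -> E})
    (g : {rmorphism C -> E}) : g \o f =1 u \o tval -> root (map_poly u (p i)) (g (e i)).
  by rewrite /p; case: cid2 => /= q _ hq; exact: hq.
have rootsP i : exists r : seq P, forall v, root (map_poly (ratev (@ncpX K)) (p i)) v -> v \in r.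
  have [r er] : exists r : seq P, (lead_coef (map_poly (ratev (@ncpX K)) (p i)))^-1 *:
      map_poly (ratev (@ncpX K)) (p i) = \prod_(a <- r) ('X - a%:P).
    apply: (closed_normal (puiseux_closed charK)).
    by rewrite monicE lead_coefZ mulVf // lead_coef_eq0 map_poly_eq0.
  exists r => v; rewrite -root_prod_XsubC -er rootZ // invr_eq0 lead_coef_eq0.
  by rewrite map_poly_eq0.
pose r i := projT1 (cid (rootsP i)).
have rP i v : root (map_poly (ratev (@ncpX K)) (p i)) v -> v \in r i.
  by rewrite /r; case: cid => /= s; apply.
have [n ln] := lvl_common (flatten [seq r i | i <- enum 'I_N]).
have lr i v : root (map_poly (ratev (@ncpX K)) (p i)) v -> lvl n v.
  move=> /rP vr; apply: ln; apply/flattenP; exists (r i) => //.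
  by apply: map_f; rewrite mem_enum.
exists n => h hf c.
have [h' eh'] := acl_lift (torus_algebraic n hf).
have hf' a : val (h' (f a)) = tstd a by rewrite eh' -(hf a).
pose s' := acl_gen (@tpow_nc n).
(* Away from s = 0 etaleness suffices. Above s = 0 the choice of [n] is used, after the substitution
   t := t^(n+1), which turns t^(1/(n+1)) into t. *)
have unr x j : place (acl_cst (@tpow_nc n)) j -> j s' = pcst x + pX K -> lvl 0 (j (h' c)).
  move=> plj js; have [x0|x0] := eqVneq x 0; last first.
    have [] // : lvl 0 (j (h' c)) /\ pint (j (h' c)).
    apply: (torus_place_lvl hf' plj); rewrite -/s' js ?res_cX //; [exact: pint_cX|exact: lvl_cX].
  move: js; rewrite x0 rmorph0 add0r => js.
  have nY : nonconst pcst (pX K ^+ n.+1).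
    move=> a /(congr1 (fun b : P => pc b n.+1%:R)) /eqP.
    by rewrite pXE pmono_exp pc_mono eqxx expr1n [X in _ == X]pc_cst pnatr_eq0 oner_eq0.
  have hY := torus_place hf' plj nY (congr1 (fun b : P => b ^+ n.+1) js).
  have sc : pscale n \o ratev (@ncpX K) =1 ratev nY.
    apply: (@ratev_comp K P P pcst pcst (pscale n)).
      by move=> a; rewrite /= pcstE pscale_mono mul0r.
    by rewrite pXE /= pscale_mono pmono_exp expr1n mul1r.
  have [d ->] := gen c; rewrite !rmorph_sum; apply: lvl_sum => i _.
  rewrite !rmorphM hY; apply: lvlM; first by apply/lvl_ratev/lvlX/lvl_X.
  have : root (map_poly (ratev nY) (p i)) (j (h' (e i))).
    by apply: (pP i _ _ (j \o h')) => a /=; rewrite hY.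
  rewrite -(eq_map_poly sc) map_poly_comp.
  have [v <-] := pscale_ex n (j (h' (e i))).
  by rewrite fmorph_root => /lr; exact: pscale_lvl.
have [a ea] := simply_connected charK (@acl_algebraic _ _ _ _ (@tpow_nc n)) unr.
have /asboolP[k [q eq]] : a \in loc_pred ('X : {poly K}).
  apply: frac_pole => x; rewrite hornerX => x0.
  have [j plj js] := place_ex charK (@acl_algebraic _ _ _ _ (@tpow_nc n)) (@ncX K x).
  have [_] : lvl 0 (j (h' c)) /\ pint (j (h' c)).
    by apply: (torus_place_lvl hf' plj); rewrite -/s' js ?res_cX //; [exact: pint_cX|exact: lvl_cX].
  by rewrite ea -[j _]/((j \o ratev _) a) (@ratev_comp K _ P _ pcst j _ _ _ (@ncX K x) plj js).
exists k, q; rewrite -eh' ea -[val _]/((val \o ratev _) a) acl_ratev.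
by rewrite -!(ratev_poly (@tpow_nc n)) -eq rmorphM rmorphXn /= ratev_poly pevX.
Qed.

End TorusCovers.

Section TorusFiber.
Variable K : closedFieldType.
Hypothesis charK : [pchar K] =i pred0.
Local Notation P := (puiseux K).
Local Notation pcst := (@pcst K).
Local Notation tstd := (@tstd K).
Local Notation tpow := (@tpow K).

Lemma tstd_frac (a : Gm K) n (p : {poly K}) :
  val a * FracField.tofrac 'X ^+ n = FracField.tofrac p ->
  tstd a * pX K ^+ n = pev pcst (pX K) p.
Proof.
move=> e; rewrite -(ratev_poly (@ncpX K)) -e rmorphM rmorphXn.
have eX : ratev (@ncpX K) (FracField.tofrac 'X) = pX K by rewrite ratev_poly pevX.
by rewrite [X in _ = _ * X ^+ _]eX.
Qed.

Lemma tstd_inj : injective tstd.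
Proof.
move=> a b; rewrite /tstd /= => ab; apply: val_inj; exact: fmorph_inj ab.
Qed.

Lemma tstdB (u v : Gm K) : tstd (u - v) = tstd u - tstd v.
Proof. by rewrite rmorphB. Qed.
Lemma tstdM (u v : Gm K) : tstd (u * v) = tstd u * tstd v.
Proof. by rewrite rmorphM. Qed.
Lemma tstdD (u v : Gm K) : tstd (u + v) = tstd u + tstd v.
Proof. by rewrite rmorphD. Qed.

Lemma theta_frac (b c : P) n p : c * pX K ^+ n = pev pcst (pX K) p ->
  b * pX K ^+ n.+1 = pev pcst (pX K) ('X * p^`() - n%:R *: p) ->
  b * pX K = ptheta c.
Proof.
move=> ea; have pX0 := pX_neq0 K.
have tX m : ptheta (pX K ^+ m) = m%:R * pX K ^+ m.
  elim: m => [|m IH].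
    by rewrite expr0 mul0r -(rmorph1 pcst); exact: (ptheta_cst charK).
  by rewrite exprS (pthetaM charK) IH (ptheta_X charK) -[m.+1]addn1 natrD; ring.
have := congr1 (fun v : P => ptheta v) ea; rewrite (pthetaM charK) tX (theta_pev charK) (ptheta_X charK) => eth.
have -> : pev pcst (pX K) ('X * p^`() - n%:R *: p) = ptheta c * pX K ^+ n.
  rewrite rmorphB rmorphM /= pevX -eth -mul_polyC rmorphM /= pevC rmorph_nat -ea.
  by ring.
by rewrite exprS mulrA => /(mulIf (expf_neq0 n pX0)).
Qed.

Lemma loc_divX (q : {poly K}) n : exists b : Gm K,
  val b * FracField.tofrac 'X ^+ n = FracField.tofrac q.
Proof.
have X0 : FracField.tofrac ('X : {poly K}) != 0 by rewrite tofrac_eq0 polyX_eq0.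
have er := divfK (expf_neq0 n X0) (FracField.tofrac q).
move: (_ / _) er => r er.
have bP : r \in loc_pred ('X : {poly K}) by apply/asboolP; exists n, q.
by exists (LocRing bP).
Qed.

Lemma torus_deriv (a : Gm K) : exists b : Gm K, tstd b * pX K = ptheta (tstd a).
Proof.
have /asboolP[n [p e]] := valP a.
have [b eb] := loc_divX ('X * p^`() - n%:R *: p) n.+1.
exists b; exact: theta_frac (tstd_frac e) (tstd_frac eb).
Qed.

Lemma thetaB_aux (A B A' B' : P) : A' * pX K = ptheta A -> B' * pX K = ptheta B ->
  (A' - B') * pX K = ptheta (A - B).
Proof. by move=> hA hB; rewrite raddfB mulrBl hA hB. Qed.
Lemma thetaM_aux (A B A' B' : P) : A' * pX K = ptheta A -> B' * pX K = ptheta B ->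
  (A * B' + A' * B) * pX K = ptheta (A * B).
Proof. by move=> hA hB; rewrite (pthetaM charK) -hA -hB; ring. Qed.

Lemma torus_derivation : exists d : Gm K -> Gm K, [/\ zmod_morphism d,
  forall a b, d (a * b) = a * d b + d a * b,
  forall c, d (loc_poly _ c%:P) = 0 & d (loc_poly _ 'X) = 1].
Proof.
have [d dE] : exists d : Gm K -> Gm K, forall a, tstd (d a) * pX K = ptheta (tstd a).
  by exists (fun a => projT1 (cid (torus_deriv a))) => a; case: cid.
have dP (a b : Gm K) : tstd b * pX K = ptheta (tstd a) -> d a = b.
  move=> e; apply: tstd_inj; apply: (mulIf (pX_neq0 K)).
  exact: etrans (dE a) (esym e).
exists d; split=> [a b|a b|c|]; apply: dP.
- by rewrite !tstdB; exact: thetaB_aux.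
- by rewrite tstdD !tstdM; exact: thetaM_aux.
- by rewrite tstd_cst rmorph0 mul0r (ptheta_cst charK).
- by rewrite tstd_X rmorph1 mul1r (ptheta_X charK).
Qed.

Variables (C : comPzRingType) (f : {rmorphism Gm K -> C}).
Hypothesis etC : finite_etale f.

(** d/dt is a morphism to the dual numbers, and formal etaleness extends it to the cover. *)
Lemma etale_derivation : exists D : C -> C, [/\ zmod_morphism D,
  forall a b, D (a * b) = a * D b + D a * b, forall c, D (f (loc_poly _ c%:P)) = 0 &
  D (f (loc_poly _ 'X)) = 1].
Proof.
have [d [dB dM dc dX]] := torus_derivation.
have d1 : d 1 = 0.
  by apply: (addIr (d 1)); have := dM 1 1; rewrite !mulr1 mul1r add0r.
have gz : zmod_morphism (fun a => Dual (f a) (f (d a))).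
  by move=> a b; apply: dualP; rewrite /= ?dB rmorphB.
have gm : monoid_morphism (fun a => Dual (f a) (f (d a))).
  split=> [|a b]; apply: dualP; rewrite /= ?rmorph1 ?rmorphM ?d1 ?rmorph0 //.
  by rewrite dM rmorphD !rmorphM.
have surj (u : C) : exists t, @dre C t = u by exists (Dual u 0).
have [a|h [h1 h2 _]] := etC.2 _ _ _ surj (@dre_square0 C) (mkrm gz gm) idfun.
  by [].
have re a : dre (h a) = a by exact: h2.
have Df a : deps (h (f a)) = f (d a) by rewrite -[h (f a)]/((h \o f) a) h1.
exists (fun c => deps (h c)); split=> [a b|a b|c|].
- by rewrite rmorphB.
- by rewrite rmorphM /= !re.
- by rewrite Df dc rmorph0.
- by rewrite Df dX rmorph1.
Qed.

Variable x : {rmorphism C -> K}.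
Hypothesis x_cst : forall c, x (f (loc_poly _ c%:P)) = c.
Hypothesis x_1 : x (f (loc_poly _ 'X)) = 1.

(** The Taylor expansion at the point [x]: the coefficient of T^k is x (D^k c) / k!, and the Leibniz
    rule makes it multiplicative. The coordinate goes to 1 + T. *)
Lemma fiber_taylor : exists l : {rmorphism C -> pseries K},
  [/\ forall c, coefps (l c) 0 = x c, forall c, l (f (loc_poly _ c%:P)) = psC c &
      l (f (loc_poly _ 'X)) = 1 + psX K].
Proof.
have [D [DB DM Dc DX]] := etale_derivation.
have D0 : D 0 = 0 by rewrite -(subrr 0) DB !subrr.
have DD a b : D (a + b) = D a + D b.
  have N c : D (- c) = - D c by rewrite -sub0r DB D0 sub0r.
  by rewrite -[b in LHS]opprK DB N opprK.
have itB k : zmod_morphism (iter k D).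
  by elim: k => [//|k IH] a b; rewrite /= IH DB.
have fact0 k : k`!%:R != 0 :> K by have := fact_gt0 k; case: (k`!) => // m _; exact: (natrK_neq0 charK).
have itM k a b : iter k D (a * b) = \sum_(i < k.+1) (iter i D a * iter (k - i) D b) *+ 'C(k, i).
  elim: k => [|k IH]; first by rewrite big_ord1 subnn bin0 mulr1n.
  have Dsum (s : seq 'I_k.+1) F : D (\sum_(i <- s) F i) = \sum_(i <- s) D (F i).
    exact: (big_morph D DD D0).
  have Dn c m : D (c *+ m) = D c *+ m.
    by elim: m => [|m IHm]; rewrite ?mulr0n // !mulrS DD IHm.
  rewrite [LHS]/= IH Dsum.
  under eq_bigr do rewrite Dn DM mulrnDl.
  rewrite big_split /= [RHS]big_ord_recl /= bin0 mulr1n ?subn0.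
  under [in RHS]eq_bigr => i _ do rewrite /bump /= add1n binS mulrnDr subSS.
  rewrite big_split /= addrA; congr (_ + _).
  rewrite big_ord_recl /= bin0 mulr1n ?subn0 -iterS; congr (_ + _).
  rewrite [RHS]big_ord_recr /= bin_small // mulr0n addr0.
  apply: eq_bigr => i _; rewrite /bump /= add1n.
  have -> : (k - i = (k - i.+1).+1)%N by have := ltn_ord i; lia.
  by [].
pose l c := PSeries (fun k => x (iter k D c) / k`!%:R).
have lz : zmod_morphism l.
  by move=> a b; apply: psP => k /=; rewrite itB rmorphB mulrBl.
have D1 : D 1 = 0.
  by apply: (addIr (D 1)); have := DM 1 1; rewrite !mulr1 mul1r add0r.
have it0 k : iter k D 0 = 0 by elim: k => //= k ->.
have lc a k : D a = 0 -> coefps (l a) k = if k == 0%N then x a else 0.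
  move=> Da; case: k => [|k]; first by rewrite /= divr1.
  by rewrite /= -iterS iterSr Da it0 rmorph0 mul0r.
have lm : monoid_morphism l.
  split=> [|a b]; apply: psP => k; first by rewrite lc // rmorph1.
  rewrite coefpsM /= itM rmorph_sum mulr_suml; apply: eq_bigr => i _.
  rewrite rmorphMn rmorphM -mulr_natr.
  have ik : (i <= k)%N by rewrite -ltnS.
  have -> : ('C(k, i)%:R : K) = k`!%:R / (i`!%:R * (k - i)`!%:R).
    by rewrite -(bin_fact ik) !natrM mulfK // mulf_neq0.
  by field; rewrite !fact0.
exists (mkrm lz lm); split=> [c|c|]; first by rewrite /= divr1.
  by apply: psP => k; rewrite /= [LHS](lc _ k) ?Dc ?x_cst.
apply: psP => -[|[|k]] /=.
- by rewrite x_1 divr1 addr0.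
- by rewrite DX !rmorph1 divr1 add0r.
- by rewrite -iterS -iterS !iterSr DX D1 it0 rmorph0 mul0r addr0.
Qed.

Section Unique.
Variables h h' : {rmorphism C -> P}.
Hypotheses (hf : h \o f =1 tstd) (hf' : h' \o f =1 tstd).

(** At the place where s = t^(1/(n+1)) expands as 1 + t, residues are values at s = 1. Equal values
    therefore give equal residues there, and rigidity of etale algebras identifies the two
    points. *)
Lemma fiber_inj : (forall c, ev1 (h c) = ev1 (h' c)) -> h =1 h'.
Proof.
have [n hn] := cover_laurent charK etC => e.
have [j plj js] := place_ex charK (@acl_algebraic _ _ _ _ (@tpow_nc K n)) (@ncX K 1).
have liftP (g : {rmorphism C -> P}) : g \o f =1 tstd ->
    exists2 g' : {rmorphism C -> acl (ratev (@tpow_nc K n))},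
      forall c, val (g' c) = g c & forall c, pc (j (g' c)) 0 = ev1 (g c).
  move=> gf; have [g' eg'] := acl_lift (torus_algebraic etC n gf).
  exists g' => // c; have [k [p ep]] := hn g gf c.
  have e1 : g' c * acl_gen (@tpow_nc K n) ^+ k = pev (acl_cst (@tpow_nc K n)) (acl_gen (@tpow_nc K n)) p.
    by apply: val_inj; rewrite acl_pev -ep -eg' rmorphM rmorphXn.
  have [_ ->] := ev1_tpow ep; have := congr1 j e1.
  rewrite rmorphM rmorphXn js (place_pev _ p plj) js.
  have [_ lp] : lvl 0 (j (g' c)) /\ pint (j (g' c)).
    have gf' a : val (g' (f a)) = tstd a by rewrite eg' -(gf a).
    apply: (torus_place_lvl charK etC gf' plj); rewrite js ?res_cX ?oner_eq0 //.
      exact: pint_cX.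
    exact: lvl_cX.
  have ic := pint_cX (1 : K); have rc := res_cX (1 : K).
  move=> /(congr1 (fun b : P => pc b 0)); rewrite res_mul //; last exact: pintX.
  rewrite resX // rc expr1n mulr1 => ->.
  by have [_ ->] := pint_pev p ic; rewrite rc.
have [g ge gr] := liftP h hf; have [g' ge' gr'] := liftP h' hf'.
have gf a : val (g (f a)) = tstd a by rewrite ge -(hf a).
have gf' a : val (g' (f a)) = tstd a by rewrite ge' -(hf' a).
have jg : j \o g =1 j \o g'.
  have h0 c : lvl 0 (j (g c)) /\ pint (j (g c)).
    apply: (torus_place_lvl charK etC gf plj); rewrite js ?res_cX ?oner_eq0 //.
      exact: pint_cX.
    exact: lvl_cX.
  apply: (@etale_rigid K _ _ f etC (j \o g) (j \o g')).
  - move=> a /=; congr (j _); apply: val_inj; exact: etrans (gf a) (esym (gf' a)).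
  - by move=> a; have [] := h0 (f a).
  - by move=> a; have [] := h0 (f a).
  - by move=> c /=; rewrite gr gr'.
move=> c; rewrite -ge -ge'; congr val; exact: fmorph_inj (jg c).
Qed.

End Unique.

(** The Taylor expansion is an embedding at t = 1 instead of t = 0. Its values are algebraic over
    the root s of 1 + t with residue 1, and a place that sends s to t^(1/(n+1)) transports it to the
    origin. The residue 1 of s corresponds to setting the roots of t to 1. *)
Lemma fiber_lift : exists h : {rmorphism C -> P}, h \o f =1 tstd /\
  forall c, ev1 (h c) = x c.
Proof.
have [n hn] := cover_laurent charK etC; have [l [l0 lc lX]] := fiber_taylor.
pose Y : P := pser 0 (1 + psX K).
have YE : Y = pcst 1 + pX K by rewrite /Y rmorphD rmorph1 rmorph1.
have iY : pint Y by rewrite YE; exact: pint_cX.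
have rY : pc Y 0 = 1 by rewrite YE res_cX.
(* The residue of any root is a root of unity; dividing by it makes the residue 1. *)
have [s sY rs] : exists2 s : P, s ^+ n.+1 = Y & pint s /\ pc s 0 = 1.
  have [|s /rootP] := closed_root (puiseux_closed charK) (p := 'X^(n.+1) - Y%:P).
    by rewrite size_XnsubC.
  rewrite !hornerE => /eqP; rewrite subr_eq0 => /eqP sY.
  have is_ : pint s.
    apply: (@pint_root _ ('X^(n.+1) - Y%:P)); first exact: monicXnsubC.
      move=> i; rewrite coefB coefXn coefC; apply: pintB; last by case: eqP => _ //; exact: pge0.
      by case: eqP => _; [exact: pint1|exact: pge0].
    by rewrite rootE !hornerE sY subrr.
  have rsn : pc s 0 ^+ n.+1 = 1 by rewrite -resX // sY.
  have s0 : pc s 0 != 0 by apply/eqP => e; move/eqP: rsn; rewrite e expr0n eq_sym oner_eq0.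
  have ic : pint (pcst (pc s 0)^-1) by exact: pint_cst.
  exists (pcst (pc s 0)^-1 * s); last first.
    by split; [exact: pintM|rewrite res_mul // res_cst mulVf].
  by rewrite exprMn sY -rmorphXn exprVn rsn invr1 rmorph1 mul1r.
case: rs => is_ rs.
have ns : nonconst pcst s.
  move=> c e; have := @ncX K 1 (c ^+ n.+1).
  by rewrite -YE -sY e -rmorphXn; apply.
have nY : nonconst pcst Y by rewrite YE; exact: ncX.
have [j plj js] := place_ex charK (@acl_algebraic _ _ _ _ ns) (@tpow_nc K n).
pose L : {rmorphism C -> P} := pser 0 \o l.
have Lf : L \o f =1 ratev nY \o tval K.
  apply: (@loc_ext K 'X P (L \o f) (ratev nY \o tval K)); first by rewrite polyX_eq0.
    by move=> c; rewrite /= lc ratev_poly pevC.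
  by rewrite /= lX ratev_poly pevX.
have algL c : algebraicOver (ratev ns) (L c).
  have [p p0 hp] := finite_root etC.1 (tval K) c.
  have e : nonconst (@FracField.tofrac {poly K} \o @polyC K) (FracField.tofrac 'X^(n.+1)).
    move=> a /eqP; rewrite /= tofrac_eq => /eqP/(congr1 (fun q : {poly K} => size q)).
    by rewrite size_polyXn size_polyC; case: eqP.
  exists (map_poly (ratev e) p); first by rewrite map_poly_eq0.
  rewrite -map_poly_comp; apply: hp => a; rewrite Lf /=.
  apply/esym; apply: (@ratev_comp K {fraction {poly K}} P _ _ (ratev ns) _ _ e nY).
    by move=> b; rewrite /= ratev_poly pevC.
  by rewrite [LHS](@ratev_poly K P pcst s ns) rmorphXn [X in X ^+ _]pevX.
have [L' eL] := acl_lift algL.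
pose h : {rmorphism C -> P} := j \o L'.
have hf : h \o f =1 tstd.
  apply: (@loc_ext K 'X P (h \o f) tstd); first by rewrite polyX_eq0.
    move=> c; apply: etrans (esym (tstd_cst c)); apply: etrans (plj c); congr (j _).
    by apply: val_inj; rewrite eL /= lc.
  apply: etrans (esym (tstd_X K)); rewrite -(tpowX K n) -js -rmorphXn /=; congr (j _).
  apply: val_inj; rewrite eL /= lX; apply: etrans (esym sY) _.
  by rewrite -[s]/(val (acl_gen ns)) -rmorphXn.
exists h; split=> // c; have [k [p ep]] := hn h hf c.
have [_ ->] := ev1_tpow ep.
have e1 : L' c * acl_gen ns ^+ k = pev (acl_cst ns) (acl_gen ns) p.
  apply: (fmorph_inj j); rewrite rmorphM rmorphXn js (place_pev _ p plj) js.
  exact: ep.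
have e2 : L c * s ^+ k = pev pcst s p.
  by rewrite -(acl_pev ns p) -e1 rmorphM rmorphXn -eL.
have rL : pc (L c) 0 = x c.
  by rewrite -l0; have := @pc_pser K 0 (l c) 0; rewrite /pexp subr0 mul0r.
have iL : pint (L c).
  move=> q q0; apply: contrapT => /eqP/plev_pser[i ei]; move: q0.
  by rewrite ei /pexp subr0 divr1 ltrn0.
have := congr1 (fun b : P => pc b 0) e2; rewrite res_mul //; last exact: pintX.
rewrite resX // rs expr1n mulr1 rL => ->.
by have [_ ->] := pint_pev p is_; rewrite rs.
Qed.

End TorusFiber.

(** * Fibers as sets of embeddings in the algebraic functions *)

Section GaloisFibers.
Variable K : closedFieldType.
Hypothesis charK : [pchar K] =i pred0.
Local Notation P := (puiseux K).
Local Notation pcst := (@pcst K).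
Variables (Om : fieldType) (kap : {rmorphism K -> Om}) (io : {rmorphism Om -> P}).
Hypothesis clOm : GRing.closed_field_axiom Om.
Hypothesis io_kap : forall c, io (kap c) = pcst c.

Section Automorphisms.
Variables (y : Om) (ny : nonconst kap y).
Hypothesis algy : forall u, algebraicOver (ratev ny) u.

(** Only endomorphisms over K(y) are recorded. They are bijective because they permute the roots of
    each minimal polynomial, see [gaut_surj]. *)
Record gaut := Gaut {
  ga_fun :> {rmorphism Om -> Om};
  ga_kap : forall c, ga_fun (kap c) = kap c;
  ga_y : ga_fun y = y
}.

Lemma ga_ratev (a : gaut) r : a (ratev ny r) = ratev ny r.
Proof. exact: (@ratev_comp K Om Om kap kap a y y ny ny (@ga_kap a) (ga_y a)). Qed.

Definition gaut1 : gaut := @Gaut idfun (fun _ => erefl) erefl.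
Lemma gautM_kap (a b : gaut) c : (a \o b) (kap c) = kap c.
Proof. by rewrite /= !ga_kap. Qed.
Lemma gautM_y (a b : gaut) : (a \o b) y = y.
Proof. by rewrite /= !ga_y. Qed.
Definition gautM (a b : gaut) : gaut :=
  @Gaut (a \o b : {rmorphism Om -> Om}) (gautM_kap a b) (gautM_y a b).

Lemma galois_roots (u : Om) : exists r : seq Om,
  u \in r /\ forall (a : {rmorphism Om -> Om}), (forall x, a (ratev ny x) = ratev ny x) ->
    forall v, v \in r -> a v \in r.
Proof.
have [p kp] := kmin_ex (algy u); have [mp pu _] := kp.
have [r er] := closed_normal clOm (p := map_poly (ratev ny) p) (monic_map _ mp).
exists r; split; first by rewrite -root_prod_XsubC -er.
move=> a fa v; rewrite -!root_prod_XsubC -er => pv.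
rewrite -(eq_map_poly (f := a \o ratev ny)) => [|x]; last exact: fa.
by rewrite map_poly_comp fmorph_root.
Qed.

Lemma gaut_surj (a : gaut) u : exists v, a v = u.
Proof.
have [r [ur ar]] := galois_roots u.
have sub : {subset map a (undup r) <= undup r}.
  by move=> _ /mapP[v vr ->]; move: vr; rewrite !mem_undup; apply: ar; exact: ga_ratev.
have ua : uniq (map a (undup r)) by rewrite map_inj_uniq ?undup_uniq //; exact: fmorph_inj.
have [_ e] := uniq_min_size ua sub (eq_leq (esym (size_map _ _))).
by have := e u; rewrite mem_undup ur => /mapP[v _ ->]; exists v.
Qed.

Lemma gaut_inv (a : gaut) : exists b : gaut, cancel a b /\ cancel b a.
Proof.
pose b u := projT1 (cid (gaut_surj a u)).
have ab u : a (b u) = u by rewrite /b; case: cid.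
have ba u : b (a u) = u by apply: (fmorph_inj a); rewrite ab.
have bz : zmod_morphism b by move=> u v; apply: (fmorph_inj a); rewrite rmorphB !ab.
have bm : monoid_morphism b.
  by split=> [|u v]; apply: (fmorph_inj a); rewrite ?rmorph1 ?rmorphM !ab.
have bk c : mkrm bz bm (kap c) = kap c by apply: (fmorph_inj a); rewrite ga_kap ab.
have by_ : mkrm bz bm y = y by apply: (fmorph_inj a); rewrite ga_y ab.
by exists (Gaut bk by_).
Qed.

Definition gautV (a : gaut) := projT1 (cid (gaut_inv a)).
Lemma gautK (a : gaut) : cancel a (gautV a).
Proof. by rewrite /gautV; case: cid => b /= []. Qed.
Lemma gautVK (a : gaut) : cancel (gautV a) a.
Proof. by rewrite /gautV; case: cid => b /= []. Qed.

End Automorphisms.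

Variables (z : pseries K) (zP : ps_nonunit z) (y : Om) (ny : nonconst kap y).
Hypothesis ioy : io y = pser 0 z.
Hypothesis algy : forall u, algebraicOver (ratev ny) u.

Definition ostd : {rmorphism P1_minus_01oo K -> Om} :=
  ratev ny \o (val : {rmorphism P1_minus_01oo K -> {fraction {poly K}}}).

Lemma io_ratev (nz : nonconst pcst (pser 0 z)) x : io (ratev ny x) = ratev nz x.
Proof. exact: (@ratev_comp K Om P kap pcst io y _ ny nz io_kap ioy). Qed.

Lemma io_ostd a : io (ostd a) = @lau K 0 (expand zP a).
Proof. by rewrite (expand_ratev zP (nc_nonunit zP)) -io_ratev. Qed.

Lemma io_image (u : P) : algebraicOver (io \o ratev ny) u -> exists v, io v = u.
Proof.
move=> [p p0 pu].
have lc0 : lead_coef (map_poly (ratev ny) p) != 0 by rewrite lead_coef_eq0 map_poly_eq0.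
have [r er] : exists r : seq Om, (lead_coef (map_poly (ratev ny) p))^-1 *:
    map_poly (ratev ny) p = \prod_(a <- r) ('X - a%:P).
  by apply: (closed_normal clOm); rewrite monicE lead_coefZ mulVf.
have : root (map_poly io (\prod_(a <- r) ('X - a%:P))) u.
  rewrite -er linearZ /= rootZ; last by rewrite fmorph_eq0 invr_eq0.
  by rewrite -map_poly_comp.
elim: r {er} => [|a r IH]; first by rewrite big_nil rmorph1 rootE hornerC oner_eq0.
rewrite big_cons rmorphM rootM => /orP[|//].
by rewrite rmorphB /= map_polyX map_polyC root_XsubC => /eqP ->; exists a.
Qed.

Lemma io_lift (C : comPzRingType) (g : {rmorphism C -> P}) :
  (forall c, exists v, io v = g c) -> exists h : {rmorphism C -> Om}, io \o h =1 g.
Proof.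
move=> hg; pose h c := projT1 (cid (hg c)).
have hE c : io (h c) = g c by rewrite /h; case: cid.
have hz : zmod_morphism h by move=> a b; apply: (fmorph_inj io); rewrite rmorphB !hE rmorphB.
have hm : monoid_morphism h.
  by split=> [|a b]; apply: (fmorph_inj io); rewrite ?rmorph1 ?rmorphM !hE ?rmorph1 ?rmorphM.
by exists (mkrm hz hm).
Qed.

Section OneCover.
Variable O : tcover zP.

(* The point [x] of the fiber at the tangential base point corresponds to the
   embedding [h] of the cover into [Om]. *)
Definition realizes (x : tfiber O) (h : {rmorphism tc_B O -> Om}) :=
  exists w : {rmorphism tc_D O -> P}, [/\ w \o tc_d O =1 @lau K 0,
    w \o tc_BD O =1 io \o h & forall c, ev1 (w (tc_CD O c)) = x c].

Let D_over (w : {rmorphism tc_D O -> P}) : w \o tc_d O =1 @lau K 0 ->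
  (w \o tc_CD O) \o tc_c O =1 @tstd K.
Proof.
move=> wd a; rewrite tstdE -wd /=; congr (w _); exact: (tc_poC O).1.
Qed.

(** The point gives an embedding of the torus algebra by [fiber_lift]. The pushout square extends it
    to the common pullback over K((t)), and restriction gives the embedding of the algebra over the
    line. *)
Lemma realizes_ex x : exists h, realizes x h.
Proof.
have [g [gf gx]] := fiber_lift charK (tc_etC O) (x := x) (@tf_const _ _ _ _ x) (tf_t1 x).
have [a|w [w1 w2 _]] := (tc_poC O).2 P g (@lau K 0); first by rewrite gf tstdE.
have [|h hE] := io_lift (g := w \o tc_BD O).
  move=> b; apply: io_image.
  have [p p0 hp] := finite_root (tc_etB O).1 (val : {rmorphism P1_minus_01oo K -> _}) b.
  exists p => //; apply: hp => a /=.
  have -> : tc_BD O (tc_b O a) = tc_d O (expand zP a) by exact: (tc_poB O).1.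
  by rewrite [LHS]w2; exact: esym (io_ostd a).
by exists h, w; split=> // c; rewrite [w _]w1.
Qed.

Lemma realizes_over x h : realizes x h -> h \o tc_b O =1 ostd.
Proof.
move=> [w [wd wB _]] a; apply: (fmorph_inj io); rewrite io_ostd -wd /= -[LHS]wB /=.
by congr (w _); exact: (tc_poB O).1.
Qed.

Lemma realizes_fun x h h' : realizes x h -> realizes x h' -> h =1 h'.
Proof.
move=> [w [wd wB wC]] [w' [wd' wB' wC']] b; apply: (fmorph_inj io).
have e : w \o tc_CD O =1 w' \o tc_CD O.
  apply: (fiber_inj charK (tc_etC O)); do ?exact: D_over.
  by move=> c; rewrite /= wC wC'.
have [a|v [_ _ un]] := (tc_poC O).2 P (w' \o tc_CD O) (@lau K 0).
  by rewrite D_over // tstdE.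
have ww : w =1 w' by move=> d; rewrite (un w) ?(un w').
by rewrite -[LHS]wB -[RHS]wB' /= ww.
Qed.

Lemma realizes_inj x x' h : realizes x h -> realizes x' h -> x = x'.
Proof.
move=> [w [wd wB wC]] [w' [wd' wB' wC']]; apply: tfiberP => c.
have [a|v [_ _ un]] := (tc_poB O).2 P (io \o h) (@lau K 0).
  apply: etrans (esym (wB _)) (etrans _ (wd _)); rewrite /=; congr (w _).
  exact: (tc_poB O).1.
have ww : w =1 w' by move=> d; rewrite (un w) ?(un w').
by rewrite -wC -wC' ww.
Qed.

(** The same route backwards: by [cover_laurent] the functions on the torus cover become series of
    finite support, which can be evaluated with all roots of t equal to 1. *)
Lemma realizes_surj (h : {rmorphism tc_B O -> Om}) : h \o tc_b O =1 ostd -> exists x, realizes x h.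
Proof.
move=> hb; have [a|w [wB wd _]] := (tc_poB O).2 P (io \o h) (@lau K 0).
  by apply: etrans (congr1 io (hb a)) (io_ostd a).
have wC := D_over wd.
have [n hn] := cover_laurent charK (tc_etC O).
have fin c : pfin (w (tc_CD O c)).
  by have [k [p /ev1_tpow[]]] := hn _ wC c.
pose g c := ev1 (w (tc_CD O c)).
have gz : zmod_morphism g.
  move=> a b; rewrite /g !rmorphB ev1D ?ev1N //; exact: pfinN.
have gm : monoid_morphism g.
  split=> [|a b]; rewrite /g ?rmorphM ?ev1M // !rmorph1.
  exact: ev1_mono.
have gc c : g (tc_c O (loc_poly _ c%:P)) = c.
  rewrite /g -[w _]/(((w \o tc_CD O) \o tc_c O) _) wC tstd_cst pcstE; exact: ev1_mono.
have g1 : g (tc_c O (loc_poly _ 'X)) = 1.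
  rewrite /g -[w _]/(((w \o tc_CD O) \o tc_c O) _) wC tstd_X pXE; exact: ev1_mono.
by exists (TFiber (O := O) gz gm gc g1), w.
Qed.

Definition hom_of x := projT1 (cid (realizes_ex x)).
Lemma hom_ofP x : realizes x (hom_of x).
Proof. by rewrite /hom_of; case: cid. Qed.

Lemma gaut_over (a : gaut y) x h : realizes x h -> (a \o h) \o tc_b O =1 ostd.
Proof.
move=> /realizes_over hb s; rewrite -[LHS]/(a ((h \o tc_b O) s)) hb.
exact: ga_ratev.
Qed.

Lemma move_ex (a : gaut y) (x : tfiber O) : exists x', realizes x' (a \o hom_of x).
Proof. exact/realizes_surj/(gaut_over a (hom_ofP x)). Qed.
Definition move_fiber a x := projT1 (cid (move_ex a x)).
Lemma move_fiberP a x : realizes (move_fiber a x) (a \o hom_of x).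
Proof. by rewrite /move_fiber; case: cid. Qed.

Lemma realizes_eq x (h h' : {rmorphism tc_B O -> Om}) : h =1 h' -> realizes x h -> realizes x h'.
Proof.
by move=> e [w [wd wB wC]]; exists w; split=> // b; rewrite wB /= e.
Qed.

Lemma move_fiberE a x h : realizes x h -> realizes (move_fiber a x) (a \o h).
Proof.
move=> xh; apply: realizes_eq (move_fiberP a x) => b /=; congr (a _).
exact: (realizes_fun (hom_ofP x) xh).
Qed.

Lemma move_fiberM (a b : gaut y) x : move_fiber (gautM a b) x = move_fiber a (move_fiber b x).
Proof.
apply: realizes_inj (move_fiberE (gautM a b) (hom_ofP x)) _.
exact: (realizes_eq _ (move_fiberE a (move_fiberE b (hom_ofP x)))).
Qed.

Lemma move_fiber1 x : move_fiber (gaut1 y) x = x.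
Proof.
apply: realizes_inj (hom_ofP x).
exact: (realizes_eq _ (move_fiberE (gaut1 y) (hom_ofP x))).
Qed.

Lemma move_fiber_ext (a b : gaut y) x : a =1 b -> move_fiber a x = move_fiber b x.
Proof.
move=> ab; apply: realizes_inj (move_fiberE a (hom_ofP x)) _.
by apply: (realizes_eq _ (move_fiberE b (hom_ofP x))) => c /=; rewrite ab.
Qed.

End OneCover.

Lemma realizes_pull (O O' : tcover zP) (m : tc_hom O O') (x' : tfiber O') h' :
  realizes x' h' -> realizes (tf_pull m x') (h' \o th_B m).
Proof.
move=> [w [wd wB wC]]; exists (w \o th_D m); split=> [a|b|c].
- by rewrite -wd /= -[th_D m _]/((th_D m \o tc_d O) a) th_d.
- by rewrite /= -[th_D m _]/((th_D m \o tc_BD O) b) th_BD /= -[LHS]/((w \o tc_BD O') _) wB.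
- by rewrite /= -[th_D m _]/((th_D m \o tc_CD O) c) th_CD /= wC.
Qed.

Section Theta.
Variable a : gaut y.

Lemma theta_K O : cancel (@move_fiber O a) (@move_fiber O (gautV algy a)).
Proof.
move=> x; rewrite -move_fiberM -[RHS]move_fiber1; apply: move_fiber_ext => u.
by rewrite /= gautK.
Qed.
Lemma theta_VK O : cancel (@move_fiber O (gautV algy a)) (@move_fiber O a).
Proof.
move=> x; rewrite -move_fiberM -[RHS]move_fiber1; apply: move_fiber_ext => u.
by rewrite /= gautVK.
Qed.
Lemma theta_nat O O' (m : tc_hom O O') (x : tfiber O') :
  move_fiber a (tf_pull m x) = tf_pull m (move_fiber a x).
Proof.
apply: realizes_inj (move_fiberE a (realizes_pull m (hom_ofP x))) _.
exact: (realizes_eq _ (realizes_pull m (move_fiberE a (hom_ofP x)))).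
Qed.
(** Post-composition of embeddings with [a], transported to the fibers by [realizes]. It is natural
    because morphisms of covers act by pre-composition. *)
Definition theta : pi1 zP := Pi1 theta_K theta_VK theta_nat.
End Theta.

Lemma thetaM a b : theta (gautM a b) = pi1_mul (theta a) (theta b).
Proof. by apply: pi1P => O x /=; rewrite move_fiberM. Qed.

Lemma theta1 : theta (gaut1 y) = pi1_one zP.
Proof. by apply: pi1P => O x; exact: move_fiber1. Qed.

End GaloisFibers.

(** A subring of the ring of functions from [T] to [R]. With [T] the Galois group, the three
    algebras of a Galois cover all take this form, and the maps to the common pullback are
    inclusions. *)
Record fpred (T : Type) (R : comPzRingType) := FPred {
  fp_fun :> (T -> R) -> Prop;
  fp_1 : fp_fun (fun _ => 1);
  fp_B : forall F H, fp_fun F -> fp_fun H -> fp_fun (fun t => F t - H t);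
  fp_M : forall F H, fp_fun F -> fp_fun H -> fp_fun (fun t => F t * H t)
}.

Record fsub (T : Type) (R : comPzRingType) (Q : fpred T R) :=
  FSub { fval :> T -> R; fvalP : Q fval }.

(** * The cover of a finite set of unramified functions *)

Section FunctionRings.
Variables (T : Type) (R : comPzRingType) (Q : fpred T R).
Implicit Types F H : fsub Q.

HB.instance Definition _ := gen_eqMixin (fsub Q).
HB.instance Definition _ := gen_choiceMixin (fsub Q).

Lemma fsubP F H : F =1 H -> F = H.
Proof.
case: F H => [F FP] [H HP] /= /funext e; subst H.
by congr FSub; exact: Prop_irrelevance.
Qed.

Lemma fp_0 : Q (fun _ => 0).
Proof.
by have := fp_B (fp_1 Q) (fp_1 Q); congr (fp_fun Q _); apply: funext => t; rewrite subrr.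
Qed.
Lemma fp_N F : Q (fun t => - F t).
Proof.
by have := fp_B fp_0 (fvalP F); congr (fp_fun Q _); apply: funext => t; rewrite sub0r.
Qed.
Lemma fp_D F H : Q (fun t => F t + H t).
Proof.
by have := fp_B (fvalP F) (fp_N H); congr (fp_fun Q _); apply: funext => t; rewrite opprK.
Qed.

Definition fsub_0 := FSub fp_0.
Definition fsub_1 := FSub (fp_1 Q).
Definition fsub_N F := FSub (fp_N F).
Definition fsub_D F H := FSub (fp_D F H).
Definition fsub_M F H := FSub (fp_M (fvalP F) (fvalP H)).

Lemma fsub_addA : associative fsub_D.
Proof. by move=> F H L; apply: fsubP => t /=; rewrite addrA. Qed.
Lemma fsub_addC : commutative fsub_D.
Proof. by move=> F H; apply: fsubP => t /=; rewrite addrC. Qed.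
Lemma fsub_add0 : left_id fsub_0 fsub_D.
Proof. by move=> F; apply: fsubP => t /=; rewrite add0r. Qed.
Lemma fsub_addN : left_inverse fsub_0 fsub_N fsub_D.
Proof. by move=> F; apply: fsubP => t /=; rewrite addNr. Qed.
HB.instance Definition _ :=
  GRing.isZmodule.Build (fsub Q) fsub_addA fsub_addC fsub_add0 fsub_addN.

Lemma fsub_mulA : associative fsub_M.
Proof. by move=> F H L; apply: fsubP => t /=; rewrite mulrA. Qed.
Lemma fsub_mulC : commutative fsub_M.
Proof. by move=> F H; apply: fsubP => t /=; rewrite mulrC. Qed.
Lemma fsub_mul1 : left_id fsub_1 fsub_M.
Proof. by move=> F; apply: fsubP => t /=; rewrite mul1r. Qed.
Lemma fsub_mulDl : left_distributive fsub_M fsub_D.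
Proof. by move=> F H L; apply: fsubP => t /=; rewrite mulrDl. Qed.
Lemma fsub_mulr1 : right_id fsub_1 fsub_M.
Proof. by move=> F; rewrite fsub_mulC fsub_mul1. Qed.
Lemma fsub_mulDr : right_distributive fsub_M fsub_D.
Proof. by move=> F H L; rewrite fsub_mulC fsub_mulDl !(fsub_mulC F). Qed.
HB.instance Definition _ := GRing.Zmodule_isPzRing.Build (fsub Q)
  fsub_mulA fsub_mul1 fsub_mulr1 fsub_mulDl fsub_mulDr.
HB.instance Definition _ := GRing.PzRing_hasCommutativeMul.Build (fsub Q) fsub_mulC.

Definition feval (t : T) (F : fsub Q) : R := F t.
Lemma feval_zmod t : zmod_morphism (feval t). Proof. by []. Qed.
Lemma feval_monoid t : monoid_morphism (feval t). Proof. by []. Qed.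
HB.instance Definition _ t :=
  GRing.isZmodMorphism.Build (fsub Q) R (feval t) (feval_zmod t).
HB.instance Definition _ t :=
  GRing.isMonoidMorphism.Build (fsub Q) R (feval t) (feval_monoid t).

Lemma fsub_sum I (s : seq I) (F : I -> fsub Q) t :
  (\sum_(i <- s) F i : fsub Q) t = \sum_(i <- s) F i t.
Proof. exact: (rmorph_sum (feval t)). Qed.

End FunctionRings.

Section FunctionMorphisms.
Variables (T : Type) (R : comPzRingType) (Q : fpred T R).

Section Constants.
Variables (A : comPzRingType) (e : {rmorphism A -> R}).
Hypothesis eQ : forall a, Q (fun _ => e a).
Definition fconst a : fsub Q := FSub (eQ a).
Lemma fconst_zmod : zmod_morphism fconst.
Proof. by move=> a b; apply: fsubP => t; rewrite /= rmorphB. Qed.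
Lemma fconst_monoid : monoid_morphism fconst.
Proof. by split=> [|a b]; apply: fsubP => t; rewrite /= ?rmorph1 ?rmorphM. Qed.
HB.instance Definition _ := GRing.isZmodMorphism.Build A (fsub Q) fconst fconst_zmod.
HB.instance Definition _ := GRing.isMonoidMorphism.Build A (fsub Q) fconst fconst_monoid.
End Constants.

Section Inclusion.
Variable Q' : fpred T R.
Hypothesis sQ : forall F, Q F -> Q' F.
Definition fincl F : fsub Q' := FSub (sQ (fvalP F)).
Lemma fincl_zmod : zmod_morphism fincl.
Proof. by move=> F H; exact: fsubP. Qed.
Lemma fincl_monoid : monoid_morphism fincl.
Proof. by split=> [|F H]; exact: fsubP. Qed.
HB.instance Definition _ := GRing.isZmodMorphism.Build (fsub Q) (fsub Q') fincl fincl_zmod.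
HB.instance Definition _ := GRing.isMonoidMorphism.Build (fsub Q) (fsub Q') fincl fincl_monoid.
End Inclusion.
End FunctionMorphisms.

(** * Functions on a finite quotient of the Galois group *)

Section GaloisCovers.
Variable K : closedFieldType.
Hypothesis charK : [pchar K] =i pred0.
Local Notation P := (puiseux K).
Local Notation pcst := (@pcst K).
Variables (Om : fieldType) (kap : {rmorphism K -> Om}) (io : {rmorphism Om -> P}).
Variable y : Om.
Local Notation G := (gaut kap y).
Local Notation id1 := (gaut1 kap y).
Variable S : seq Om.
Hypothesis stabS : forall (a : G) v, v \in S -> a v \in S.

Definition eqS (a b : G) := forall v, v \in S -> a v = b v.

(** The group acts on the finite stable set [S] through permutations, hence through a finite
    quotient. *)
Lemma galois_reps : exists m (g : 'I_m -> G) (i0 : 'I_m),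
  [/\ forall a, exists i, eqS a (g i), forall i j, eqS (g i) (g j) -> i = j &
      eqS (g i0) id1].
Proof.
pose n := size S.
have code_lt (a : G) (i : 'I_n) : (index (a (tnth (in_tuple S) i)) S < n)%N.
  by rewrite index_mem stabS // mem_tnth.
pose code (a : G) := [ffun i => Ordinal (code_lt a i)].
have codeP a b : code a = code b <-> eqS a b.
  split=> [ab v vS|ab]; last first.
    by apply/ffunP => i; apply: val_inj; rewrite !ffunE /= ab // mem_tnth.
  have iv : (index v S < n)%N by rewrite index_mem.
  have := congr1 (fun f : {ffun 'I_n -> 'I_n} => val (f (Ordinal iv))) ab.
  rewrite !ffunE /= !(tnth_nth v) /= nth_index // => e.
  by rewrite -[a v](nth_index v (stabS a vS)) e nth_index // stabS.
pose T := [set c | `[< exists a, code a = c >]].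
have Tn (i : 'I_#|T|) : exists a, code a = enum_val i.
  by have := enum_valP i; rewrite inE => /asboolP.
pose g i := projT1 (cid (Tn i)).
have gE i : code (g i) = enum_val i by rewrite /g; case: cid.
have cT a : code a \in T by rewrite inE; apply/asboolP; exists a.
exists #|T|, g, (enum_rank_in (cT id1) (code id1)); split=> [a|i j|].
- exists (enum_rank_in (cT id1) (code a)).
  by apply/codeP; rewrite gE enum_rankK_in.
- by move=> /codeP; rewrite !gE => /enum_val_inj.
- by apply/codeP; rewrite gE enum_rankK_in.
Qed.

Variables (m : nat) (g : 'I_m -> G) (i0 : 'I_m).
Hypothesis g_cov : forall a, exists i, eqS a (g i).
Hypothesis g_inj : forall i j, eqS (g i) (g j) -> i = j.
Hypothesis g_0 : eqS (g i0) id1.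

Definition rho_move (r : {rmorphism P -> P}) (a b : G) :=
  forall u, io (b u) = r (io (a u)).

(** Functions on the finite quotient that are equivariant under local monodromy, which acts on
    automorphisms through the expansion [io]: the Galois descent to K((t)) of the split algebra. *)
Definition isD (F : G -> P) := (forall a b, eqS a b -> F a = F b) /\
  forall r a b, pfix r -> rho_move r a b -> F b = r (F a).

Lemma isD_1 : isD (fun _ => 1).
Proof. by split=> // r a b _ _; rewrite rmorph1. Qed.
Lemma isD_B F H : isD F -> isD H -> isD (fun t => F t - H t).
Proof.
move=> [F1 F2] [H1 H2]; split=> [a b ab|r a b fr ab]; first by rewrite (F1 a b) ?(H1 a b).
by rewrite (F2 r a b) ?(H2 r a b) // rmorphB.
Qed.
Lemma isD_M F H : isD F -> isD H -> isD (fun t => F t * H t).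
Proof.
move=> [F1 F2] [H1 H2]; split=> [a b ab|r a b fr ab]; first by rewrite (F1 a b) ?(H1 a b).
by rewrite (F2 r a b) ?(H2 r a b) // rmorphM.
Qed.
Definition dpred := FPred isD_1 isD_B isD_M.

Lemma isD_shift F (c : G) : isD F -> isD (fun a => F (gautM a c)).
Proof.
move=> [F1 F2]; split=> [a b ab|r a b fr ab].
  by apply: F1 => v vS /=; rewrite ab // stabS.
by apply: (F2 r) => // u /=; exact: ab.
Qed.

Lemma isD_big_shift (T : Type) (idx : T) (op : Monoid.com_law idx) (h : P -> T) F a :
  isD F -> \big[op/idx]_i h (F (gautM a (g i))) = \big[op/idx]_i h (F (g i)).
Proof.
move=> [F1 _]; pose s i := projT1 (cid (g_cov (gautM a (g i)))).
have sE i : eqS (gautM a (g i)) (g (s i)) by rewrite /s; case: cid.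
have s_inj : injective s.
  move=> i j ij; apply: g_inj => v vS; apply: (fmorph_inj a).
  by rewrite -[LHS]/(gautM a (g i) v) sE // ij -sE.
by rewrite [RHS](reindex_inj s_inj); apply: eq_bigr => i _; congr (h _); exact: F1.
Qed.

Lemma isD_sum_shift F a : isD F -> \sum_i F (gautM a (g i)) = \sum_i F (g i).
Proof. exact: (isD_big_shift _ id). Qed.

Hypothesis rho_ex : forall r a, pfix r -> exists b, rho_move r a b.

(** Monodromy permutes the classes by a left translation, so it fixes the sum; and a series fixed by
    the monodromy lies in K((t)). *)
Lemma isD_trace_lvl F : isD F -> lvl 0 (\sum_i F (g i)).
Proof.
move=> FD; apply: (pfix_fixed charK) => r fr; rewrite rmorph_sum.
have [b b1] := rho_ex id1 fr.
rewrite -(isD_sum_shift b FD); apply: eq_bigr => i _.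
have [a ra] := rho_ex (g i) fr; rewrite -(FD.2 r _ _ fr ra); apply: FD.1 => v vS /=.
apply: (fmorph_inj io); rewrite ra; apply/esym; exact: (b1 (g i v)).
Qed.

Lemma g_rinv i : exists i', eqS (gautM (g i) (g i')) id1.
Proof.
pose s l := projT1 (cid (g_cov (gautM (g i) (g l)))).
have sE l : eqS (gautM (g i) (g l)) (g (s l)) by rewrite /s; case: cid.
have s_inj : injective s.
  move=> l k lk; apply: g_inj => v vS; apply: (fmorph_inj (g i)).
  by rewrite -[LHS]/(gautM (g i) (g l) v) sE // lk -sE.
have [t st ts] := injF_bij s_inj; exists (t i0) => v vS.
by rewrite sE // ts g_0.
Qed.

Section Trace.
Variables (R : comPzRingType) (e : {rmorphism R -> P}) (Q : fpred G P).
Hypothesis e_inj : injective e.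
Hypothesis QD : forall F, Q F -> isD F.
Hypothesis Qe : forall r, Q (fun _ => e r).
Hypothesis Qtr : forall F, Q F -> exists r, e r = \sum_i F (g i).
Local Notation f := (fconst Qe).

Definition ftr (F : fsub Q) := projT1 (cid (Qtr (fvalP F))).
Lemma ftrE F : e (ftr F) = \sum_i F (g i).
Proof. by rewrite /ftr; case: cid. Qed.

Lemma ftrB : zmod_morphism ftr.
Proof. by move=> F H; apply: e_inj; rewrite rmorphB !ftrE -sumrB. Qed.
Lemma ftrZ r F : ftr (f r * F) = r * ftr F.
Proof. by apply: e_inj; rewrite rmorphM !ftrE mulr_sumr. Qed.

(* The functions [x k] and [y k] of the fibers: [\sum_k x k (a) * y k (a g_i)] is
   [v] for the trivial coset and vanishes for the cosets in [J]. *)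
Definition separates (v : fsub Q) (J : pred 'I_m) :=
  exists (n : nat) (x y : 'I_n -> fsub Q),
  forall a i, (i == i0 -> \sum_k x k a * y k (gautM a (g i)) = v a) /\
              (J i -> \sum_k x k a * y k (gautM a (g i)) = 0).

Lemma separatesU v v' J J' : separates v J -> separates v' J' ->
  separates (v * v') (fun i => J i || J' i).
Proof.
move=> [n [x [w h]]] [n' [x' [w' h']]].
pose T2 : finType := ('I_n * 'I_n')%type.
pose ev (k : 'I_#|T2|) : 'I_n * 'I_n' := enum_val k.
pose X k : fsub Q := x (ev k).1 * x' (ev k).2.
pose W k : fsub Q := w (ev k).1 * w' (ev k).2.
exists #|T2|, X, W => a i.
have -> : \sum_k X k a * W k (gautM a (g i)) =
    (\sum_k x k a * w k (gautM a (g i))) * (\sum_k x' k a * w' k (gautM a (g i))).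
  rewrite mulr_suml; under [RHS]eq_bigr do rewrite mulr_sumr.
  rewrite pair_bigA /= (reindex ev) /=; last first.
    by apply: onW_bij; exact: enum_val_bij.
  by apply: eq_bigr => k _; rewrite /X /W /= mulrACA.
have [h1 h2] := h a i; have [h3 h4] := h' a i; split=> [ii|/orP[J1|J2]].
- by rewrite h1 ?h3.
- by rewrite h2 ?mul0r.
- by rewrite h4 ?mulr0.
Qed.

Lemma separatesD v v' J : separates v J -> separates v' J -> separates (v + v') J.
Proof.
move=> [n [x [w h]]] [n' [x' [w' h']]].
pose cat (u : 'I_n -> fsub Q) (u' : 'I_n' -> fsub Q) (k : 'I_(n + n')) : fsub Q :=
  match fintype.split k with inl l => u l | inr l => u' l end.
exists (n + n')%N, (cat x x'), (cat w w') => a i.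
have -> : \sum_k cat x x' k a * cat w w' k (gautM a (g i)) =
    \sum_k x k a * w k (gautM a (g i)) + \sum_k x' k a * w' k (gautM a (g i)).
  rewrite big_split_ord; congr (_ + _); apply: eq_bigr => k _; rewrite /cat.
    by rewrite (unsplitK (inl k)).
  by rewrite (unsplitK (inr k)).
have [h1 h2] := h a i; have [h3 h4] := h' a i; split=> [ii|Ji].
- by rewrite h1 ?h3.
- by rewrite h2 ?h4 ?addr0.
Qed.

Lemma separatesZ u v J : separates v J -> separates (u * v) J.
Proof.
move=> [n [x [w h]]]; exists n, (fun k => u * x k), w => a i.
have -> : \sum_k (u * x k : fsub Q) a * w k (gautM a (g i)) =
    u a * \sum_k x k a * w k (gautM a (g i)).
  by rewrite mulr_sumr; apply: eq_bigr => k _; rewrite mulrA.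
by have [h1 h2] := h a i; split=> [/h1->|/h2->]; rewrite ?mulr0.
Qed.

Lemma separates_all (v : 'I_m -> fsub Q) :
  (forall i, i != i0 -> separates (v i) (pred1 i)) ->
  separates (\prod_(i | i != i0) v i) (fun i => i != i0).
Proof.
move=> h.
have hs (s : seq 'I_m) : i0 \notin s -> separates (\prod_(i <- s) v i) (fun i => i \in s).
  elim: s => [_|i s IH].
    rewrite big_nil; exists 1%N, (fun _ => 1), (fun _ => 1) => a i; split=> // _.
    by rewrite big_ord1; exact: mulr1.
  rewrite inE negb_or eq_sym => /andP[ii0 si]; rewrite big_cons.
  have [n [x [w hw]]] := separatesU (h i ii0) (IH si).
  by exists n, x, w => a l; have := hw a l; rewrite inE.
have [|n [x [w hw]]] := hs (filter (fun i => i != i0) (enum 'I_m)).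
  by rewrite mem_filter eqxx.
rewrite -big_filter; exists n, x, w => a i.
have -> : index_enum _ = enum 'I_m by rewrite enumT.
have [w1 w2] := hw a i; split=> // ii0.
by apply: w2; rewrite mem_filter ii0 mem_enum.
Qed.

Hypothesis Qsh : forall F c, Q F -> Q (fun a => F (gautM a c)).
Definition fshift (c : G) (F : fsub Q) : fsub Q := FSub (Qsh c (fvalP F)).

(** Writing F^g for the shift, the factor 1 (x) F - F^g (x) 1 vanishes on the class of [g i] and
    equals F - F^g on the trivial class. The product over the nontrivial classes is a
    discriminant. *)
Lemma separates_disc (F : fsub Q) :
  separates (\prod_(i | i != i0) (F - fshift (g i) F)) (fun i => i != i0).
Proof.
apply: separates_all => i ii0.
have FS a b : eqS a b -> F a = F b by exact: (QD (fvalP F)).1.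
exists 2, (fun k => if k == ord0 then 1 else - fshift (g i) F),
  (fun k => if k == ord0 then F else 1) => a l.
rewrite !big_ord_recl big_ord0 /= addr0 [1 * _]mul1r [_ * 1]mulr1.
split=> [/eqP ->|/eqP ->]; last exact: subrr.
by congr (_ + _); apply: FS => v vS; rewrite /= g_0.
Qed.

Hypothesis sep : separates 1 (fun i => i != i0).

(** Separation with value 1 makes the tensor the Kronecker delta of the classes. The trace is the
    sum over the classes, so contracting with it recovers each function: these are dual bases. *)
Lemma separated_dual : exists (n : nat) (x y : 'I_n -> fsub Q),
  [/\ forall b, b = \sum_k f (ftr (y k * b)) * x k,
      forall b, b = \sum_k f (ftr (x k * b)) * y k & \sum_k x k * y k = 1] /\
  forall F, isD F -> forall a, F a = \sum_k x k a * \sum_i y k (g i) * F (g i).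
Proof.
have [n [x [w h]]] := sep.
have wS (F : fsub Q) a b : eqS a b -> F a = F b by exact: (QD (fvalP F)).1.
have gi0 a : eqS (gautM a (g i0)) a by move=> v vS; rewrite /= g_0.
have h1 a i : \sum_k x k a * w k (gautM a (g i)) = (i == i0)%:R.
  by have [e1 e2] := h a i; case: (i =P i0) => [/eqP/e1|/eqP/e2].
have h2 a i : \sum_k w k a * x k (gautM a (g i)) = (i == i0)%:R.
  have [i' ei'] := g_rinv i.
  have -> : (i == i0) = (i' == i0).
    apply/eqP/eqP => ii; apply: g_inj => v vS.
      by rewrite g_0 // -[RHS](ei' v vS) /= ii g_0 // stabS.
    by rewrite g_0 // -[RHS](ei' v vS) /= ii g_0.
  rewrite -(h1 (gautM a (g i)) i'); apply: eq_bigr => k _; rewrite mulrC; congr (_ * _).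
  by apply: wS => v vS; rewrite /= -[g i (g i' v)]/(gautM (g i) (g i') v) ei'.
have key (u v : 'I_n -> fsub Q) : (forall a i, \sum_k u k a * v k (gautM a (g i)) = (i == i0)%:R) ->
    forall F, isD F -> forall a, F a = \sum_k u k a * \sum_i v k (g i) * F (g i).
  move=> huv F FD a.
  have ek k : \sum_i v k (g i) * F (g i) = \sum_i v k (gautM a (g i)) * F (gautM a (g i)).
    by apply/esym; apply: (isD_sum_shift a (F := fun t => v k t * F t)); apply: isD_M => //; exact/QD/fvalP.
  under eq_bigr do rewrite ek mulr_sumr.
  rewrite exchange_big /= (bigD1 i0) //= [X in _ + X]big1 ?addr0 => [|i ii0].
    under eq_bigr do rewrite mulrA.
    by rewrite -mulr_suml huv eqxx mul1r; apply/esym/FD.1/gi0.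
  under eq_bigr do rewrite mulrA.
  by rewrite -mulr_suml huv (negPf ii0) mul0r.
have key' (u v : 'I_n -> fsub Q) : (forall a i, \sum_k u k a * v k (gautM a (g i)) = (i == i0)%:R) ->
    forall b, b = \sum_k f (ftr (v k * b)) * u k.
  move=> huv b; apply: fsubP => a; rewrite fsub_sum (key _ _ huv b (QD (fvalP b)) a).
  by apply: eq_bigr => k _; rewrite mulrC; congr (_ * _); rewrite /= ftrE.
exists n, x, w; split; last by exact: key.
split; try exact: key'.
apply: fsubP => a; rewrite fsub_sum; apply: etrans _ (etrans (h1 a i0) (congr1 (fun b : bool => b%:R) (eqxx i0))).
by apply: eq_bigr => k _ /=; congr (_ * _); apply/esym/wS/gi0.
Qed.

Lemma cover_etale : finite_etale f.
Proof.
have [n [x [w [[d1 d2 d3] _]]]] := separated_dual.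
exact: (trace_finite_etale ftrB ftrZ d1 d2 d3).
Qed.

Hypothesis lauD : forall a, isD (fun _ => @lau K 0 a).
Variable (toT : {rmorphism R -> laurent K}).
Hypothesis toTE : forall r, @lau K 0 (toT r) = e r.

Lemma cover_pushout : is_pushout f toT (fincl (Q' := dpred) QD)
  (fconst (Q := dpred) lauD).
Proof.
have [n [x [w [[d1 d2 d3] dd]]]] := separated_dual.
have trx (F : fsub dpred) : exists r, @lau K 0 r = \sum_i F (g i).
  by have [r er] := isD_trace_lvl (fvalP F); exists r.
pose trd F := projT1 (cid (trx F)).
have trdE F : @lau K 0 (trd F) = \sum_i F (g i) by rewrite /trd; case: cid.
have lau_inj : injective (@lau K 0) by exact: fmorph_inj.
have lauB (s t : laurent K) : @lau K 0 (s - t) = @lau K 0 s - @lau K 0 t by exact: rmorphB.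
have lauM (s t : laurent K) : @lau K 0 (s * t) = @lau K 0 s * @lau K 0 t by exact: rmorphM.
apply: (@trace_pushout _ _ f ftr n x w d1 _ _ toT _ _ trd).
- by move=> r; apply: fsubP => a; rewrite /= toTE.
- move=> F H; apply: lau_inj; rewrite trdE lauB !trdE -sumrB.
  by [].
- by move=> t F; apply: lau_inj; rewrite trdE lauM trdE mulr_sumr.
- by move=> F; apply: lau_inj; rewrite toTE trdE ftrE.
- move=> F; apply: fsubP => a; rewrite fsub_sum (dd F (fvalP F) a).
  by apply: eq_bigr => k _ /=; rewrite trdE.
Qed.

End Trace.
End GaloisCovers.

(** * General position over an algebraically closed field *)

Section FieldAvoidance.
Variable K : closedFieldType.
Hypothesis charK : [pchar K] =i pred0.

(** A root of 1 + X times the product of the X - a lies outside the list. *)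
Lemma exists_notin (s : seq K) : exists c, c \notin s.
Proof.
have [|c /rootP] := closed_root (@solve_monicpoly K) (p := 1 + 'X * \prod_(a <- s) ('X - a%:P)).
  have s0 : \prod_(a <- s) ('X - a%:P) != 0 :> {poly K} by rewrite monic_neq0 // monic_prod_XsubC.
  rewrite addrC size_polyDl ?size_polyC ?oner_eq0 mulrC size_mulX // size_prod_XsubC //.
move=> e; exists c; apply/negP; rewrite -root_prod_XsubC => /rootP c0.
by move/eqP: e; rewrite !hornerE c0 mulr0 addr0 oner_eq0.
Qed.

(** A one-variable Nullstellensatz: the roots of a generator of the ideal are roots of [f], so the
    generator divides a power of [f]. *)
Lemma poly_ideal (I : {poly K} -> Prop) (f : {poly K}) : f != 0 ->
  (forall p q, I p -> I q -> I (p + q)) -> (forall p q, I q -> I (p * q)) ->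
  (forall c, f.[c] != 0 -> exists2 p, I p & p.[c] != 0) -> exists n, I (f ^+ n).
Proof.
move=> f0 ID IM If.
have rts (p : {poly K}) : p != 0 -> exists r, p = lead_coef p *: \prod_(a <- r) ('X - a%:P).
  move=> p0; have [|r er] := closed_normal (@solve_monicpoly K) (p := (lead_coef p)^-1 *: p).
    by rewrite monicE lead_coefZ mulVf // lead_coef_eq0.
  by exists r; rewrite -er scalerA mulfV ?lead_coef_eq0 // scale1r.
have [c fc] : exists c, f.[c] != 0.
  have [r er] := rts _ f0; have [c cr] := exists_notin r; exists c.
  rewrite er hornerZ mulf_neq0 ?lead_coef_eq0 //.
  by rewrite -/(root _ _) root_prod_XsubC.
have [p0 Ip0 pc0] := If _ fc.
have exd : exists n, `[< exists p, [/\ I p, p != 0 & size p = n] >].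
  exists (size p0); apply/asboolP; exists p0; split=> //.
  by apply: contraNneq pc0 => ->; rewrite horner0.
have [d [Id d0 ds] dmin] : exists2 d, [/\ I d, d != 0 & size d = ex_minn exd] &
    forall q, I q -> q != 0 -> (size d <= size q)%N.
  case: ex_minnP => n /asboolP[d [Id d0 ds]] nmin; exists d => // q Iq q0.
  by rewrite ds; apply: nmin; apply/asboolP; exists q.
have dvd q : I q -> exists a, q = a * d.
  move=> Iq; exists (q %/ d); apply/eqP; rewrite -subr_eq0; apply: contraT => r0.
  have rE : q - q %/ d * d = q %% d.
    by rewrite {1}(divp_eq q d) addrC addKr.
  have Ir : I (q - q %/ d * d) by rewrite -mulNr; apply: ID => //; exact: IM.
  by have := dmin _ Ir r0; rewrite rE leqNgt ltn_modp d0.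
have [r er] := rts _ d0; exists (size r).
have fr a : a \in r -> exists b, f = b * ('X - a%:P).
  move=> ar; apply/factor_theorem; apply: contraT => fa.
  have [p /dvd[q ->]] := If a fa; rewrite hornerM er hornerZ.
  have /rootP -> : root (\prod_(a0 <- r) ('X - a0%:P)) a by rewrite root_prod_XsubC.
  by rewrite !mulr0 eqxx.
have [b eb] : exists b, f ^+ size r = b * \prod_(a <- r) ('X - a%:P).
  elim: r fr {er} => [|a r IH] fr; first by exists 1; rewrite big_nil expr0 mulr1.
  have [b1 e1] := fr a (mem_head a r).
  have [x xr|b2 e2] := IH; first by apply: fr; rewrite inE xr orbT.
  by exists (b1 * b2); rewrite big_cons /= exprS {1}e1 e2; ring.
have -> : f ^+ size r = ((lead_coef d)^-1 *: b) * d.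
  by rewrite eb {2}er -scalerAl -scalerAr scalerA mulVf ?scale1r // lead_coef_eq0.
exact: IM.
Qed.

(** Finitely many nonzero linear forms have a common point where none vanishes: by induction, v + c
    u works for all but finitely many c. *)
Lemma generic_nonzero (V : zmodType) (sc : K -> V -> V) (D : V -> Prop) (I : eqType)
    (phi : I -> V -> K) (s : seq I) :
  D 0 -> (forall u v, D u -> D v -> D (u + v)) -> (forall c v, D v -> D (sc c v)) ->
  (forall i u v, D u -> D v -> phi i (u + v) = phi i u + phi i v) ->
  (forall i c v, D v -> phi i (sc c v) = c * phi i v) ->
  (forall i, i \in s -> exists2 v, D v & phi i v != 0) ->
  exists2 v, D v & forall i, i \in s -> phi i v != 0.
Proof.
move=> D0 DD DZ pD pZ; elim: s => [_|i s IH h]; first by exists 0.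
have [j js|v Dv vs] := IH; first by apply: h; rewrite inE js orbT.
have [u Du ui] := h i (mem_head i s).
have [c] := exists_notin ([seq - phi j v / phi j u | j <- i :: s]).
move=> cn; exists (v + sc c u); first by apply: DD => //; exact: DZ.
move=> j js; rewrite pD ?pZ //; last exact: DZ.
have [u0|u0] := eqVneq (phi j u) 0.
  rewrite u0 mulr0 addr0; move: js; rewrite inE => /orP[/eqP ji|]; last exact: vs.
  by move: ui; rewrite -ji u0 eqxx.
apply: contraNneq cn => e; apply/mapP; exists j => //.
by apply: (mulIf u0); rewrite divfK //; apply/eqP; rewrite -addr_eq0 addrC e.
Qed.
End FieldAvoidance.

(** * The algebra of unramified functions over the line minus 0 and 1 *)

Section Unramified.
Variable K : closedFieldType.
Hypothesis charK : [pchar K] =i pred0.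
Local Notation P := (puiseux K).
Local Notation pcst := (@pcst K).
Variables (Om : fieldType) (kap : {rmorphism K -> Om}) (io : {rmorphism Om -> P}).
Hypothesis clOm : GRing.closed_field_axiom Om.
Hypothesis io_kap : forall c, io (kap c) = pcst c.
Variables (y : Om) (ny : nonconst kap y).
Hypothesis algy : forall u, algebraicOver (ratev ny) u.
Local Notation G := (gaut kap y).
Local Notation f01 := ('X * (1 - 'X) : {poly K}).

Lemma f01E c : (f01.[c] != 0) = (c != 0) && (c != 1).
Proof. by rewrite !hornerE mulf_eq0 negb_or subr_eq0 (eq_sym 1). Qed.

Lemma f01_neq0 : f01 != 0.
Proof.
rewrite mulf_neq0 ?polyX_eq0 // subr_eq0.
by apply/eqP => /(congr1 (fun p : {poly K} => size p)); rewrite size_polyX size_poly1.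
Qed.

Lemma j_ratev (j : {rmorphism Om -> P}) Y (nY : nonconst pcst Y) r :
  place kap j -> j y = Y -> j (ratev ny r) = ratev nY r.
Proof. by move=> pj jy; exact: (@ratev_comp K Om P kap pcst j y _ ny nY pj jy). Qed.

Definition residue_at c (Y : P) := [/\ lvl 0 Y, pint Y & pc Y 0 = c].

Lemma residue_at_cX c : residue_at c (pcst c + pX K).
Proof.
by split; [exact: lvl_cX|exact: pint_cX|exact: res_cX].
Qed.

(* Being unramified over the affine line minus {0, 1} is tested on Puiseux
   expansions, at all the places over these points. *)
Definition unramified u := forall c, f01.[c] != 0 -> forall j : {rmorphism Om -> P},
  place kap j -> residue_at c (j y) -> lvl 0 (j u).

Lemma unramified_ratev r : unramified (ratev ny r).
Proof.
move=> c _ j plj [l0 _ _].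
rewrite (j_ratev (place_nc ny plj)) //.
exact: lvl_ratev.
Qed.
Lemma unramifiedB u v : unramified u -> unramified v -> unramified (u - v).
Proof. by move=> hu hv c c0 j pj jy; rewrite rmorphB; apply: lvlB; [exact: (hu c)|exact: (hv c)]. Qed.
Lemma unramifiedM u v : unramified u -> unramified v -> unramified (u * v).
Proof. by move=> hu hv c c0 j pj jy; rewrite rmorphM; apply: lvlM; [exact: (hu c)|exact: (hv c)]. Qed.
Lemma unramifiedV u : unramified u -> unramified u^-1.
Proof. by move=> hu c c0 j pj jy; rewrite fmorphV; apply: lvlV; exact: (hu c). Qed.
Lemma place_gaut (a : G) (j : {rmorphism Om -> P}) : place kap j -> place kap (j \o a : {rmorphism Om -> P}).
Proof. by move=> pj c; rewrite /= ga_kap. Qed.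
Lemma unramified_gaut (a : G) u : unramified u -> unramified (a u).
Proof.
move=> hu c c0 j pj jy; apply: (hu c c0 (j \o a)); first exact: place_gaut.
by rewrite /= ga_y.
Qed.

Lemma place_conj (j j' : {rmorphism Om -> P}) : place kap j -> place kap j' ->
  j y = j' y -> exists a : G, j' =1 j \o a.
Proof.
move=> pj pj' jy; have nY := place_nc ny pj'.
have e := @ratev_comp K Om P kap pcst j y _ ny nY pj jy.
have e' := @ratev_comp K Om P kap pcst j' y _ ny nY pj' erefl.
have [u|a ja] := io_lift (io := j) (g := j').
  have [p p0 pu] := algy u; apply: (io_image clOm (io := j) (kap := kap) (y := y) (ny := ny)).
  exists p => //; rewrite (eq_map_poly (g := j' \o ratev ny)); last first.
    by move=> r; rewrite [LHS]e [RHS]e'.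
  by rewrite map_poly_comp fmorph_root.
have ak c : a (kap c) = kap c by apply: (fmorph_inj j); rewrite [LHS]ja pj pj'.
have ay : a y = y by apply: (fmorph_inj j); rewrite [LHS]ja jy.
by exists (Gaut ak ay) => u; rewrite [RHS]ja.
Qed.

Variables (z : pseries K) (zP : ps_nonunit z).
Hypothesis ioy : io y = pser 0 z.

Lemma cover_unramified (O : tcover zP) (h : {rmorphism tc_B O -> Om}) b :
  h \o tc_b O =1 ostd ny -> unramified (h b).
Proof.
move=> ho c c0 j pj [l0 ij rj].
have e a : j (h (tc_b O a)) = ratev (place_nc ny pj) (val a).
  rewrite -[h _]/((h \o tc_b O) a) ho.
  exact: j_ratev.
apply: (@etale_unramified K charK _ _ (tc_b O) (j \o h) b (tc_etB O)) => a /=; rewrite e.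
  exact: lvl_ratev.
by apply: pint_loc; [exact: valP|exact: ij|rewrite rj].
Qed.

Lemma rho_move_ex (r : {rmorphism P -> P}) (a : G) : pfix r -> exists b : G, rho_move io r a b.
Proof.
move=> fr; have rst x : r (io (ratev ny x)) = io (ratev ny x).
  rewrite (io_ratev io_kap ny ioy (nc_nonunit zP)); apply: (pfix_lvl fr).
  by apply: lvl_ratev; exact: lvl_ps.
have [u|b rb] := io_lift (io := io) (g := (r \o (io \o a) : {rmorphism Om -> P})).
  have [p p0 pu] := algy u; apply: (io_image clOm (io := io) (kap := kap) (y := y) (ny := ny)).
  exists p => //; rewrite (eq_map_poly (g := (r \o (io \o a)) \o ratev ny)); last first.
    by move=> x /=; rewrite ga_ratev rst.
  by rewrite map_poly_comp fmorph_root.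
have bk c : b (kap c) = kap c.
  apply: (fmorph_inj io); rewrite [LHS]rb /= ga_kap io_kap.
  by apply: (pfix_lvl fr); exact: lvl_cst.
have by_ : b y = y.
  apply: (fmorph_inj io); rewrite [LHS]rb /= ga_y ioy.
  by apply: (pfix_lvl fr); exact: lvl_ps.
by exists (Gaut bk by_) => u; exact: rb.
Qed.

Variable S : seq Om.
Hypothesis stabS : forall (a : G) v, v \in S -> a v \in S.
Hypothesis unrS : forall v, v \in S -> unramified v.

Definition fixedS b := forall a : G, (forall v, v \in S -> a v = v) -> a b = b.
(** For unramified [S], the integral closure of K[z, 1/z, 1/(1-z)] in the field generated by [S],
    described by expansions at all places. *)
Definition inB b := [/\ fixedS b, unramified b & forall c, f01.[c] != 0 ->
  forall j : {rmorphism Om -> P}, place kap j -> j y = pcst c + pX K -> pint (j b)].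

Lemma fixedS_ratev r : fixedS (ratev ny r).
Proof. by move=> a _; exact: ga_ratev. Qed.
Lemma fixedS_gaut (a : G) b : fixedS b -> fixedS (a b).
Proof.
move=> hb c cS; have e v : v \in S -> (gautM (gautV clOm algy a) (gautM c a)) v = v.
  by move=> vS; rewrite /= cS ?stabS // gautK.
by have /= := hb _ e; move=> /(congr1 a); rewrite gautVK.
Qed.
Lemma inB_ostd a : inB (ostd ny a).
Proof.
split; [exact: fixedS_ratev|exact: unramified_ratev|] => c c0 j pj jy.
have -> : j (ostd ny a) = ratev (@ncX K c) (val a).
  exact: j_ratev.
by apply: pint_loc; [exact: valP|exact: pint_cX|rewrite res_cX].
Qed.
Lemma inBB u v : inB u -> inB v -> inB (u - v).
Proof.
move=> [u1 u2 u3] [v1 v2 v3]; split.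
- by move=> a aS; rewrite rmorphB u1 ?v1.
- exact: unramifiedB.
- by move=> c c0 j pj jy; rewrite rmorphB; apply: pintB; [exact: (u3 c)|exact: (v3 c)].
Qed.
Lemma inBM u v : inB u -> inB v -> inB (u * v).
Proof.
move=> [u1 u2 u3] [v1 v2 v3]; split.
- by move=> a aS; rewrite rmorphM u1 ?v1.
- exact: unramifiedM.
- by move=> c c0 j pj jy; rewrite rmorphM; apply: pintM; [exact: (u3 c)|exact: (v3 c)].
Qed.
Lemma inB_gaut (a : G) b : inB b -> inB (a b).
Proof.
move=> [b1 b2 b3]; split; [exact: fixedS_gaut|exact: unramified_gaut|].
move=> c c0 j pj jy; apply: (b3 c c0 (j \o a)); first exact: place_gaut.
by rewrite /= ga_y.
Qed.

Lemma inB_fixed b : inB b -> (forall a : G, a b = b) -> exists a, b = ostd ny a.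
Proof.
move=> [_ _ b3] hb; have charO : [pchar Om] =i pred0.
  by move=> l; rewrite (fmorph_pchar kap); exact: charK.
have [a fa|r er] := fixed_in clOm charO algy (u := b).
  have ak c : a (kap c) = kap c by rewrite -(pevC kap y) -(ratev_poly ny) [LHS]fa.
  have ay : a y = y by rewrite -{1}(pevX kap y) -(ratev_poly ny) [LHS]fa /= ratev_poly pevX.
  exact: (hb (Gaut ak ay)).
have rP : r \in loc_pred f01.
  apply: frac_pole => c c0; have [j pj jy] := place_ex charK algy (@ncX K c).
  have := b3 c c0 j pj jy; rewrite er.
  by rewrite (j_ratev (@ncX K c)).
by exists (LocRing rP).
Qed.

Lemma inB_fixedS b : inB b -> fixedS b. Proof. by case. Qed.

(** An element is encoded by the expansions of its conjugates, so that it is a function on the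
    Galois group like the elements of the other two algebras. *)
Definition isB (F : G -> P) := exists2 b, inB b & forall a, F a = io (a b).

Lemma isB_1 : isB (fun _ => 1).
Proof.
exists 1 => [|a]; last by rewrite !rmorph1.
by have := inB_ostd 1; rewrite rmorph1.
Qed.
Lemma isB_B F H : isB F -> isB H -> isB (fun t => F t - H t).
Proof.
move=> [b hb eb] [c hc ec]; exists (b - c); first exact: inBB.
by move=> a; rewrite !rmorphB eb ec.
Qed.
Lemma isB_M F H : isB F -> isB H -> isB (fun t => F t * H t).
Proof.
move=> [b hb eb] [c hc ec]; exists (b * c); first exact: inBM.
by move=> a; rewrite !rmorphM eb ec.
Qed.
Definition bpred := FPred isB_1 isB_B isB_M.

Lemma fixedS_eq b (a a' : G) : fixedS b -> eqS S a a' -> a b = a' b.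
Proof.
move=> hb e; have /= := hb (gautM (gautV clOm algy a') a).
move=> /(_ _)/(congr1 a'); rewrite gautVK; apply.
by move=> v vS /=; rewrite e // gautK.
Qed.

Lemma isB_D F : isB F -> isD io S F.
Proof.
move=> [b [hb _ _] eb]; split=> [a a' aa'|r a a' _ aa']; rewrite !eb; last exact: aa'.
by rewrite (fixedS_eq hb aa').
Qed.

Lemma isB_shift F (c : G) : isB F -> isB (fun a => F (gautM a c)).
Proof. by move=> [b hb eb]; exists (c b); [exact: inB_gaut|move=> a; rewrite eb]. Qed.

Definition io_ostd_rm : {rmorphism P1_minus_01oo K -> P} := io \o ostd ny.
Lemma isB_const a : isB (fun _ => io_ostd_rm a).
Proof. by exists (ostd ny a); [exact: inB_ostd|move=> t; rewrite /= ga_ratev]. Qed.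
Lemma io_ostd_inj : injective io_ostd_rm.
Proof. by move=> a b /fmorph_inj/fmorph_inj/val_inj. Qed.

Variables (m : nat) (g : 'I_m -> G) (i0 : 'I_m).
Hypothesis g_cov : forall a, exists i, eqS S a (g i).
Hypothesis g_inj : forall i j, eqS S (g i) (g j) -> i = j.
Hypothesis g_0 : eqS S (g i0) (gaut1 kap y).

Lemma isB_trace F : isB F -> exists r, io_ostd_rm r = \sum_i F (g i).
Proof.
move=> FB; have [b hb eb] := FB; have FD := isB_D FB.
have inS : inB (\sum_i g i b).
  have in0 : inB 0 by have := inB_ostd 0; rewrite rmorph0.
  have inD u v : inB u -> inB v -> inB (u + v).
    by move=> hu hv; rewrite -[v]opprK -[- v]sub0r; apply: inBB => //; exact: inBB.
  by apply: (big_ind inB) => // i _; exact: inB_gaut.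
have [a|r er] := inB_fixed inS; last first.
  exists r; apply: etrans (congr1 io (esym er)) _; rewrite rmorph_sum.
  by apply: eq_bigr => i _; rewrite eb.
apply: (fmorph_inj io); rewrite !rmorph_sum /=.
transitivity (\sum_i F (gautM a (g i))); first by apply: eq_bigr => i _; rewrite eb.
by rewrite (isD_sum_shift g_cov g_inj a FD); apply: eq_bigr => i _; rewrite eb.
Qed.

Section LocalSeparation.
Variables (c : K) (j : {rmorphism Om -> P}).
Hypotheses (c0 : f01.[c] != 0) (pj : place kap j) (jy : j y = pcst c + pX K).

(** As [inB], but integral only at the places above c: a localization. *)
Definition locB F := [/\ fixedS F, unramified F & forall k, pint (j (g k F))].

Lemma ps_drop n (h : pseries K) : pser 0 h =
  \sum_(k < n) pcst (coefps h k) * pX K ^+ k +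
  pX K ^+ n * pser 0 (PSeries (fun k => coefps h (n + k))).
Proof.
elim: n => [|n IH].
  by rewrite big_ord0 add0r expr0 mul1r; congr pser; exact: psP.
rewrite IH big_ord_recr /= -addrA; congr (_ + _).
rewrite exprSr -mulrA -[pcst _ * _]mulrC -mulrDr; congr (_ * _).
rewrite -[pcst _]/(pser 0 _) -[pX K]/(pser 0 (psX K)) -rmorphM -rmorphD; congr pser.
apply: psP => -[|k] /=; first by rewrite big_ord1 mul0r addr0 addn0.
rewrite big_ord_recl mul0r !add0r big_ord_recl /= subSS subn0 mul1r big1 ?addr0 ?addSnnS //.
by move=> i _; rewrite mul0r.
Qed.

Lemma j_pev p : j (pev kap y p) = pev pcst (pcst c + pX K) p.
Proof. by rewrite (place_pev _ p pj) jy. Qed.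
Lemma g_pev k p : g k (pev kap y p) = pev kap y p.
Proof. by rewrite -(ratev_poly ny); exact: ga_ratev. Qed.
Lemma pev_fixed p : fixedS (pev kap y p).
Proof. by rewrite -(ratev_poly ny); exact: fixedS_ratev. Qed.
Lemma pev_unramified p : unramified (pev kap y p).
Proof. by rewrite -(ratev_poly ny); exact: unramified_ratev. Qed.
Lemma j_X : j (pev kap y ('X - c%:P)) = pX K.
Proof. by rewrite j_pev rmorphB /= pevX pevC addrC addKr. Qed.
Lemma fixedSM u v : fixedS u -> fixedS v -> fixedS (u * v).
Proof. by move=> hu hv a aS; rewrite rmorphM hu ?hv. Qed.
Lemma fixedSB u v : fixedS u -> fixedS v -> fixedS (u - v).
Proof. by move=> hu hv a aS; rewrite rmorphB hu ?hv. Qed.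
Lemma fixedSV u : fixedS u -> fixedS u^-1.
Proof. by move=> hu a aS; rewrite fmorphV hu. Qed.

(** Some [u] in [S] is moved differently by [g i] and [g l]. Subtracting the Taylor polynomial that
    the two expansions share, and dividing by the power of y - c up to which they agree, makes the
    residues differ. Poles may arise at other conjugates; the transformation 1 / (x - lam), with
    [lam] outside all residues, removes them. *)
Lemma separate_pair i l : i != l -> exists2 F, locB F &
  pc (j (g i F)) 0 != pc (j (g l F)) 0.
Proof.
move=> il; have [u uS ne] : exists2 u, u \in S & g i u != g l u.
  apply: contrapT => h; case/eqP: il; apply: g_inj => v vS; apply/eqP.
  by apply: contrapT => /negP nv; apply: h; exists v.
have [q q0 qP] := clear_poles charK algy u.
pose u' := pev kap y q * u.
have fu' : fixedS u' by apply: fixedSM; [exact: pev_fixed|move=> a; apply].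
have ru' : unramified u' by apply: unramifiedM; [exact: pev_unramified|exact: unrS].
have pg k : place kap (j \o g k : {rmorphism Om -> P}) by exact: place_gaut.
have [h hE] : exists h, forall k, j (g k u') = pser 0 (h k).
  have hk k : exists s, j (g k u') = pser 0 s.
    apply: lvl_int_ps.
      by apply: (ru' c c0 _ (pg k)); rewrite /= ga_y jy; exact: residue_at_cX.
    by apply: (qP (j \o g k)) => //; rewrite /= ga_y jy; exact: pint_cX.
  by exists (fun k => projT1 (cid (hk k))) => k; case: cid.
have hne : h i - h l != 0.
  rewrite subr_eq0; apply: contraNneq ne => e.
  have := hE i; rewrite e -hE => /fmorph_inj; rewrite !rmorphM !g_pev => /mulfI -> //.
  by rewrite -(ratev_poly ny) fmorph_eq0 tofrac_eq0.
clearbody u'.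
have [n [hn hlt]] := ps_neq0P hne.
pose tau := \sum_(k < n) (coefps (h i) k)%:P * ('X - c%:P) ^+ k.
pose t := pev kap y ('X - c%:P).
have t0 : t != 0 by rewrite -(fmorph_eq0 j) j_X pX_neq0.
pose u1 := (u' - pev kap y tau) / t ^+ n.
have fu1 : fixedS u1.
  apply: fixedSM; first by apply: fixedSB => //; exact: pev_fixed.
  by apply: fixedSV; rewrite -rmorphXn; exact: pev_fixed.
have ru1 : unramified u1.
  apply: unramifiedM; first by apply: unramifiedB => //; exact: pev_unramified.
  by apply: unramifiedV; rewrite -rmorphXn; exact: pev_unramified.
have jtau : j (pev kap y tau) = \sum_(k < n) pcst (coefps (h i) k) * pX K ^+ k.
  rewrite /tau !rmorph_sum; apply: eq_bigr => k _.
  by rewrite !rmorphM !rmorphXn j_X /= pevC pj.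
have res1 k : (forall o, (o < n)%N -> coefps (h i) o = coefps (h k) o) ->
    pint (j (g k u1)) /\ pc (j (g k u1)) 0 = coefps (h k) n.
  move=> hk; have -> : j (g k u1) = pser 0 (PSeries (fun o => coefps (h k) (n + o))).
    rewrite /u1 !(rmorphM, rmorphB, fmorphV, rmorphXn) !g_pev /= jtau hE j_X (ps_drop n (h k)).
    have -> : \sum_(o < n) pcst (coefps (h i) o) * pX K ^+ o =
        \sum_(o < n) pcst (coefps (h k) o) * pX K ^+ o.
      by apply: eq_bigr => o _; rewrite hk.
    by rewrite addrC addKr mulrC mulKf // expf_neq0 // pX_neq0.
  split.
    move=> x x0; apply: contrapT => /eqP/plev_pser[o eo]; move: x0.
    by rewrite eo /pexp subr0 divr1 ltrn0.
  have := @pc_pser K 0 (PSeries (fun o => coefps (h k) (n + o))) 0.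
  by rewrite /pexp subr0 mul0r /= addn0.
have [pi_ ri] := res1 i (fun _ _ => erefl).
have [|pl rl] := res1 l.
  by move=> o /hlt /= /eqP; rewrite subr_eq0 => /eqP.
have [lam ln] := exists_notin [seq pc (j (g k u1)) 0 | k <- enum 'I_m].
have lk k : pc (j (g k u1)) 0 - lam != 0.
  by rewrite subr_eq0; apply: contraNneq ln => <-; apply: map_f; rewrite mem_enum.
have jF k : j (g k (u1 - kap lam)^-1) = (j (g k u1) - pcst lam)^-1.
  by rewrite !fmorphV !rmorphB ga_kap pj.
have rk k : pc (j (g k u1) - pcst lam) 0 != 0.
  by rewrite pcB [pc (pcst _) _]res_cst.
have pk k : pint (j (g k u1)) -> pint (j (g k u1) - pcst lam).
  by move=> h1; apply: pintB => //; exact: pint_cst.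
exists (u1 - kap lam)^-1; first split.
- by apply: fixedSV; apply: fixedSB => // a _; exact: ga_kap.
- apply: unramifiedV; apply: unramifiedB => //.
  by rewrite -(pevC kap y); exact: pev_unramified.
- move=> k; rewrite jF.
  have [h1|h1] := pselect (pint (j (g k u1) - pcst lam)); first exact: pint_unit.
  by have [] := pint_or_inv h1.
rewrite !jF (res_inv (pk _ pi_)) ?rk // (res_inv (pk _ pl)) ?rk //.
rewrite (inj_eq invr_inj) !pcB ri rl (inj_eq (addIr _)).
by move: hn; rewrite /= subr_eq0.
Qed.

(** Differences of residues are linear forms, so a generic combination separates all pairs of
    classes at once. *)
Lemma separate_all : exists2 F, locB F &
  forall i l, i != l -> pc (j (g i F)) 0 != pc (j (g l F)) 0.
Proof.
pose phi (s : 'I_m * 'I_m) v := pc (j (g s.1 v)) 0 - pc (j (g s.2 v)) 0.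
have [||c1 v|s u v _ _|s c1 v [_ _ vk]|s|F FB hF] := @generic_nonzero K Om (fun c v => kap c * v)
  locB _ phi [seq s <- enum {: 'I_m * 'I_m} | s.1 != s.2].
- split; first by move=> a _; rewrite rmorph0.
    by move=> c1 _ j1 _ _; rewrite rmorph0; exact: lvl0.
  by move=> k; rewrite !rmorph0; exact: pge0.
- move=> u v [u1 u2 u3] [v1 v2 v3]; split.
  + by move=> a aS; rewrite rmorphD u1 ?v1.
  + by move=> c1 h1 j1 h2 h3; rewrite rmorphD; apply: lvlD; [exact: (u2 c1)|exact: (v2 c1)].
  + by move=> k; rewrite !rmorphD; exact: pintD.
- move=> [v1 v2 v3]; split.
  + by move=> a aS; rewrite rmorphM ga_kap v1.
  + apply: unramifiedM => //; rewrite -(pevC kap y); exact: pev_unramified.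
  + by move=> k; rewrite !rmorphM ga_kap pj; apply: pintM => //; exact: pint_cst.
- by rewrite /phi !rmorphD !pcD; ring.
- have pp k : pc (j (g k (kap c1 * v))) 0 = c1 * pc (j (g k v)) 0.
    by rewrite !rmorphM ga_kap pj pc_cstM.
  by rewrite /phi !pp mulrBr.
- rewrite mem_filter => /andP[s12 _]; have [F FB hF] := separate_pair s12.
  by exists F => //; rewrite /phi subr_eq0.
exists F => // i l il; have := hF (i, l); rewrite mem_filter mem_enum il /phi subr_eq0.
by apply.
Qed.

(** The poles above points other than c are removed by a polynomial that does not vanish at c: the
    clearing polynomial without its factors X - c. *)
Lemma separate_inB : exists2 b, inB b &
  forall i l, i != l -> pc (j (g i b)) 0 != pc (j (g l b)) 0.
Proof.
have [F [f1 f2 f3] hF] := separate_all.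
have [q q0 qP] := clear_poles charK algy F.
have [k [q' q'c qE]] := multiplicity_XsubC q c.
rewrite q0 /= in q'c.
exists (pev kap y q' * F).
  split.
  - by apply: fixedSM => //; exact: pev_fixed.
  - by apply: unramifiedM => //; exact: pev_unramified.
  - move=> c' c'0 j' pj' jy'; have [cc|cc] := eqVneq c' c.
      have jj : j y = j' y by rewrite jy jy' cc.
      have [a ja] := place_conj pj pj' jj; have [l al] := g_cov a.
      rewrite ja /= rmorphM (fixedS_eq f1 al) -(ratev_poly ny) ga_ratev ratev_poly.
      rewrite rmorphM j_pev; apply: pintM => //.
      by have [] := pint_pev q' (pint_cX c).
    have iq : pint (j' (pev kap y q * F)) by apply: qP => //; rewrite jy'; exact: pint_cX.
    have [ix rx] := pint_pev ('X - c%:P) (pint_cX c').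
    rewrite res_cX !hornerE in rx.
    have x0 : pev pcst (pcst c' + pX K) ('X - c%:P) != 0.
      apply/eqP => e; move: rx; rewrite e pc0 => /esym/eqP.
      by rewrite subr_eq0 (negPf cc).
    have -> : j' (pev kap y q' * F) =
        j' (pev kap y q * F) * (pev pcst (pcst c' + pX K) ('X - c%:P)) ^- k.
      rewrite qE !rmorphM !rmorphXn /= (place_pev _ ('X - c%:P) pj') jy'.
      by rewrite [RHS]mulrAC mulfK // expf_neq0.
    rewrite -exprVn; apply: pintM => //; apply: pintX.
    by have := pint_unit ix; rewrite rx subr_eq0 => /(_ cc).
have [iq rq] := pint_pev q' (pint_cX c); rewrite res_cX in rq.
have pe k0 : pc (j (g k0 (pev kap y q' * F))) 0 = q'.[c] * pc (j (g k0 F)) 0.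
  by rewrite !rmorphM g_pev j_pev res_mul // rq.
by move=> i l il; rewrite !pe (inj_eq (mulfI _)) ?hF.
Qed.

End LocalSeparation.

Local Notation Bc := (@fconst G P bpred _ io_ostd_rm isB_const).
Local Notation Bsep v := (@separates K Om kap y m g i0 bpred v (fun i => i != i0)).
Local Notation l01 p := (loc_poly f01 p : P1_minus_01oo K).

Lemma loc_clear (r : P1_minus_01oo K) : exists n p, l01 p = r * l01 f01 ^+ n.
Proof.
have /asboolP[n [p e]] := valP r; exists n, p; apply: val_inj.
by rewrite rmorphM rmorphXn /= e.
Qed.

(** For [b] separating the conjugates at c, the discriminant has nonzero residues there. Multiplied
    by its other conjugates it becomes a norm in the base ring; up to a power of X (1 - X) this is
    [p]. *)
Lemma separate_value c : f01.[c] != 0 -> exists2 p, Bsep (Bc (l01 p)) & p.[c] != 0.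
Proof.
move=> c0; have [j pj jy] := place_ex charK algy (@ncX K c).
have [b bB hb] := separate_inB c0 pj jy.
have FB : isB (fun a => io (a b)) by exists b.
pose F : fsub bpred := @FSub G P bpred _ FB.
have := separates_disc (Q := bpred) g_0 isB_D isB_shift F.
set v := \prod_(i | _) _ => sv.
pose r := \prod_(i | i != i0) (b - g i b).
have vE a : v a = io (a r).
  rewrite -[v a]/(feval a v) rmorph_prod /r !rmorph_prod; apply: eq_bigr => i _.
  by rewrite /feval /= !rmorphB.
pose u := \prod_(i | i != i0) fshift (Q := bpred) isB_shift (g i) v.
have uv a : (u * v : fsub bpred) a = \prod_i v (gautM a (g i)).
  rewrite (bigD1 i0) //= mulrC; congr (_ * _).
    by apply: (isB_D (fvalP v)).1 => w wS; rewrite /= g_0.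
  by rewrite -[u a]/(feval a u) rmorph_prod; apply: eq_bigr => i _.
have [n nB nE] := fvalP (u * v).
have [a|x xE] := inB_fixed nB.
  apply: (fmorph_inj io); rewrite -nE -[X in _ = io X]/(gaut1 kap y n) -nE !uv.
  rewrite (isD_big_shift g_cov g_inj _ id a (isB_D (fvalP v))).
  by rewrite (isD_big_shift g_cov g_inj _ id (gaut1 kap y) (isB_D (fvalP v))).
have [N [p ep]] := loc_clear x.
have uvx : u * v = Bc x.
  by apply: fsubP => a; rewrite nE xE /= ga_ratev.
exists p.
  have -> : Bc (l01 p) = Bc (l01 f01 ^+ N) * u * v.
    by rewrite -mulrA uvx -rmorphM; apply: (congr1 Bc); exact: etrans ep (mulrC _ _).
  exact: separatesZ.
have rr k : pint (j (g k r)) /\ pc (j (g k r)) 0 != 0.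
  have ig l : pint (j (g l b)).
    case: bB => _ _ hp; apply: (hp c c0 (j \o g l)); first exact: place_gaut.
    by rewrite /= ga_y.
  have igg i : exists l, (g k (g i b) = g l b) /\ (i != i0 -> k != l).
    have [l el] := g_cov (gautM (g k) (g i)); exists l.
    split; first by have := fixedS_eq (inB_fixedS bB) el.
    apply: contraNneq => kl; apply/eqP; apply: g_inj => w wS.
    by apply: (fmorph_inj (g k)); rewrite g_0 // -[LHS]/(gautM (g k) (g i) w) el // -kl.
  rewrite /r !rmorph_prod.
  apply: (big_ind (fun X => pint X /\ pc X 0 != 0)) => [|X X' [X1 X2] [X3 X4]|i ii0].
  - by split; [exact: pint1|rewrite res1 oner_eq0].
  - by split; [exact: pintM|rewrite res_mul // mulf_neq0].
  - have [l [e kl]] := igg i; rewrite !rmorphB e; split; first exact: pintB.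
    by rewrite pcB subr_eq0; apply: hb; exact: kl.
have nr : n = \prod_i g i r.
  apply: (fmorph_inj io); rewrite -[X in io X = _]/(gaut1 kap y n) -nE uv rmorph_prod.
  by apply: eq_bigr => i _; rewrite vE.
have [jn1 jn2] : pint (j n) /\ pc (j n) 0 != 0.
  rewrite nr rmorph_prod.
  apply: (big_ind (fun X => pint X /\ pc X 0 != 0)) => [|X X' [X1 X2] [X3 X4]|i _].
  - by split; [exact: pint1|rewrite res1 oner_eq0].
  - by split; [exact: pintM|rewrite res_mul // mulf_neq0].
  - exact: rr.
have e : pev pcst (pcst c + pX K) p = j n * pev pcst (pcst c + pX K) f01 ^+ N.
  rewrite -!(j_pev pj jy) xE -rmorphXn -rmorphM; congr (j _).
  have := congr1 (ostd ny) ep; rewrite rmorphM rmorphXn.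
  by rewrite /ostd /= !ratev_poly.
have [ip rp] := pint_pev p (pint_cX c); have [if_ rf] := pint_pev f01 (pint_cX c).
have := congr1 (fun X : P => pc X 0) e; rewrite rp res_cX res_mul //; last exact: pintX.
rewrite resX // rf res_cX => ->; by rewrite mulf_neq0 // expf_neq0.
Qed.

(** The polynomials that can be separated form an ideal whose common zeros are among 0 and 1. It
    contains a power of X (1 - X), which is a unit of the coordinate ring. *)
Lemma separates_B : Bsep 1.
Proof.
have lD p q : l01 (p + q) = l01 p + l01 q by apply: val_inj; rewrite /= tofracD.
have lM p q : l01 (p * q) = l01 p * l01 q by apply: val_inj; rewrite /= tofracM.
have [||n hn] := @poly_ideal K (fun p => Bsep (Bc (l01 p))) f01 f01_neq0 _ _ separate_value.
- by move=> p q hp hq; rewrite lD rmorphD; exact: separatesD.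
- by move=> p q hq; rewrite lM rmorphM; exact: separatesZ.
have f0 : FracField.tofrac f01 != 0 by rewrite tofrac_eq0 f01_neq0.
have er := mulVf (expf_neq0 n f0).
have iP : (FracField.tofrac f01 ^+ n)^-1 \in loc_pred f01.
  by apply/asboolP; exists n, 1; rewrite tofrac1.
have -> : 1 = Bc (LocRing iP : P1_minus_01oo K) * Bc (l01 (f01 ^+ n)).
  by rewrite -rmorphM -(rmorph1 Bc); congr (Bc _); apply: val_inj; rewrite rmorphM rmorph1 /= tofracXn.
exact: separatesZ.
Qed.

End Unramified.

(** * Local monodromy at the origin and the torus algebra *)

Section MonodromyAtZero.
Variable K : closedFieldType.
Hypothesis charK : [pchar K] =i pred0.
Local Notation P := (puiseux K).
Local Notation pcst := (@pcst K).

Lemma pfin_tstd (u : P) : lvl 0 u -> pfin u -> exists a, tstd K a = u.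
Proof.
move=> lu /pfin_uniq[l ul hl]; rewrite (pfinE ul hl).
apply: (big_ind (fun v => exists a, tstd K a = v)).
- by exists 0; rewrite rmorph0.
- by move=> _ _ [a <-] [b <-]; exists (a + b); rewrite rmorphD.
move=> q _; have [->|uq] := eqVneq (pc u q) 0.
  by exists 0; rewrite rmorph0; apply: puiseuxP => r; rewrite pc_mono pc0; case: ifP.
have [N /(_ q uq)[i ->]] := lvl_plev lu; move: (pc u _) => x.
have [b /tstd_frac eb] := loc_divX (x%:P * 'X^i) N; exists b.
apply: (mulIf (expf_neq0 N (pX_neq0 K))); rewrite eb rmorphM rmorphXn /= pevC pevX.
rewrite [X in X * _ = _ * _](pcstE x) pXE !pmono_exp !expr1n !pmonoM add0r !mulr1; congr pmono.
by rewrite /pexp divr1 subrK.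
Qed.

Lemma root_unity_cst m (v : P) : v ^+ m.+1 = 1 -> exists c, v = pcst c.
Proof.
move=> v1; have [r er] := closed_normal (@solve_monicpoly K) (monicXnsubC (1 : K) (ltn0Sn m)).
have : root (map_poly pcst ('X^(m.+1) - 1%:P)) v.
  by rewrite rmorphB /= map_polyXn map_polyC /= rmorph1 rootE !hornerE v1 subrr.
rewrite er; elim: r {er} => [|a r IH]; first by rewrite big_nil rmorph1 rootE hornerC oner_eq0.
rewrite big_cons rmorphM rootM => /orP[|//].
by rewrite rmorphB /= map_polyX map_polyC root_XsubC => /eqP ->; exists a.
Qed.

Variable n : nat.
Local Notation s := (tpow K n).

Lemma lvl_split (u : P) : lvl n u -> exists a : 'I_n.+1 -> P,
  (forall i, lvl 0 (a i)) /\ u = \sum_i a i * s ^+ i.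
Proof.
move=> lu; have [N pN] := lvl_plev lu.
have iu : pint (pX K ^+ N * u).
  rewrite pXE pmono_exp expr1n => q q0; rewrite pcZ mul1r; apply: contrapT => /eqP/pN[i ei].
  have : q - N%:R = (i%:R - N%:R) / n.+1%:R by exact: ei.
  move=> /eqP; rewrite subr_eq => /eqP eq; move: q0; rewrite eq -[N%:R in X in _ + X](mulfK (_ : n.+1%:R != 0 :> rat)) ?pnatr_eq0 //.
  rewrite -mulrDl pmulr_llt0 ?invr_gt0 ?ltr0n //.
  have -> : i%:R - N%:R + N%:R * n.+1%:R = (i + N * n)%:R :> rat.
    by rewrite -[n.+1]addn1 !natrD natrM; ring.
  by rewrite ltrn0.
have [f ef] : exists f, pX K ^+ N * u = pser n f.
  apply: lvl_int_ps => //; apply: lvlM => //; apply: lvlX.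
  by have := lvl_scale n (lvl_X K); rewrite mul1n.
have X0 := expf_neq0 N (pX_neq0 K).
exists (fun i : 'I_n.+1 => (pX K ^+ N)^-1 * pser 0 (PSeries (fun k => coefps f (i + k * n.+1)))).
split=> [i|]; first by apply: lvlM; [apply/lvlV/lvlX/lvl_X|exact: lvl_ps].
apply: (mulfI X0); rewrite ef pser_split mulr_sumr; apply: eq_bigr => i _.
by rewrite !mulrA mulfV // mul1r.
Qed.

Lemma split_free (b : 'I_n.+1 -> P) : (forall i, lvl 0 (b i)) ->
  \sum_i b i * s ^+ i = 0 -> forall i, b i = 0.
Proof.
move=> lb e i; apply: puiseuxP => q; rewrite pc0; apply: contrapT => /eqP bq.
have n0 : n.+1%:R != 0 :> rat by rewrite pnatr_eq0.
have tE k x : pc (b k * s ^+ k) x = pc (b k) (x - k%:R / n.+1%:R).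
  by rewrite mulrC pmono_exp expr1n pcZ mul1r -[_ *+ k]mulr_natl.
have := congr1 (fun u : P => pc u (q + i%:R / n.+1%:R)) e; rewrite pc0 pc_sum.
rewrite (bigD1 i) //= big1 ?addr0 => [|k ki].
  by rewrite tE addrK => /eqP; rewrite (negPf bq).
rewrite tE; apply: contrapT => /eqP bk; case/eqP: ki; apply: val_inj => /=.
have [w ew] := lvl0_supp (lb k) bk; have [w' ew'] := lvl0_supp (lb i) bq.
have e1 : (w' - w) *+ n.+1 = (k : nat)%:Z - (i : nat)%:Z.
  apply: (intr_inj (R := rat)); rewrite rmorphMn !rmorphB /= -ew -ew' -[_ *+ n.+1]mulr_natr.
  by rewrite -!pmulrn; move: (n.+1%:R) n0 => N1 N10; field.
have ki := ltn_ord k; have ii := ltn_ord i.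
have {e1} : (w' - w) * n.+1%:Z = (k : nat)%:Z - (i : nat)%:Z.
  by rewrite -e1 -mulr_natr natz.
move: (w' - w) (nat_of_ord k) (nat_of_ord i) ki ii => d k' i' ka ib.
have [->|[d1|d1]] : d = 0 \/ (1 <= d)%R \/ (d <= -1)%R by lia.
- by rewrite mul0r; lia.
- by nia.
- by nia.
Qed.

Lemma pfix_tpow r : pfix r -> exists c, c ^+ n.+1 = 1 /\ r s = pcst c * s.
Proof.
move=> fr; have s0 := tpow_neq0 K n.
have e : (r s / s) ^+ n.+1 = 1.
  rewrite expr_div_n -rmorphXn tpowX (pfix_lvl fr (lvl_X K)) divff //; exact: pX_neq0.
have [c ec] := root_unity_cst e; exists c; split; last by rewrite -ec divfK.
by apply: (fmorph_inj pcst); rewrite rmorphXn rmorph1; apply: etrans e; rewrite ec.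
Qed.

Lemma pfix_split r c a : pfix r -> r s = pcst c * s -> (forall i : 'I_n.+1, lvl 0 (a i)) ->
  r (\sum_i a i * s ^+ i) = \sum_i (a i * pcst c ^+ i) * s ^+ i.
Proof.
move=> fr rs la; rewrite rmorph_sum; apply: eq_bigr => i _.
by rewrite rmorphM rmorphXn (pfix_lvl fr (la i)) rs exprMn mulrA.
Qed.

Lemma pfix_comp (r r' : {rmorphism P -> P}) : pfix r -> pfix r' -> pfix (r \o r').
Proof. by move=> fr fr' x; rewrite /= -[r' _]/((r' \o _) x) fr'; exact: fr. Qed.

(** On series in s = t^(1/(n+1)) the morphism multiplies s by a root of unity of order dividing n +
    1, so its n-th power inverts it. *)
Lemma pfix_inv (r : {rmorphism P -> P}) : pfix r ->
  exists2 r' : {rmorphism P -> P}, pfix r' & forall u, lvl n u -> r' (r u) = u.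
Proof.
move=> fr; have [c [c1 rs]] := pfix_tpow fr.
have [r' fr' rs'] : exists2 r' : {rmorphism P -> P}, pfix r' & r' s = pcst (c ^+ n) * s.
  elim: {2}n => [|k [r' fr' IH]].
    by exists idfun; rewrite ?expr0 ?rmorph1 ?mul1r.
  exists (r' \o r : {rmorphism P -> P}); first exact: pfix_comp.
  rewrite /= rs rmorphM IH (pfix_lvl fr' (lvl_cst 0 c)) mulrA -rmorphM -exprS.
  by [].
exists r' => // u /lvl_split[a [la ->]].
rewrite (pfix_split fr rs la) (pfix_split fr' rs').
  apply: eq_bigr => i _; congr (_ * _); rewrite -mulrA -exprMn -rmorphM -exprS c1 rmorph1.
  by rewrite expr1n mulr1.
by move=> i; apply: lvlM => //; apply: lvlX; exact: lvl_cst.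
Qed.

Variables (I : Type) (u : I -> P).
Hypothesis lu : forall i, lvl n (u i).

Definition agree (r r' : P -> P) := forall i, r (u i) = r' (u i).

(** Kummer theory: over K((t)) the [u i] generate the same field as one monomial s^k. Here [k] is
    the least positive exponent whose monomial is controlled by the [u i]; by division with
    remainder, the exponents occurring in the [u i] are multiples of it. *)
Lemma monomial_test : exists k, forall r r' : {rmorphism P -> P}, pfix r -> pfix r' ->
  (agree r r' <-> r (s ^+ k) = r' (s ^+ k)).
Proof.
pose H k := forall r r' : {rmorphism P -> P}, pfix r -> pfix r' -> agree r r' ->
  r (s ^+ k) = r' (s ^+ k).
have exH : exists k, `[< H k >] && (0 < k)%N.
  exists n.+1; rewrite andbT; apply/asboolP => r r' fr fr' _.
  by rewrite tpowX !(pfix_lvl _ (lvl_X K)).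
have [k /andP[/asboolP Hk k0] kmin] := ex_minnP exH.
exists k => r r' fr fr'; split; first exact: Hk.
move=> e i; have [a [la ua]] := lvl_split (lu i).
have s0 := tpow_neq0 K n.
have [c [c1 rs]] := pfix_tpow fr; have [c' [c1' rs']] := pfix_tpow fr'.
have cst_inj : injective pcst by exact: fmorph_inj.
have rX (q : {rmorphism P -> P}) d j : q s = pcst d * s -> q (s ^+ j) = pcst (d ^+ j) * s ^+ j.
  by move=> qs; rewrite rmorphXn qs exprMn rmorphXn.
have key (l : 'I_n.+1) : a l != 0 -> H l.
  move=> al r1 r2 f1 f2 /(_ i); rewrite ua.
  have [d [d1 rd]] := pfix_tpow f1; have [d' [d1' rd']] := pfix_tpow f2.
  rewrite (pfix_split f1 rd la) (pfix_split f2 rd' la) => /eqP.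
  rewrite -subr_eq0 -sumrB => /eqP e0.
  have := @split_free (fun l => a l * (pcst (d ^+ l) - pcst (d' ^+ l))) _ _ l.
  move=> /(_ _ _)/eqP; rewrite mulf_eq0 (negPf al) subr_eq0 => h.
  rewrite (rX _ _ _ rd) (rX _ _ _ rd'); congr (_ * _); apply/eqP/h.
    by move=> l'; apply: lvlM => //; apply: lvlB; exact: lvl_cst.
  rewrite -[RHS]e0; apply: eq_bigr => l' _.
  by rewrite -mulrBl mulrBr !rmorphXn.
have Hdvd l : H l -> r (s ^+ l) = r' (s ^+ l).
  move=> Hl; have Hm : H (l %% k)%N.
    move=> r1 r2 f1 f2 ag; have e1 := Hl _ _ f1 f2 ag; have e2 := Hk _ _ f1 f2 ag.
    have nz : r1 (s ^+ (l %/ k * k)) != 0 by rewrite fmorph_eq0 expf_neq0.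
    apply: (mulfI nz); rewrite -rmorphM -exprD -divn_eq e1 {1}(divn_eq l k) exprD rmorphM.
    by congr (_ * _); rewrite mulnC exprM [LHS]rmorphXn [RHS]rmorphXn; congr (_ ^+ _).
  have /eqP m0 : (l %% k == 0)%N.
    apply: contraT => m0; have := kmin (l %% k)%N.
    rewrite lt0n m0 andbT => /(_ _); rewrite leqNgt ltn_mod k0 => h; apply: h.
    exact/asboolP.
  by rewrite (divn_eq l k) m0 addn0 mulnC exprM [LHS]rmorphXn [RHS]rmorphXn; congr (_ ^+ _).
rewrite ua !rmorph_sum; apply: eq_bigr => l _; rewrite !rmorphM.
rewrite !(pfix_lvl _ (la l)) //.
have [->|al] := eqVneq (a l) 0; first by rewrite !mul0r.
by rewrite Hdvd //; exact: key.
Qed.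

End MonodromyAtZero.

Section GaloisClosedCovers.
Variable K : closedFieldType.
Hypothesis charK : [pchar K] =i pred0.
Local Notation P := (puiseux K).
Local Notation pcst := (@pcst K).
Variables (Om : fieldType) (kap : {rmorphism K -> Om}) (io : {rmorphism Om -> P}).
Hypothesis clOm : GRing.closed_field_axiom Om.
Hypothesis io_kap : forall c, io (kap c) = pcst c.
Variables (y : Om) (ny : nonconst kap y).
Hypothesis algy : forall u, algebraicOver (ratev ny) u.
Local Notation G := (gaut kap y).
Variables (z : pseries K) (zP : ps_nonunit z).
Hypothesis ioy : io y = pser 0 z.
Variable S : seq Om.
Hypothesis stabS : forall (a : G) v, v \in S -> a v \in S.
Hypothesis unrS : forall v, v \in S -> unramified kap y v.
Variables (m : nat) (g : 'I_m -> G) (i0 : 'I_m).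
Hypothesis g_cov : forall a, exists i, eqS S a (g i).
Hypothesis g_inj : forall i j, eqS S (g i) (g j) -> i = j.
Hypothesis g_0 : eqS S (g i0) (gaut1 kap y).
Local Notation isD := (@isD K Om kap io y S).

(** The equivariant functions whose values are Laurent polynomials in roots of t: the algebra of the
    torus cover with the given pullback to K((t)). *)
Definition isC (F : G -> P) := isD F /\ forall a, pfin (F a).
Lemma isC_1 : isC (fun _ => 1).
Proof. by split=> [|_]; [exact: isD_1|exact: pfin1]. Qed.
Lemma isC_B F H : isC F -> isC H -> isC (fun t => F t - H t).
Proof. by move=> [F1 F2] [H1 H2]; split=> [|a]; [exact: isD_B|exact: pfinB]. Qed.
Lemma isC_M F H : isC F -> isC H -> isC (fun t => F t * H t).
Proof. by move=> [F1 F2] [H1 H2]; split=> [|a]; [exact: isD_M|exact: pfinM]. Qed.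
Definition cpred := FPred isC_1 isC_B isC_M.
Lemma isC_D F : isC F -> isD F. Proof. by case. Qed.
Lemma isC_shift F (c : G) : isC F -> isC (fun a => F (gautM a c)).
Proof. by move=> [F1 F2]; split=> // ; exact: isD_shift. Qed.
Lemma isD_lvl0 (a : P) : lvl 0 a -> isD (fun _ => a).
Proof. by move=> la; split=> // r _ _ fr _; rewrite (pfix_lvl fr la). Qed.
Lemma isC_const a : isC (fun _ => tstd K a).
Proof.
split=> [|_]; first by apply: isD_lvl0; exists (expand (psX_nonunit K) a); exact: tstdE.
have /asboolP[k [p e]] := valP a.
have ea : tstd K a * tpow K 0 ^+ k = pev pcst (tpow K 0) p.
  by rewrite -[tpow K 0]expr1 tpowX; exact: tstd_frac.
by have [] := ev1_tpow ea.
Qed.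
Lemma isC_trace F : isC F -> exists r, tstd K r = \sum_i F (g i).
Proof.
move=> [F1 F2]; apply: pfin_tstd; last by apply: pfin_sum.
apply: (isD_trace_lvl charK g_cov g_inj _ F1) => r a fr.
exact: (rho_move_ex clOm io_kap algy zP ioy a fr).
Qed.

Lemma gaut_seq (a : G) v : v \in S -> exists2 w, w \in S & a w = v.
Proof.
move=> vS; exists (gautV clOm algy a v); last exact: gautVK.
exact: stabS.
Qed.

Definition orb (r : P -> P) (a b : G) := forall v, v \in S -> io (b v) = r (io (a v)).

Lemma monomial_separator : exists2 F : fsub cpred, True & forall i, i != i0 ->
  exists2 W : fsub cpred, True & W * (F - fshift (Q := cpred) isC_shift (g i) F) = 1.
Proof.
have [n ln] := lvl_common [seq io v | v <- S].
have lS v : v \in S -> lvl n (io v) by move=> vS; apply: ln; exact: map_f.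
pose u (v : seq_sub S) := io (val v).
have [k hk] := @monomial_test K n (seq_sub S) u (fun v => lS _ (valP v)).
set s := tpow K n ^+ k in hk.
have s0 : s != 0 by rewrite expf_neq0 // tpow_neq0.
have agreeP (r r' : P -> P) (a : G) : (forall v, v \in S -> r (io (a v)) = r' (io (a v))) ->
    agree u r r'.
  move=> h [v vS]; rewrite /u /=; have [w wS <-] := gaut_seq a vS; exact: h.
have rs (r : {rmorphism P -> P}) : pfix r -> exists2 c, c ^+ n.+1 = 1 & r s = pcst c * s.
  move=> fr; have [c [c1 rc]] := pfix_tpow n fr; exists (c ^+ k).
    by rewrite exprAC c1 expr1n.
  by rewrite /s rmorphXn rc exprMn rmorphXn.
pose Pk (a : G) l := `[< exists (i : 'I_m) (r : {rmorphism P -> P}),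
  [/\ i = l :> nat, pfix r & orb r (g i) a] >].
have Pex a : exists l, Pk a l.
  have [i ai] := g_cov a; exists i; apply/asboolP; exists i, idfun; split=> //.
  by move=> v vS; rewrite /= ai.
have Porb r a b : pfix r -> orb r a b -> Pk a =1 Pk b.
  move=> fr ab l; apply/asboolP/asboolP => [[i [r' [il fr' ga]]]|[i [r' [il fr' gb]]]].
    exists i, (r \o r' : {rmorphism P -> P}); split=> //; first exact: pfix_comp.
    by move=> v vS; rewrite ab // ga.
  have [q fq qr] := pfix_inv n fr.
  exists i, (q \o r' : {rmorphism P -> P}); split=> //; first exact: pfix_comp.
  by move=> v vS; rewrite /= -gb // ab // qr //; apply: lS; exact: stabS.
(* The least index of a representative in the monodromy orbit of [a]; it names the orbit. *)
pose kp a := ex_minn (Pex a).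
have kp_orb r a b : pfix r -> orb r a b -> kp a = kp b.
  move=> fr ab; apply: eq_ex_minn; exact: (Porb r).
have rho a : exists p : 'I_m * {rmorphism P -> P},
    [/\ p.1 = kp a :> nat, pfix p.2 & orb p.2 (g p.1) a].
  rewrite /kp; case: ex_minnP => l /asboolP[i [r h]] _.
  by exists (i, r).
pose ri a := (projT1 (cid (rho a))).1.
pose rr a := (projT1 (cid (rho a))).2.
have rP a : [/\ ri a = kp a :> nat, pfix (rr a) & orb (rr a) (g (ri a)) a].
  by rewrite /rr /ri; case: (cid (rho a)).
clearbody ri rr.
pose F0 (a : G) : P := pcst (2 ^ kp a)%:R * rr a s.
have F_orb (r : {rmorphism P -> P}) a b : pfix r -> orb r a b -> F0 b = r (F0 a).
  move=> fr ab; have [i1 f1 o1] := rP a; have [i2 f2 o2] := rP b.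
  have kk := kp_orb _ _ _ fr ab.
  have ii : ri a = ri b by apply: val_inj; rewrite /= i1 i2.
  rewrite /F0 -kk rmorphM (pfix_lvl fr (lvl_cst 0 _)); congr (_ * _).
  rewrite -[RHS]/((r \o rr a : {rmorphism P -> P}) s).
  apply/(hk _ (r \o rr a : {rmorphism P -> P}) f2 (pfix_comp fr f1)).
  apply: (agreeP _ _ (g (ri b))) => v vS.
  by rewrite -o2 // ab // -ii /= -o1.
have FC : isC F0.
  split; first split=> [a b ab|r a b fr ab].
  - by rewrite (F_orb idfun b a) // => v vS /=; rewrite ab.
  - by apply: F_orb => // v _; exact: ab.
  - move=> a; have [_ fa _] := rP a; have [c _ e] := rs _ fa; rewrite /F0 e.
    apply: pfinM; first by rewrite pcstE; exact: pfin_mono.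
    apply: pfinM; first by rewrite pcstE; exact: pfin_mono.
    by apply: pfinX; exact: pfin_mono.
exists (@FSub G P cpred F0 FC) => // i ii0.
have diff a : exists2 c, c != 0 & F0 a - F0 (gautM a (g i)) = pcst c * s.
  have [i1 f1 o1] := rP a; have [i2 f2 o2] := rP (gautM a (g i)).
  have [c c1 ec] := rs _ f1; have [d d1 ed] := rs _ f2.
  exists ((2 ^ kp a)%:R * c - (2 ^ kp (gautM a (g i)))%:R * d); last first.
    by rewrite /F0 ec ed !mulrA -!rmorphM -mulrBl -rmorphB.
  rewrite subr_eq0; apply: contra_neq ii0 => e.
  (* The power n + 1 kills the roots of unity [c] and [d] and leaves powers of 2, which are distinct
     in characteristic zero. *)
  have kk : kp a = kp (gautM a (g i)).
    have /eqP := congr1 (fun x => x ^+ n.+1) e.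
    have natI (x y' : nat) : x%:R = y'%:R :> K -> x = y'.
      wlog xy : x y' / (x <= y')%N.
        by move=> h; case: (leqP x y') => [/h//|/ltnW/h h' /esym/h'].
      move=> /eqP; rewrite eq_sym -subr_eq0 -natrB // => /eqP h.
      by have := natrK_neq0 charK (y' - x).-1; case: (posnP (y' - x)) => [|p0]; [lia|rewrite prednK // h eqxx].
    rewrite !exprMn c1 d1 !mulr1 -!natrX => /eqP/natI.
    rewrite -!expnM => /eqP; rewrite eqn_exp2l // eqn_mul2r /= => /eqP.
    by [].
  have cd : c = d.
    move: e; rewrite kk => /mulfI; apply.
    by have := natrK_neq0 charK (2 ^ kp (gautM a (g i))).-1; rewrite prednK // expn_gt0.
  have ii : ri a = ri (gautM a (g i)) by apply: val_inj; rewrite /= i1 i2.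
  have ag : agree u (rr a) (rr (gautM a (g i))).
    by apply/(hk _ _ f1 f2); rewrite ec ed cd.
  apply: g_inj => v vS; rewrite g_0 //; apply: (fmorph_inj a); apply: (fmorph_inj io).
  rewrite -[LHS]/(io (gautM a (g i) v)) o2 // o1 // -ii.
  have gS : g (ri a) v \in S by exact: stabS.
  by apply/esym; exact: (ag (SeqSub gS)).
have WC : isC (fun a => (F0 a - F0 (gautM a (g i)))^-1).
  split.
    have [D1 D2] := isD_B FC.1 (isC_shift (g i) FC).1.
    split=> [a b ab|r a b fr ab]; first by rewrite (D1 a b ab).
    by rewrite (D2 r a b fr ab) fmorphV.
  move=> a; have [c c0 ->] := diff a.
  have -> : (pcst c * s)^-1 = pmono (- (n.+1%:R^-1 *+ k)) c^-1.
    apply: (mulfI (_ : pcst c * s != 0)); first by rewrite mulf_neq0 ?fmorph_eq0.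
    rewrite mulfV; last by rewrite mulf_neq0 ?fmorph_eq0.
    rewrite [X in X * s]pcstE /s /tpow pmono_exp expr1n !pmonoM add0r subrr mulr1 mulfV //.
  exact: pfin_mono.
exists (@FSub G P cpred _ WC) => //; apply: fsubP => a /=.
by have [c c0 e] := diff a; rewrite mulVf // e mulf_neq0 ?fmorph_eq0.
Qed.

Lemma separates_C : @separates K Om kap y m g i0 cpred 1 (fun i => i != i0).
Proof.
have [F _ hF] := monomial_separator.
have := separates_disc (Q := cpred) g_0 isC_D isC_shift F.
have [W hW] : exists W : 'I_m -> fsub cpred, forall i, i != i0 ->
    W i * (F - fshift (Q := cpred) isC_shift (g i) F) = 1.
  have hF' i : exists W, i != i0 -> W * (F - fshift (Q := cpred) isC_shift (g i) F) = 1.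
    by have [->|ii0] := eqVneq i i0; [exists 0|have [W _ hW] := hF i ii0; exists W].
  by exists (fun i => projT1 (cid (hF' i))) => i; case: cid.
move=> /(separatesZ (\prod_(i | i != i0) W i)).
by rewrite -big_split big1 //= => i ii0; rewrite hW.
Qed.

Lemma isD_lau a : isD (fun _ => @lau K 0 a).
Proof. by apply: isD_lvl0; exists a. Qed.

Local Notation Q := (bpred io ny S).
Local Notation cb := (@fconst G P Q _ (io_ostd_rm io ny) (isB_const io ny S)).
Local Notation cc := (@fconst G P cpred _ (tstd K) isC_const).
Local Notation cd := (@fconst G P (@dpred K Om kap io y S) _ (@lau K 0) isD_lau).

Let BD : forall F, Q F -> isD F.
Proof. by move=> F; exact: isB_D. Qed.
Let Btr : forall F, Q F -> exists r, io_ostd_rm io ny r = \sum_i F (g i).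
Proof. by move=> F; exact: (isB_trace charK clOm algy stabS g_cov g_inj). Qed.
Let sepB := separates_B charK io clOm algy stabS unrS g_cov g_inj g_0.
Let rex : forall (r : {rmorphism P -> P}) (a : G), pfix r -> exists b, rho_move io r a b.
Proof. by move=> r a; exact: (rho_move_ex clOm io_kap algy zP ioy). Qed.

Lemma tstd_injective : injective (tstd K).
Proof. by move=> a b /fmorph_inj/val_inj. Qed.

Lemma galois_etB : finite_etale cb.
Proof. exact: (@cover_etale K Om kap io y S stabS m g i0 g_cov g_inj g_0 _ _ Q (@io_ostd_inj _ _ _ io _ ny) BD _ Btr sepB). Qed.
Lemma galois_etC : finite_etale cc.
Proof. exact: (@cover_etale K Om kap io y S stabS m g i0 g_cov g_inj g_0 _ _ cpred tstd_injective isC_D _ isC_trace separates_C). Qed.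
Lemma galois_poB : is_pushout cb (expand zP (f := _)) (fincl (Q := Q) (Q' := @dpred K Om kap io y S) BD) cd.
Proof.
apply: (@cover_pushout K charK Om kap io y S stabS m g i0 g_cov g_inj g_0 rex _ _ Q BD _ Btr sepB isD_lau (expand zP (f := _))).
by move=> a; apply/esym; exact: io_ostd.
Qed.
Lemma galois_poC : is_pushout cc (expand (psX_nonunit K) (f := _)) (fincl (Q := cpred) (Q' := @dpred K Om kap io y S) isC_D) cd.
Proof.
apply: (@cover_pushout K charK Om kap io y S stabS m g i0 g_cov g_inj g_0 rex _ _ cpred isC_D _ isC_trace separates_C isD_lau (expand (psX_nonunit K) (f := _))).
by move=> a; apply/esym; exact: tstdE.
Qed.

Definition galois_cover : tcover zP := TCover galois_etB galois_etC galois_poB galois_poC.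

End GaloisClosedCovers.

(** * The fundamental group as a Galois group *)

Section FullFiber.
Variable K : closedFieldType.
Hypothesis charK : [pchar K] =i pred0.
Local Notation P := (puiseux K).
Local Notation pcst := (@pcst K).
Variables (Om : fieldType) (kap : {rmorphism K -> Om}) (io : {rmorphism Om -> P}).
Hypothesis clOm : GRing.closed_field_axiom Om.
Hypothesis io_kap : forall c, io (kap c) = pcst c.
Variables (y : Om) (ny : nonconst kap y).
Hypothesis algy : forall u, algebraicOver (ratev ny) u.
Local Notation G := (gaut kap y).
Variables (z : pseries K) (zP : ps_nonunit z).
Hypothesis ioy : io y = pser 0 z.
Local Notation unram := (unramified kap y).
Local Notation inB := (@inB K Om kap y).
Local Notation fixedS := (@fixedS K Om kap y).
Local Notation theta := (theta charK clOm io_kap zP ioy algy).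

Definition good (S : seq Om) := (forall (a : G) v, v \in S -> a v \in S) /\
  (forall v, v \in S -> unram v).

Lemma good_cat S T : good S -> good T -> good (S ++ T).
Proof.
move=> [S1 S2] [T1 T2]; split=> [a v|v]; rewrite !mem_cat => /orP[h|h].
- by rewrite S1.
- by rewrite T1 // orbT.
- exact: S2.
- exact: T2.
Qed.

Lemma conjugate_roots u p v : kmin (ratev ny) u p -> root (map_poly (ratev ny) p) v ->
  exists a : G, a u = v.
Proof.
move=> kp pv; have [a fa au] := mgraph_extend1 clOm algy kp pv.
have ak c : a (kap c) = kap c by rewrite -(pevC kap y) -(ratev_poly ny) [LHS]fa.
have ay : a y = y by rewrite -{1}(pevX kap y) -(ratev_poly ny) [LHS]fa /= ratev_poly pevX.
by exists (Gaut ak ay).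
Qed.

Lemma good_ex u : unram u -> exists2 S, good S & u \in S.
Proof.
move=> hu; have [p kp] := kmin_ex (algy u); have [mp pu _] := kp.
have [r er] := closed_normal clOm (p := map_poly (ratev ny) p) (monic_map _ mp).
exists r; last by rewrite -root_prod_XsubC -er.
split=> [a v|v]; rewrite -!root_prod_XsubC -er => pv.
  rewrite -(eq_map_poly (f := a \o ratev ny)) => [|x]; last exact: ga_ratev.
  by rewrite map_poly_comp fmorph_root.
by have [a <-] := conjugate_roots kp pv; exact: unramified_gaut.
Qed.

Lemma good_seq (us : seq Om) : (forall u, u \in us -> unram u) ->
  exists2 S, good S & {subset us <= S}.
Proof.
elim: us => [|u us IH] h; first by exists [::].
have [S gS uS] := good_ex (h u (mem_head u us)).
have [|T gT sT] := IH; first by move=> v vu; apply: h; rewrite inE vu orbT.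
exists (S ++ T); first exact: good_cat.
by move=> v; rewrite inE mem_cat => /orP[/eqP ->|/sT ->]; rewrite ?uS ?orbT.
Qed.

(** The last two clauses are what controls automorphisms of the fiber functor: the embeddings of
    this cover are conjugate, and any algebra of a cover that embeds in its algebra does so by a
    morphism of covers. *)
Lemma galois_cover_ex S : good S -> exists (O : tcover zP) (hB : {rmorphism tc_B O -> Om}),
  [/\ hB \o tc_b O =1 ostd ny, forall u, inB S u <-> exists b, hB b = u,
      forall h : {rmorphism tc_B O -> Om}, h \o tc_b O =1 ostd ny ->
        exists a : G, h =1 a \o hB &
      forall (O' : tcover zP) (h : {rmorphism tc_B O' -> Om}), h \o tc_b O' =1 ostd ny ->
        (forall b, inB S (h b)) -> exists f : tc_hom O' O, hB \o th_B f =1 h].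
Proof.
move=> [stabS unrS]; have [m [g [i0 [g_cov g_inj g_0]]]] := galois_reps stabS.
pose O := galois_cover charK clOm io_kap algy zP ioy stabS unrS g_cov g_inj g_0.
pose Q := bpred io ny S.
have [|hB hBE] := io_lift (io := io) (g := (feval (Q := Q) (gaut1 kap y))).
  by move=> F; have [b _ eb] := fvalP F; exists b; exact: esym (eb (gaut1 kap y)).
have FhB (F : fsub Q) a : F a = io (a (hB F)).
  have [b _ eb] := fvalP F; rewrite eb; congr (io (a _)); apply: (fmorph_inj io).
  by rewrite [RHS]hBE; exact: esym (eb (gaut1 kap y)).
have hb : hB \o tc_b O =1 ostd ny by move=> r; apply: (fmorph_inj io); exact: hBE.
exists O, hB; split=> //.
- move=> u; split=> [uB|[b <-]].
    have FB : @isB K Om kap io y S (fun a => io (a u)) by exists u.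
    exists (@FSub G P Q _ FB); apply: (fmorph_inj io); exact: hBE.
  have [b' b'B eb] := fvalP b; suff -> : hB b = b' by [].
  by apply: (fmorph_inj io); rewrite [LHS]hBE; exact: (eb (gaut1 kap y)).
- move=> h hh.
  have BD F : Q F -> isD io S F by exact: isB_D.
  have Btr F : Q F -> exists r, io_ostd_rm io ny r = \sum_i F (g i).
    exact: (isB_trace charK clOm algy stabS g_cov g_inj).
  have [n [x [w [[d1 d2 d3] _]]]] := @separated_dual K Om kap io y S stabS m g i0 g_cov g_inj g_0
    _ _ Q BD (isB_const io ny S) Btr
    (separates_B charK io clOm algy stabS unrS g_cov g_inj g_0).
  set tr := ftr Btr in d1 d2.
  have trE F : ostd ny (tr F) = \sum_i g i (hB F).
    apply: (fmorph_inj io); rewrite -[LHS]/(io_ostd_rm io ny (tr F)) ftrE rmorph_sum.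
    by apply: eq_bigr => i _; rewrite FhB.
  pose e i := \sum_k h (x k) * g i (hB (w k)).
  (* The [e i] add up to h 1 = 1. Where [e i] is nonzero, [separable_comm] allows to cancel it and
     gives h b = g i (hB b). *)
  have [i ei] : exists i, e i != 0.
    apply: contrapT => ne; have := oner_neq0 Om; rewrite -(rmorph1 h) (d1 1) rmorph_sum.
    apply/negP/negPn; rewrite (eq_bigr (fun k => \sum_i h (x k) * g i (hB (w k)))); last first.
      move=> k _; rewrite mulr1 rmorphM -[h (fconst _ _)]/((h \o tc_b O) _) hh trE.
      by rewrite mulrC mulr_sumr.
    rewrite exchange_big big1 // => i _; apply/eqP/negPn/negP => ei; apply: ne.
    by exists i.
  exists (g i) => b.
  have hst r : h (fconst (Q := Q) (isB_const io ny S) r) = ostd ny r by exact: hh.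
  have gst r : g i (hB (fconst (Q := Q) (isB_const io ny S) r)) = ostd ny r.
    by rewrite -[hB _]/((hB \o tc_b O) r) hb; exact: ga_ratev.
  have e0 : \sum_k h (b * x k) * g i (hB (w k)) = \sum_k h (x k) * g i (hB (w k * b)).
    apply: (@separable_comm _ _ (fconst (Q := Q) (isB_const io ny S)) tr n x w d1 d2 Om (ostd ny)
      (fun u v => h u * g i (hB v))).
    + by move=> *; rewrite rmorphD mulrDl.
    + by move=> *; rewrite !rmorphD mulrDr.
    + by move=> r u v; rewrite rmorphM hst mulrA.
    + by move=> r u v; rewrite !rmorphM gst mulrCA.
  apply: (mulIf ei); rewrite mulr_sumr.
  transitivity (\sum_k h (b * x k) * g i (hB (w k))).
    by apply: eq_bigr => k _; rewrite rmorphM mulrA.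
  rewrite e0 mulr_sumr; apply: eq_bigr => k _.
  by rewrite !rmorphM /= [RHS]mulrCA; congr (_ * _); rewrite mulrC.
- move=> O' h hh hB'.
  have wex (a : G) : exists w : {rmorphism tc_D O' -> P}, [/\ w \o tc_d O' =1 @lau K 0,
      w \o tc_BD O' =1 io \o (a \o h) & forall w' : {rmorphism tc_D O' -> P},
      w' \o tc_d O' =1 @lau K 0 -> w' \o tc_BD O' =1 io \o (a \o h) -> w' =1 w].
    have [r|w [w1 w2 w3]] := (tc_poB O').2 P (io \o (a \o h)) (@lau K 0).
      rewrite -[RHS](io_ostd io_kap zP ny ioy) /= -[h _]/((h \o tc_b O') r) hh.
      by congr (io _); exact: ga_ratev.
    by exists w; split=> // w' h1 h2; exact: w3.
  pose wa a := projT1 (cid (wex a)).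
  have waP a : [/\ wa a \o tc_d O' =1 @lau K 0, wa a \o tc_BD O' =1 io \o (a \o h) &
      forall w' : {rmorphism tc_D O' -> P},
      w' \o tc_d O' =1 @lau K 0 -> w' \o tc_BD O' =1 io \o (a \o h) -> w' =1 wa a].
    by rewrite /wa; case: cid.
  have DD d : isD io S (fun a => wa a d).
    split=> [a b ab|r a b fr ab].
      have [a1 a2 _] := waP a; have [_ _ b3] := waP b; apply: b3 => // c.
      by rewrite [LHS]a2 /= (fixedS_eq clOm algy (inB_fixedS (hB' c)) ab).
    have [a1 a2 _] := waP a; have [_ _ b3] := waP b; apply/esym.
    apply: (b3 (r \o wa a : {rmorphism tc_D O' -> P})) => [x|c].
      by rewrite -[LHS]/(r ((wa a \o tc_d O') x)) a1; exact: fr.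
    by rewrite -[LHS]/(r ((wa a \o tc_BD O') c)) a2 /= ab.
  have CC c : isC io S (fun a => wa a (tc_CD O' c)).
    split=> // a; have [a1 a2 _] := waP a.
    have cov : (wa a \o tc_CD O') \o tc_c O' =1 tstd K.
      by move=> r; rewrite tstdE -a1 /=; congr (wa a _); exact: (tc_poC O').1.
    have [k hk] := cover_laurent charK (tc_etC O').
    by have [l [p /ev1_tpow[]]] := hk _ cov c.
  have BB b : @isB K Om kap io y S (fun a => io (a (h b))) by exists (h b).
  pose fB b : tc_B O := @FSub G P Q _ (BB b).
  pose fC c : tc_C O := @FSub G P (@cpred K Om kap io y S) _ (CC c).
  pose fD d : tc_D O := @FSub G P (@dpred K Om kap io y S) _ (DD d).
  have fBz : zmod_morphism fB by move=> b c; apply: fsubP => a; rewrite /= !rmorphB.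
  have fBm : monoid_morphism fB.
    by split=> [|b c]; apply: fsubP => a; rewrite /= ?rmorph1 ?rmorphM.
  have fCz : zmod_morphism fC by move=> b c; apply: fsubP => a; rewrite /= !rmorphB.
  have fCm : monoid_morphism fC.
    by split=> [|b c]; apply: fsubP => a; rewrite /= ?rmorph1 ?rmorphM.
  have fDz : zmod_morphism fD by move=> b c; apply: fsubP => a; rewrite /= !rmorphB.
  have fDm : monoid_morphism fD.
    by split=> [|b c]; apply: fsubP => a; rewrite /= ?rmorph1 ?rmorphM.
  have m1 : mkrm fBz fBm \o tc_b O' =1 tc_b O.
    move=> r; apply: fsubP => a; rewrite /= -[h _]/((h \o tc_b O') r) hh.
    by congr (io _); exact: ga_ratev.
  have m2 : mkrm fCz fCm \o tc_c O' =1 tc_c O.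
    move=> r; apply: fsubP => a; have [a1 a2 _] := waP a.
    apply: etrans (esym (tstdE r)); apply: etrans (a1 _); rewrite /=; congr (wa a _).
    exact: (tc_poC O').1.
  have m3 : mkrm fDz fDm \o tc_d O' =1 tc_d O.
    by move=> r; apply: fsubP => a; have [a1 a2 _] := waP a; exact: a1.
  have m4 : mkrm fDz fDm \o tc_BD O' =1 tc_BD O \o mkrm fBz fBm.
    by move=> r; apply: fsubP => a; have [a1 a2 _] := waP a; exact: a2.
  have m5 : mkrm fDz fDm \o tc_CD O' =1 tc_CD O \o mkrm fCz fCm.
    by move=> r; apply: fsubP => a.
  exists (@TCHom K z zP O' O (mkrm fBz fBm) (mkrm fCz fCm) (mkrm fDz fDm) m1 m2 m3 m4 m5).
  by move=> b; apply: (fmorph_inj io); rewrite [LHS]hBE.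
Qed.

Lemma good_cover (O : tcover zP) (h : {rmorphism tc_B O -> Om}) : h \o tc_b O =1 ostd ny ->
  exists2 S, good S & forall b, inB S (h b).
Proof.
move=> hh; have [N [_ [e [_ [gen _]]]]] := (tc_etB O).1.
have hu b : unram (h b) by exact: (cover_unramified charK b hh).
have [|S gS eS] := good_seq (us := [seq h (e i) | i <- enum 'I_N]).
  by move=> _ /mapP[i _ ->].
exists S => // b; split=> //.
  move=> a aS; have [c ->] := gen b; rewrite !rmorph_sum; apply: eq_bigr => i _.
  rewrite !rmorphM -[h (tc_b O _)]/((h \o tc_b O) _) hh; congr (_ * _).
    exact: ga_ratev.
  by apply/aS/eS/map_f; rewrite mem_enum.
move=> c c0 j pj jy; apply: (@finite_pint K _ _ (tc_b O) (tc_etB O).1 (j \o h)) => r.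
have [_ _ hp] := inB_ostd ny S r; have := hp c c0 j pj jy.
by rewrite -hh.
Qed.

Lemma inB_multiple S v : good S -> v \in S -> exists2 q, q != 0 & inB S (pev kap y q * v).
Proof.
move=> [_ unrS] vS; have [q q0 qP] := clear_poles charK algy v; exists q => //.
split; last 1 first.
- by move=> c c0 j pj jy; apply: qP => //; rewrite jy; exact: pint_cX.
- move=> a aS; rewrite rmorphM (aS v vS); congr (_ * _).
  by rewrite -(ratev_poly ny); exact: ga_ratev.
- apply: unramifiedM; last exact: unrS.
  by rewrite -(ratev_poly ny); exact: unramified_ratev.
Qed.

Lemma eqS_inB S (a b : G) : good S -> (forall u, inB S u -> a u = b u) -> eqS S a b.
Proof.
move=> gS ab v vS; have [q q0 qB] := inB_multiple gS vS.
have nz : pev kap y q != 0 by rewrite -(ratev_poly ny) fmorph_eq0 tofrac_eq0.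
have := ab _ qB; rewrite !rmorphM -(ratev_poly ny) !ga_ratev => /mulfI; apply.
by rewrite ratev_poly.
Qed.

(** One direction is read on the Galois cover of a stable set containing [u]; the other holds
    because embedded covers consist of unramified functions. *)
Theorem theta_kernel (a b : G) : theta a = theta b <-> (forall u, unram u -> a u = b u).
Proof.
split=> [ab u hu|ab].
  have [S gS uS] := good_ex hu; have [O [hB [hb Bi _ _]]] := galois_cover_ex gS.
  have [x xh] := realizes_surj charK io_kap ioy hb.
  have e := congr1 (fun t : pi1 zP => t O x) ab.
  have ra := move_fiberE charK clOm io_kap ny ioy a xh.
  have rb := move_fiberE charK clOm io_kap ny ioy b xh.
  have : a \o hB =1 b \o hB.
    by apply: (realizes_fun charK ra); move: e => /= ->.
  move=> e'; apply: (eqS_inB gS) uS => v /Bi[c <-]; exact: e'.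
apply: pi1P => O x /=.
have xh := hom_ofP charK clOm io_kap ny ioy x.
apply: (realizes_inj (move_fiberE charK clOm io_kap ny ioy a xh)).
apply: realizes_eq (move_fiberE charK clOm io_kap ny ioy b xh) => c /=.
by apply/esym/ab; apply: (cover_unramified charK c); exact: (realizes_over io_kap ny ioy xh).
Qed.

(* The embeddings of the covers that a given automorphism of the fiber functor
   prescribes are compatible, and they extend to an automorphism of [Om]. *)
Theorem theta_surj (t : pi1 zP) : exists a, theta a = t.
Proof.
have loc S : exists a : G, good S -> exists (O : tcover zP) (hB : {rmorphism tc_B O -> Om}) x,
    [/\ forall u, inB S u <-> exists b, hB b = u, realizes io x hB, realizes io (t O x) (a \o hB) &
      forall (O' : tcover zP) (h : {rmorphism tc_B O' -> Om}), h \o tc_b O' =1 ostd ny ->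
        (forall b, inB S (h b)) -> exists f : tc_hom O' O, hB \o th_B f =1 h].
  have [gS|nS] := pselect (good S); last by exists (gaut1 kap y).
  have [O [hB [hb Bi tr un]]] := galois_cover_ex gS.
  have [x xh] := realizes_surj charK io_kap ioy hb.
  have th := hom_ofP charK clOm io_kap ny ioy (t O x).
  have [a ha] := tr _ (realizes_over io_kap ny ioy th).
  by exists a => _; exists O, hB, x; split=> //; exact: realizes_eq th.
pose al S := projT1 (cid (loc S)).
have alP S : good S -> exists (O : tcover zP) (hB : {rmorphism tc_B O -> Om}) x,
    [/\ forall u, inB S u <-> exists b, hB b = u, realizes io x hB, realizes io (t O x) (al S \o hB) &
      forall (O' : tcover zP) (h : {rmorphism tc_B O' -> Om}), h \o tc_b O' =1 ostd ny ->
        (forall b, inB S (h b)) -> exists f : tc_hom O' O, hB \o th_B f =1 h].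
  by rewrite /al; case: cid.
(* Found on one Galois cover, [al S] describes [t] on every cover that embeds in it, by
   naturality. *)
have act S (O' : tcover zP) (x' : tfiber O') h : good S -> realizes io x' h ->
    (forall b, inB S (h b)) -> realizes io (t O' x') (al S \o h).
  move=> gS xh hS; have [O [hB [x [Bi xB tB un]]]] := alP S gS.
  have [f ef] := un _ _ (realizes_over io_kap ny ioy xh) hS.
  have -> : x' = tf_pull f x.
    by apply: realizes_inj xh (realizes_eq _ (realizes_pull f xB)) => b; exact: ef.
  rewrite pi_nat; apply: realizes_eq (realizes_pull f tB) => b /=.
  by congr (al S _); exact: ef.
have mono S T u : {subset S <= T} -> fixedS S u -> fixedS T u.
  by move=> ST fu a aT; apply: fu => v /ST; exact: aT.
have coh S T : good S -> good T -> {subset S <= T} -> forall u, fixedS S u -> al S u = al T u.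
  move=> gS gT ST u fu; apply: (fixedS_eq clOm algy fu); apply: (eqS_inB gS) => v vB.
  have [O [hB [x [Bi xB tB _]]]] := alP S gS; have /Bi[b <-] := vB.
  have hBT c : inB T (hB c).
    by have [b1 b2 b3] : inB S (hB c) by [apply/Bi; exists c]; split=> //; exact: mono b1.
  exact: (realizes_fun charK tB (act T O x hB gT xB hBT)).
have good0 : good [::] by split.
(* The union of the [al S] restricted to their fixed fields; it is a graph because good sets are
   directed by concatenation. *)
pose G0 : set (Om * Om) := [set w | exists S, [/\ good S, fixedS S w.1 & w.2 = al S w.1]].
have G0T S (w : Om * Om) : good S -> fixedS S w.1 -> w.2 = al S w.1 -> forall T, good T ->
    fixedS (S ++ T) w.1 /\ w.2 = al (S ++ T) w.1 /\ fixedS (T ++ S) w.1 /\ w.2 = al (T ++ S) w.1.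
  move=> gS fw ew T gT.
  have s1 : {subset S <= S ++ T} by move=> v vS; rewrite mem_cat vS.
  have s2 : {subset S <= T ++ S} by move=> v vS; rewrite mem_cat vS orbT.
  rewrite ew; split; first exact: mono fw.
  split; first by apply: coh => //; exact: good_cat.
  split; first exact: mono fw.
  by apply: coh => //; exact: good_cat.
have gG0 : graph G0.
  split.
  - by exists [::]; split=> //= [a _|]; rewrite rmorph1.
  - move=> w w' [S [gS fS eS]] [T [gT fT eT]]; exists (S ++ T).
    have [f1 [e1 _]] := G0T _ _ gS fS eS T gT; have [_ [_ [f2 e2]]] := G0T _ _ gT fT eT S gS.
    split; first exact: good_cat.
      by move=> a aS; rewrite /= rmorphB f1 ?f2.
    by rewrite /= rmorphB e1 e2.
  - move=> w w' [S [gS fS eS]] [T [gT fT eT]]; exists (S ++ T).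
    have [f1 [e1 _]] := G0T _ _ gS fS eS T gT; have [_ [_ [f2 e2]]] := G0T _ _ gT fT eT S gS.
    split; first exact: good_cat.
      by move=> a aS; rewrite /= rmorphM f1 ?f2.
    by rewrite /= rmorphM e1 e2.
  - move=> w [S [gS fS eS]] _; exists S; split=> //=.
      by move=> a aS; rewrite fmorphV fS.
    by rewrite fmorphV eS.
  - by move=> q [S [_ _ /= ->]]; rewrite rmorph0.
have galgG0 u : galg G0 u.
  have [p p0 pu] := algy u.
  pose df (r : {fraction {poly K}}) : Om * Om := (ratev ny r, ratev ny r).
  have dfz : zmod_morphism df by move=> a b; rewrite /df !rmorphB.
  have dfm : monoid_morphism df by split=> [|a b]; rewrite /df ?rmorph1 ?rmorphM.
  pose fr : {rmorphism {fraction {poly K}} -> (Om * Om)%type} := mkrm dfz dfm.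
  exists (map_poly fr p); split.
  - move=> i; rewrite coef_map; exists [::]; split=> //=.
      by move=> a _; exact: ga_ratev.
    by apply/esym; exact: ga_ratev.
  - rewrite -(map_poly_eq0 (fst \o fr : {rmorphism _ -> Om})) in p0.
    by apply: contraNneq p0 => e; rewrite map_poly_comp e map_poly0.
  - by rewrite -map_poly_comp.
have [a ha] := graph_extend clOm gG0 galgG0.
have aE S u : good S -> fixedS S u -> a u = al S u.
  by move=> gS fu; apply: (ha (u, al S u)); exists S.
have ar r : a (ratev ny r) = ratev ny r.
  by rewrite (aE [::]) // ?ga_ratev // => b _; exact: ga_ratev.
have ak c : a (kap c) = kap c by rewrite -(pevC kap y) -(ratev_poly ny).
have ay : a y = y by rewrite -{1}(pevX kap y) -(ratev_poly ny) ar ratev_poly pevX.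
exists (Gaut ak ay); apply: pi1P => O x /=.
have xh := hom_ofP charK clOm io_kap ny ioy x.
have [S gS hS] := good_cover (realizes_over io_kap ny ioy xh).
apply: (realizes_inj (move_fiberE charK clOm io_kap ny ioy (Gaut ak ay) xh)).
apply: realizes_eq (act S O x _ gS xh hS) => b /=.
by apply/esym/aE => //; exact: inB_fixedS (hS b).
Qed.

End FullFiber.

(** * Two auxiliary base points *)

Section BaseChange.
Variable F : fieldType.
Hypothesis charF : [pchar F] =i pred0.

Lemma natF_neq0 n : n.+1%:R != 0 :> F.
Proof. by have /pcharf0P -> : [pchar F] =i pred0 by []. Qed.

(** The equation w (w - 1)^2 = u reduces to X (X - 1)^2, whose root 0 is simple; Hensel's lemma
    splits off the corresponding linear factor without leaving [F]. *)
Lemma cubic_series (zF : pseries F) : coefps zF 0 = 0 -> exists w : pseries F,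
  coefps w 0 = 0 /\ psC (27%:R / 4%:R) * (w * (1 - w) ^+ 2) = zF.
Proof.
move=> z0; pose u := psC (4%:R / 27%:R) * zF.
have u0 : coefps u 0 = 0 by rewrite coefps0_mul z0 mulr0.
pose b : {poly F} := ('X - 1) ^+ 2.
have bm : b \is monic by rewrite monic_exp // -polyC1 monicXsubC.
have ab : coprimep 'X b.
  by apply: coprimep_expr; rewrite -polyC1 coprimep_XsubC rootE hornerX oner_eq0.
pose p : {poly pseries F} := 'X * ('X - 1) ^+ 2 - u%:P.
have sb : size ('X * ('X - 1) ^+ 2 : {poly pseries F}) = 4.
  rewrite mulrC size_mulX ?expf_neq0 -?size_poly_gt0 -?polyC1 ?size_XsubC //.
  by rewrite size_exp_XsubC.
have pm : p \is monic.
  rewrite monicE lead_coefDl; last by rewrite sb size_polyN size_polyC; case: (u != 0).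
  by rewrite -monicE monicMl ?monicX // monic_exp // -polyC1 monicXsubC.
have rp : map_poly (@ps_res F) p = 'X * b.
  rewrite rmorphB rmorphM rmorphXn rmorphB /= map_polyX rmorph1.
  have -> : map_poly (@ps_res F) u%:P = 0 by rewrite map_polyC /= [X in X%:P]u0.
  by rewrite subr0.
have [g [h [gm sg e rg]]] := hensel pm (monicX F) bm ab rp.
rewrite size_polyX in sg.
have ge : g = 'X + (g`_0)%:P.
  apply/polyP => i; rewrite coefD coefX coefC; case: i => [|[|i]] /=.
  - by rewrite add0r.
  - by rewrite addr0; have := monicP gm; rewrite lead_coefE sg.
  - by rewrite addr0 nth_default // sg.
have g00 : coefps g`_0 0 = 0.
  by have := congr1 (fun q : {poly F} => q`_0) rg; rewrite coef_map coefX.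
exists (- g`_0); split; first by rewrite /= g00 oppr0.
have e2 : (- g`_0) * (- g`_0 - 1) ^+ 2 = u.
  have : p.[- g`_0] = 0 by rewrite e hornerM {1}ge hornerD hornerX hornerC addNr mul0r.
  rewrite /p hornerD hornerN hornerC hornerM hornerX horner_exp hornerD hornerX hornerN -polyC1 hornerC.
  by move/eqP; rewrite subr_eq0 => /eqP.
have -> : (1 - - g`_0) ^+ 2 = (- g`_0 - 1) ^+ 2 by ring.
have n4 : 4%:R != 0 :> F by exact: natF_neq0 3.
have n27 : 27%:R != 0 :> F by exact: natF_neq0 26.
rewrite e2 /u mulrA -rmorphM; have -> : 27%:R / 4%:R * (4%:R / 27%:R) = 1 :> F by field; rewrite n4 n27.
by rewrite rmorph1 mul1r.
Qed.

Lemma derivX0 (q : {poly F}) : ('X * q)^`().[0] = q.[0].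
Proof. by rewrite derivM derivX mul1r !hornerE. Qed.

(* The parameter of [b] as a function of the new coordinate z' when
   [z = A(z')/B(z')]: its numerator and denominator are homogenized. *)
Lemma base_point_change v (b : tangential_base_point v) (A B : {poly F}) (z' : pseries F) :
  coefps z' 0 = 0 -> A.[0] = 0 -> B.[0] = 1 -> A^`().[0] != 0 ->
  ps_subst z' A = tb_z b * ps_subst z' B ->
  exists v' (b' : tangential_base_point v'), v' != 0 /\ tb_z b' = z'.
Proof.
case: b => num den den0 num0 dt z z0 zE /= z'0 A0 B0 A1 zAB.
pose M := maxn (size num) (size den); pose N := M.+1.
pose hom (p : {poly F}) := \sum_(i < N.+1) p`_i *: (A ^+ i * B ^+ (N - i)).
have homE (p : {poly F}) : (size p <= N.+1)%N -> ps_subst z' (hom p) = ps_subst z p * ps_subst z' B ^+ N.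
  move=> sp; have -> : ps_subst z p = \sum_(i < N.+1) psC p`_i * z ^+ i.
    have {1}-> : p = \sum_(i < N.+1) p`_i *: 'X^i.
      rewrite -poly_def; apply/polyP => i; rewrite coef_poly; case: ltnP => // h.
      by rewrite nth_default // (leq_trans sp).
    rewrite rmorph_sum; apply: eq_bigr => i _.
    by rewrite -mul_polyC rmorphM rmorphXn /= ps_substC ps_substX.
  rewrite rmorph_sum mulr_suml; apply: eq_bigr => i _.
  rewrite -mul_polyC !rmorphM !rmorphXn /= ps_substC zAB exprMn -!mulrA; congr (_ * (_ * _)).
  by rewrite -exprD subnKC // -ltnS.
have hom0 (p : {poly F}) : (hom p).[0] = p.[0].
  rewrite /hom big_ord_recl /= expr0 mul1r subn0 hornerD hornerZ horner_exp B0 expr1n mulr1.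
  rewrite horner_sum big1 ?addr0 ?horner_coef0 // => i _.
  by rewrite /bump /= hornerZ hornerM !horner_exp A0 exprS mul0r mul0r mulr0.
have hom1 (p : {poly F}) : p.[0] = 0 -> (hom p)^`().[0] = p^`().[0] * A^`().[0].
  rewrite horner_coef0 => p0; rewrite /hom !big_ord_recl /= p0 scale0r add0r.
  rewrite [p^`().[0]]horner_coef0 coef_deriv mulr1n derivD hornerD derivZ hornerZ.
  rewrite expr1 derivM hornerD !hornerM horner_exp B0 expr1n A0 mul0r addr0 mulr1.
  rewrite (raddf_sum (@deriv F)) horner_sum big1 ?addr0 // => i _.
  rewrite /bump /= !add1n derivZ hornerZ derivM hornerD !hornerM exprS derivM hornerD !hornerM.
  by rewrite exprS hornerM A0 !mul0r !mulr0 !addr0 mul0r mulr0.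
have sn : (size num <= N.+1)%N by rewrite /N ltnW // ltnS ltnW // ltnS leq_maxl.
have sd : (size den <= N.+1)%N by rewrite /N ltnW // ltnS ltnW // ltnS leq_maxr.
have n1 : num^`().[0] != 0.
  by apply/eqP => e; move/eqP: dt; rewrite e mul0r mulr0 eq_sym oner_eq0.
(* The tangent vector is forced by the condition dt(v') = 1. *)
pose v' := ((hom num)^`().[0] / (hom den).[0])^-1.
have q0 : (hom num)^`().[0] / (hom den).[0] != 0.
  by rewrite hom0 hom1 // mulf_neq0 ?mulf_neq0 ?invr_eq0.
have h1 : (hom den).[0] != 0 by rewrite hom0.
have h2 : (hom num).[0] = 0 by rewrite hom0.
have h3 : v' * ((hom num)^`().[0] / (hom den).[0]) = 1 by rewrite mulVf.
have h4 : ps_subst z' (hom num) = psX F * ps_subst z' (hom den).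
  by rewrite !homE // zE mulrA.
exists v', (TangentialBasePoint h1 h2 h3 z'0 h4); split=> //.
by rewrite invr_eq0.
Qed.

(* [z = 27/4 w (1 - w)^2], and both [3 w] and [w / (4 - 3 w)] are coordinates
   of the projective line with respect to which [w] is unramified outside three
   points. *)
Lemma two_base_points v (b : tangential_base_point v) :
  exists (w : pseries F) v1 (b1 : tangential_base_point v1) v2 (b2 : tangential_base_point v2),
  [/\ v1 != 0, v2 != 0, tb_z b = psC (27%:R / 4%:R) * (w * (1 - w) ^+ 2),
      tb_z b1 = psC 3%:R * w & (4%:R - 3%:R * w) * tb_z b2 = w].
Proof.
have [w [w0 ew]] := cubic_series (tb_z0 b).
have n4 : 4%:R != 0 :> F by exact: natF_neq0 3.
have n3 : 3%:R != 0 :> F by exact: natF_neq0 2.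
have n27 : 27%:R != 0 :> F by exact: natF_neq0 26.
have psCn n : psC n%:R = n%:R :> pseries F by rewrite rmorph_nat.
have psCV n : n%:R != 0 :> F -> psC n%:R^-1 * n%:R = 1 :> pseries F.
  by move=> n0; rewrite -psCn -rmorphM mulVf ?rmorph1.
(* With z' = 3 w the cubic becomes z = z' (3 - z')^2 / 4. *)
have [|||||v1 [b1 [v10 e1]]] := @base_point_change v b
  (4%:R^-1 *: ('X * (3%:R%:P - 'X) ^+ 2)) 1 (psC 3%:R * w).
- by rewrite coefps0_mul w0 mulr0.
- by rewrite hornerZ hornerM hornerX mul0r mulr0.
- by rewrite hornerC.
- rewrite derivZ hornerZ derivX0.
  by rewrite horner_exp hornerD hornerN hornerX hornerC subr0 mulf_neq0 ?invr_eq0 // expf_neq0.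
- rewrite rmorph1 mulr1 -mul_polyC rmorphM rmorphM rmorphXn rmorphB /= !ps_substC ps_substX -ew.
  rewrite rmorphM /= !psCn; have := psCV _ n4; move: (psC _) => q _; ring.
have [c hc] : exists c, (4%:R - 3%:R * w) * c = 1.
  apply: ps_inv_ex; rewrite -!psCn.
  rewrite -[coefps _ _]/(coefps (psC (4%:R : F)) 0 - coefps (psC 3%:R * w) 0).
  by rewrite coefps0_mul w0 mulr0 subr0.
(* With z' = w / (4 - 3 w), so that w = 4 z' / (1 + 3 z'), it becomes z = 27 z' (1 - z')^2 / (1 + 3
   z')^3. *)
have [|||||v2 [b2 [v20 e2]]] := @base_point_change v b
  (27%:R *: ('X * (1 - 'X) ^+ 2)) ((1 + 3%:R *: 'X) ^+ 3) (w * c).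
- by rewrite coefps0_mul w0 mul0r.
- by rewrite hornerZ hornerM hornerX mul0r mulr0.
- by rewrite horner_exp hornerD hornerZ hornerX mulr0 -polyC1 hornerC addr0 expr1n.
- rewrite derivZ hornerZ derivX0.
  by rewrite horner_exp hornerD hornerN hornerX -polyC1 hornerC subr0 expr1n mulf_neq0 ?oner_eq0.
- have -> : ps_subst (w * c) (27%:R *: ('X * (1 - 'X) ^+ 2)) = psC 27%:R * ((w * c) * (1 - w * c) ^+ 2).
    by rewrite -mul_polyC rmorphM rmorphM rmorphXn rmorphB rmorph1 /= ps_substC ps_substX.
  have -> : ps_subst (w * c) ((1 + 3%:R *: 'X) ^+ 3) = (1 + psC 3%:R * (w * c)) ^+ 3.
    by rewrite -mul_polyC rmorphXn rmorphD rmorphM rmorph1 /= ps_substC ps_substX.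
  rewrite -ew.
  rewrite rmorphM /= !psCn; have := psCV _ n4; move: (psC _) => q hq.
  have e3 : 1 + 3%:R * (w * c) = 4%:R * c.
    by rewrite -{1}hc; ring.
  have e4 : 1 - w * c = 4%:R * (1 - w) * c by rewrite -{1}hc; ring.
  rewrite e3 e4; have -> : 27%:R * q * (w * (1 - w) ^+ 2) * (4%:R * c) ^+ 3 = (q * 4%:R) * (27%:R * (w * (1-w)^+2) * 16%:R * c ^+ 3) by ring.
  by rewrite hq; ring.
exists w, v1, b1, v2, b2; split=> //.
- by rewrite e2 mulrCA hc mulr1.
Qed.

End BaseChange.

(** * The topology of pi_1 in terms of finite sets of functions *)

Section FiberLists.
Variable K : closedFieldType.
Hypothesis charK : [pchar K] =i pred0.
Local Notation P := (puiseux K).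
Local Notation pcst := (@pcst K).
Variables (Om : fieldType) (kap : {rmorphism K -> Om}) (io : {rmorphism Om -> P}).
Hypothesis clOm : GRing.closed_field_axiom Om.
Hypothesis io_kap : forall c, io (kap c) = pcst c.
Variables (y : Om) (ny : nonconst kap y).
Hypothesis algy : forall u, algebraicOver (ratev ny) u.
Local Notation G := (gaut kap y).
Variables (z : pseries K) (zP : ps_nonunit z).
Hypothesis ioy : io y = pser 0 z.
Local Notation unram := (unramified kap y).
Local Notation theta := (theta charK clOm io_kap zP ioy algy).

(** A point of the Galois cover of a stable set containing [us] serves. With [theta_open] this
    compares pointwise convergence on fibers with pointwise convergence on unramified functions. *)
Lemma theta_detects (us : seq Om) : (forall u, u \in us -> unram u) ->
  exists (O : tcover zP) (x : tfiber O), forall a b : G,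
    theta a O x = theta b O x -> forall u, u \in us -> a u = b u.
Proof.
move=> uus; have [S gS us_S] := good_seq clOm algy uus.
have [O [hB [hb Bi _ _]]] := galois_cover_ex charK clOm io_kap algy zP ioy gS.
have [x xh] := realizes_surj charK io_kap ioy hb.
exists O, x => a b e u /us_S uS.
have ra := move_fiberE charK clOm io_kap ny ioy a xh.
have rb := move_fiberE charK clOm io_kap ny ioy b xh.
have e' : a \o hB =1 b \o hB.
  by apply: (realizes_fun charK ra); move: e => /= ->.
apply: (eqS_inB charK algy gS) uS => v /Bi[c <-]; exact: e'.
Qed.

Lemma theta_depends (O : tcover zP) (x : tfiber O) : exists us : seq Om,
  (forall u, u \in us -> unram u) /\ forall a b : G,
    (forall u, u \in us -> a u = b u) -> theta a O x = theta b O x.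
Proof.
have xh := hom_ofP charK clOm io_kap ny ioy x; set h := hom_of _ _ _ _ _ _ in xh.
have hh := realizes_over io_kap ny ioy xh.
have [N [_ [e [_ [gen _]]]]] := (tc_etB O).1.
exists [seq h (e i) | i <- enum 'I_N]; split.
  by move=> _ /mapP[i _ ->]; exact: (cover_unramified charK (e i) hh).
move=> a b ab; apply: (realizes_inj (move_fiberE charK clOm io_kap ny ioy a xh)).
apply: realizes_eq (move_fiberE charK clOm io_kap ny ioy b xh) => c /=.
have [d ->] := gen c; rewrite !rmorph_sum; apply: eq_bigr => i _.
rewrite !rmorphM -[h (tc_b O _)]/((h \o tc_b O) _) hh; congr (_ * _).
  by rewrite /= /ostd /= !ga_ratev.
by apply/esym/ab/map_f; rewrite mem_enum.
Qed.

Lemma theta_open (s : seq {O : tcover zP & tfiber O}) : exists us : seq Om,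
  (forall u, u \in us -> unram u) /\ forall a b : G,
    (forall u, u \in us -> b u = a u) -> agree_on (@pi_fun K z zP) s (theta a) (theta b).
Proof.
suff [us [uus usP]] : exists us : seq Om, (forall u, u \in us -> unram u) /\ forall a b : G,
    (forall u, u \in us -> b u = a u) -> forall x : {O : tcover zP & tfiber O},
    List.In x s -> theta b _ (projT2 x) = theta a _ (projT2 x).
  by exists us; split=> // a b ab O x xs; have := usP a b ab _ xs.
elim: s => [|[O x] s [us [uus IH]]]; first by exists [::].
have [vs [uvs xP]] := theta_depends x; exists (vs ++ us); split.
  by move=> u; rewrite mem_cat => /orP[/uvs|/uus].
move=> a b ab x' [<-|]; first by apply: xP => u uu; apply: ab; rewrite mem_cat uu.
by apply: IH => u uu; apply: ab; rewrite mem_cat uu orbT.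
Qed.
End FiberLists.

(** * Compatibility with the Galois action on coefficients *)

Section Equivariance.
Variables (F : fieldType) (K : closedFieldType) (iota : {rmorphism F -> K}).
Hypothesis charK : [pchar K] =i pred0.
Local Notation P := (puiseux K).
Local Notation pcst := (@pcst K).

Lemma pmap_lau (s : {rmorphism K -> K}) x : pmap s (@lau K 0 x) = @lau K 0 (laurent_map s x).
Proof.
apply: (@frac_morph_ext _ _ (pmap s \o @lau K 0) (@lau K 0 \o laurent_map s)) => f.
by rewrite /= /laurent_map frac_map_tofrac !lau_ps pmap_pser.
Qed.

Lemma pc_pmap (s : {rmorphism K -> K}) u q : pc (pmap s u) q = s (pc u q).
Proof. by []. Qed.

Lemma ev1_pmap (s : {rmorphism K -> K}) u : ev1 (pmap s u) = s (ev1 u).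
Proof.
have supp q : (pc (pmap s u) q != 0) = (pc u q != 0) by rewrite pc_pmap fmorph_eq0.
have [fu|nf] := pselect (pfin u).
  have [l ul al] := pfin_uniq fu.
  rewrite (ev1E ul al) (@ev1E _ _ l) // => [|q]; last by rewrite supp => /al.
  by rewrite rmorph_sum; apply: eq_bigr => q _; rewrite pc_pmap.
rewrite /ev1; case: pselect => [[l hl]|_]; first by case: nf; exists l => q; rewrite -supp => /hl.
by case: pselect => // _; rewrite rmorph0.
Qed.

Variables (zF : pseries F).
Let z := ps_map iota zF.
Variable (zP : ps_nonunit z).
Variables (Om : fieldType) (kap : {rmorphism K -> Om}) (io : {rmorphism Om -> P}).
Hypothesis clOm : GRing.closed_field_axiom Om.
Hypothesis io_kap : forall c, io (kap c) = pcst c.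
Variables (y : Om) (ny : nonconst kap y).
Hypothesis algy : forall u, algebraicOver (ratev ny) u.
Hypothesis ioy : io y = pser 0 z.
Variables (s : Defs.gal iota) (t : {rmorphism Om -> Om}).
Hypothesis tE : forall u, io (t u) = pmap s (io u).
Local Notation theta := (theta charK clOm io_kap zP ioy algy).

Lemma realizes_up (O : tcover zP) (x : tfiber (twist s O)) (h : {rmorphism tc_B O -> Om}) :
  @realizes K Om io z zP (twist s O) x h -> realizes io (tf_up x) (t \o h : {rmorphism tc_B O -> Om}).
Proof.
move=> [w [wd wb wc]]; exists (pmap s \o w); split.
- move=> a /=; have := wd (laurent_map (Defs.galV s) a); rewrite /= laurent_mapK => [->|]; last exact: gal_funVK.
  rewrite pmap_lau; congr lau; apply: laurent_mapK; exact: gal_funVK.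
- by move=> b /=; rewrite tE; have := wb b => /= ->.
- by move=> c /=; rewrite ev1_pmap wc.
Qed.

(** If [h] realizes a point of the twisted cover, then [t \o h] realizes the corresponding point of
    the cover, since setting the roots to 1 commutes with acting on coefficients. So the action of
    [s] on pi_1 becomes conjugation by [t]. *)
Lemma theta_equivariant (a b : gaut kap y) : (forall u, b (t u) = t (a u)) ->
  theta b = gal_act s (theta a).
Proof.
move=> bt; apply: pi1P => O x.
have xh := hom_ofP charK clOm io_kap ny ioy (tf_down s x).
have := realizes_up xh; rewrite tf_downK => xh'.
apply: (realizes_inj (move_fiberE charK clOm io_kap ny ioy b xh')).
apply: realizes_eq (realizes_up (move_fiberE charK clOm io_kap ny ioy a xh)) => c /=.
by rewrite bt.
Qed.
End Equivariance.

(** * The cubic and the ramification of its two coordinates *)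

Section LargerRationalField.
Variables (K : closedFieldType) (E : fieldType) (kap : {rmorphism K -> E}).
Variables (y w : E) (ny : nonconst kap y) (nw : nonconst kap w) (x : {fraction {poly K}}).
Hypothesis yE : y = ratev nw x.

Lemma ratev_larger : exists h : {rmorphism {fraction {poly K}} -> {fraction {poly K}}},
  forall r, ratev ny r = ratev nw (h r).
Proof.
pose kf : {rmorphism K -> {fraction {poly K}}} := @FracField.tofrac _ \o @polyC K.
have nx : nonconst kf x.
  by move=> c e; apply: (ny (c := c)); rewrite yE e /= ratev_poly pevC.
exists (ratev nx) => r.
apply/esym; apply: (@ratev_comp K _ E kf kap (ratev nw) x y nx ny) => [c|]; last by rewrite yE.
by rewrite /= ratev_poly pevC.
Qed.

Lemma algebraic_over_larger :
  (forall u, algebraicOver (ratev ny) u) -> forall u, algebraicOver (ratev nw) u.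
Proof.
move=> alg u; have [p p0 pu] := alg u; have [h e] := ratev_larger.
exists (map_poly h p); first by rewrite map_poly_eq0.
by rewrite -map_poly_comp -(eq_map_poly e).
Qed.
End LargerRationalField.

Section CubicAlgebra.
Variable E : fieldType.
Lemma cubic_sub (A B : E) : A * (1 - A) ^+ 2 - B * (1 - B) ^+ 2 =
  (A - B) * (1 - 2%:R * (A + B) + (A * A + A * B + B * B)).
Proof. ring. Qed.
Lemma cubic_deriv (d : E) : 1 - 2%:R * (d + d) + (d * d + d * d + d * d) = (1 - d) * (1 - 3%:R * d).
Proof. ring. Qed.
Lemma cubic_value (k3 d : E) : k3 * 3%:R = 1 -> 3%:R * d = 1 -> 27%:R * (d * (1 - d) ^+ 2) = 4%:R.
Proof.
move=> hk hd; have -> : d = k3 by rewrite -[d]mul1r -hk -mulrA hd mulr1.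
have -> : 27%:R * (k3 * (1 - k3) ^+ 2) = 9%:R * (k3 * 3%:R) - 18%:R * (k3 * 3%:R) * k3 + 9%:R * k3 * k3 * (k3 * 3%:R) :> E by ring.
rewrite hk; have -> : 9%:R * 1 - 18%:R * 1 * k3 + 9%:R * k3 * k3 * 1 = 9%:R - 6%:R * (k3 * 3%:R) + (k3 * 3%:R) * (k3 * 3%:R) :> E by ring.
by rewrite hk; ring.
Qed.
End CubicAlgebra.

Lemma inv_shift (E : fieldType) (a p q : E) : a != 0 -> a / (p - q * a) = (p * a^-1 - q)^-1.
Proof.
move=> a0; have -> : p - q * a = (p * a^-1 - q) * a by rewrite mulrBl divfK.
by rewrite invfM mulrCA divff // mulr1.
Qed.

Section Branches.
Variable K : closedFieldType.
Hypothesis charK : [pchar K] =i pred0.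
Local Notation P := (puiseux K).
Local Notation pcst := (@pcst K).
Variables (Om : fieldType) (kap : {rmorphism K -> Om}) (w : Om).
Definition coord := kap (27%:R / 4%:R) * (w * (1 - w) ^+ 2).
Definition coord1 := kap 3%:R * w.
Definition coord2 := w / (kap 4%:R - kap 3%:R * w).

Definition unram_at d u := forall j : {rmorphism Om -> P}, place kap j ->
  residue_at d (j w) -> lvl 0 (j u).
Definition unram_infty u := forall j : {rmorphism Om -> P}, place kap j ->
  residue_at 0 (j w)^-1 -> lvl 0 (j u).

Lemma nat_neq0K n : n.+1%:R != 0 :> K.
Proof. by have /pcharf0P -> : [pchar K] =i pred0 by []. Qed.

Lemma residueM c d (Y Z : P) : residue_at c Y -> residue_at d Z -> residue_at (c * d) (Y * Z).
Proof.
move=> [l1 i1 r1] [l2 i2 r2]; split; [exact: lvlM|exact: pintM|by rewrite res_mul // r1 r2].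
Qed.
Lemma residueB c d (Y Z : P) : residue_at c Y -> residue_at d Z -> residue_at (c - d) (Y - Z).
Proof.
by move=> [l1 i1 r1] [l2 i2 r2]; split; [exact: lvlB|exact: pintB|rewrite pcB r1 r2].
Qed.
Lemma residueV c (Y : P) : c != 0 -> residue_at c Y -> residue_at c^-1 Y^-1.
Proof.
move=> c0 [l1 i1 r1]; split; [exact: lvlV|apply: pint_unit|rewrite res_inv] => //; rewrite ?r1 //.
Qed.
Lemma residue_cst c : residue_at c (pcst c).
Proof. by split; [exact: lvl_cst|exact: pint_cst|exact: res_cst]. Qed.

Lemma unram_coord1 u : unramified kap coord1 u ->
  forall d, d != 0 -> 3%:R * d != 1 -> unram_at d u.
Proof.
move=> hu d d0 d1 j pj jw; apply: (hu (3%:R * d) _ j pj).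
  by rewrite f01E mulf_neq0 // nat_neq0K.
by rewrite /coord1 rmorphM /= pj; apply: residueM => //; exact: residue_cst.
Qed.

Lemma unram_coord2 u : unramified kap coord2 u ->
  forall d, d != 0 -> d != 1 -> 4%:R - 3%:R * d != 0 -> unram_at d u.
Proof.
move=> hu d d0 d1 d4 j pj jw; apply: (hu (d / (4%:R - 3%:R * d)) _ j pj).
  rewrite f01E mulf_neq0 ?invr_eq0 //=; apply: contraNneq d1 => e.
  have e' : d = 4%:R - 3%:R * d by rewrite -[LHS](divfK d4) e mul1r.
  have : 4%:R * d = 4%:R * 1 by rewrite mulr1 -[RHS](subrK (3%:R * d)) -e'; ring.
  by move/(mulfI (nat_neq0K 3)) ->.
rewrite /coord2 rmorphM fmorphV rmorphB rmorphM /= !pj; apply: residueM => //.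
apply: residueV => //; apply: residueB; first exact: residue_cst.
by apply: residueM => //; exact: residue_cst.
Qed.

Lemma unram_coord2_infty u : unramified kap coord2 u -> w != 0 -> unram_infty u.
Proof.
move=> hu w0 j pj jw; apply: (hu (4%:R * 0 - 3%:R)^-1 _ j pj).
  have n3 := nat_neq0K 2; rewrite mulr0 sub0r f01E invr_eq0 oppr_eq0 n3 /=.
  apply/eqP => e; have : 4%:R = 0 :> K.
    have : - 3%:R = 1 :> K by rewrite -[LHS]invrK e invr1.
    move=> e3; have -> : 4%:R = 1 - (- 3%:R) :> K by ring.
    by rewrite e3 subrr.
  by apply/eqP; exact: nat_neq0K 3.
have -> : j coord2 = (pcst 4%:R * (j w)^-1 - pcst 3%:R)^-1.
  by rewrite /coord2 rmorphM fmorphV rmorphB rmorphM /= !pj inv_shift // fmorph_eq0.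
apply: residueV; first by rewrite mulr0 sub0r oppr_eq0 nat_neq0K.
by apply: residueB; [apply: residueM => //|]; exact: residue_cst.
Qed.

(** The cubic equation makes j w integral. Its residue avoids 0, 1, 1/3 and 4/3, the points above 0
    and 1. A conjugate of j w over K((t)) has the same residue, which is a simple root as it is
    neither 1 nor 1/3; so it equals j w, and j w lies in K((t)). *)
Lemma coord_residue (j : {rmorphism Om -> P}) c : place kap j -> c != 0 -> c != 1 ->
  residue_at c (j coord) -> exists d, [/\ d != 0, d != 1, 3%:R * d != 1, 4%:R - 3%:R * d != 0 &
    residue_at d (j w)].
Proof.
move=> pj c0 c1 [lY iY rY].
have n4 := nat_neq0K 3; have n27 := nat_neq0K 26; have n3 := nat_neq0K 2.
pose q := 27%:R / 4%:R : K; have q0 : q != 0 by rewrite mulf_neq0 ?invr_eq0.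
have eY : j coord = pcst q * (j w * (1 - j w) ^+ 2).
  by rewrite /coord rmorphM rmorphM rmorphXn rmorphB rmorph1 /= pj.
pose Z := pcst q^-1 * j coord.
have iZ : pint Z by apply: pintM => //; exact: pint_cst.
have eZ : j w * (1 - j w) ^+ 2 = Z.
  rewrite /Z eY mulrA -[pcst q^-1 * _](rmorphM pcst) mulVf // rmorph1 mul1r //.
pose p : {poly P} := 'X^3 - 2%:R *: 'X^2 + 'X - Z%:P.
have root_int (W : P) : W * (1 - W) ^+ 2 = Z -> pint W.
  move=> eW; apply: (@pint_root _ p).
  - have sp : (size (- (2%:R *: 'X^2) + 'X - Z%:P : {poly P})%R <= 3)%N.
      rewrite (leq_trans (size_polyD _ _)) // geq_max size_polyN size_polyC; apply/andP; split; last by case: (Z != 0).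
      rewrite (leq_trans (size_polyD _ _)) // geq_max size_polyN size_polyX andbT.
      by rewrite (leq_trans (size_scale_leq _ _)) // size_polyXn.
    rewrite monicE /p -!addrA lead_coefDl ?lead_coefXn // size_polyXn ltnS; rewrite !addrA in sp *; exact: sp.
  - move=> i; rewrite /p !(coefD, coefN, coefZ, coefXn, coefX, coefC).
    have ib (b : bool) : pint (b%:R : P) by case: b; [exact: pint1|exact: pge0].
    apply: pintB; last by case: (i == 0%N); [exact: iZ|exact: pge0].
    apply: pintD; last exact: ib.
    apply: pintB; first exact: ib.
    by apply: pintM; [have := pint_cst (2%:R : K); rewrite rmorph_nat|exact: ib].
  - rewrite rootE /p !hornerE /= -eW; apply/eqP; ring.
have iw := root_int _ eZ; set d := pc (j w) 0.
have i1 : pint (1 - j w) by apply: pintB => //; exact: pint1.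
have rd : q * (d * (1 - d) ^+ 2) = c.
  rewrite -rY eY pc_cstM [X in _ = _ * X]res_mul //; last exact: pintX.
  by rewrite !expr2 res_mul // pcB pc1 eqxx.
have d0 : d != 0 by apply: contraNneq c0 => e; rewrite -rd e mul0r mulr0.
have d1 : d != 1 by apply: contraNneq c0 => e; rewrite -rd e subrr expr0n mulr0 mulr0.
have d3 : 3%:R * d != 1.
  apply: contraNneq c1 => e; rewrite -rd /q mulrAC (cubic_value (k3 := 3%:R^-1)) ?mulVf //.
  by rewrite divff.
have d4 : 4%:R - 3%:R * d != 0.
  apply: contraNneq c1 => e; rewrite -rd.
  have e4 : d = 4%:R / 3%:R by apply: (mulfI n3); rewrite [RHS]mulrC divfK //; apply/eqP; rewrite eq_sym -subr_eq0 e.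
  by rewrite e4 /q; apply/eqP; field; rewrite n3 n4.
exists d; split=> //; split=> //; apply: pfix_fixed => // r rf.
have rZ : r Z = Z by apply: (pfix_lvl rf); apply: lvlM => //; exact: lvl_cst.
have [irw rrw] := pfix_res rf iw.
have := cubic_sub (r (j w)) (j w); rewrite eZ -{1}rZ -eZ !(rmorphM, rmorphXn, rmorphB, rmorph1) /= subrr.
move=> /esym/eqP; rewrite mulf_eq0 subr_eq0 => /orP[/eqP //|/eqP e].
have : (1 - d) * (1 - 3%:R * d) = 0.
  rewrite -cubic_deriv; have := congr1 (fun u => pc u 0) e.
  rewrite pc0 !pcD pcN !res_mul // ?pcD ?rrw ?pc1 ?eqxx.
  - by rewrite -/d /= => <-; ring.
  - by have := pint_cst (2%:R : K); rewrite rmorph_nat.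
  - exact: pintD.
by move/eqP; rewrite mulf_eq0 !subr_eq0 ![1 == _]eq_sym (negPf d1) (negPf d3).
Qed.

Lemma unram_w : unramified kap coord w.
Proof.
move=> c; rewrite f01E => /andP[c0 c1] j pj jy.
by have [d [_ _ _ _ []]] := coord_residue pj c0 c1 jy.
Qed.
Lemma unram1_coord u : unramified kap coord1 u -> unramified kap coord u.
Proof.
move=> hu c; rewrite f01E => /andP[c0 c1] j pj jy.
have [d [d0 d1 d3 d4 jw]] := coord_residue pj c0 c1 jy.
exact: (unram_coord1 hu d0 d3 pj jw).
Qed.
Lemma unram2_coord u : unramified kap coord2 u -> unramified kap coord u.
Proof.
move=> hu c; rewrite f01E => /andP[c0 c1] j pj jy.
have [d [d0 d1 d3 d4 jw]] := coord_residue pj c0 c1 jy.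
exact: (unram_coord2 hu d0 d1 d4 pj jw).
Qed.

Variable nw : nonconst kap w.
Hypothesis algw : forall u, algebraicOver (ratev nw) u.

Lemma w_neq0 : w != 0.
Proof. by apply/eqP => e; apply: (nw (c := 0)); rewrite e rmorph0. Qed.

Lemma ncV : nonconst kap w^-1.
Proof. by move=> c e; apply: (nw (c := c^-1)); rewrite fmorphV -e invrK. Qed.

(** At w = 1/3 and at infinity the second coordinate shows that [u] is unramified, at the other
    nonzero points the first. The coordinate 1/w moves the remaining point 0 to infinity, and simple
    connectedness of the affine line applies. *)
Lemma unram_both u (a : gaut kap w) : unramified kap coord1 u -> unramified kap coord2 u -> a u = u.
Proof.
move=> h1 h2.
have algV : forall v, algebraicOver (ratev ncV) v.
  apply: (@algebraic_over_larger _ _ _ _ _ nw _ (FracField.tofrac 'X)^-1 _ algw).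
  have e : ratev ncV (FracField.tofrac 'X) = w^-1 by rewrite ratev_poly pevX.
  by rewrite fmorphV [X in _ = X^-1]e invrK.
have [|r ->] := simply_connected charK algV (u := u).
  move=> c j pj jv; have [c0|c0] := eqVneq c 0.
    apply: (unram_coord2_infty h2 w_neq0 pj).
    by rewrite -fmorphV jv -c0; exact: residue_at_cX.
  have jw : residue_at c^-1 (j w) by rewrite -[j w]invrK -fmorphV jv; apply: residueV => //; exact: residue_at_cX.
  have cV0 : c^-1 != 0 by rewrite invr_eq0.
  have [e3|n3] := eqVneq (3%:R * c^-1) 1; last exact: (unram_coord1 h1 cV0 n3) pj jw.
  apply: (unram_coord2 h2 cV0) pj jw; last first.
    by rewrite e3 -[4%:R]/((1 + 3)%:R) natrD addrAC subrr add0r nat_neq0K.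
  apply: contraNneq (nat_neq0K 1) => e; move: e3; rewrite e mulr1 => e3.
  by rewrite -[2%:R]/((3 - 1)%:R) natrB // e3 subrr.
have aV : a w^-1 = w^-1 by rewrite fmorphV ga_y.
exact: (@ratev_comp K Om Om kap kap a _ _ ncV ncV (@ga_kap _ _ _ _ a) aV).
Qed.
End Branches.

(** * Goursat's lemma for two normal subfields *)

Section JointAutomorphisms.
Variable K : closedFieldType.
Hypothesis charK : [pchar K] =i pred0.
Variables (Om : fieldType) (kap : {rmorphism K -> Om}).
Hypothesis clOm : GRing.closed_field_axiom Om.
Hypothesis charO : [pchar Om] =i pred0.
Variables (w : Om) (nw : nonconst kap w).
Hypothesis algw : forall u, algebraicOver (ratev nw) u.
Local Notation G := (gaut kap w).

Lemma graph_galg (B : set (Om * Om)) u : (forall r, B (ratev nw r, ratev nw r)) -> galg B u.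
Proof.
move=> hB; have [P [gP P0 rP]] := galg_mgraph (ratev nw) (algw u).
exists P; split; [|exact: P0|exact: rP].
move=> i; have [r ->] := gP i; exact: hB.
Qed.

Lemma gaut_of (g : {rmorphism Om -> Om}) : (forall r, g (ratev nw r) = ratev nw r) ->
  exists a : G, forall u, a u = g u.
Proof.
move=> hg; have gk c : g (kap c) = kap c.
  by have := hg (FracField.tofrac c%:P); rewrite ratev_poly pevC.
have gw : g w = w by have := hg (FracField.tofrac 'X); rewrite ratev_poly pevX.
by exists (Gaut gk gw).
Qed.

Record normal_subfield (M : set Om) := NormalSubfield {
  nsf_ratev : forall r, M (ratev nw r);
  nsf_B : forall u v, M u -> M v -> M (u - v);
  nsf_M : forall u v, M u -> M v -> M (u * v);
  nsf_V : forall u, M u -> M u^-1;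
  nsf_gaut : forall (a : G) u, M u -> M (a u)
}.

Lemma fixed_normal M u : normal_subfield M ->
  (forall a : G, (forall v, M v -> a v = v) -> a u = u) -> M u.
Proof.
move=> [Mr MB MM MV _] fu; apply: contrapT => nMu.
have m1 : M 1 by have := Mr 1; rewrite rmorph1.
pose B : set (Om * Om) := [set x | M x.1 /\ x.1 = x.2].
have gB : graph B.
  split; first by split.
  - move=> x y [h1 e1] [h2 e2]; split; first exact: MB.
    by rewrite /= e1 e2.
  - move=> x y [h1 e1] [h2 e2]; split; first exact: MM.
    by rewrite /= e1 e2.
  - by move=> x [h1 e1] _; split; [exact: MV|rewrite /= e1].
  - by move=> q [_ /= <-].
have aB v : galg B v by apply: graph_galg => r; split; [exact: Mr|].
have [x [_ //]|[] //|g gM gu] := graph_moves clOm charO gB _ aB (u := u).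
have [|a ag] := gaut_of (g := g); first by move=> r; apply: (gM (ratev nw r, ratev nw r)); split; [exact: Mr|].
case/eqP: gu; rewrite -ag; by apply: fu => v Mv; rewrite ag; apply: (gM (v, v)); split.
Qed.

Variables M1 M2 : set Om.
Hypotheses (nM1 : normal_subfield M1) (nM2 : normal_subfield M2).
Hypothesis M12 : forall u, M1 u -> M2 u -> forall a : G, a u = u.

(** Take the orbit of [S] under the automorphisms that fix [M1], and the polynomial with this orbit
    as its roots. Its coefficients are fixed by those automorphisms, so they lie in [M1], and in
    [M2] by normality. Hence [d] fixes them and preserves the orbit. *)
Lemma joint_finite (S : seq Om) (d : G) : (forall (a : G) v, v \in S -> a v \in S) ->
  (forall v, v \in S -> M2 v) ->
  exists c : G, (forall u, M1 u -> c u = u) /\ (forall v, v \in S -> c v = d v).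
Proof.
move=> stabS SM; pose N1 (c : G) := forall u, M1 u -> c u = u.
have [m [g [i0 [gc _ _]]]] := galois_reps stabS.
(* The list [S] is packed into one polynomial, so that the action on all of [S] is the action on a
   single element. *)
pose Th := \poly_(i < size S) S`_i.
have Thc (a b : G) : map_poly a Th = map_poly b Th <-> eqS S a b.
  split=> [e v vS|e].
    have := congr1 (fun p : {poly Om} => p`_(index v S)) e.
    by rewrite !coef_map !coef_poly index_mem vS nth_index.
  apply/polyP => i; rewrite !coef_map !coef_poly; case: ltnP => iS; first by apply: e; exact: mem_nth.
  exact: etrans (rmorph0 a) (esym (rmorph0 b)).
pose L := undup [seq map_poly (g i) Th | i <- enum 'I_m & `[<exists2 c : G, N1 c & eqS S c (g i)>]].
have LP x : x \in L <-> exists2 c : G, N1 c & x = map_poly c Th.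
  rewrite mem_undup; split=> [/mapP[i]|[c Nc ->]].
    by rewrite mem_filter => /andP[/asboolP[c Nc cg] _] ->; exists c => //; apply/Thc => v vS; rewrite cg.
  have [i ci] := gc c; apply/mapP; exists i; last exact/Thc.
  by rewrite mem_filter mem_enum andbT; apply/asboolP; exists c.
pose Gp : {poly {poly Om}} := \prod_(x <- L) ('X - x%:P).
have mapG (c : G) : map_poly (map_poly c) Gp = \prod_(x <- map (map_poly c) L) ('X - x%:P).
  rewrite rmorph_prod big_map; apply: eq_bigr => x _.
  by rewrite rmorphB /= map_polyX map_polyC.
have fixG (c : G) : N1 c -> map_poly (map_poly c) Gp = Gp.
  move=> Nc; rewrite mapG; apply: perm_big; apply: uniq_perm.
  - by rewrite map_inj_uniq ?undup_uniq //; exact: map_poly_inj.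
  - exact: undup_uniq.
  - apply: (uniq_min_size _ _ _).2; rewrite ?size_map //.
      by rewrite map_inj_uniq ?undup_uniq //; exact: map_poly_inj.
    move=> _ /mapP[x /LP[b Nb ->] ->]; apply/LP; exists (gautM c b).
      by move=> u Mu /=; rewrite Nb // Nc.
    by rewrite -map_poly_comp.
have m0 : M2 0 by rewrite -(rmorph0 (ratev nw)); exact: nsf_ratev.
have m1 : M2 1 by rewrite -(rmorph1 (ratev nw)); exact: nsf_ratev.
have mD u v : M2 u -> M2 v -> M2 (u + v).
  by move=> hu hv; rewrite -[v]opprK -[- v]sub0r; apply: (nsf_B nM2) => //; exact: (nsf_B nM2).
have coM2 i k : M2 (Gp`_i)`_k.
  have: forall x, x \in L -> forall k, M2 x`_k.
    move=> x /LP[c _ ->] l; rewrite coef_map; apply: (nsf_gaut nM2).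
    by rewrite coef_poly; case: ltnP => // lS; apply/SM/mem_nth.
  rewrite /Gp; move: (L) => s0; elim: s0 i k => [|x s IH] i k hs.
    by rewrite big_nil coef1; case: (i == 0%N); rewrite ?coef1 ?coef0 //; case: (k == 0%N).
  rewrite big_cons mulrC mulrBr coefB coefMX coefMC coefB; apply: (nsf_B nM2).
    by case: ifP => _; [rewrite coef0|apply: IH => y ys; apply: hs; rewrite inE ys orbT].
  rewrite coefM; apply: (big_ind M2) => // l _; apply: (nsf_M nM2).
    by apply: IH => y ys; apply: hs; rewrite inE ys orbT.
  by apply: hs; rewrite inE eqxx.
have fixd : map_poly (map_poly d) Gp = Gp.
  apply/polyP => i; apply/polyP => k; rewrite !coef_map /=; apply: M12 => //.
  apply: (fixed_normal nM1) => c Nc.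
  have := congr1 (fun p : {poly {poly Om}} => (p`_i)`_k) (fixG c Nc).
  by rewrite !coef_map /=.
have ThL : Th \in L by apply/LP; exists (gaut1 kap w) => //; rewrite map_poly_id.
have : map_poly d Th \in L.
  rewrite -root_prod_XsubC -/Gp -fixd; apply: rmorph_root.
  by rewrite root_prod_XsubC.
by move=> /LP[c Nc /Thc e]; exists c; split=> // v vS; rewrite -e.
Qed.

(** The values forced by prescribing [b] on [M1] and on some finite stable part of [M2] form a
    graph; it is single-valued because the finite case provides automorphisms. [graph_extend] takes
    the place of a compactness argument. *)
Lemma joint_automorphism (a1 a2 : G) : exists b : G,
  (forall u, M1 u -> b u = a1 u) /\ (forall u, M2 u -> b u = a2 u).
Proof.
have fin u : exists2 S : seq Om, (forall (a : G) v, v \in S -> a v \in S) &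
    (forall v, v \in S -> M2 v) /\ (M2 u -> u \in S).
  have [r [ur rP]] := galois_roots clOm algw u.
  exists [seq v <- r | `[<M2 v>]].
    move=> a v; rewrite !mem_filter => /andP[/asboolP Mv vr].
    rewrite rP // ?andbT; first by apply/asboolP; exact: (nsf_gaut nM2).
    by move=> x; exact: ga_ratev.
  split=> [v|Mu]; first by rewrite mem_filter => /andP[/asboolP].
  by rewrite mem_filter ur andbT; apply/asboolP.
pose ok (S : seq Om) := (forall (a : G) v, v \in S -> a v \in S) /\ (forall v, v \in S -> M2 v).
have okU S T : ok S -> ok T -> ok (S ++ T).
  move=> [s1 s2] [t1 t2]; split=> [a v|v]; rewrite !mem_cat => /orP[]; do ?[by move=> /s2|by move=> /t2].
    by move=> /s1 ->.
  by move=> /t1 ->; rewrite orbT.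
pose B : set (Om * Om) := [set x | exists2 S, ok S & forall b : G,
  (forall u, M1 u -> b u = a1 u) -> (forall v, v \in S -> b v = a2 v) -> b x.1 = x.2].
have ex S : ok S -> exists b : G, (forall u, M1 u -> b u = a1 u) /\ (forall v, v \in S -> b v = a2 v).
  move=> [s1 s2]; have [c [c1 c2]] := joint_finite (gautM (gautV clOm algw a1) a2) s1 s2.
  exists (gautM a1 c); split=> [u Mu|v vS] /=; first by rewrite c1.
  by rewrite c2 //= gautVK.
have gB : graph B.
  split.
  - by exists [::]; [split|move=> b _ _; rewrite rmorph1].
  - move=> x x' [S oS hS] [T oT hT]; exists (S ++ T); first exact: okU.
    move=> b b1 b2; rewrite rmorphB hS ?hT // => v vS; apply: b2; by rewrite mem_cat vS ?orbT.
  - move=> x x' [S oS hS] [T oT hT]; exists (S ++ T); first exact: okU.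
    move=> b b1 b2; rewrite rmorphM hS ?hT // => v vS; apply: b2; by rewrite mem_cat vS ?orbT.
  - by move=> x [S oS hS] _; exists S => // b b1 b2; rewrite fmorphV hS.
  - move=> q [S oS hS]; have [b [b1 b2]] := ex S oS.
    by have := hS b b1 b2; rewrite rmorph0.
have [|g gP] := graph_extend clOm gB.
  move=> u; apply: graph_galg => r; exists [::]; first by split.
  by move=> b _ _; exact: ga_ratev.
have [|b bg] := gaut_of (g := g).
  move=> r; apply: (gP (ratev nw r, ratev nw r)); exists [::]; first by split.
  by move=> b _ _; exact: ga_ratev.
exists b; split=> u Mu; rewrite bg.
  by apply: (gP (u, a1 u)); exists [::]; [split|move=> c c1 _; exact: c1].
have [S s1 [s2 uS]] := fin u; apply: (gP (u, a2 u)); exists S; first by split.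
by move=> c _ c2; apply: c2; exact: uS.
Qed.
End JointAutomorphisms.

(* A surjection from an open subgroup of finite index of [Pi] to [Pi1 * Pi2],
   compatible with the actions of [G]. *)
Section Correspondence.
Variables (G Pi Pi1 Pi2 : topGroup).
Variables (a : G -> Pi -> Pi) (a1 : G -> Pi1 -> Pi1) (a2 : G -> Pi2 -> Pi2).
Record corresp := Corresp {
  cH : Pi -> Prop;
  cr1 : Pi -> Pi1;
  cr2 : Pi -> Pi2;
  c_1 : cH (tg_one Pi);
  c_M : forall g h, cH g -> cH h -> [/\ cH (tg_mul g h),
    cr1 (tg_mul g h) = tg_mul (cr1 g) (cr1 h) & cr2 (tg_mul g h) = tg_mul (cr2 g) (cr2 h)];
  c_V : forall g, cH g -> cH (tg_inv g);
  c_open : tg_open cH;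
  c_cont1 : forall U, tg_open U -> tg_open (fun g => cH g /\ U (cr1 g));
  c_cont2 : forall U, tg_open U -> tg_open (fun g => cH g /\ U (cr2 g));
  c_fin : exists m (d : 'I_m -> Pi), forall g, exists i, cH (tg_mul (tg_inv (d i)) g);
  c_act : forall s g, cH g -> [/\ cH (a s g), cr1 (a s g) = a1 s (cr1 g) & cr2 (a s g) = a2 s (cr2 g)];
  c_surj : forall x1 x2, exists g, [/\ cH g, cr1 g = x1 & cr2 g = x2];
  c_proper : exists g, ~ cH g
}.
End Correspondence.

Lemma tg_mulKg (G : topGroup) (g h : G) : tg_mul (tg_inv g) (tg_mul g h) = h.
Proof. by rewrite tg_mulA tg_mulVg tg_mul1g. Qed.

Section Coordinate.
Variables (F : fieldType) (K : closedFieldType) (iota : {rmorphism F -> K}).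
Hypothesis charK : [pchar K] =i pred0.
Local Notation P := (puiseux K).
Local Notation pcst := (@pcst K).
Variables (Om : fieldType) (kap : {rmorphism K -> Om}) (io : {rmorphism Om -> P}).
Hypothesis clOm : GRing.closed_field_axiom Om.
Hypothesis io_kap : forall c, io (kap c) = pcst c.
Variables (w y : Om) (ny : nonconst kap y).
Hypothesis algy : forall u, algebraicOver (ratev ny) u.
Hypothesis yw : forall a : gaut kap w, a y = y.
Variables (zF : pseries F) (zP : ps_nonunit (ps_map iota zF)).
Hypothesis ioy : io y = pser 0 (ps_map iota zF).
Local Notation theta := (theta charK clOm io_kap zP ioy algy).

Definition rst (a : gaut kap w) : gaut kap y := Gaut (@ga_kap _ _ _ _ a) (yw a).
Definition theta_w a := theta (rst a).

Lemma theta_wM a b : theta_w (gautM a b) = pi1_mul (theta_w a) (theta_w b).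
Proof. by rewrite /theta_w -thetaM; apply/theta_kernel. Qed.

Lemma theta_w_eq a b : theta_w a = theta_w b <-> forall u, unramified kap y u -> a u = b u.
Proof. exact: theta_kernel. Qed.

Lemma theta_w_open (U : pi1_group zP -> Prop) a : tg_open U -> U (theta_w a) ->
  exists us : seq Om, (forall u, u \in us -> unramified kap y u) /\
    forall b : gaut kap w, (forall u, u \in us -> b u = a u) -> U (theta_w b).
Proof.
move=> oU /oU[s sU]; have [us [uus usP]] := theta_open charK clOm io_kap algy ioy s.
by exists us; split=> // b ab; apply: sU; exact: usP.
Qed.

Lemma theta_w_act (s : Defs.gal iota) (t : {rmorphism Om -> Om}) (a b : gaut kap w) :
  (forall u, io (t u) = pmap s (io u)) -> (forall u, b (t u) = t (a u)) ->
  theta_w b = gal_act s (theta_w a).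
Proof. by move=> tE bt; exact (theta_equivariant charK zP clOm io_kap algy ioy tE (a := rst a) (b := rst b) bt). Qed.

Hypothesis wy : forall a : gaut kap y, a w = w.
Lemma theta_w_surj (x : pi1 zP) : exists a, theta_w a = x.
Proof.
have [a <-] := theta_surj charK clOm io_kap algy ioy x.
by exists (Gaut (@ga_kap _ _ _ _ a) (wy a)); apply/theta_kernel.
Qed.

Lemma unram_normal (nw : nonconst kap w) : (forall r, unramified kap y (ratev nw r)) ->
  normal_subfield nw (unramified kap y).
Proof.
move=> hr; split=> //.
- by move=> u v; exact: unramifiedB.
- by move=> u v; exact: unramifiedM.
- by move=> u; exact: unramifiedV.
- by move=> a u hu; exact: (unramified_gaut (rst a) hu).
Qed.
End Coordinate.

Section PolynomialEvaluation.
Variables (K : closedFieldType) (E : fieldType) (kap : {rmorphism K -> E}) (y : E).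
Lemma pev_1 : pev kap y 1 = 1. Proof. exact: rmorph1. Qed.
Lemma pev_D p q : pev kap y (p + q) = pev kap y p + pev kap y q. Proof. exact: rmorphD. Qed.
Lemma pev_B p q : pev kap y (p - q) = pev kap y p - pev kap y q. Proof. exact: rmorphB. Qed.
Lemma pev_M p q : pev kap y (p * q) = pev kap y p * pev kap y q. Proof. exact: rmorphM. Qed.
Lemma pev_Xn p n : pev kap y (p ^+ n) = pev kap y p ^+ n. Proof. exact: rmorphXn. Qed.
End PolynomialEvaluation.

Lemma rmorph_homography (R S : fieldType) (f : {rmorphism R -> S}) p q x :
  f (p * x / (1 + q * x)) = f p * f x / (1 + f q * f x).
Proof. by rewrite fmorph_div rmorphD !rmorphM rmorph1. Qed.

Lemma rmorph_cubic (R S : comNzRingType) (f : {rmorphism R -> S}) c x :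
  f (c * (x * (1 - x) ^+ 2)) = f c * (f x * (1 - f x) ^+ 2).
Proof. by rewrite expr2 !rmorphM rmorphB rmorph1. Qed.

Lemma inv_factor (E : fieldType) (x q u t : E) : x != 0 -> x^-1 = q * u -> x * (q * (t * u)) = t.
Proof.
move=> x0 e; have -> : x * (q * (t * u)) = x * (q * u) * t by ring.
by rewrite -e divff // mul1r.
Qed.

Lemma cubic_algebraic (k E : fieldType) (f : {rmorphism k -> E}) c d x : d != 0 ->
  f d = f c * (x * (1 - x) ^+ 2) -> algebraicOver f x.
Proof.
move=> d0 e; exists (c%:P * ('X * (1 - 'X) ^+ 2) - d%:P).
  apply: contraNneq d0 => /(congr1 (fun r : {poly k} => r.[0])).
  rewrite horner0 hornerD hornerN hornerC hornerM [('X * _).[_]]hornerM hornerX mul0r mulr0 add0r => /eqP.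
  by rewrite oppr_eq0.
have -> : map_poly f (c%:P * ('X * (1 - 'X) ^+ 2) - d%:P) = (f c)%:P * ('X * (1 - 'X) ^+ 2) - (f d)%:P.
  by rewrite rmorphB rmorph_cubic /= map_polyX !map_polyC.
rewrite rootE hornerD hornerN hornerM !hornerC [('X * _).[_]]hornerM hornerX horner_exp.
by rewrite hornerD hornerN hornerX -polyC1 hornerC -e subrr.
Qed.

Section CoordinateImages.
Variables (K : closedFieldType) (E Q : fieldType) (kap : {rmorphism K -> E}) (f : {rmorphism E -> Q}).
Lemma coord_image w : f (coord kap w) = f (kap (27%:R / 4%:R)) * (f w * (1 - f w) ^+ 2).
Proof. exact: rmorph_cubic. Qed.
Lemma coord1_image w : f (coord1 kap w) = f (kap 3%:R) * f w.
Proof. exact: rmorphM. Qed.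
Lemma coord2_image w : f (coord2 kap w) = f w / (f (kap 4%:R) - f (kap 3%:R) * f w).
Proof. by rewrite /coord2 rmorphM fmorphV rmorphB rmorphM. Qed.
End CoordinateImages.

(** * The correspondence between three base points *)

Section CorrespondenceOfBasePoints.
Variables (F : fieldType) (K : closedFieldType) (iota : {rmorphism F -> K}).
Hypothesis charK : [pchar K] =i pred0.
Local Notation P := (puiseux K).
Local Notation pcst := (@pcst K).
Variables (Om : fieldType) (kap : {rmorphism K -> Om}) (io : {rmorphism Om -> P}).
Hypothesis clOm : GRing.closed_field_axiom Om.
Hypothesis charO : [pchar Om] =i pred0.
Hypothesis io_kap : forall c, io (kap c) = pcst c.
Variable w : Om.
Local Notation y := (coord kap w).
Local Notation y1 := (coord1 kap w).
Local Notation y2 := (coord2 kap w).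
Variables (ny : nonconst kap y) (ny1 : nonconst kap y1) (ny2 : nonconst kap y2).
Hypothesis algy : forall u, algebraicOver (ratev ny) u.
Variables (z z1 z2 : pseries F).
Variables (zP : ps_nonunit (ps_map iota z)) (zP1 : ps_nonunit (ps_map iota z1))
  (zP2 : ps_nonunit (ps_map iota z2)).
Hypothesis ioy : io y = pser 0 (ps_map iota z).
Hypothesis ioy1 : io y1 = pser 0 (ps_map iota z1).
Hypothesis ioy2 : io y2 = pser 0 (ps_map iota z2).
Hypothesis lift_gal : forall s : Defs.gal iota, exists t : {rmorphism Om -> Om},
  (forall u, io (t u) = pmap s (io u)) /\ t w = w.
Local Notation Gw := (gaut kap w).

Lemma kapn n : kap n%:R = n%:R. Proof. exact: rmorph_nat. Qed.
Lemma kapn0 n : n.+1%:R != 0 :> Om. Proof. by rewrite -kapn fmorph_eq0; exact: nat_neq0K. Qed.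

Lemma nw : nonconst kap w.
Proof. by move=> c e; apply: (ny1 (c := 3%:R * c)); rewrite /coord1 e rmorphM. Qed.

Lemma den_neq0 : kap 4%:R - kap 3%:R * w != 0.
Proof.
apply/eqP => /eqP; rewrite subr_eq0 !kapn => /eqP e; apply: (nw (c := 4%:R / 3%:R)).
apply: (mulfI (kapn0 2)); rewrite -e fmorph_div !kapn mulrC divfK //; exact: kapn0 2.
Qed.

Lemma algw : forall u, algebraicOver (ratev nw) u.
Proof.
apply: (algebraic_over_larger (x := FracField.tofrac ((27%:R / 4%:R)%:P * ('X * (1 - 'X) ^+ 2))) _ algy).
by rewrite ratev_poly !(pev_M, pev_Xn, pev_B, pev_1, pevC, pevX).
Qed.

Lemma w_coord1 : w = ratev ny1 (FracField.tofrac (3%:R^-1%:P * 'X)).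
Proof.
rewrite ratev_poly pev_M pevC pevX /coord1 mulrA -rmorphM mulVf ?rmorph1 ?mul1r //.
exact: nat_neq0K.
Qed.

Lemma alg1 : forall u, algebraicOver (ratev ny1) u.
Proof. exact: (algebraic_over_larger w_coord1 algw). Qed.

Lemma coord2_w : kap 4%:R * y2 / (1 + kap 3%:R * y2) = w.
Proof.
have d0 := den_neq0; rewrite /coord2; set D := _ - _ in d0 *.
have e : 1 + kap 3%:R * (w / D) = kap 4%:R / D.
  by apply: (mulIf d0); rewrite mulrDl mul1r mulrA !divfK // /D subrK.
by rewrite e mulrA invf_div mulrA divfK // mulrC mulKf // kapn; exact: kapn0 3.
Qed.

Lemma w_coord2 : w = ratev ny2 (FracField.tofrac (4%:R%:P * 'X) / FracField.tofrac (1 + 3%:R%:P * 'X)).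
Proof.
rewrite -{1}coord2_w fmorph_div /= !ratev_poly; congr (_ / _).
  by rewrite pev_M pevC pevX.
by rewrite pev_D pev_1 pev_M pevC pevX.
Qed.

Lemma alg2 : forall u, algebraicOver (ratev ny2) u.
Proof. exact: (algebraic_over_larger w_coord2 algw). Qed.

Lemma yw (a : Gw) : a y = y.
Proof. by rewrite /coord rmorphM rmorphM rmorphXn rmorphB rmorph1 ga_kap ga_y. Qed.
Lemma yw1 (a : Gw) : a y1 = y1.
Proof. by rewrite /coord1 rmorphM ga_kap ga_y. Qed.
Lemma yw2 (a : Gw) : a y2 = y2.
Proof. by rewrite /coord2 rmorphM fmorphV rmorphB rmorphM !ga_kap ga_y. Qed.
Lemma wy1 (a : gaut kap y1) : a w = w.
Proof.
have e : w = kap 3%:R^-1 * y1.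
  by rewrite /coord1 mulrA -rmorphM mulVf ?rmorph1 ?mul1r //; exact: nat_neq0K.
by rewrite [LHS](congr1 a e) rmorphM ga_kap ga_y -e.
Qed.
Lemma wy2 (a : gaut kap y2) : a w = w.
Proof.
rewrite [LHS](congr1 a (esym coord2_w)) rmorph_homography !ga_kap ga_y.
exact: coord2_w.
Qed.

Local Notation T0 := (theta_w charK clOm io_kap algy yw zP ioy).
Local Notation T1 := (theta_w charK clOm io_kap alg1 yw1 zP1 ioy1).
Local Notation T2 := (theta_w charK clOm io_kap alg2 yw2 zP2 ioy2).

(** Otherwise [w] would lie in K(y). At a place where y = 1/t it would then have a pole of integral
    order, and the cubic would give [y] a pole of order at least 3. *)
Lemma w_moves : exists a : gaut kap y, a w != w.
Proof.
apply: contrapT => na; have [|r er] := fixed_in clOm charO (i := ratev ny) (u := w) algy.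
  move=> g gr; have gk c : g (kap c) = kap c.
    by have := gr (FracField.tofrac c%:P); rewrite /= ratev_poly pevC.
  have gy : g y = y by have := gr (FracField.tofrac 'X); rewrite /= ratev_poly pevX.
  by apply: contrapT => /eqP gw; apply: na; exists (Gaut gk gy).
have [j pj jy] := place_ex charK algy (@ncXV K).
have lW : lvl 0 (j w).
  by rewrite er (j_ratev ny (@ncXV K) r pj jy); apply: lvl_ratev; apply: lvlV; exact: lvl_X.
pose q := 27%:R / 4%:R : K; have q0 : q != 0.
  by rewrite mulf_neq0 ?invr_eq0 //; [exact: nat_neq0K 26|exact: nat_neq0K 3].
have eW : (pX K)^-1 = pcst q * (j w * (1 - j w) ^+ 2).
  by rewrite -jy /coord rmorphM rmorphM rmorphXn rmorphB rmorph1 pj.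
have nW : ~ pint (j w).
  move=> iW; have iX : pint (pX K)^-1.
    rewrite eW; apply: pintM; first exact: pint_cst.
    by apply: pintM => //; apply: pintX; apply: pintB => //; exact: pint1.
  have := @pgeM _ 1 0 _ _ (@pge_X K) iX; rewrite divff ?pX_neq0 // => h1.
  have := h1 0 isT; rewrite pc1 eqxx => /eqP; by rewrite oner_eq0.
have [iV rV] := pint_or_inv nW; set V := (j w)^-1 in iV rV.
have W0 : j w != 0 by rewrite fmorph_eq0; exact: (w_neq0 nw).
have V1 : pge 1 V by apply: pint_lvl0_pge1 => //; exact: lvlV.
have eV : pX K * (pcst q * (V - 1) ^+ 2) = V * (V * V).
  have e1 : (V - 1) ^+ 2 = V * (V * V) * (j w * (1 - j w) ^+ 2).
    have e2 : V * j w = 1 by rewrite /V mulVf.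
    have -> : V * (V * V) * (j w * (1 - j w) ^+ 2) = (V * j w) * (V - V * j w) ^+ 2 by ring.
    by rewrite e2 mul1r.
  by rewrite e1; apply: inv_factor eW; exact: pX_neq0.
have i2 : pint (V - 1) by apply: pintB => //; exact: pint1.
have := congr1 (fun u => pc u 1) eV.
have -> : pc (V * (V * V)) 1 = 0.
  apply: (pgeM V1 (pgeM V1 V1)); by [].
have iq : pint (pcst q * (V - 1) ^+ 2) by apply: pintM; [exact: pint_cst|apply: pintX].
have := pc_lead (@pge_X K) iq; rewrite addr0 => ->.
rewrite pc_X1 mul1r pc_cstM expr2 res_mul // pcB rV pc1 eqxx => /eqP.
by rewrite mulf_eq0 (negPf q0) /= sub0r mulrNN mulr1 oner_eq0.
Qed.

Lemma T0_kernel (a b : Gw) : T0 a = T0 b -> T1 a = T1 b /\ T2 a = T2 b.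
Proof.
move=> /theta_w_eq ab; split; apply/theta_w_eq => u hu; apply: ab.
  exact: (unram1_coord charK).
exact: (unram2_coord charK).
Qed.

Definition on_H (g : pi1 zP) := exists a : Gw, T0 a = g.
(** An automorphism of [Om] that fixes [w] is reread through another base point; by [T0_kernel] its
    choice does not matter. The value 1 off the subgroup is arbitrary. *)
Definition tr1 (g : pi1 zP) : pi1 zP1 := if pselect (on_H g) is left e then T1 (projT1 (cid e)) else pi1_one zP1.
Definition tr2 (g : pi1 zP) : pi1 zP2 := if pselect (on_H g) is left e then T2 (projT1 (cid e)) else pi1_one zP2.

Lemma tr1E a : tr1 (T0 a) = T1 a.
Proof.
rewrite /tr1; case: pselect => [e|[]]; last by exists a.
by case: (cid e) => b /= /T0_kernel[].
Qed.
Lemma tr2E a : tr2 (T0 a) = T2 a.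
Proof.
rewrite /tr2; case: pselect => [e|[]]; last by exists a.
by case: (cid e) => b /= /T0_kernel[].
Qed.

(* An automorphism close to [T0 a] comes from an automorphism that agrees with
   [a] on any given finite set of unramified elements, for instance on [w]. *)
Lemma near_H (us : seq Om) (a : Gw) : (forall u, u \in us -> unramified kap y u) ->
  exists U : pi1_group zP -> Prop, [/\ tg_open U, U (T0 a) & forall g, U g ->
    exists b : Gw, T0 b = g /\ forall u, u \in us -> b u = a u].
Proof.
move=> uus; have uw : forall u, u \in w :: us -> unramified kap y u.
  by move=> u; rewrite inE => /orP[/eqP ->|/uus //]; exact: unram_w.
have [O [x xP]] := theta_detects charK clOm io_kap algy zP ioy uw.
pose s : seq {O : tcover zP & tfiber O} := [:: existT _ O x].
exists (agree_on (@pi_fun K _ zP) s (T0 a)); split.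
- exact: agree_on_open.
- by [].
- move=> g ga; have [b bg] := theta_surj charK clOm io_kap algy ioy g.
  have eb u : u \in w :: us -> b u = a u.
    apply: (xP b (rst yw a)); rewrite bg; exact: (ga O x (or_introl erefl)).
  have bw : b w = w by rewrite eb ?inE ?eqxx // ga_y.
  exists (Gaut (@ga_kap _ _ _ _ b) bw); split=> [|u uu]; last by apply: eb; rewrite inE uu orbT.
  by rewrite -bg; apply/theta_kernel.
Qed.

Lemma pointwise_local (U : pi1_group zP -> Prop) : (forall g, U g ->
  exists V, [/\ @tg_open (pi1_group zP) V, V g & forall h, V h -> U h]) -> tg_open U.
Proof.
move=> h; suff: pointwise_open (@pi_fun K _ zP) U by [].
move=> g Ug; have [V [oV Vg VU]] := h g Ug.
by have [s sV] := (oV : pointwise_open (@pi_fun K _ zP) V) g Vg; exists s => k /sV /VU.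
Qed.

(** Conjugation by one lift of [s] to [Om] that fixes [w] serves all three base points. *)
Lemma gal_lift (s : Defs.gal iota) (a : Gw) : exists b : Gw,
  [/\ T0 b = gal_act s (T0 a), T1 b = gal_act s (T1 a) & T2 b = gal_act s (T2 a)].
Proof.
have [t [tE tw]] := lift_gal s; have [t' [tE' tw']] := lift_gal (Defs.galV s).
have pmapK (g h : {rmorphism K -> K}) : cancel g h -> cancel (pmap g) (pmap h).
  by move=> gh u; apply: puiseuxP => r; rewrite !pc_pmap gh.
have tK : cancel t t'.
  by move=> u; apply: (fmorph_inj io); rewrite tE' tE; apply: pmapK; exact: gal_funK.
have tk c : t (kap c) = kap (s c).
  by apply: (fmorph_inj io); rewrite tE !io_kap pcstE pmap_mono -pcstE.
have tk' c : t' (kap c) = kap (Defs.galV s c).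
  by apply: (fmorph_inj io); rewrite tE' !io_kap pcstE pmap_mono -pcstE.
pose g : {rmorphism Om -> Om} := t \o a \o t'.
have gk c : g (kap c) = kap c by rewrite /= tk' ga_kap tk; exact: (congr1 kap (gal_funVK s c)).
have gw : g w = w by rewrite /= tw' ga_y tw.
by exists (Gaut gk gw); split; apply: theta_w_act tE _ => u /=; rewrite tK.
Qed.

Theorem base_point_corresp :
  exists C : @corresp (galois_group iota) (pi1_group zP) (pi1_group zP1) (pi1_group zP2)
    (fun s => gal_act s) (fun s => gal_act s) (fun s => gal_act s), True.
Proof.
have cM g h : on_H g -> on_H h -> [/\ on_H (pi1_mul g h),
    tr1 (pi1_mul g h) = pi1_mul (tr1 g) (tr1 h) & tr2 (pi1_mul g h) = pi1_mul (tr2 g) (tr2 h)].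
  move=> [a <-] [b <-]; rewrite -theta_wM !tr1E !tr2E !theta_wM; split=> //.
  by exists (gautM a b); rewrite theta_wM.
have H1 : on_H (pi1_one zP).
  by exists (gaut1 kap w); rewrite -(theta1 charK clOm io_kap zP ioy algy); apply/theta_kernel.
have cV g : on_H g -> on_H (pi1_inv g).
  move=> [a <-]; exists (gautV clOm algw a).
  have e : pi1_mul (T0 a) (T0 (gautV clOm algw a)) = pi1_one zP.
    rewrite -theta_wM -(theta1 charK clOm io_kap zP ioy algy); apply/theta_kernel => u _ /=.
    exact: gautVK.
  rewrite -[LHS](@tg_mulKg (pi1_group zP) (T0 a)) [X in tg_mul _ X]e.
  by apply: pi1P => O x.
have cO : @tg_open (pi1_group zP) on_H.
  apply: pointwise_local => g [a <-]; have [//|U [oU Ua UP]] := @near_H [::] a.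
  by exists U; split=> // h /UP[b [<- _]]; exists b.
have ct1 U : @tg_open (pi1_group zP1) U -> @tg_open (pi1_group zP) (fun g => on_H g /\ U (tr1 g)).
  move=> oU; apply: pointwise_local => g [[a <-]]; rewrite tr1E => Ua.
  have [us [uus usP]] := theta_w_open oU Ua.
  have [|W [oW Wa WP]] := @near_H us a; first by move=> u /uus; exact: (unram1_coord charK).
  exists W; split=> // h /WP[b [<- ab]]; rewrite tr1E; split; [by exists b|exact: usP].
have ct2 U : @tg_open (pi1_group zP2) U -> @tg_open (pi1_group zP) (fun g => on_H g /\ U (tr2 g)).
  move=> oU; apply: pointwise_local => g [[a <-]]; rewrite tr2E => Ua.
  have [us [uus usP]] := theta_w_open oU Ua.
  have [|W [oW Wa WP]] := @near_H us a; first by move=> u /uus; exact: (unram2_coord charK).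
  exists W; split=> // h /WP[b [<- ab]]; rewrite tr2E; split; [by exists b|exact: usP].
have cF : exists m (d : 'I_m -> pi1_group zP), forall g, exists i, on_H (tg_mul (tg_inv (d i)) g).
  have [r [wr rP]] := galois_roots clOm algy w.
  have ex v : exists d : gaut kap y, (exists b : gaut kap y, b w = v) -> d w = v.
    by have [[b bv]|nb] := pselect (exists b : gaut kap y, b w = v); [exists b|exists (gaut1 kap y)].
  pose d v := projT1 (cid (ex v)).
  have dP v (b : gaut kap y) : b w = v -> d v w = v by rewrite /d; case: cid => x xP bv; apply: xP; exists b.
  (* One coset representative for each conjugate of [w]. *)
  exists (size r), (fun i => theta charK clOm io_kap zP ioy algy (d r`_i)) => g.
  have [b <-] := theta_surj charK clOm io_kap algy ioy g.
  have br : b w \in r by apply: (rP b) wr => x; exact: ga_ratev.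
  have ir : (index (b w) r < size r)%N by rewrite index_mem.
  exists (Ordinal ir); rewrite /= nth_index //; set dd := d (b w).
  have ddw : dd w = b w := dP _ _ erefl.
  pose c := gautM (gautV clOm algy dd) b.
  have cw : c w = w by rewrite /= -ddw gautK.
  exists (Gaut (@ga_kap _ _ _ _ c) cw).
  have -> : theta charK clOm io_kap zP ioy algy b = @tg_mul (pi1_group zP) (theta charK clOm io_kap zP ioy algy dd) (theta charK clOm io_kap zP ioy algy c).
    by rewrite -[RHS]thetaM; apply/theta_kernel => u _ /=; rewrite gautVK.
  rewrite [RHS](@tg_mulKg (pi1_group zP) (theta charK clOm io_kap zP ioy algy dd) (theta charK clOm io_kap zP ioy algy c)).
  exact/theta_kernel.
have cA (s : galois_group iota) g : on_H g -> [/\ on_H (gal_act s g), tr1 (gal_act s g) = gal_act s (tr1 g) & tr2 (gal_act s g) = gal_act s (tr2 g)].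
  move=> [a <-]; have [b [<- e1 e2]] := gal_lift s a.
  by rewrite !tr1E !tr2E; split=> //; exists b.
have cS x1 x2 : exists g, [/\ on_H g, tr1 g = x1 & tr2 g = x2].
  have [a1 <-] := theta_w_surj charK clOm io_kap alg1 yw1 ioy1 wy1 x1.
  have [a2 <-] := theta_w_surj charK clOm io_kap alg2 yw2 ioy2 wy2 x2.
  have r1 r : unramified kap y1 (ratev nw r).
    by have [h ->] := ratev_larger nw w_coord1; exact: unramified_ratev.
  have r2 r : unramified kap y2 (ratev nw r).
    by have [h ->] := ratev_larger nw w_coord2; exact: unramified_ratev.
  have i12 u : unramified kap y1 u -> unramified kap y2 u -> forall a : Gw, a u = u.
    by move=> h1 h2 a; exact: (unram_both charK algw).
  have [b [b1 b2]] := joint_automorphism clOm charO algw (unram_normal yw1 r1) (unram_normal yw2 r2) i12 a1 a2.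
  exists (T0 b); rewrite tr1E tr2E; split; first by exists b.
    by apply/theta_w_eq.
  by apply/theta_w_eq.
have cP : exists g, ~ on_H g.
  have uw : unramified kap y w by exact: unram_w.
  have [a aw] := w_moves; exists (theta charK clOm io_kap zP ioy algy a) => -[b] /theta_kernel/(_ w uw) e.
  by case/eqP: aw; rewrite -e; exact: (ga_y b).
by exists (Corresp (G := galois_group iota) (Pi := pi1_group zP) (Pi1 := pi1_group zP1) (Pi2 := pi1_group zP2) H1 cM cV cO ct1 ct2 cF cA cS cP).
Qed.
End CorrespondenceOfBasePoints.

(** * Algebraic functions realized inside the Puiseux series *)

Section BasePoints.
Variables (F : fieldType) (K : closedFieldType) (iota : {rmorphism F -> K}).
Hypothesis charF : [pchar F] =i pred0.
Local Notation P := (puiseux K).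

Lemma charK_of : [pchar K] =i pred0.
Proof. by move=> p; rewrite (fmorph_pchar iota) charF. Qed.
Local Notation charK := charK_of.

Lemma laurent_expansion : exists J : {rmorphism pseries F -> P},
  (forall f, J f = pser 0 (ps_map iota f)) /\ forall c, J (psC c) = pcst (iota c).
Proof.
exists (pser 0 \o ps_map iota : {rmorphism pseries F -> P}); split=> // c.
by rewrite /= /pcst /=; congr pser; apply: psP => -[|n] //=; exact: rmorph0.
Qed.

Lemma pev_pmap (s : {rmorphism K -> K}) (Y : P) q : pmap s Y = Y ->
  pev (@pcst K) Y (map_poly s q) = pmap s (pev (@pcst K) Y q).
Proof.
move=> sY; elim/poly_ind: q => [|q c IH]; first by rewrite !raddf0.
have -> : map_poly s (q * 'X + c%:P) = map_poly s q * 'X + (s c)%:P.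
  by rewrite rmorphD rmorphM /= map_polyX map_polyC.
rewrite !(pev_D, pev_M) !pevX !pevC IH.
apply/esym; apply: etrans (rmorphD (pmap s) _ _) _; congr (_ + _).
  by apply: etrans (rmorphM (pmap s) _ _) _; congr (_ * _).
apply: etrans (congr1 (pmap s) (pcstE c)) _; rewrite pmap_mono; exact/esym/pcstE.
Qed.

Lemma ratev_pmap (s : {rmorphism K -> K}) (Y : P) (nY : nonconst (@pcst K) Y) r : pmap s Y = Y ->
  ratev nY (ratfun_map s r) = pmap s (ratev nY r).
Proof.
move=> sY; apply: (@frac_morph_ext _ _ (ratev nY \o ratfun_map s) (pmap s \o ratev nY)) => q.
by rewrite /= /ratfun_map frac_map_tofrac !ratev_poly pev_pmap.
Qed.

Lemma algebraic_functions z (nz : nonconst (@pcst K) (pser 0 z)) :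
  exists (Om : fieldType) (kap : {rmorphism K -> Om}) (io : {rmorphism Om -> P}) (y : Om)
    (ny : nonconst kap y), [/\ forall c, io (kap c) = pcst c, io y = pser 0 z,
    forall u, algebraicOver (ratev ny) u, GRing.closed_field_axiom Om &
    forall x, algebraicOver (ratev nz) x -> exists u, io u = x].
Proof.
exists (acl (ratev nz)), (acl_cst nz), val, (acl_gen nz), (@acl_nonconst _ _ _ _ nz).
split=> //; first exact: acl_algebraic.
  apply: acl_closed; exact: (puiseux_closed charK).
exact: acl_ex.
Qed.

Theorem tangential_corresp v (b : tangential_base_point v) :
  exists v1 (b1 : tangential_base_point v1) v2 (b2 : tangential_base_point v2),
  [/\ v1 != 0, v2 != 0 & exists C : @corresp (galois_group iota) (tangential_pi1 iota b)
    (tangential_pi1 iota b1) (tangential_pi1 iota b2)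
    (fun s => gal_act s) (fun s => gal_act s) (fun s => gal_act s), True].
Proof.
have [wF [v1 [b1 [v2 [b2 [v10 v20 eb e1 e2]]]]]] := two_base_points charF b.
exists v1, b1, v2, b2; split=> //.
have [J [JE JC]] := laurent_expansion.
have nz := nc_nonunit (tb_nonunit b iota).
have [Om [kap [io [y0 [ny0 [io_kap ioy0 algy0 clOm io_surj]]]]]] := algebraic_functions nz.
pose W := J wF.
have Jn n : J (psC n%:R) = pcst n%:R by rewrite JC rmorph_nat.
have Jn' n : J n%:R = pcst n%:R by rewrite !rmorph_nat.
have Js (s : Defs.gal iota) f : pmap s (J f) = J f.
  by rewrite JE pmap_pser; congr pser; apply: psP => n /=; rewrite gal_fix.
have eZ : J (tb_z b) = pcst (27%:R / 4%:R) * (W * (1 - W) ^+ 2).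
  rewrite eb rmorph_cubic JC; congr (pcst _ * _).
  by rewrite fmorph_div !rmorph_nat.
have eZ1 : J (tb_z b1) = pcst 3%:R * W by rewrite e1 rmorphM Jn.
have eZ2 : (pcst 4%:R - pcst 3%:R * W) * J (tb_z b2) = W.
  by rewrite -[RHS](congr1 J e2) [RHS]rmorphM rmorphB rmorphM !Jn'.
have algW : algebraicOver (ratev nz) W.
  apply: (@cubic_algebraic _ _ (ratev nz) (FracField.tofrac (27%:R / 4%:R)%:P) (FracField.tofrac 'X)).
    by rewrite tofrac_eq0 polyX_eq0.
  have rX : ratev nz (FracField.tofrac 'X) = J (tb_z b).
    exact: etrans (ratev_poly nz 'X) (etrans (pevX _ _) (esym (JE _))).
  have rC c : ratev nz (FracField.tofrac c%:P) = pcst c.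
    exact: etrans (ratev_poly nz c%:P) (pevC _ _ _).
  exact: etrans rX (etrans eZ (esym (congr1 (fun u => u * _) (rC _)))).
have [w wW] := io_surj _ algW.
have ey : y0 = coord kap w.
  by apply: (fmorph_inj io); rewrite ioy0 -JE eZ (coord_image kap io) wW io_kap.
have ny : nonconst kap (coord kap w) by rewrite -ey.
have algy : forall u, algebraicOver (ratev ny) u.
  apply: (algebraic_over_larger (x := FracField.tofrac 'X) _ algy0).
  by rewrite ratev_poly pevX.
have ioy : io (coord kap w) = pser 0 (ps_map iota (tb_z b)) by rewrite -ey.
have ioy1 : io (coord1 kap w) = pser 0 (ps_map iota (tb_z b1)).
  by rewrite -JE eZ1 (coord1_image kap io) wW io_kap.
have n4 : pcst 4%:R != 0 :> P by rewrite fmorph_eq0; exact: (nat_neq0K charK 3).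
have d0 : pcst 4%:R - pcst 3%:R * W != 0.
  apply: contraNneq n4 => d0; have W0 : W = 0 by rewrite -eZ2 d0 mul0r.
  by move: d0; rewrite W0 mulr0 subr0 => ->.
have ioy2 : io (coord2 kap w) = pser 0 (ps_map iota (tb_z b2)).
  rewrite -JE (coord2_image kap io) wW !io_kap.
  by rewrite -[X in X / _]eZ2 mulrAC divff // mul1r.
have ny1 : nonconst kap (coord1 kap w).
  by move=> c /(congr1 io); rewrite ioy1 io_kap; exact: nc_nonunit (tb_nonunit b1 iota) c.
have ny2 : nonconst kap (coord2 kap w).
  by move=> c /(congr1 io); rewrite ioy2 io_kap; exact: nc_nonunit (tb_nonunit b2 iota) c.
have charO : [pchar Om] =i pred0 by move=> q; rewrite (fmorph_pchar kap) charK.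
apply: (base_point_corresp charK clOm charO io_kap ny1 ny2 algy _ _ _ ioy ioy1 ioy2) => s.
(* Acting on coefficients preserves algebraicity over K(z), because the power series z has its
   coefficients in [F]. *)
have ex u : exists u', io u' = pmap s (io u).
  apply: io_surj; have [p p0 pu] := algy0 u.
  have er : io \o ratev ny0 =1 ratev nz by apply: ratev_comp; [exact: io_kap|exact: ioy0].
  exists (map_poly (ratfun_map s) p); first by rewrite map_poly_eq0.
  have e : ratev nz \o ratfun_map s =1 pmap s \o io \o ratev ny0.
    by move=> r; rewrite /= [io _]er; apply: ratev_pmap; rewrite -JE Js.
  by rewrite -map_poly_comp (eq_map_poly e) !map_poly_comp !fmorph_root.
pose t u := projT1 (cid (ex u)).
have tE u : io (t u) = pmap s (io u) by rewrite /t; case: cid.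
have tz : zmod_morphism t.
  move=> u u'; apply: (fmorph_inj io); apply: etrans (tE _) _; rewrite (rmorphB io u u').
  by apply: etrans (rmorphB (pmap s) _ _) _; rewrite [RHS](rmorphB io) !tE.
have tm : monoid_morphism t.
  split=> [|u u']; apply: (fmorph_inj io); apply: etrans (tE _) _.
    by rewrite (rmorph1 io); exact: rmorph1.
  rewrite (rmorphM io u u'); apply: etrans (rmorphM (pmap s) _ _) _.
  by rewrite [RHS](rmorphM io) !tE.
exists (mkrm tz tm); split=> //; apply: (fmorph_inj io).
by rewrite [LHS]tE wW Js.
Qed.
End BasePoints.

(** * Functions on topological groups *)

Section PadicContinuity.
Variables (p : nat) (p_pr : prime p).
Local Notation Zp := (padic_int p_pr).
Local Notation Qp := (padic p_pr).
Local Notation "x %:F" := (@FracField.tofrac _ x).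
Local Notation pZ n := ((p ^ n)%N%:Z).

Lemma dvdz_sub (d a b : int) : (d %| a)%Z -> (d %| b)%Z -> (d %| a - b)%Z.
Proof. exact: rpredB. Qed.

Lemma pfactor_split m n (a b : int) : (pZ (m + n) %| a * b)%Z -> ~~ (pZ n %| a)%Z -> (pZ m %| b)%Z.
Proof.
rewrite !dvdzE abszM !absz_nat; move: `|a|%N `|b|%N => x y.
have [->|y0] := posnP y; first by rewrite dvdn0.
have [->|x0] := posnP x; first by rewrite dvdn0.
rewrite !pfactor_dvdn ?muln_gt0 ?x0 // lognM // -ltnNge => h lx.
by rewrite -(leq_add2r n) (leq_trans h) // addnC leq_add2l ltnW.
Qed.

(** When p^n does not divide [d], Bezout makes p^n a multiple of [d] modulo p^(m+n) for every m. The
    quotients are determined modulo p^m, so they form a p-adic integer. *)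
Lemma pz_dvd_pow (d : Zp) : d != 0 -> exists n e, d * e = p%:R ^+ n.
Proof.
move=> /pz_neq0P[n dn].
have bz m : exists e : int, ((pz_seq d (m + n) * e) %% pZ (m + n) = pZ n %% pZ (m + n))%Z.
  set x := pz_seq d _; have [u [v uv]] := Bezoutz x (pZ (m + n)).
  have [j jm ej] : exists2 j, (j <= m + n)%N & gcdz x (pZ (m + n)) = pZ j.
    have : (`|gcdz x (pZ (m + n))| %| p ^ (m + n))%N by rewrite /gcdz absz_nat; exact: dvdn_gcdr.
    move=> /(dvdn_pfactor _ _ p_pr)[j jm ej]; exists j => //.
    by rewrite -ej /gcdz.
  have jn : (j <= n)%N.
    rewrite leqNgt; apply: contra (dn (m + n)%N (leq_addl m n)) => nj.
    by apply: dvdz_trans (dvdz_pexp p (ltnW nj)) _; rewrite -ej; exact: dvdz_gcdl.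
  exists (u * pZ (n - j)); apply/eqP; rewrite eqz_mod_dvd.
  have -> : x * (u * pZ (n - j)) - pZ n = - (v * pZ (n - j)) * pZ (m + n).
    have e2 : pZ n = pZ j * pZ (n - j) by rewrite -PoszM -expnD subnKC.
    by rewrite e2 -ej -uv; ring.
  exact: dvdz_mull.
pose e m := projT1 (cid (bz m)).
have eP m : ((pz_seq d (m + n) * e m) %% pZ (m + n) = pZ n %% pZ (m + n))%Z by rewrite /e; case: cid.
have step m : (e m.+1 = e m %[mod pZ m])%Z.
  apply/eqP; rewrite eqz_mod_dvd; apply: (@pfactor_split m n (pz_seq d (m + n))); last first.
    exact: dn (leq_addl m n).
  have h1 : (pZ (m + n) %| pz_seq d (m + n) * e m - pZ n)%Z by rewrite -eqz_mod_dvd eP.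
  have h2 : (pZ (m + n) %| pz_seq d (m.+1 + n) * e m.+1 - pZ n)%Z.
    by apply: dvdz_trans (dvdz_pexp p (leqnSn _)) _; rewrite -addSn -eqz_mod_dvd eP.
  have h3 : (pZ (m + n) %| pz_seq d (m.+1 + n) - pz_seq d (m + n))%Z.
    by rewrite -eqz_mod_dvd addSn pz_seq_step.
  have -> : pz_seq d (m + n) * (e m.+1 - e m) =
    (pz_seq d (m.+1 + n) * e m.+1 - pZ n) - (pz_seq d (m + n) * e m - pZ n)
    - (pz_seq d (m.+1 + n) - pz_seq d (m + n)) * e m.+1 by ring.
  by apply: dvdz_sub; [exact: dvdz_sub|exact: dvdz_mulr].
exists n, (pz_mk p_pr step); rewrite -natrX; apply: padic_intP => m.
have nat_seq k i : pz_seq (k%:R : Zp) i = (k%:Z %% pZ i)%Z.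
  elim: k => [|k IH]; first by [].
  by rewrite -natr1 /= IH modzDm -PoszD addn1.
rewrite nat_seq /= modzMmr; apply/eqP; rewrite eqz_mod_dvd.
have h1 : (pZ m %| pz_seq d (m + n) * e m - pZ n)%Z.
  by apply: dvdz_trans (dvdz_pexp p (leq_addr n m)) _; rewrite -eqz_mod_dvd eP.
have h3 : (pZ m %| pz_seq d (m + n) - pz_seq d m)%Z.
  by rewrite -eqz_mod_dvd (pz_seq_le d (leq_addr n m)).
have -> : pz_seq d m * e m - pZ n = (pz_seq d (m + n) * e m - pZ n) - (pz_seq d (m + n) - pz_seq d m) * e m by ring.
by apply: dvdz_sub => //; exact: dvdz_mulr.
Qed.

Lemma padic_bounded (x : Qp) : exists n (a : Zp), p%:R ^+ n * x = a%:F.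
Proof.
rewrite (frac_numden x); have d0 := denom_ratioP (repr x).
move: (\n_ _) (\d_ _) d0 => m d d0; have [n [e de]] := pz_dvd_pow d0.
exists n, (e * m); have -> : p%:R ^+ n = d%:F * e%:F :> Qp.
  by rewrite -tofracM de tofracXn; congr (_ ^+ _); rewrite rmorph_nat.
have dF : d%:F != 0 by rewrite tofrac_eq0.
have -> : d%:F * e%:F * (m%:F / d%:F) = e%:F * m%:F * (d%:F / d%:F) by ring.
by rewrite divff // mulr1 tofracM.
Qed.

Lemma close_refl k (x : Qp) : padic_close k x x.
Proof. by exists 0; rewrite subrr tofrac0 mulr0. Qed.

Lemma close_D k (x x' y y' : Qp) : padic_close k x x' -> padic_close k y y' ->
  padic_close k (x + y) (x' + y').
Proof.
move=> [a ea] [b eb]; exists (a + b); rewrite tofracD mulrDr -ea -eb; ring.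
Qed.

Lemma close_Z (c : Qp) : exists n, forall k (x y : Qp),
  padic_close (k + n) x y -> padic_close k (c * x) (c * y).
Proof.
have [n [b eb]] := padic_bounded c; exists n => k x y [a e]; exists (b * a).
by rewrite -mulrBr e exprD tofracM -eb; ring.
Qed.

Lemma close_M k (x x' y y' : Qp) : padic_close k x x' -> padic_close k y y' ->
  padic_close k ((x - x') * (y - y')) 0.
Proof.
move=> [a ->] [b ->]; exists (p%:R ^+ k * a * b); rewrite subr0 !tofracM tofracXn [(p%:R)%:F]rmorph_nat; ring.
Qed.

Section Functions.
Variable G : topGroup.
Implicit Types f g : G -> Qp.

Lemma cont_ext f g : f =1 g -> padic_continuous f -> padic_continuous g.
Proof.
by move=> e cf x k; have [U [oU Ux hU]] := cf x k; exists U; split=> // h /hU; rewrite !e.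
Qed.

Lemma cont_const c : padic_continuous (fun _ : G => c : Qp).
Proof.
move=> x k; exists (fun _ => True); split=> //; first exact: tg_openT.
by move=> h _; exact: close_refl.
Qed.

Lemma cont_D f g : padic_continuous f -> padic_continuous g -> padic_continuous (fun x => f x + g x).
Proof.
move=> cf cg x k; have [U [oU Ux hU]] := cf x k; have [V [oV Vx hV]] := cg x k.
exists (fun y => U y /\ V y); split=> //; first exact: tg_openI.
by move=> h [/hU h1 /hV h2]; exact: close_D.
Qed.

Lemma cont_Z c f : padic_continuous f -> padic_continuous (fun x => c * f x).
Proof.
move=> cf x k; have [n nP] := close_Z c; have [U [oU Ux hU]] := cf x (k + n)%N.
by exists U; split=> // h /hU; exact: nP.
Qed.

Lemma cont_M f g : padic_continuous f -> padic_continuous g -> padic_continuous (fun x => f x * g x).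
Proof.
move=> cf cg x k; have [U [oU Ux hU]] := cf x k; have [V [oV Vx hV]] := cg x k.
have [U' [oU' Ux' hU']] := cont_Z (g x) cf x k; have [V' [oV' Vx' hV']] := cont_Z (f x) cg x k.
exists (fun y => (U y /\ V y) /\ (U' y /\ V' y)); split=> //.
  by apply: tg_openI; exact: tg_openI.
move=> h [[/hU h1 /hV h2] [/hU' h3 /hV' h4]].
have := close_D (close_D (close_M h1 h2) h3) h4.
have -> : (f h - f x) * (g h - g x) + g x * f h + f x * g h = f h * g h + f x * g x by ring.
move=> h5; have := close_D h5 (close_refl k (- (f x * g x))).
by rewrite addrK add0r; have -> : g x * f x + f x * g x - f x * g x = f x * g x by ring.
Qed.

Lemma cont_sum (I : Type) (s : seq I) (F : I -> G -> Qp) :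
  (forall i, padic_continuous (F i)) -> padic_continuous (fun x => \sum_(i <- s) F i x).
Proof.
move=> cF; elim: s => [|i s IH].
  by apply: cont_ext (cont_const 0) => x; rewrite big_nil.
by apply: cont_ext (cont_D (cF i) IH) => x; rewrite big_cons.
Qed.

Lemma cont_shift f (g1 g2 : G) : padic_continuous f ->
  padic_continuous (fun x => f (tg_mul (tg_mul g1 x) g2)).
Proof.
move=> cf x k; have [U [oU Ux hU]] := cf (tg_mul (tg_mul g1 x) g2) k.
have [V [W [oV oW Vx Wx VW]]] := tg_mul_cont oU Ux.
have [V1 [V2 [oV1 oV2 V1g V2x V12]]] := tg_mul_cont oV Vx.
by exists V2; split=> // h V2h; apply: hU; apply: VW => //; exact: V12.
Qed.

(** The translates of [f] span a finite-dimensional space: its coproduct is a finite tensor. In this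
    form stability under products and extension by zero is direct. *)
Definition dec f := exists (I : finType) (a b : I -> G -> Qp),
  forall x y : G, f (tg_mul x y) = \sum_i a i x * b i y.

Lemma dec_ext f g : f =1 g -> dec f -> dec g.
Proof. by move=> e [I [a [b h]]]; exists I, a, b => x y; rewrite -e h. Qed.

Lemma dec_const c : dec (fun _ => c).
Proof.
by exists unit, (fun _ _ => c), (fun _ _ => 1) => x y; rewrite big_const card_unit /= addr0 mulr1.
Qed.

Lemma dec_lin c f g : dec f -> dec g -> dec (fun x => c * f x + g x).
Proof.
move=> [I [a [b ab]]] [J [d [e de]]].
exists (I + J)%type, (fun k x => match k with inl i => c * a i x | inr j => d j x end),
  (fun k x => match k with inl i => b i x | inr j => e j x end) => x y.
rewrite big_sumType /= ab de mulr_sumr; congr (_ + _).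
by apply: eq_bigr => i _; rewrite mulrA.
Qed.

Lemma dec_M f g : dec f -> dec g -> dec (fun x => f x * g x).
Proof.
move=> [I [a [b ab]]] [J [d [e de]]].
exists (I * J)%type, (fun k x => a k.1 x * d k.2 x), (fun k x => b k.1 x * e k.2 x) => x y.
rewrite ab de big_distrl /= -(pair_bigA _ (fun i j => a i x * d j x * (b i y * e j y))) /=.
by apply: eq_bigr => i _; rewrite big_distrr; apply: eq_bigr => j _; rewrite mulrACA.
Qed.

Lemma dec_sum (I : Type) (s : seq I) (F : I -> G -> Qp) :
  (forall i, dec (F i)) -> dec (fun x => \sum_(i <- s) F i x).
Proof.
move=> dF; elim: s => [|i s IH]; first by apply: dec_ext (dec_const 0) => x; rewrite big_nil.
by apply: dec_ext (dec_lin 1 (dF i) IH) => x; rewrite big_cons mul1r.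
Qed.

Lemma dec_X f n : dec f -> dec (fun x => f x ^+ n).
Proof.
move=> df; elim: n => [|n IH]; first exact: (dec_const 1).
by apply: dec_ext (dec_M df IH) => x; rewrite exprS.
Qed.

Lemma dec_prod (I : Type) (s : seq I) (F : I -> G -> Qp) :
  (forall i, dec (F i)) -> dec (fun x => \prod_(i <- s) F i x).
Proof.
move=> dF; elim: s => [|i s IH]; first by apply: dec_ext (dec_const 1) => x; rewrite big_nil.
by apply: dec_ext (dec_M (dF i) IH) => x; rewrite big_cons.
Qed.

Lemma proalg_dec f : proalg_function f -> dec f.
Proof.
move=> [_ [n [rho [P [k [[r1 rM _] fE]]]]]].
suff h : dec (fun g : G => mpoly.meval (fun i => mxvec (rho g) 0 i) P * (\det (rho g))^-1 ^+ k).
  by apply: dec_ext h => g; rewrite fE exprVn.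
apply: dec_M; last first.
  apply: dec_X; exists unit, (fun _ x => (\det (rho x))^-1), (fun _ x => (\det (rho x))^-1) => x y.
  by rewrite big_const card_unit /= addr0 rM det_mulmx invfM.
suff h : dec (fun g : G => \sum_(m <- mpoly.msupp P)
    mpoly.mcoeff m P * mpoly.mmap1 (fun i => mxvec (rho g) 0 i) m).
  by apply: dec_ext h => g; rewrite mpoly.mevalE.
apply: dec_sum => m; apply: dec_M; first exact: dec_const.
rewrite /mpoly.mmap1; apply: dec_prod => i; apply: dec_X; case/mxvec_indexP: i => i j.
exists 'I_n, (fun k x => rho x i k), (fun k x => rho x k j) => x y.
by rewrite mxvecE rM mxE.
Qed.
End Functions.
End PadicContinuity.

Import (canonicals) mpoly.

Section MatrixCoefficients.
Variables (p : nat) (p_pr : prime p).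
Local Notation Qp := (padic p_pr).

Section PolynomialFunctions.
Variable N : nat.
Definition poly_function (f : ('I_N -> Qp) -> Qp) :=
  exists P : mpoly.mpoly N Qp, forall v, mpoly.meval v P = f v.

Lemma poly_function_linear (c : 'I_N -> Qp) (s : seq 'I_N) : poly_function (fun v => \sum_(i <- s) c i * v i).
Proof.
elim: s => [|i s [P IH]].
  by exists 0 => v; rewrite big_nil raddf0.
have [X hX] : exists X : mpoly.mpoly N Qp, forall v, mpoly.meval v X = v i.
  by eexists => v; exact: mpoly.mevalXU.
exists (c i *: X + P) => v.
by rewrite mpoly.mevalD mpoly.mevalZ hX IH big_cons.
Qed.
End PolynomialFunctions.

Variable G : topGroup.

Lemma tg_mulg1 (x : G) : tg_mul x (tg_one G) = x.
Proof.
have mulgV y : tg_mul y (tg_inv y) = tg_one G :> G.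
  rewrite -[LHS]tg_mul1g -{1}(tg_mulVg (tg_inv y)) -tg_mulA.
  by rewrite [tg_mul (tg_inv y) _]tg_mulA tg_mulVg tg_mul1g tg_mulVg.
by rewrite -(tg_mulVg x) tg_mulA mulgV tg_mul1g.
Qed.

(* A maximal invertible matrix of values [f (g_i h_j)] turns the left translates
   of [f] into a matrix representation. *)
Lemma dec_proalg (f : G -> Qp) : padic_continuous f -> dec f -> proalg_function f.
Proof.
move=> cf [I [a [b ab]]]; split=> //.
pose V r (g h : 'I_r -> G) : 'M[Qp]_r := \matrix_(i, j) f (tg_mul (g i) (h j)).
pose P r := `[< exists g h, V r g h \in unitmx >].
have P0 : exists r, P r.
  exists 0%N; apply/asboolP; exists (fun _ => tg_one G), (fun _ => tg_one G).
  by rewrite unitmxE det_mx00 unitr1.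
have Pb r : P r -> (r <= #|I|)%N.
  move=> /asboolP[g [h]]; rewrite -row_full_unit => /eqP <-.
  have -> : V r g h = (\matrix_(i < r, k < #|I|) a (enum_val k) (g i)) *m (\matrix_(k < #|I|, j < r) b (enum_val k) (h j)).
    apply/matrixP => i j; rewrite !mxE ab big_enum_val /=.
    by apply: eq_bigr => k _; rewrite !mxE.
  exact: leq_trans (mxrankM_maxl _ _) (rank_leq_col _).
case: (ex_maxnP P0 Pb) => r /asboolP[g [h ug]] rmax; set A := V r g h in ug.
pose row_ x : 'rV[Qp]_r := \row_j f (tg_mul x (h j)).
pose col_ y : 'cV[Qp]_r := \col_i f (tg_mul (g i) y).
(* Bordering [A] by a row and a column gives a singular matrix, by maximality; so its Schur
   complement is zero. *)
have key x y : f (tg_mul x y) = (row_ x *m invmx A *m col_ y) 0 0.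
  pose g' (i : 'I_(r + 1)) := match fintype.split i with inl k => g k | inr _ => x end.
  pose h' (i : 'I_(r + 1)) := match fintype.split i with inl k => h k | inr _ => y end.
  have nu : V (r + 1)%N g' h' \notin unitmx.
    apply/negP => u; have := rmax (r + 1)%N; rewrite addn1 ltnn => hr.
    by suff: false by []; apply: hr; apply/asboolP; move: g' h' u; rewrite addn1 => g' h' u; exists g', h'.
  have eB : V (r + 1)%N g' h' = block_mx A (col_ y) (row_ x) (f (tg_mul x y))%:M.
    apply/matrixP => i j; rewrite mxE /g' /h'; case: (split_ordP i) => k ->; case: (split_ordP j) => l ->.
    - by rewrite block_mxEul mxE.
    - by rewrite block_mxEur mxE.
    - by rewrite block_mxEdl mxE.
    - by rewrite block_mxEdr mxE !ord1 eqxx.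
  have := congr1 determinant (congr1 (mulmx^~ (block_mx 1%:M (- (invmx A *m col_ y)) 0 1%:M)) eB).
  rewrite mulmx_block !mulmx1 !mulmx0 !addr0 mulmxN mulmxA mulmxV // mul1mx addNr det_lblock.
  rewrite det_mulmx det_ublock !det1 !mulr1 det_mx11 => e.
  move: nu; rewrite unitmxE unitfE negbK e mulf_eq0 => /orP[/eqP e0|/eqP].
    by move: ug; rewrite unitmxE e0 unitr0.
  rewrite mulmxN mulmxA; move: (row_ x *m invmx A *m col_ y) => X.
  rewrite !mxE eqxx mulr1n addrC => /eqP.
  by rewrite subr_eq0 => /eqP.
pose N_ x : 'M[Qp]_r := \matrix_(i, j) f (tg_mul (tg_mul (g i) x) (h j)).
have keyM x y : N_ x *m invmx A *m N_ y = N_ (tg_mul x y).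
  apply/matrixP => i j; rewrite [RHS]mxE tg_mulA -[tg_mul (tg_mul _ y) _]tg_mulA key.
  have -> : row_ (tg_mul (g i) x) = row i (N_ x) by apply/rowP => k; rewrite !mxE.
  have -> : col_ (tg_mul y (h j)) = col j (N_ y) by apply/colP => k; rewrite !mxE tg_mulA.
  rewrite -!row_mul [RHS]mxE [LHS]mxE [RHS]mxE; apply: eq_bigr => k _.
  by rewrite [col _ _ _ _]mxE.
(* By [keyM] one has N_x A^-1 N_y = N_(xy), so multiplication by A^-1 gives a representation. *)
pose rho x := invmx A *m N_ x; exists r, rho.
pose u := row_ (tg_one G); pose v := invmx A *m col_ (tg_one G).
have fE x : f x = (u *m rho x *m v) 0 0.
  rewrite -[x in LHS]tg_mul1g key -/u /rho /v -!mulmxA; congr ((_ *m (_ *m _)) 0 0).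
  apply/colP => i; rewrite mxE -[x]tg_mulg1 [tg_mul (g i) _]tg_mulA key -mulmxA !mxE.
  by apply: eq_bigr => k _; rewrite !mxE tg_mulg1.
have [P' hP] := poly_function_linear (fun k => \sum_i \sum_j (if mxvec_index i j == k then u 0 i * v j 0 else 0)) (index_enum 'I_(r * r)).
exists P', 0%N; split; first split.
- have -> : rho (tg_one G) = invmx A *m A.
    by congr (_ *m _); apply/matrixP => i j; rewrite !mxE tg_mulg1.
  exact: mulVmx.
- by move=> x y; rewrite /rho -keyM !mulmxA.
- move=> i j; apply: (@cont_ext _ _ _ (fun x => \sum_k invmx A i k * f (tg_mul (tg_mul (g k) x) (h j)))).
    by move=> x; rewrite mxE; apply: eq_bigr => k _; rewrite [N_ x k j]mxE.
  by apply: cont_sum => k; apply: cont_Z; exact: cont_shift.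
- move=> x; rewrite expr0 divr1 hP fE.
  have {hP}-> (X : 'I_(r * r) -> Qp) : \sum_k (\sum_i \sum_j (if mxvec_index i j == k then u 0 i * v j 0 else 0)) * X k
      = \sum_i \sum_j u 0 i * v j 0 * X (mxvec_index i j).
    under eq_bigr => k _ do rewrite mulr_suml.
    rewrite exchange_big /=; apply: eq_bigr => i _.
    under eq_bigr => k _ do rewrite mulr_suml.
    rewrite exchange_big /=; apply: eq_bigr => j _.
    rewrite (bigD1 (mxvec_index i j)) //= eqxx big1 ?addr0 // => k kij.
    by rewrite eq_sym (negPf kij) mul0r.
  rewrite mxE; under eq_bigr => j _ do rewrite mxE mulr_suml.
  rewrite exchange_big /=; apply: eq_bigr => i _; apply: eq_bigr => j _.
  by rewrite mxvecE mulrAC.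
Qed.
End MatrixCoefficients.

Section TameFunctions.
Variables (p : nat) (p_pr : prime p).
Local Notation Qp := (padic p_pr).
Variables (GF : topGroup).

Lemma orbit_finite_fin (X : Type) (act : GF -> (X -> Qp) -> X -> Qp) f (I : finType) (e : I -> X -> Qp) :
  (forall s, exists c : I -> Qp, forall x, act s f x = \sum_i c i * e i x) -> orbit_finite act f.
Proof.
move=> h; exists #|I|, (fun i => e (enum_val i)) => s; have [c hc] := h s.
by exists (fun i => c (enum_val i)) => x; rewrite hc big_enum_val.
Qed.

Section OneGroup.
Variables (G : topGroup) (a : GF -> G -> G).
Definition pull_act s (f : G -> Qp) : G -> Qp := fun x => f (a (tg_inv s) x).

Definition tame f := [/\ padic_continuous f, dec f & orbit_finite pull_act f].

Lemma tameP f : tame f <-> proalg_function f /\ orbit_finite pull_act f.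
Proof.
split=> [[cf df of_]|[pf of_]]; first by split=> //; exact: dec_proalg.
by split=> //; [case: pf|exact: proalg_dec].
Qed.

Lemma tame_ext f g : f =1 g -> tame f -> tame g.
Proof. by move=> /funext ->. Qed.

Lemma tame_const c : tame (fun _ => c).
Proof.
split; [exact: cont_const|exact: dec_const|].
apply: (@orbit_finite_fin _ _ _ unit (fun _ _ => c)) => s; exists (fun _ => 1) => x.
by rewrite big_const card_unit /= addr0 mul1r.
Qed.

Lemma tame_lin c f g : tame f -> tame g -> tame (fun x => c * f x + g x).
Proof.
move=> [cf df [m [e he]]] [cg dg [n [e' he']]]; split.
- by apply: cont_D => //; exact: cont_Z.
- exact: dec_lin.
- apply: (@orbit_finite_fin _ _ _ ('I_m + 'I_n)%type (fun k => match k with inl i => e i | inr j => e' j end)) => s.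
  have [d hd] := he s; have [d' hd'] := he' s.
  exists (fun k => match k with inl i => c * d i | inr j => d' j end) => x.
  rewrite big_sumType /=; move: (hd x) (hd' x); rewrite /pull_act => -> ->.
  by rewrite mulr_sumr; congr (_ + _); apply: eq_bigr => i _; rewrite mulrA.
Qed.

Lemma tame_M f g : tame f -> tame g -> tame (fun x => f x * g x).
Proof.
move=> [cf df [m [e he]]] [cg dg [n [e' he']]]; split; [exact: cont_M|exact: dec_M|].
apply: (@orbit_finite_fin _ _ _ ('I_m * 'I_n)%type (fun k x => e k.1 x * e' k.2 x)) => s.
have [d hd] := he s; have [d' hd'] := he' s.
exists (fun k => d k.1 * d' k.2) => x.
move: (hd x) (hd' x); rewrite /pull_act => -> ->.
rewrite big_distrl /= -(pair_bigA _ (fun i j => d i * d' j * (e i x * e' j x))) /=.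
by apply: eq_bigr => i _; rewrite big_distrr; apply: eq_bigr => j _; rewrite mulrACA.
Qed.

Lemma tame_sum (I : Type) (s : seq I) (F : I -> G -> Qp) :
  (forall i, tame (F i)) -> tame (fun x => \sum_(i <- s) F i x).
Proof.
move=> tF; elim: s => [|i s IH]; first by apply: tame_ext (tame_const 0) => x; rewrite big_nil.
by apply: tame_ext (tame_lin 1 (tF i) IH) => x; rewrite big_cons mul1r.
Qed.
End OneGroup.

Section Extension.
Variables (Pi G : topGroup) (a : GF -> Pi -> Pi) (a1 : GF -> G -> G).
Variables (H : Pi -> Prop) (r : Pi -> G).
Hypothesis H_M : forall x y, H x -> H y -> H (tg_mul x y).
Hypothesis r_M : forall x y, H x -> H y -> r (tg_mul x y) = tg_mul (r x) (r y).
Hypothesis H_1 : H (tg_one Pi).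
Hypothesis H_V : forall x, H x -> H (tg_inv x).
Hypothesis H_open : tg_open H.
Hypothesis r_cont : forall U, tg_open U -> tg_open (fun x => H x /\ U (r x)).
Hypothesis H_fin : exists m (d : 'I_m -> Pi), forall g, exists i, H (tg_mul (tg_inv (d i)) g).
Hypothesis r_act : forall s x, H x -> H (a s x) /\ r (a s x) = a1 s (r x).
Hypothesis aK : forall s x, a (tg_inv s) (a s x) = x.
Hypothesis aVK : forall s x, a s (a (tg_inv s) x) = x.

Definition ext0 (f : G -> Qp) : Pi -> Qp := fun x => if pselect (H x) then f (r x) else 0.

Lemma ext0E f x : H x -> ext0 f x = f (r x).
Proof. by rewrite /ext0; case: pselect. Qed.
Lemma ext0N f x : ~ H x -> ext0 f x = 0.
Proof. by rewrite /ext0; case: pselect. Qed.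

Lemma H_cancel x y : H x -> H (tg_mul x y) -> H y.
Proof. by move=> hx hxy; rewrite -(tg_mulKg x y); apply: H_M => //; exact: H_V. Qed.
Lemma tg_mulgV (x : Pi) : tg_mul x (tg_inv x) = tg_one Pi.
Proof. by rewrite -[LHS](tg_mulKg (tg_inv x)) [tg_mul (tg_inv x) _]tg_mulKg tg_mulVg. Qed.
Lemma H_cancelr x y : H y -> H (tg_mul x y) -> H x.
Proof.
move=> hy hxy; rewrite -[x]tg_mulg1 -(tg_mulgV y) tg_mulA; apply: H_M => //; exact: H_V.
Qed.

Lemma H_closed x : ~ H x -> exists U, [/\ tg_open U, U x & forall y, U y -> ~ H y].
Proof.
move=> nx; have h1 : H (tg_mul (tg_inv x) x) by rewrite tg_mulVg.
have [V [W [oV oW Vx Wx VW]]] := tg_mul_cont H_open h1.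
exists W; split=> // y Wy hy; apply: nx.
have h2 := H_cancelr hy (VW _ _ Vx Wy).
by apply: (H_cancel h2); rewrite tg_mulVg.
Qed.

(** Let d be the coset representative of y. Then xy is in [H] exactly when x d is, and there f is
    decomposed at r (x d) and r (d^-1 y). Continuity off [H] holds because an open subgroup is
    closed. *)
Lemma tame_ext0 f : tame a1 f -> tame a (ext0 f).
Proof.
move=> [cf [I [al [be ab]]] [m [e he]]]; split.
- move=> x k; have [hx|nx] := pselect (H x).
    have [U [oU Ux hU]] := cf (r x) k; exists (fun y => H y /\ U (r y)); split=> //; first exact: r_cont.
    by move=> y [hy /hU]; rewrite !ext0E.
  have [U [oU Ux hU]] := H_closed nx; exists U; split=> // y /hU ny.
  by rewrite !ext0N //; exact: close_refl.
- have [n [d dP]] := H_fin; pose kk y := projT1 (cid (dP y)).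
  have kP y : H (tg_mul (tg_inv (d (kk y))) y) by rewrite /kk; case: cid.
  exists ('I_n * I)%type, (fun k x => ext0 (al k.2) (tg_mul x (d k.1))),
    (fun k y => if kk y == k.1 then be k.2 (r (tg_mul (tg_inv (d k.1)) y)) else 0) => x y.
  rewrite -(pair_bigA _ (fun k i => ext0 (al i) (tg_mul x (d k)) *
    (if kk y == k then be i (r (tg_mul (tg_inv (d k)) y)) else 0))) /=.
  rewrite (bigD1 (kk y)) //= eqxx [X in _ + X]big1 ?addr0; last first.
    by move=> k nk; rewrite big1 // => i _; rewrite eq_sym (negPf nk) mulr0.
  have e1 : tg_mul (tg_mul x (d (kk y))) (tg_mul (tg_inv (d (kk y))) y) = tg_mul x y.
    by rewrite -tg_mulA [tg_mul (d _) _]tg_mulA tg_mulgV tg_mul1g.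
  have [hx|nx] := pselect (H (tg_mul x (d (kk y)))).
    rewrite ext0E -e1; last exact: H_M.
    by rewrite r_M // ab; apply: eq_bigr => i _; rewrite ext0E.
  rewrite ext0N => [|hxy]; last by apply: nx; apply: (H_cancelr (kP y)); rewrite e1.
  by rewrite big1 // => i _; rewrite ext0N // mul0r.
- exists m, (fun i => ext0 (e i)) => s; have [c hc] := he s; exists c => x; rewrite /pull_act.
  have [hx|nx] := pselect (H x).
    have [h1 h2] := r_act (tg_inv s) hx.
    rewrite ext0E // h2; have := hc (r x); rewrite /pull_act => ->.
    by apply: eq_bigr => i _; rewrite ext0E.
  rewrite ext0N => [|hx]; last by apply: nx; rewrite -(aVK s x); exact: (r_act s hx).1.
  by rewrite big1 // => i _; rewrite ext0N // mulr0.
Qed.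
End Extension.
End TameFunctions.

(** * Transfer of subquotients *)

Section SubquotientRelations.
Variables (p : nat) (p_pr : prime p).
Local Notation Qp := (padic p_pr).
Variables (G : topGroup) (X : Type) (act : G -> (X -> Qp) -> (X -> Qp)).

(* A subquotient is the same as a linear equivariant relation with full image
   whose only value at [0] is [0]. *)
Record subq_rel (W : (X -> Qp) -> Prop) n (rho : G -> 'M[Qp]_n) (rel : (X -> Qp) -> 'cV[Qp]_n -> Prop) : Prop := SubqRel {
  sr_0 : rel (fun _ => 0) 0;
  sr_lin : forall c f g u v, rel f u -> rel g v -> rel (fun x => c * f x + g x) (c *: u + v);
  sr_single : forall v, rel (fun _ => 0) v -> v = 0;
  sr_act : forall s f v, rel f v -> rel (act s f) (rho s *m v);
  sr_surj : forall v, exists f, rel f v;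
  sr_sub : forall f v, rel f v -> W f
}.

Lemma subquotient_rel W n (rho : G -> 'M[Qp]_n) : is_subquotient act W rho -> exists rel, subq_rel W rho rel.
Proof.
move=> [W1 [W2 [q [[[w0 wl] ws wW] [_ _ _] ql qa [qs _]]]]].
have q0 : q (fun _ => 0) = 0.
  have := ql 1 _ _ w0 w0; rewrite scale1r.
  have -> : (fun x : X => 1 * 0 + 0) = (fun _ => 0 : Qp) by apply: funext => x; rewrite mulr0 addr0.
  by move=> e; apply: (addrI (q (fun _ => 0))); rewrite addr0 -e.
exists (fun f v => W1 f /\ q f = v); split=> //.
- by move=> c f g u v [hf <-] [hg <-]; split; [exact: wl|rewrite ql].
- by move=> v [_ <-].
- by move=> s f v [hf <-]; split; [exact: ws|rewrite qa].
- by move=> v; have [f hf <-] := qs v; exists f.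
- by move=> f v [/wW].
Qed.

Lemma rel_subquotient W n (rho : G -> 'M[Qp]_n) rel : subq_rel W rho rel -> is_subquotient act W rho.
Proof.
move=> [r0 rl rs ra rj rW].
have fn f u v : rel f u -> rel f v -> u = v.
  move=> hu hv; have := rl (-1) _ _ _ _ hu hv.
  have -> : (fun x => -1 * f x + f x) = (fun _ => 0) by apply: funext => x; rewrite mulN1r addNr.
  by move/rs/eqP; rewrite scaleN1r addrC subr_eq0 => /eqP.
have ex f : exists v, (exists v', rel f v') -> rel f v.
  by have [[v hv]|n'] := pselect (exists v', rel f v'); [exists v|exists 0].
pose q f := projT1 (cid (ex f)).
have qP f v : rel f v -> q f = v.
  by move=> hv; apply: (fn f) (hv); rewrite /q; case: cid => u /=; apply; exists v.
exists (fun f => exists v, rel f v), (fun f => rel f 0), q; split.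
- split; first split; first by exists 0.
  + by move=> c f g [u hu] [v hv]; exists (c *: u + v); exact: rl.
  + by move=> s f [v hv]; exists (rho s *m v); exact: ra.
  + by move=> f [v /rW].
- split; first split => //.
  + by move=> c f g hu hv; have := rl c _ _ _ _ hu hv; rewrite scaler0 addr0.
  + by move=> s f hv; have := ra s _ _ hv; rewrite mulmx0.
  + by move=> f hf; exists 0.
- by move=> c f g [u hu] [v hv]; rewrite (qP _ _ hu) (qP _ _ hv); apply/qP; exact: rl.
- by move=> s f [v hv]; rewrite (qP _ _ hv); apply/qP; exact: ra.
- split=> [v|f [v hv]]; first by have [f hf] := rj v; exists f; [exists v|exact: qP].
  by rewrite (qP _ _ hv); split=> [<-|/(fn _ _ _ hv)].
Qed.

Lemma subq_rel_sum W n (rho : G -> 'M[Qp]_n) rel (I : Type) (s : seq I) (c : I -> Qp) f u :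
  subq_rel W rho rel -> (forall i, rel (f i) (u i)) ->
  rel (fun x => \sum_(i <- s) c i * f i x) (\sum_(i <- s) c i *: u i).
Proof.
move=> [r0 rl _ _ _ _] h; elim: s => [|i s IH].
  by rewrite big_nil; have -> : (fun x : X => \sum_(i <- [::]) c i * f i x) = (fun _ => 0) by apply: funext => x; rewrite big_nil.
rewrite big_cons; have -> : (fun x => \sum_(i <- i :: s) c i * f i x) = (fun x => c i * f i x + \sum_(i <- s) c i * f i x).
  by apply: funext => x; rewrite big_cons.
exact: rl.
Qed.
End SubquotientRelations.

Section Transfer.
Variables (p : nat) (p_pr : prime p).
Local Notation Qp := (padic p_pr).
Variables (GF Pi Pi1 Pi2 : topGroup).
Variables (a : GF -> Pi -> Pi) (a1 : GF -> Pi1 -> Pi1) (a2 : GF -> Pi2 -> Pi2).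
Hypothesis aVK : forall s x, a s (a (tg_inv s) x) = x.
Variable C : corresp a a1 a2.

Definition ext (f : Pi1 -> Qp) (h : Pi2 -> Qp) : Pi -> Qp := fun x => ext0 (cH C) (cr1 C) f x * ext0 (cH C) (cr2 C) h x.

Lemma tame_ext_prod f h : tame a1 f -> tame a2 h -> tame a (ext f h).
Proof.
move=> tf th; apply: tame_M.
  apply: (tame_ext0 (a1 := a1) (H := cH C)) tf => //.
  - by move=> x y hx hy; have [] := c_M hx hy.
  - by move=> x y hx hy; have [] := c_M hx hy.
  - exact: c_1.
  - by move=> x; exact: c_V.
  - exact: c_open.
  - exact: c_cont1.
  - exact: c_fin.
  - by move=> s x hx; have [] := c_act s hx.
apply: (tame_ext0 (a1 := a2) (H := cH C)) th => //.
- by move=> x y hx hy; have [] := c_M hx hy.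
- by move=> x y hx hy; have [] := c_M hx hy.
- exact: c_1.
- by move=> x; exact: c_V.
- exact: c_open.
- exact: c_cont2.
- exact: c_fin.
- by move=> s x hx; have [] := c_act s hx.
Qed.

Lemma ext_on f h x : cH C x -> ext f h x = f (cr1 C x) * h (cr2 C x).
Proof. by move=> hx; rewrite /ext !ext0E. Qed.
Lemma ext_off f h x : ~ cH C x -> ext f h x = 0.
Proof. by move=> hx; rewrite /ext !ext0N // mul0r. Qed.

Lemma ext_act s f h : pull_act a s (ext f h) = ext (pull_act a1 s f) (pull_act a2 s h).
Proof.
apply: funext => x; rewrite /pull_act; have [hx|nx] := pselect (cH C x).
  by have [h1 h2 h3] := c_act (tg_inv s) hx; rewrite !ext_on // h2 h3.
rewrite !ext_off // => hx; apply: nx; rewrite -(aVK s x); by have [] := c_act s hx.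
Qed.

Variables (n1 n2 : nat).

Section Tensor.
Variables (V1 : GF -> 'M[Qp]_n1) (V2 : GF -> 'M[Qp]_n2).
Variables (rel1 : (Pi1 -> Qp) -> 'cV[Qp]_n1 -> Prop) (rel2 : (Pi2 -> Qp) -> 'cV[Qp]_n2 -> Prop).
Hypothesis R1 : subq_rel (pull_act a1) (tame a1) V1 rel1.
Hypothesis R2 : subq_rel (pull_act a2) (tame a2) V2 rel2.

Definition ten (u : 'cV[Qp]_n1) (v : 'cV[Qp]_n2) : 'cV[Qp]_(n1 * n2) :=
  \col_k (u (mxtens.mxtens_unindex k).1 0 * v (mxtens.mxtens_unindex k).2 0).

Lemma tens_ten s u v : rep_tens V1 V2 s *m ten u v = ten (V1 s *m u) (V2 s *m v).
Proof.
apply/colP => k; rewrite !mxE mxtens.mulr_sum; apply: eq_bigr => l _.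
by rewrite !mxE mulrACA.
Qed.

Definition rel_tens f w := exists (I : finType) (f1 : I -> Pi1 -> Qp) (f2 : I -> Pi2 -> Qp) u v,
  [/\ forall i, rel1 (f1 i) (u i), forall i, rel2 (f2 i) (v i),
      f = (fun x => \sum_i ext (f1 i) (f2 i) x) & w = \sum_i ten (u i) (v i)].

(** The relation is single-valued because the subgroup maps onto the product: a vanishing sum of
    products vanishes at all pairs (x, y), so it can be contracted in one variable at a time, by
    [rel1] and then by [rel2]. *)
Lemma tensor_subquotient : is_subquotient (pull_act a) (tame a) (rep_tens V1 V2).
Proof.
apply: (@rel_subquotient _ _ _ _ _ _ _ _ rel_tens); split.
- exists void, (fun _ _ => 0), (fun _ _ => 0), (fun _ => 0), (fun _ => 0); split=> [[]|[]||].
    by apply: funext => x; rewrite big_pred0 // => -[].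
  by rewrite big_pred0 // => -[].
- move=> c f g u v [I [f1 [f2 [u1 [u2 [h1 h2 -> ->]]]]]] [J [g1 [g2 [v1 [v2 [k1 k2 -> ->]]]]]].
  exists (I + J)%type, (fun k => match k with inl i => (fun x => c * f1 i x) | inr j => g1 j end),
    (fun k => match k with inl i => f2 i | inr j => g2 j end),
    (fun k => match k with inl i => c *: u1 i | inr j => v1 j end),
    (fun k => match k with inl i => u2 i | inr j => v2 j end); split.
  + move=> [i|j] //; have := sr_lin R1 c (h1 i) (sr_0 R1); rewrite addr0.
    by congr rel1; apply: funext => x; rewrite addr0.
  + by case.
  + apply: funext => x; rewrite big_sumType /= mulr_sumr; congr (_ + _); apply: eq_bigr => i _.
    have [hx|nx] := pselect (cH C x); last by rewrite !ext_off // mulr0.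
    by rewrite !ext_on // mulrA.
  + rewrite big_sumType /= scaler_sumr; congr (_ + _); apply: eq_bigr => i _.
    by apply/colP => k; rewrite !mxE mulrA.
- move=> w [I [f1 [f2 [u [v [h1 h2 e ->]]]]]].
  have e0 x y : \sum_i f1 i x * f2 i y = 0.
    have [g [hg <- <-]] := c_surj C x y.
    apply: etrans (esym (congr1 (fun f : Pi -> Qp => f g) e)) => /=.
    by apply: eq_bigr => i _; rewrite ext_on.
  have e1 y : \sum_i f2 i y *: u i = 0.
    apply: (sr_single R1); have := subq_rel_sum (index_enum I) (fun i => f2 i y) R1 h1.
    congr rel1; apply: funext => x; rewrite -[RHS](e0 x y).
    by apply: eq_bigr => i _; rewrite mulrC.
  have e2 k : \sum_i u i k 0 *: v i = 0.
    apply: (sr_single R2); have := subq_rel_sum (index_enum I) (fun i => u i k 0) R2 h2.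
    congr rel2; apply: funext => y; have := congr1 (fun m : 'cV[Qp]_n1 => m k 0) (e1 y).
    rewrite summxE [X in _ = X]mxE => e3; rewrite -[RHS]e3.
    by apply: eq_bigr => i _; rewrite mxE mulrC.
  apply/colP => k; rewrite summxE mxE.
  have := congr1 (fun m : 'cV[Qp]_n2 => m (mxtens.mxtens_unindex k).2 0) (e2 (mxtens.mxtens_unindex k).1).
  rewrite summxE [X in _ = X]mxE => e3; rewrite -[RHS]e3.
  by apply: eq_bigr => i _; rewrite !mxE.
- move=> s f w [I [f1 [f2 [u [v [h1 h2 -> ->]]]]]].
  exists I, (fun i => pull_act a1 s (f1 i)), (fun i => pull_act a2 s (f2 i)), (fun i => V1 s *m u i), (fun i => V2 s *m v i); split.
  + by move=> i; exact: (sr_act R1).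
  + by move=> i; exact: (sr_act R2).
  + by apply: funext => x; rewrite /pull_act; apply: eq_bigr => i _; rewrite -ext_act.
  + by rewrite mulmx_sumr; apply: eq_bigr => i _; rewrite tens_ten.
- move=> w; pose I : finType := ('I_n1 * 'I_n2)%type.
  have [f1 h1] : exists f1 : I -> Pi1 -> Qp, forall i, rel1 (f1 i) (w (mxtens.mxtens_index i) 0 *: delta_mx i.1 0).
    by exists (fun i => projT1 (cid (sr_surj R1 (w (mxtens.mxtens_index i) 0 *: delta_mx i.1 0)))) => i; case: cid.
  have [f2 h2] : exists f2 : I -> Pi2 -> Qp, forall i, rel2 (f2 i) (delta_mx i.2 0).
    by exists (fun i => projT1 (cid (sr_surj R2 (delta_mx i.2 0)))) => i; case: cid.
  exists (fun x => \sum_i ext (f1 i) (f2 i) x), I, f1, f2,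
    (fun i => w (mxtens.mxtens_index i) 0 *: delta_mx i.1 0), (fun i => delta_mx i.2 0); split=> //.
  apply/colP => k; rewrite summxE (bigD1 (mxtens.mxtens_unindex k)) //= !mxE !eqxx !mulr1.
  rewrite mxtens.mxtens_unindexK big1 ?addr0 // => -[i j] nk; rewrite !mxE /=.
  have [e1|n'] := eqVneq (mxtens.mxtens_unindex k).1 i; last by rewrite mulr0 mul0r.
  have [e2|n''] := eqVneq (mxtens.mxtens_unindex k).2 j; last by rewrite mulr0.
  by case/eqP: nk; rewrite -e1 -e2.
- move=> f w [I [f1 [f2 [u [v [h1 h2 -> _]]]]]]; apply: tame_sum => i.
  by apply: tame_ext_prod; [exact: sr_sub R1 _ _ (h1 i)|exact: sr_sub R2 _ _ (h2 i)].
Qed.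
End Tensor.

Section DirectSum.
Variables (V1 : GF -> 'M[Qp]_n1) (V2 : GF -> 'M[Qp]_n2).
Variables (rel1 : (Pi1 -> Qp) -> 'cV[Qp]_n1 -> Prop) (rel2 : (Pi1 -> Qp) -> 'cV[Qp]_n2 -> Prop).
Hypothesis R1 : subq_rel (pull_act a1) (tame a1) V1 rel1.
Hypothesis R2 : subq_rel (pull_act a1) (tame a1) V2 rel2.
Variable ka : Pi2 -> Qp.
Hypothesis tka : tame a2 ka.
Hypothesis ka_act : forall s, pull_act a2 s ka = ka.
Variables (y1 y0 : Pi2).
Hypotheses (ka1 : ka y1 = 1) (ka0 : ka y0 = 0).
Let kb y := 1 - ka y.

Definition rel_dsum f w := exists f1 f2 u v, [/\ rel1 f1 u, rel2 f2 v,
  f = (fun x => ext f1 ka x + ext f2 kb x) & w = col_mx u v].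

(** The second argument is free and [ka] takes the values 1 and 0, so evaluating there recovers f1
    and f2 from f1 ka + f2 (1 - ka). Invariance of [ka] makes the relation equivariant. *)
Lemma dsum_subquotient : is_subquotient (pull_act a) (tame a) (rep_dsum V1 V2).
Proof.
have tkb : tame a2 kb.
  by apply: tame_ext (tame_lin (-1) tka (tame_const a2 1)) => y; rewrite mulN1r addrC.
have kb_act s : pull_act a2 s kb = kb.
  by apply: funext => y; rewrite /kb -[in RHS](ka_act s).
apply: (@rel_subquotient _ _ _ _ _ _ _ _ rel_dsum); split.
- exists (fun _ => 0), (fun _ => 0), 0, 0; split; [exact: sr_0 R1|exact: sr_0 R2| |by rewrite col_mx0].
  apply: funext => x; have [hx|nx] := pselect (cH C x); last by rewrite !ext_off // addr0.
  by rewrite !ext_on // !mul0r addr0.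
- move=> c f g u v [f1 [f2 [u1 [u2 [h1 h2 -> ->]]]]] [g1 [g2 [v1 [v2 [k1 k2 -> ->]]]]].
  exists (fun x => c * f1 x + g1 x), (fun x => c * f2 x + g2 x), (c *: u1 + v1), (c *: u2 + v2); split.
  + exact: (sr_lin R1).
  + exact: (sr_lin R2).
  + apply: funext => x; have [hx|nx] := pselect (cH C x); last by rewrite !ext_off // !addr0 mulr0.
    by rewrite !ext_on //; ring.
  + by rewrite scale_col_mx add_col_mx.
- move=> w [f1 [f2 [u [v [h1 h2 e ->]]]]].
  have ev x y : f1 x * ka y + f2 x * kb y = 0.
    have [g [hg <- <-]] := c_surj C x y.
    by apply: etrans (esym (congr1 (fun f : Pi -> Qp => f g) e)) => /=; rewrite !ext_on.
  have e1 : f1 = (fun _ => 0).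
    by apply: funext => x; have := ev x y1; rewrite /kb ka1 subrr mulr0 addr0 mulr1.
  have e2 : f2 = (fun _ => 0).
    by apply: funext => x; have := ev x y0; rewrite /kb ka0 subr0 mulr0 add0r mulr1.
  move: h1 h2; rewrite e1 e2 => /(sr_single R1) -> /(sr_single R2) ->.
  exact: col_mx0.
- move=> s f w [f1 [f2 [u [v [h1 h2 -> ->]]]]].
  exists (pull_act a1 s f1), (pull_act a1 s f2), (V1 s *m u), (V2 s *m v); split.
  + exact: (sr_act R1).
  + exact: (sr_act R2).
  + by rewrite -{2}(ka_act s) -{2}(kb_act s) -!ext_act.
  + by rewrite /rep_dsum mul_block_col !mul0mx addr0 add0r.
- move=> w; have [f1 h1] := sr_surj R1 (usubmx w); have [f2 h2] := sr_surj R2 (dsubmx w).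
  exists (fun x => ext f1 ka x + ext f2 kb x), f1, f2, (usubmx w), (dsubmx w); split=> //.
  by rewrite vsubmxK.
- move=> f w [f1 [f2 [u [v [h1 h2 -> _]]]]].
  have t1 := tame_ext_prod (sr_sub R1 h1) tka; have t2 := tame_ext_prod (sr_sub R2 h2) tkb.
  by apply: tame_ext (tame_lin 1 t1 t2) => x; rewrite mul1r.
Qed.
End DirectSum.
End Transfer.

Section ActionInverse.
Variables (F K : fieldType) (iota : {rmorphism F -> K}) (zF : pseries F).
Variable zP : ps_nonunit (ps_map iota zF).

(** Twisting by [s] and by its inverse keeps the rings and changes the structure maps to pointwise
    equal ones. The identity maps thus form a morphism of covers, and naturality compares the
    fibers. *)
Lemma gal_actVK (s : Defs.gal iota) (x : pi1 zP) : gal_act s (gal_act (Defs.galV s) x) = x.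
Proof.
apply: pi1P => O x0; pose O' := twist (Defs.galV s) (twist s O).
have mb : idfun \o tc_b O =1 tc_b O'.
  move=> r /=; congr (tc_b O _); apply/esym; apply: (loc_mapK (s := Defs.galV s) (t := s)); exact: gal_funVK.
have mc : idfun \o tc_c O =1 tc_c O'.
  move=> r /=; congr (tc_c O _); apply/esym; apply: (loc_mapK (s := Defs.galV s) (t := s)); exact: gal_funVK.
have md : idfun \o tc_d O =1 tc_d O'.
  move=> r /=; congr (tc_d O _); apply/esym; apply: (laurent_mapK (s := Defs.galV s) (t := s)); exact: gal_funVK.
pose m : tc_hom O O' := @TCHom _ _ _ O O' idfun idfun idfun mb mc md (fun _ => erefl) (fun _ => erefl).
pose x1 := tf_down (Defs.galV s) (tf_down s x0).
have e1 : tf_pull m x1 = x0.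
  by apply: tfiberP => c /=; rewrite gal_funVK.
rewrite -[in RHS]e1 pi_nat; apply: tfiberP => c /=.
by rewrite gal_funVK.
Qed.
End ActionInverse.

Section ContinuousRepresentations.
Variables (p : nat) (p_pr : prime p).
Local Notation Qp := (padic p_pr).
Variables (G : topGroup) (n1 n2 : nat) (V1 : G -> 'M[Qp]_n1) (V2 : G -> 'M[Qp]_n2).
Hypotheses (c1 : continuous_rep V1) (c2 : continuous_rep V2).

Lemma continuous_dsum : continuous_rep (rep_dsum V1 V2).
Proof.
have [o1 m1 k1] := c1; have [o2 m2 k2] := c2; rewrite /rep_dsum; split.
- by rewrite o1 o2 -scalar_mx_block.
- by move=> g h; rewrite m1 m2 mulmx_block !mulmx0 !mul0mx !addr0 !add0r.
- move=> i j; case: (split_ordP i) => k ->; case: (split_ordP j) => l ->.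
  + by apply: cont_ext (k1 k l) => x; rewrite block_mxEul.
  + by apply: cont_ext (cont_const 0) => x; rewrite block_mxEur mxE.
  + by apply: cont_ext (cont_const 0) => x; rewrite block_mxEdl mxE.
  + by apply: cont_ext (k2 k l) => x; rewrite block_mxEdr.
Qed.

Lemma continuous_tens : continuous_rep (rep_tens V1 V2).
Proof.
have [o1 m1 k1] := c1; have [o2 m2 k2] := c2; rewrite /rep_tens; split.
- rewrite o1 o2; apply/matrixP => i j; rewrite !mxE -natrM mulnb.
  congr (nat_of_bool _)%:R; apply/andP/eqP => [[/eqP e1 /eqP e2]|->]; last by rewrite !eqxx.
  by apply: (can_inj (@mxtens.mxtens_unindexK n1 n2)); apply: injective_projections.
- by move=> g h; rewrite m1 m2 mxtens.tensmx_mul.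
- move=> i j; apply: cont_ext (cont_M (k1 (mxtens.mxtens_unindex i).1 (mxtens.mxtens_unindex j).1) (k2 (mxtens.mxtens_unindex i).2 (mxtens.mxtens_unindex j).2)) => x.
  by rewrite mxE.
Qed.
End ContinuousRepresentations.

Theorem proposition1p7 (F : fieldExtType rat) (Fbar : closedFieldType)
    (iota : {rmorphism F -> Fbar})
    (Fbar_alg : forall x : Fbar, algebraicOver iota x)
    (p : nat) (p_pr : prime p) (n1 n2 : nat)
    (V1 : galois_group iota -> 'M[padic p_pr]_n1)
    (V2 : galois_group iota -> 'M[padic p_pr]_n2) :
  in_classC V1 -> in_classC V2 ->
  in_classC (rep_dsum V1 V2) /\ in_classC (rep_tens V1 V2).
Proof.
move=> [c1 s1] [c2 s2].
have charF : [pchar F] =i pred0 by move=> q; rewrite (pchar_lalg F) pchar_num.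
pose ac v (b : tangential_base_point v) (s : galois_group iota) : tangential_pi1 iota b -> tangential_pi1 iota b := gal_act s.
have aVK v (b : tangential_base_point v) s x : ac v b s (ac v b (tg_inv s) x) = x by exact: gal_actVK.
have tW v (b : tangential_base_point v) : (fun f => proalg_function f /\ orbit_finite (@gal_act_fun F Fbar iota p p_pr v b) f) = tame (p_pr := p_pr) (ac v b).
  by apply: funext => f; apply: propext; apply: iff_sym; exact: tameP.
have rel_of v (b : tangential_base_point v) n (V : galois_group iota -> 'M[padic p_pr]_n) :
    is_subquotient (@gal_act_fun F Fbar iota p p_pr v b) (fun f => proalg_function f /\ orbit_finite (@gal_act_fun F Fbar iota p p_pr v b) f) V ->
    exists rel, subq_rel (pull_act (ac v b)) (tame (p_pr := p_pr) (ac v b)) V rel.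
  by rewrite tW; exact: subquotient_rel.
split; split; [exact: continuous_dsum| |exact: continuous_tens|] => v v0 b; rewrite tW.
  have [v1 [b1 [v2 [b2 [v10 v20 [C _]]]]]] := tangential_corresp iota charF b.
  (* Only its subgroup is wanted: a proper open subgroup of the group at [b2], stable under the
     Galois action. *)
  have [v3 [b3 [v4 [b4 [_ _ [C' _]]]]]] := tangential_corresp iota charF b2.
  have [rel1 R1] := rel_of _ b1 _ _ (s1 v1 v10 b1); have [rel2 R2] := rel_of _ b1 _ _ (s2 v1 v10 b1).
  have [y0 y0P] := c_proper C'.
  (* The constant 1 extended by zero: the indicator function of that subgroup. *)
  pose ka := ext (p_pr := p_pr) C' (fun _ => 1) (fun _ => 1).
  have tka : tame (ac v2 b2) ka by apply: (tame_ext_prod (@aVK v2 b2)); exact: tame_const.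
  have aka s : pull_act (ac v2 b2) s ka = ka by rewrite /ka (ext_act (@aVK v2 b2)).
  have ka1 : ka (tg_one _) = 1 by rewrite /ka ext_on ?mulr1 //; exact: c_1.
  have ka0 : ka y0 = 0 by rewrite /ka ext_off.
  exact: (dsum_subquotient (@aVK v b) C R1 R2 tka aka ka1 ka0).
have [v1 [b1 [v2 [b2 [v10 v20 [C _]]]]]] := tangential_corresp iota charF b.
have [rel1 R1] := rel_of _ b1 _ _ (s1 v1 v10 b1); have [rel2 R2] := rel_of _ b2 _ _ (s2 v2 v20 b2).
exact: (tensor_subquotient (@aVK v b) C R1 R2).
Qed.
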